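(* For $\beta>0$ and $\lambda>0$ let $\rho_\beta^{(2)}(0,\lambda)$ denote the pair correlation function of the $\mathrm{Sine}_\beta$ process. Then $\rho_{\beta}^{(2)}(0,\lambda)$ is continuous in each of the variables $\beta$ and $\lambda$: for every fixed $\beta>0$ it is continuous in $\lambda>0$ (i.e. has a, necessarily unique, continuous version on $(0,\infty)$), and, using this version, for every fixed $\lambda>0$ it is continuous in $\beta>0$. Moreover, the function $(\beta,\lambda)\mapsto\rho_{\beta}^{(2)}(0,\lambda)$ is jointly continuous on $\{(\beta,\lambda):\beta>2,\ \lambda>0\}$.
   Context: The $\mathrm{Sine}_\beta$ process ($\beta>0$) is the translation and reflection invariant simple point process on $\mathbb{R}$ with density $\frac1{2\pi}$ obtained as the $n\to\infty$ point process limit of $n\Lambda_n$, where $\Lambda_n=\{\theta_1,\dots,\theta_n\}\subset[-\pi,\pi)$ has joint density proportional to $\prod_{1\le j<k\le n}|e^{i\theta_j}-e^{i\theta_k}|^\beta$ (circular beta-ensemble). Equivalently, let $Z$ be a two-sided complex Brownian motion with independent standard real and imaginary parts, let $\psi_\lambda(u)$, $\lambda\in\mathbb R$, be the strong solutions (driven by the same $Z$ for all $\lambda$) of $d\psi_\lambda=\lambda\frac{\beta}{4}e^{\frac{\beta}{4}u}du+\Re[(e^{-i\psi_\lambda}-1)dZ]$ with $\lim_{u\to-\infty}\psi_\lambda(u)=0$, and let $\Theta$ be uniform on $[0,2\pi)$ and independent of $Z$; then $\mathrm{Sine}_\beta$ has the law of $\{\lambda\in\mathbb{R}:\psi_\lambda(0)=\Theta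 \bmod 2\pi\}$. For a simple point process $\Xi$ on $\mathbb R$, with $\Xi(A)$ the number of points in $A$, the pair correlation function is the symmetric function $\rho^{(2)}:\mathbb R^2\to\mathbb R_+$ with $E[\Xi(D_1)\Xi(D_2)]=\int_{D_1}\int_{D_2}\rho^{(2)}(x,y)\,dy\,dx$ for all disjoint Borel sets $D_1,D_2$; it is determined up to Lebesgue-null sets. For $\mathrm{Sine}_\beta$ it is denoted $\rho^{(2)}_\beta$, and by invariance $\rho^{(2)}_\beta(x,y)=\rho^{(2)}_\beta(0,|y-x|)$. *)

(* Defs.v *)
From HB Require Import structures.
From mathcomp Require Import all_boot all_order all_algebra.
From mathcomp Require Import all_classical all_reals all_analysis.
From mathcomp Require Import measurable_realfun.

Set Implicit Arguments.
Unset Strict Implicit.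
Unset Printing Implicit Defensive.

Import Order.TTheory GRing.Theory Num.Theory.
Import numFieldNormedType.Exports.

Local Open Scope classical_set_scope.
Local Open Scope ring_scope.

(* Simple point configurations on the line are represented by their sets of
   points; a simple point process is a random locally finite set. *)
Definition locally_finite (R : realType) (S : set R) : Prop :=
  forall a b : R, finite_set (S `&` `[a, b]).

Definition npoints (R : realType) (S A : set R) : \bar R :=
  counting (S `&` A).

Definition simple_point_process (R : realType) (d : measure_display)
    (T : measurableType d) (Xi : T -> set R) : Prop :=
  (forall w, locally_finite (Xi w)) /\
  (forall A : set R, measurable A ->
     measurable_fun [set: T] (fun w => npoints (Xi w) A)).

Definition conf_measurable (R : realType) : set (set (set R)) :=
  <<s [set E | exists (A : set R) (B : set (\bar R)),
         [/\ measurable A, measurable B &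
             E = [set S : set R | B (npoints S A)]] ] >>.

Definition same_law (R : realType) (d : measure_display)
    (T : measurableType d) (P : probability T R) (Xi Xi' : T -> set R) : Prop :=
  forall E, conf_measurable E -> P (Xi @^-1` E) = P (Xi' @^-1` E).

Definition translation_invariant (R : realType) (d : measure_display)
    (T : measurableType d) (P : probability T R) (Xi : T -> set R) : Prop :=
  forall t : R, same_law P Xi (fun w => [set x + t | x in Xi w]).

Definition reflection_invariant (R : realType) (d : measure_display)
    (T : measurableType d) (P : probability T R) (Xi : T -> set R) : Prop :=
  same_law P Xi (fun w => [set - x | x in Xi w]).

Definition has_density (R : realType) (d : measure_display)
    (T : measurableType d) (P : probability T R) (Xi : T -> set R) (c : R) :
    Prop :=
  forall A : set R, measurable A ->
    (\int[P]_w npoints (Xi w) A = c%:E * lebesgue_measure A)%E.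

Definition continuous_compact_support (R : realType) (f : R -> R) : Prop :=
  continuous f /\ exists r : R, forall x, r < `|x| -> f x = 0.

(* The sum over [S] has finitely many nonzero terms for [f] compactly supported
   and [S] locally finite. *)
Definition linear_statistic (R : realType) (f : R -> R) (S : set R) : R :=
  \sum_(x \in S) f x.

(* Continuity for the vague topology, i.e. the coarsest topology on locally
   finite configurations making all the linear statistics of continuous
   compactly supported functions continuous. *)
Definition vaguely_continuous (R : realType) (F : set R -> R) : Prop :=
  forall S, locally_finite S -> forall e : R, 0 < e ->
  exists (m : nat) (f : 'I_m -> R -> R) (delta : R),
    [/\ 0 < delta,
        forall i, continuous_compact_support (f i) &
        forall S', locally_finite S' ->
          (forall i,
             `|linear_statistic (f i) S' - linear_statistic (f i) S| < delta) ->
          `|F S' - F S| < e].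

(* Iterated Lebesgue integral over the cube [-pi, pi)^n. *)
Fixpoint angle_integral (R : realType) (n : nat) :
    (n.-tuple R -> R) -> R :=
  match n with
  | 0%N => fun f => f [tuple]
  | m.+1 => fun f =>
      \int[lebesgue_measure]_(x in `[(- pi)%R, pi[)
        angle_integral (fun t : m.-tuple R => f [tuple of x :: t])
  end.

(* |e^{ia} - e^{ib}| *)
Definition chord (R : realType) (a b : R) : R :=
  Num.sqrt ((cos a - cos b) ^+ 2 + (sin a - sin b) ^+ 2).

Definition circular_weight (R : realType) (beta : R) (n : nat)
    (theta : n.-tuple R) : R :=
  \prod_(j < n) \prod_(k < n | (j < k)%N)
    (chord (tnth theta j) (tnth theta k)) `^ beta.

(* Expectation of [f (theta_1, ..., theta_n)] for the circular beta-ensemble. *)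
Definition circular_mean (R : realType) (beta : R) (n : nat)
    (f : n.-tuple R -> R) : R :=
  angle_integral (fun theta => f theta * circular_weight beta theta) /
  angle_integral (fun theta : n.-tuple R => circular_weight beta theta).

(* The rescaled configuration n Lambda_n, as a set. *)
Definition scaled_angles (R : realType) (n : nat) (theta : n.-tuple R) :
    set R :=
  [set n%:R * x | x in [set` theta]].

(* Convergence in law, for the vague topology, of n Lambda_n to [Xi]. *)
Definition circular_limit (R : realType) (beta : R) (d : measure_display)
    (T : measurableType d) (P : probability T R) (Xi : T -> set R) : Prop :=
  forall F : set R -> R,
    vaguely_continuous F -> (exists M : R, forall S, `|F S| <= M) ->
    (circular_mean beta (fun theta : n.-tuple R => F (scaled_angles theta)))%:E
      @[n --> \oo] --> (\int[P]_w (F (Xi w))%:E)%E.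

Definition is_sine_process (R : realType) (beta : R) (d : measure_display)
    (T : measurableType d) (P : probability T R) (Xi : T -> set R) : Prop :=
  [/\ simple_point_process Xi,
      translation_invariant P Xi,
      reflection_invariant P Xi,
      has_density P Xi (2 * pi)^-1 &
      circular_limit beta P Xi].

Definition is_pair_correlation (R : realType) (d : measure_display)
    (T : measurableType d) (P : probability T R) (Xi : T -> set R)
    (rho : R -> R -> R) : Prop :=
  [/\ (forall x y, 0 <= rho x y),
      (forall x y, rho x y = rho y x),
      measurable_fun [set: R * R] (fun p : R * R => rho p.1 p.2) &
      forall D1 D2 : set R, measurable D1 -> measurable D2 ->
        D1 `&` D2 = set0 ->
        (\int[P]_w (npoints (Xi w) D1 * npoints (Xi w) D2) =
         \int[lebesgue_measure]_(x in D1)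
           \int[lebesgue_measure]_(y in D2) (rho x y)%:E)%E].

(* [g lambda] stands for rho(0, lambda); the pair correlation function is then
   (x, y) |-> g |y - x|.  The value [g 0] is immaterial, as it only affects the
   diagonal. *)
Definition is_continuous_version (R : realType) (d : measure_display)
    (T : measurableType d) (P : probability T R) (Xi : T -> set R)
    (g : R -> R) : Prop :=
  is_pair_correlation P Xi (fun x y => g `|y - x|) /\
  {within [set l : R | 0 < l], continuous g}.

(* Main.v *)
(** The argument never uses the SDE.  Fix one of the [m + 1] points of the
    circular ensemble at the origin, on a circle of length [2 pi (m + 1)], and
    order the others as [0 < X_1 < ... < X_m].  Divided by its maximum, attained
    at equidistant points, the product [w] of the chord lengths is log-concave in
    these coordinates, and the law of [X] has density proportional to [w ^ beta].

    By Prekopa-Leindler the density [p_k] of each [X_k] is log-concave, hence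
    locally Lipschitz away from the origin in terms of its mass only.  The
    tangent inequality for [ln sin] shows that many points in a fixed window
    cost a factor in [w]; contracting towards equidistant points compares the
    partition functions at different [beta].  Together they make the tail
    [sum_(k > K) P(X_k <= x)] uniformly small in [m].  Dependence on [beta] is
    controlled through exponential moments of [sum_i f(X_(i+k) - X_i)]: moving two
    configurations to their midpoint gains a Gaussian factor.  So
    [R_m(beta, x) = sum_k p_k(x)] is asymptotically equicontinuous in
    [(beta, x)] on compact subsets of [(0, oo)^2].

    By the Palm formula, [E (sum phi)(sum psi) = (2 pi)^-1 int phi(x) int
    psi(x + y) R_m(y) dy dx] for [phi], [psi] with separated supports, and
    truncating both sums changes this by little uniformly in [m].  The truncated
    statistics are bounded and vaguely continuous, so their means converge; with
    narrow [phi], [psi] this makes [R_m(beta, .)] Cauchy, and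
    [lim R_m / (2 pi)] is the pair correlation of the limit process, jointly
    continuous in [(beta, x)] for all [beta > 0]. *)
Require Import Defs.
From HB Require Import structures.
From mathcomp Require Import all_boot all_order all_algebra.
From mathcomp Require Import all_classical all_reals all_analysis.
From mathcomp Require Import measurable_realfun.
From mathcomp Require Import ring lra zify.

Set Implicit Arguments.
Unset Strict Implicit.
Unset Printing Implicit Defensive.

Import Order.TTheory GRing.Theory Num.Theory.
Import numFieldNormedType.Exports.

Local Open Scope classical_set_scope.
Local Open Scope ring_scope.

(** * Iterated Lebesgue integrals *)

(** The obstacle throughout is uniformity in [m]. A change of [beta] alters [w ^ beta] by factors
    that may be exponential in [m], so densities at two temperatures cannot be compared directly.
    The remedy is a statistic that itself has about [m] terms, all of the same law by rotation
    invariance: comparing partition functions costs [m ln (b / a)] in an exponent, and dividing by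
    the number of terms leaves a multiple of [ln (b / a)].

    The Lipschitz bound for the density of [X_k] needs mass bounded below, uniformly in [m], on both
    sides of the interval considered. It comes from a squeezing argument. In a window free of the
    other points, the product of the distances from a moving point to those others is log-concave,
    so it favours one half of the window. Pushing the points of that half towards the middle costs a
    factor depending only on their number and on [beta], and it opens a macroscopic gap. Opening one
    gap bounds [P(X_1 >= x)] from below; iterating the push compresses many points into a small
    window and bounds [P(X_k <= y)] from below. *)

Lemma eqfun_measurable d1 d2 (T1 : measurableType d1) (T2 : measurableType d2)
    (g f : T1 -> T2) : (forall x, g x = f x) ->
  measurable_fun [set: T1] g -> measurable_fun [set: T1] f.
Proof. by move=> /funext ->. Qed.

Section iterated_integral.
Context {R : realType}.
Local Open Scope ereal_scope.
Local Notation mu := (@lebesgue_measure R).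
Implicit Types (f g : seq R -> \bar R).

(** The integrand takes untyped sequences, so that inserting, concatenating and rotating coordinates
    needs no transport between tuple lengths. Only measurability is stated on tuples. *)
Fixpoint iint (n : nat) (f : seq R -> \bar R) : \bar R :=
  match n with
  | 0%N => f [::]
  | m.+1 => \int[mu]_x iint m (fun s => f (x :: s))
  end.

(* Only the values of [f] on sequences of length [n] matter. *)
Definition smeas (n : nat) f := measurable_fun [set: n.-tuple R] (fun t : n.-tuple R => f t).

Local Notation sge0 f := (forall s : seq R, 0 <= f s).

Lemma measurable_fun_tuple d (T : measurableType d) n (h : T -> n.-tuple R) :
  (forall i, (i < n)%N -> measurable_fun [set: T] (fun x => nth 0%R (h x) i)) ->
  measurable_fun [set: T] h.
Proof.
move=> H; apply/measurable_fun_tnthP => i.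
have := H i (ltn_ord i); apply: eqfun_measurable => x /=.
by rewrite (tnth_nth 0%R).
Qed.

Lemma measurable_nth n i : measurable_fun [set: n.-tuple R] (fun t : n.-tuple R => nth 0%R t i).
Proof.
case: (ltnP i n) => ni.
  have := @measurable_tnth _ R n (Ordinal ni); apply: eqfun_measurable => t /=.
  by rewrite (tnth_nth 0%R).
have := @measurable_cst _ _ (n.-tuple R) R setT 0%R; apply: eqfun_measurable => t /=.
by rewrite nth_default// size_tuple.
Qed.

(** The one cast from sequences to tuples. Measurability after a rearrangement of coordinates
    reduces here to one claim per coordinate. *)
Lemma smeas_param d (T : measurableType d) n (f : seq R -> \bar R) (h : T -> seq R) :
  smeas n f -> (forall x, size (h x) = n) ->
  (forall i, (i < n)%N -> measurable_fun [set: T] (fun x => nth 0%R (h x) i)) ->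
  measurable_fun [set: T] (fun x => f (h x)).
Proof.
move=> mf sh mh.
pose h' x : n.-tuple R := tcast (sh x) (in_tuple (h x)).
have h'E x : h' x = h x :> seq R by rewrite /h' val_tcast.
have mh' : measurable_fun [set: T] h'.
  apply: measurable_fun_tuple => i ni.
  by have := mh _ ni; apply: eqfun_measurable => x; rewrite h'E.
have := measurableT_comp mf mh'; apply: eqfun_measurable => x /=.
by rewrite h'E.
Qed.

Lemma smeas_param2 d (T : measurableType d) n m (f : seq R -> \bar R) (h : T -> seq R -> seq R) :
  smeas n f -> (forall x s, size s = m -> size (h x s) = n) ->
  (forall i, (i < n)%N -> measurable_fun [set: T * m.-tuple R] (fun x => nth 0%R (h x.1 x.2) i)) ->
  measurable_fun [set: T * m.-tuple R] (fun x => f (h x.1 x.2)).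
Proof.
move=> mf sh mh.
apply: (@smeas_param _ (T * m.-tuple R)%type n f (fun x => h x.1 x.2)) => //.
by move=> x; apply: sh; rewrite size_tuple.
Qed.

Lemma smeas_map n m f (h : seq R -> seq R) :
  smeas n f -> (forall s, size s = m -> size (h s) = n) ->
  (forall i, (i < n)%N -> measurable_fun [set: m.-tuple R] (fun x => nth 0%R (h x) i)) ->
  smeas m (f \o h).
Proof.
move=> mf sh mh.
apply: (@smeas_param _ (m.-tuple R)%type n f (fun x => h x)) => //.
by move=> x; apply: sh; rewrite size_tuple.
Qed.

Lemma measurable_cons_param n f : smeas n.+1 f ->
  measurable_fun [set: R * n.-tuple R] (fun x => f (x.1 :: x.2)).
Proof.
move=> mf; apply: (@smeas_param2 _ R n.+1 n f (fun x s => x :: s)) => //.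
  by move=> x s /= ->.
case=> [|i] ni /=; first exact: measurable_fst.
exact: (measurableT_comp (@measurable_nth n i)).
Qed.

Lemma smeas_cons n f x : smeas n.+1 f -> smeas n (fun s => f (x :: s)).
Proof.
move=> mf; apply: (@smeas_map n.+1 n f (fun s => x :: s)) => //.
  by move=> s /= ->.
case=> [|i] ni /=; first exact: measurable_cst.
exact: measurable_nth.
Qed.

Lemma iint_ge0 n f : sge0 f -> 0 <= iint n f.
Proof.
elim: n f => [|n IH] f f0 /=; first exact: f0.
by apply: integral_ge0 => x _; apply: IH => s.
Qed.

Lemma measurable_iint d (T : measurableType d) n (f : T -> seq R -> \bar R) :
  (forall x, sge0 (f x)) ->
  measurable_fun [set: T * n.-tuple R] (fun p => f p.1 p.2) ->
  measurable_fun [set: T] (fun x => iint n (f x)).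
Proof.
elim: n d T f => [|n IH] d T f f0 mf /=.
  have : measurable_fun [set: T] (fun x => (x, [tuple] : 0.-tuple R)).
    by apply: measurable_fun_pair => //; exact: measurable_cst.
  by move=> /(measurableT_comp mf).
apply: (@measurable_fun_fubini_tonelli_F _ _ T _ R mu
  (fun p => iint n (fun s => f p.1 (p.2 :: s)))).
  apply: (IH _ (T * R)%type (fun p s => f p.1 (p.2 :: s))) => //.
  have mh : measurable_fun [set: T * R * n.-tuple R]
     (fun p => (p.1.1, [the n.+1.-tuple R of p.1.2 :: p.2])).
    apply: measurable_fun_pair => /=.
      exact: measurableT_comp.
    apply: measurable_cons => //.
    exact: measurableT_comp.
  exact: (measurableT_comp mf mh).
by move=> p; apply: iint_ge0.
Qed.

Lemma measurable_iint_cons n f : sge0 f -> smeas n.+1 f ->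
  measurable_fun [set: R] (fun x => iint n (fun s => f (x :: s))).
Proof.
move=> f0 mf; apply: (@measurable_iint _ R n (fun x s => f (x :: s))) => //.
exact: measurable_cons_param.
Qed.

Lemma eq_iint n f g : (forall s, size s = n -> f s = g s) -> iint n f = iint n g.
Proof.
elim: n f g => [|n IH] f g fg /=; first exact: fg.
by apply: eq_integral => x _; apply: IH => s sn; apply: fg; rewrite /= sn.
Qed.

Lemma le_iint n f g : sge0 f -> sge0 g -> smeas n f -> smeas n g ->
  (forall s, size s = n -> f s <= g s) -> iint n f <= iint n g.
Proof.
elim: n f g => [|n IH] f g f0 g0 mf mg fg /=; first exact: fg.
apply: ge0_le_integral => //.
- by move=> x _; apply: iint_ge0.
- exact: measurable_iint_cons.
- exact: measurable_iint_cons.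
move=> x _; apply: IH => //; try exact: smeas_cons.
by move=> s sn; apply: fg; rewrite /= sn.
Qed.

Lemma iintZ n f (c : R) : (0 <= c)%R -> sge0 f -> smeas n f ->
  iint n (fun s => c%:E * f s) = c%:E * iint n f.
Proof.
move=> c0; elim: n f => [|n IH] f f0 mf //=.
rewrite -ge0_integralZl//.
- apply: eq_integral => x _; apply: IH => //; exact: smeas_cons.
- exact: measurable_iint_cons.
- by move=> x _; apply: iint_ge0.
Qed.

Lemma iintD n f g : sge0 f -> sge0 g -> smeas n f -> smeas n g ->
  iint n (fun s => f s + g s) = iint n f + iint n g.
Proof.
elim: n f g => [|n IH] f g f0 g0 mf mg //=.
rewrite -ge0_integralD//.
- apply: eq_integral => x _; apply: IH => //; exact: smeas_cons.
- by move=> x _; apply: iint_ge0.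
- exact: measurable_iint_cons.
- by move=> x _; apply: iint_ge0.
- exact: measurable_iint_cons.
Qed.

Lemma iint_cst0 n : iint n (fun=> 0) = 0.
Proof. by elim: n => [|n IH] //=; rewrite IH integral0. Qed.

Lemma smeas_sum (I : Type) (r : seq I) n (F : I -> seq R -> \bar R) :
  (forall i, smeas n (F i)) -> smeas n (fun s => \sum_(i <- r) F i s).
Proof. by move=> mF; apply: emeasurable_sum => i; exact: mF. Qed.

Lemma iint_sum (I : Type) (r : seq I) n (F : I -> seq R -> \bar R) :
  (forall i, sge0 (F i)) -> (forall i, smeas n (F i)) ->
  iint n (fun s => \sum_(i <- r) F i s) = \sum_(i <- r) iint n (F i).
Proof.
move=> F0 mF; elim: r => [|i r IH].
  rewrite big_nil; under eq_iint do rewrite big_nil; exact: iint_cst0.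
rewrite big_cons -IH -iintD//.
- by apply: eq_iint => s _; rewrite big_cons.
- by move=> s; apply: sume_ge0 => j _.
- exact: smeas_sum.
Qed.

Lemma iint_cat a b f : iint (a + b) f = iint a (fun s => iint b (fun t => f (s ++ t))).
Proof.
elim: a f => [|a IH] f //=; apply: eq_integral => x _; exact: IH.
Qed.

Definition ins (k : nat) (x : R) (s : seq R) := take k s ++ x :: drop k s.

Lemma size_ins k x s : size (ins k x s) = (size s).+1.
Proof. by rewrite /ins size_cat /= addnS -size_cat cat_take_drop. Qed.

Lemma nth_ins k x s i : (k <= size s)%N ->
  nth 0%R (ins k x s) i = if (i < k)%N then nth 0%R s i
                          else if i == k then x else nth 0%R s i.-1.
Proof.
move=> ks; rewrite /ins nth_cat size_takel//.
case: ltnP => ik; first by rewrite nth_take.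
have [->|ki] := eqVneq i k; first by rewrite subnn.
have ik' : (k < i)%N by rewrite ltn_neqAle eq_sym ki.
case: i ik ki ik' => // i ik ki ik'.
by rewrite subSn// /= nth_drop subnKC.
Qed.

Lemma measurable_ins_param n k f : (k <= n)%N -> smeas n.+1 f ->
  measurable_fun [set: R * n.-tuple R] (fun p => f (ins k p.1 p.2)).
Proof.
move=> kn mf; apply: (@smeas_param2 _ R n.+1 n f (fun x s => ins k x s)) => //.
  by move=> x s sn; rewrite size_ins sn.
move=> i ni.
apply: (@eqfun_measurable _ _ _ _
  (fun p : R * n.-tuple R => if (i < k)%N then nth 0%R p.2 i
                          else if i == k then p.1 else nth 0%R p.2 i.-1)).
  by move=> p; rewrite nth_ins ?size_tuple.
case: (i < k)%N; first exact: (measurableT_comp (@measurable_nth n i)).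
case: (i == k); first exact: measurable_fst.
exact: (measurableT_comp (@measurable_nth n i.-1)).
Qed.

Lemma smeas_ins n k x f : (k <= n)%N -> smeas n.+1 f -> smeas n (fun s => f (ins k x s)).
Proof.
move=> kn mf.
have mh : measurable_fun [set: n.-tuple R] (fun t : n.-tuple R => (x, t)).
  by apply: measurable_fun_pair.
exact: (measurableT_comp (measurable_ins_param kn mf) mh).
Qed.

(** Tonelli, once per position: the variable to be pulled out is exchanged with the current
    outermost one. This isolates the [k]-th coordinate, hence gives access to its marginal
    density. *)
Lemma iint_ins n k f : (k <= n)%N -> sge0 f -> smeas n.+1 f ->
  iint n.+1 f = \int[mu]_x iint n (fun s => f (ins k x s)).
Proof.
elim: k n f => [|k IH] n f kn f0 mf; first by rewrite /ins/=; apply: eq_integral => x _; apply: eq_iint => s _; rewrite take0 drop0.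
case: n kn mf => [//|n] kn mf.
transitivity (\int[mu]_x \int[mu]_y iint n (fun s => f (x :: ins k y s))).
  apply: eq_integral => x _; apply: (IH n (fun s => f (x :: s))) => //; exact: smeas_cons.
have mF : measurable_fun [set: R * R] (fun p => iint n (fun s => f (p.1 :: ins k p.2 s))).
  apply: (@measurable_iint _ (R * R)%type n (fun p s => f (p.1 :: ins k p.2 s))) => //.
  apply: (@smeas_param2 _ (R * R)%type n.+2 n f (fun p s => p.1 :: ins k p.2 s)) => //.
    by move=> p s sn /=; rewrite size_ins sn.
  case=> [|i] ni /=; first by apply: measurableT_comp.
  apply: (@eqfun_measurable _ _ _ _
    (fun p : R * R * n.-tuple R => if (i < k)%N then nth 0%R p.2 i
                          else if i == k then p.1.2 else nth 0%R p.2 i.-1)).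
    by move=> p; rewrite nth_ins ?size_tuple.
  case: (i < k)%N; first exact: (measurableT_comp (@measurable_nth n i)).
  case: (i == k); first exact: measurableT_comp.
  exact: (measurableT_comp (@measurable_nth n i.-1)).
have F0 (p : R * R) : 0 <= iint n (fun s => f (p.1 :: ins k p.2 s)) by apply: iint_ge0.
exact: (@fubini_tonelli _ _ _ _ R mu mu _ mF F0).
Qed.

(** The map may depend on the index because contraction towards equidistant points moves each
    coordinate relative to its own lattice point. *)
Fixpoint amap (T : nat -> R -> R) (s : seq R) : seq R :=
  if s is x :: s' then T 0%N x :: amap (T \o S) s' else [::].

Lemma size_amap T s : size (amap T s) = size s.
Proof. by elim: s T => //= x s IH T; rewrite IH. Qed.

Lemma nth_amap T s i : (i < size s)%N -> nth 0%R (amap T s) i = T i (nth 0%R s i).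
Proof. by elim: s T i => //= x s IH T [|i] //= si; rewrite IH. Qed.

Lemma amap_cst (T : R -> R) s : amap (fun=> T) s = map T s.
Proof. by elim: s => //= x s IH; rewrite -[in RHS]IH. Qed.

Lemma smeas_amap n f (T : nat -> R -> R) : (forall i, measurable_fun [set: R] (T i)) ->
  smeas n f -> smeas n (f \o amap T).
Proof.
move=> mT mf; apply: (@smeas_map n n f (amap T)) => //.
  by move=> s sn; rewrite size_amap.
move=> i ni.
apply: (@eqfun_measurable _ _ _ _ (fun t : n.-tuple R => T i (nth 0%R t i))).
  by move=> t; rewrite nth_amap ?size_tuple.
apply: measurableT_comp => //; exact: measurable_nth.
Qed.

Lemma measurable_amap_param n f (T : nat -> R -> R) : (forall i, measurable_fun [set: R] (T i)) ->
  smeas n.+1 f -> measurable_fun [set: R * n.-tuple R] (fun p => f (p.1 :: amap T p.2)).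
Proof.
move=> mT mf; apply: (@smeas_param2 _ R n.+1 n f (fun x s => x :: amap T s)) => //.
  by move=> x s sn /=; rewrite size_amap sn.
case=> [|i] ni /=; first exact: measurable_fst.
apply: (@eqfun_measurable _ _ _ _ (fun p : R * n.-tuple R => T i (nth 0%R p.2 i))).
  by move=> t; rewrite nth_amap ?size_tuple.
apply: measurableT_comp => //; exact: (measurableT_comp (@measurable_nth n i)).
Qed.

(* For a coordinatewise change of variables it is enough to have the
   one-dimensional (in)equality; [a] plays the role of the Jacobian. *)
Lemma iint_amap_ge n f (a : R) (T : nat -> R -> R) : (0 <= a)%R ->
  (forall i, measurable_fun [set: R] (T i)) ->
  (forall i (h : R -> \bar R), (forall x, 0 <= h x) -> measurable_fun [set: R] h ->
     a%:E * \int[mu]_x h (T i x) <= \int[mu]_x h x) ->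
  sge0 f -> smeas n f ->
  (a ^+ n)%:E * iint n (f \o amap T) <= iint n f.
Proof.
move=> a0; elim: n f T => [|n IH] f T mT HT f0 mf /=; first by rewrite expr0 mul1e.
set h := fun x => iint n (fun s => f (x :: amap (T \o S) s)).
have h0 x : 0 <= h x by apply: iint_ge0.
have mh : measurable_fun [set: R] h.
  apply: (@measurable_iint _ R n (fun x s => f (x :: amap (T \o S) s))) => //; apply: measurable_amap_param => // i; exact: mT.
rewrite exprSr EFinM -muleA.
apply: (@le_trans _ _ ((a ^+ n)%:E * \int[mu]_x h x)).
  apply: lee_wpmul2l; rewrite ?lee_fin ?exprn_ge0//; exact: (HT 0%N h).
rewrite -ge0_integralZl//; last by rewrite lee_fin exprn_ge0.
apply: ge0_le_integral => //.
- by move=> x _; rewrite mule_ge0 ?lee_fin ?exprn_ge0.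
- by apply: measurable_funeM.
- exact: measurable_iint_cons.
move=> x _; apply: (IH (fun s => f (x :: s)) (T \o S)) => //; last exact: smeas_cons.
- by move=> i; exact: mT.
- by move=> i; exact: HT.
Qed.

Lemma iint_amap n f (a : R) (T : nat -> R -> R) : (0 <= a)%R ->
  (forall i, measurable_fun [set: R] (T i)) ->
  (forall i (h : R -> \bar R), (forall x, 0 <= h x) -> measurable_fun [set: R] h ->
     a%:E * \int[mu]_x h (T i x) = \int[mu]_x h x) ->
  sge0 f -> smeas n f ->
  (a ^+ n)%:E * iint n (f \o amap T) = iint n f.
Proof.
move=> a0; elim: n f T => [|n IH] f T mT HT f0 mf /=; first by rewrite expr0 mul1e.
set h := fun x => iint n (fun s => f (x :: amap (T \o S) s)).
have h0 x : 0 <= h x by apply: iint_ge0.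
have mh : measurable_fun [set: R] h.
  apply: (@measurable_iint _ R n (fun x s => f (x :: amap (T \o S) s))) => //; apply: measurable_amap_param => // i; exact: mT.
rewrite exprSr EFinM -muleA (HT 0%N h)//.
rewrite -ge0_integralZl//; last by rewrite lee_fin exprn_ge0.
apply: eq_integral => x _.
apply: (IH (fun s => f (x :: s)) (T \o S)) => //; last exact: smeas_cons.
- by move=> i; exact: mT.
- by move=> i; exact: HT.
Qed.

End iterated_integral.

(** * Affine changes of variables on the line *)

Section affine.
Context {R : realType}.
Local Open Scope ereal_scope.
Local Notation mu := (@lebesgue_measure R).

Lemma measurable_affine (a b : R) : measurable_fun [set: R] (fun x : R => a * x + b)%R.
Proof. by apply: measurable_funD => //; apply: measurable_funM. Qed.

Lemma measurable_shift (F : R -> \bar R) (d : R) : measurable_fun [set: R] F ->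
  measurable_fun [set: R] (fun x => F (x + d)%R).
Proof.
move=> mF; apply: (measurableT_comp mF); exact: measurable_funD.
Qed.

Lemma measurable_reflect (F : R -> \bar R) : measurable_fun [set: R] F ->
  measurable_fun [set: R] (fun x => F (- x)%R).
Proof. by move=> mF; apply: (measurableT_comp mF). Qed.

(** Lebesgue measure is determined by its values on half-open intervals, where the claim is a
    computation. *)
Lemma lebesgue_measure_affine (a b : R) (A : set R) : (0 < a)%R -> measurable A ->
  a%:E * pushforward mu (fun x : measurableTypeR R => (a * x + b)%R : measurableTypeR R) A = mu A.
Proof.
move=> a0 mA.
have ma : measurable_fun [set: measurableTypeR R]
  (fun x : measurableTypeR R => (a * x + b)%R : measurableTypeR R) by exact: measurable_affine.
pose m1 : {measure set (measurableTypeR R) -> \bar R} :=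
  pushforward mu (fun x : measurableTypeR R => (a * x + b)%R : measurableTypeR R).
pose a' := NngNum (ltW a0).
pose m2 : {measure set (measurableTypeR R) -> \bar R} := mscale a' (m1 ma).
rewrite [RHS](@lebesgue_measure_unique _ m2)//.
move=> _ [[x y] _ <-].
have -> : m2 `]x, y]%classic = a%:E * mu `]((x - b) / a)%R, ((y - b) / a)%R]%classic.
  rewrite /m2 /mscale/=; congr (_ * mu _).
  by apply/seteqP; split => z /=; rewrite !in_itv/= ltr_pdivrMr// ler_pdivlMr// ltrBlDr lerBrDr mulrC.
rewrite !lebesgue_measure_itv/= !lte_fin ltr_pM2r ?invr_gt0// ltrD2r.
case: ifP => _; last by rewrite mule0.
by rewrite -!EFinB -EFinM; congr (_%:E); field; rewrite gt_eqF.
Qed.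

Lemma ge0_integral_affine (a b : R) (h : R -> \bar R) : (0 < a)%R ->
  (forall x, 0 <= h x) -> measurable_fun [set: R] h ->
  a%:E * \int[mu]_x h (a * x + b)%R = \int[mu]_x h x.
Proof.
move=> a0 h0 mh.
have ma : measurable_fun [set: measurableTypeR R]
  (fun x : measurableTypeR R => (a * x + b)%R : measurableTypeR R) by exact: measurable_affine.
pose m1 : {measure set (measurableTypeR R) -> \bar R} :=
  pushforward mu (fun x : measurableTypeR R => (a * x + b)%R : measurableTypeR R).
pose a' := NngNum (ltW a0).
pose m2 : {measure set (measurableTypeR R) -> \bar R} := mscale a' (m1 ma).
transitivity (\int[m2]_x h x).
  rewrite ge0_integral_mscale//=; congr (_ * _).
  by rewrite ge0_integral_pushforward.
apply: eq_measure_integral => A mA _ /=.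
exact: lebesgue_measure_affine.
Qed.

Lemma ge0_integral_shift (b : R) (h : R -> \bar R) :
  (forall x, 0 <= h x) -> measurable_fun [set: R] h ->
  \int[mu]_x h (x + b)%R = \int[mu]_x h x.
Proof.
move=> h0 mh; rewrite -[RHS](ge0_integral_affine b ltr01)// mul1e.
by apply: eq_integral => x _; rewrite mul1r.
Qed.

Lemma ge0_integral_opp (h : R -> \bar R) :
  (forall x, 0 <= h x) -> measurable_fun [set: R] h ->
  \int[mu]_x h (- x)%R = \int[mu]_x h x.
Proof.
move=> h0 mh.
pose m1 : {measure set (measurableTypeR R) -> \bar R} :=
  pushforward mu (fun x : measurableTypeR R => (- x)%R : measurableTypeR R).
have mo : measurable_fun [set: measurableTypeR R]
  (fun x : measurableTypeR R => (- x)%R : measurableTypeR R) by exact: oppr_measurable.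
transitivity (\int[m1 mo]_x h x).
  by rewrite ge0_integral_pushforward.
by apply: eq_measure_integral => A mA _ /=; exact: lebesgue_measureN.
Qed.

Lemma ge0_integral_reflect (b : R) (h : R -> \bar R) :
  (forall x, 0 <= h x) -> measurable_fun [set: R] h ->
  \int[mu]_x h (b - x)%R = \int[mu]_x h x.
Proof.
move=> h0 mh.
rewrite -[RHS](ge0_integral_shift b)// -[RHS]ge0_integral_opp//.
- by apply: eq_integral => x _; rewrite addrC.
- by apply: measurableT_comp => //; exact: measurable_funD.
Qed.

End affine.

(** * The Prekopa-Leindler inequality *)

Section prekopa_leindler.
Context {R : realType}.
Local Notation mu := (@lebesgue_measure R).

Lemma measurable_hypograph (f : R -> R) : measurable_fun setT f ->
  measurable [set q : R * R | q.2 < f q.1].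
Proof.
move=> mf.
have mg : measurable_fun setT (fun q : R * R => f q.1 - q.2).
  by apply: measurable_funB => //; exact: measurableT_comp.
have -> : [set q : R * R | q.2 < f q.1] = setT `&` (fun q : R * R => f q.1 - q.2) @^-1` `]0, +oo[%classic.
  by apply/seteqP; split => q /=; rewrite in_itv/= andbT subr_gt0//; case.
exact: mg.
Qed.

(** Tonelli on the region below the graph of [f]. *)
Lemma layer_cake (f : R -> R) : (forall x, 0 <= f x) -> measurable_fun setT f ->
  (\int[mu]_x (f x)%:E = \int[mu]_(r in `]0%R, +oo[) mu [set x | (r < f x)%R])%E.
Proof.
move=> f0 mf.
pose F (p : R * R) : \bar R := (\1_[set q : R * R | 0 < q.2 < f q.1] p)%:E.
have mF : measurable_fun setT F.
  apply/measurable_EFinP; apply: measurable_indic.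
  have -> : [set q : R * R | 0 < q.2 < f q.1] =
     [set q : R * R | 0 < q.2] `&` [set q | q.2 < f q.1].
    by apply/seteqP; split => q /=; [move=> /andP[]|move=> [-> ->]].
  apply: measurableI; last exact: measurable_hypograph.
  have -> : [set q : R * R | 0 < q.2] = setT `&` snd @^-1` `]0, +oo[%classic.
    by apply/seteqP; split => q /=; rewrite in_itv/= andbT//; case.
  exact: measurable_snd.
have F0 p : (0 <= F p)%E by rewrite lee_fin.
transitivity (\int[mu]_x \int[mu]_r F (x, r))%E.
  apply: eq_integral => x _.
  have -> : (fun r => F (x, r)) = (fun r => (\1_(`]0, f x[%classic) r)%:E).
    apply/funext => r; rewrite /F !indicE; congr ((_ %:R)%:E).
  transitivity (mu `](0%R : R), f x[%classic); last first.
    rewrite -[in LHS](setIT `](0%R : R), f x[%classic).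
    rewrite -(@integral_indic _ _ R mu setT measurableT); last exact: measurable_itv.
    by apply: eq_integral.
  rewrite lebesgue_measure_itv/= lte_fin.
  case: ltP => [_|h]; first by rewrite sube0.
  by congr (_%:E); apply/eqP; rewrite eq_le h f0.
rewrite (@fubini_tonelli _ _ _ _ R mu mu F mF F0) [RHS]integral_mkcond.
apply: eq_integral => r _; rewrite patchE.
case: ifPn => [|]; rewrite ?mem_setE ?notin_setE/= in_itv/= andbT => r0.
  have -> : [set x | r < f x] = [set x | 0 < r < f x] by apply/seteqP; split => x /=; rewrite r0.
  have -> : (fun x => F (x, r)) = (fun x => (\1_[set x | 0 < r < f x] x)%:E).
    by apply/funext => x; rewrite /F !indicE.
  rewrite integral_indic ?setIT//.
  have -> : [set x | 0 < r < f x] = setT `&` f @^-1` `]r, +oo[%classic.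
    by apply/seteqP; split => q /=; rewrite r0 in_itv/= andbT//; case.
  exact: mf.
have -> : (fun x => F (x, r)) = cst 0%E.
  apply/funext => x; rewrite /F indicE memNset//=.
  by rewrite (negbTE r0).
by rewrite integral0.
Qed.

Lemma measurable_superlevel (f : R -> R) r : measurable_fun setT f -> measurable [set x | r < f x].
Proof.
move=> mf.
have -> : [set x | r < f x] = setT `&` f @^-1` `]r, +oo[%classic.
  by apply/seteqP; split => q /=; rewrite in_itv/= andbT//; case.
exact: mf.
Qed.

Lemma measurable_distribution (f : R -> R) : measurable_fun setT f ->
  measurable_fun setT (fun r : R => mu [set x | r < f x]).
Proof.
move=> mf.
pose F (p : R * R) : \bar R := (\1_[set q : R * R | q.2 < f q.1] p)%:E.
have mF : measurable_fun setT F.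
  by apply/measurable_EFinP; apply: measurable_indic; exact: measurable_hypograph.
have F0 p : (0 <= F p)%E by rewrite lee_fin.
apply: eqfun_measurable (@measurable_fun_fubini_tonelli_G _ _ _ _ R mu F mF F0).
move=> r; rewrite /fubini_G.
have -> : (fun x => F (x, r)) = (fun x => (\1_[set x | r < f x] x)%:E).
  apply/funext => x; rewrite /F !indicE; congr ((_ %:R)%:E).
by rewrite integral_indic ?setIT//; exact: measurable_superlevel.
Qed.

(** With [a] close to [sup A] and [b] close to [inf B], both [S1 = (1-t) A + t b] and
    [S2 = (1-t) a + t B] lie in [C]. The first lies to the left of [c] and the second to the right
    of [c - e], so they overlap in length at most [e]. *)
Lemma brunn_minkowski1 (t : R) (A B C : set R) (M : R) : 0 < t < 1 ->
  measurable A -> measurable B -> measurable C -> A !=set0 -> B !=set0 ->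
  (forall a, A a -> `|a| <= M) -> (forall b, B b -> `|b| <= M) ->
  (forall a b, A a -> B b -> C ((1 - t) * a + t * b)) ->
  ((1 - t)%:E * mu A + t%:E * mu B <= mu C)%E.
Proof.
move=> /andP[t0 t1] mA mB mC A0 B0 AM BM ABC.
have t1' : 0 < 1 - t by rewrite subr_gt0.
have sA : has_sup A by split => //; exists M => a /AM; apply: le_trans; exact: ler_norm.
have iB : has_inf B.
  by split => //; exists (- M) => b /BM; rewrite ler_norml => /andP[].
apply/lee_addgt0Pr => e e0.
have [a Aa ae] := sup_adherent e0 sA.
have [b Bb be] := inf_adherent e0 iB.
pose c := (1 - t) * sup A + t * b.
pose fA := fun z : R => (1 - t)^-1 * z + - ((1 - t)^-1 * (t * b)).
pose fB := fun z : R => t^-1 * z + - (t^-1 * ((1 - t) * a)).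
pose S1 := fA @^-1` A.
pose S2 := fB @^-1` B.
have mS1 : measurable S1.
  by rewrite -[S1]setTI; apply: measurable_affine.
have mS2 : measurable S2.
  by rewrite -[S2]setTI; apply: measurable_affine.
have S1E : ((1 - t)%:E * mu A = mu S1)%E.
  rewrite -(@lebesgue_measure_affine R (1 - t)^-1 (- ((1 - t)^-1 * (t * b))) A) ?invr_gt0//.
  by rewrite muleA -EFinM mulfV ?gt_eqF// mul1e.
have S2E : (t%:E * mu B = mu S2)%E.
  rewrite -(@lebesgue_measure_affine R t^-1 (- (t^-1 * ((1 - t) * a))) B) ?invr_gt0//.
  by rewrite muleA -EFinM mulfV ?gt_eqF// mul1e.
have S1C : S1 `<=` C `&` `]-oo, c]%classic.
  move=> z S1z; split.
    have -> : z = (1 - t) * fA z + t * b by rewrite /fA; field; rewrite gt_eqF.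
    exact: ABC.
  rewrite /= in_itv/=.
  have -> : z = (1 - t) * fA z + t * b by rewrite /fA; field; rewrite gt_eqF.
  rewrite lerD2r ler_pM2l//; exact: sup_ubound sA.2 _ S1z.
have S2C : S2 `<=` C `&` `[c - e, +oo[%classic.
  move=> z S2z.
  have zE : z = (1 - t) * a + t * fB z by rewrite /fB; field; rewrite gt_eqF.
  split; first by rewrite zE; exact: ABC.
  rewrite /= in_itv/= andbT zE /c.
  have h1 : inf B <= fB z by apply: inf_lbound iB.2 _ S2z.
  have h2 : t * b <= t * (fB z + e) by rewrite ler_pM2l//; lra.
  have h3 : (1 - t) * sup A <= (1 - t) * (a + e) by rewrite ler_pM2l//; lra.
  rewrite mulrDr in h2; rewrite mulrDr in h3; lra.
rewrite S1E S2E.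
have mS2' : measurable (S2 `&` `]c, +oo[) by exact: measurableI.
have h2 : (mu S2 <= mu (S2 `&` `]c, +oo[) + e%:E)%E.
  have -> : e%:E = mu `[c - e, c]%classic.
    rewrite lebesgue_measure_itv/= lte_fin ltrBlDr ltrDl e0 -EFinB; congr (_%:E); lra.
  apply: le_trans (measureU2 _ _ _) => //.
  apply: le_measure; rewrite ?inE//; first exact: measurableU.
  move=> z S2z; have [zc|zc] := leP z c; [right|left] => /=.
    by rewrite in_itv/= zc andbT; have [_] := S2C _ S2z; rewrite /= in_itv/= andbT.
  by split => //; rewrite in_itv/= andbT.
apply: le_trans (leeD (lexx _) h2) _.
rewrite addeA leeD2r//.
rewrite -measureU//.
  apply: le_measure; rewrite ?inE//; first exact: measurableU.
  by move=> z [/S1C[]//|[/S2C[]]].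
apply/seteqP; split => // z [/S1C[_ /=]]; rewrite in_itv/= => zc [_ /=].
by rewrite in_itv/= andbT ltNge zc.
Qed.

Lemma powR_AMGM (a b t : R) : 0 <= a -> 0 <= b -> 0 < t < 1 ->
  a `^ (1 - t) * b `^ t <= (1 - t) * a + t * b.
Proof.
move=> a0 b0 /andP[t0 t1].
have t1' : 0 < 1 - t by rewrite subr_gt0.
have := @conjugate_powR R (a `^ (1 - t)) (b `^ t) (1 - t)^-1 t^-1.
rewrite !powR_ge0 !invr_gt0 !invrK -!powRrM !mulfV ?gt_eqF// !powRr1//.
move=> /(_ isT isT t1' t0); rewrite subrK => /(_ erefl) /le_trans; apply.
lra.
Qed.

(** Brunn-Minkowski applies to super-level sets only when both are nonempty, so [f] and [g] are
    first normalised to supremum 1: at each level [r < 1] both sets are nonempty, and for [r >= 1]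
    both are empty. Integrating over the levels gives the arithmetic version, and AM-GM the
    geometric one. *)
Lemma prekopa_leindler1 (t : R) (f g h : R -> R) (M B : R) : 0 < t < 1 ->
  measurable_fun setT f -> measurable_fun setT g -> measurable_fun setT h ->
  (forall x, 0 <= f x <= M) -> (forall x, 0 <= g x <= M) -> (forall x, 0 <= h x) ->
  (forall x, B < `|x| -> f x = 0) -> (forall x, B < `|x| -> g x = 0) ->
  (forall x y, f x `^ (1 - t) * g y `^ t <= h ((1 - t) * x + t * y)) ->
  ((fine (\int[mu]_x (f x)%:E) `^ (1 - t) * fine (\int[mu]_x (g x)%:E) `^ t)%:E
    <= \int[mu]_x (h x)%:E)%E.
Proof.
move=> /[dup] t01 /andP[t0 t1] mf mg mh f0M g0M h0 fB gB fgh.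
have t1' : 0 < 1 - t by rewrite subr_gt0.
have f0 x : 0 <= f x by case/andP: (f0M x).
have g0 x : 0 <= g x by case/andP: (g0M x).
have ih0 : (0 <= \int[mu]_x (h x)%:E)%E by apply: integral_ge0 => x _; rewrite lee_fin.
have [f00|] := pselect (forall x, f x = 0).
  rewrite (_ : (fun x => (f x)%:E) = cst 0%E); last by apply/funext => x; rewrite f00.
  by rewrite integral0/= powR0 ?gt_eqF// mul0r.
move=> /existsNP[x0 fx0].
have [g00|] := pselect (forall x, g x = 0).
  rewrite (_ : (fun x => (g x)%:E) = cst 0%E); last by apply/funext => x; rewrite g00.
  by rewrite integral0/= powR0 ?gt_eqF// mulr0.
move=> /existsNP[y0 gy0].
have sf : has_sup (range f).
  by split; [exists (f x0); exists x0|exists M => _ [x _ <-]; case/andP: (f0M x)].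
have sg : has_sup (range g).
  by split; [exists (g y0); exists y0|exists M => _ [x _ <-]; case/andP: (g0M x)].
pose a := sup (range f); pose b := sup (range g).
have fa x : f x <= a by apply: sup_ubound sf.2 _ _; exists x.
have gb x : g x <= b by apply: sup_ubound sg.2 _ _; exists x.
have a0 : 0 < a by apply: lt_le_trans (fa x0); rewrite lt_neqAle eq_sym f0 andbT; exact/eqP.
have b0 : 0 < b by apply: lt_le_trans (gb y0); rewrite lt_neqAle eq_sym g0 andbT; exact/eqP.
pose c := a `^ (1 - t) * b `^ t.
have c0 : 0 < c by rewrite mulr_gt0 ?powR_gt0.
pose f1 x := a^-1 * f x; pose g1 x := b^-1 * g x; pose h1 x := c^-1 * h x.
have mf1 : measurable_fun setT f1 by exact: measurable_funM.
have mg1 : measurable_fun setT g1 by exact: measurable_funM.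
have mh1 : measurable_fun setT h1 by exact: measurable_funM.
have f10 x : 0 <= f1 x by rewrite mulr_ge0// invr_ge0 ltW.
have g10 x : 0 <= g1 x by rewrite mulr_ge0// invr_ge0 ltW.
have h10 x : 0 <= h1 x by rewrite mulr_ge0// invr_ge0 ltW.
have f11 x : f1 x <= 1 by rewrite ler_pdivrMl// mulr1.
have g11 x : g1 x <= 1 by rewrite ler_pdivrMl// mulr1.
have key : ((1 - t)%:E * \int[mu]_x (f1 x)%:E + t%:E * \int[mu]_x (g1 x)%:E <= \int[mu]_x (h1 x)%:E)%E.
  rewrite !layer_cake//.
  have mlev (k : R -> R) : measurable_fun setT k ->
      measurable_fun `](0%R : R), +oo[%classic (fun r : R => mu [set x | r < k x]).
    by move=> mk; apply: measurable_funTS; exact: measurable_distribution.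
  rewrite -!ge0_integralZl//; try exact: mlev; try by rewrite lee_fin ltW.
  rewrite -ge0_integralD//; last 4 first.
  - by move=> r _; rewrite mule_ge0// lee_fin ltW.
  - apply: measurable_funeM; exact: mlev.
  - by move=> r _; rewrite mule_ge0// lee_fin ltW.
  - apply: measurable_funeM; exact: mlev.
  apply: ge0_le_integral => //.
  - by move=> r _; rewrite adde_ge0// mule_ge0// lee_fin ltW.
  - by apply: emeasurable_funD; apply: measurable_funeM; exact: mlev.
  - exact: mlev.
  move=> r /=; rewrite in_itv/= andbT => r0.
  have [r1|r1] := leP 1 r.
    rewrite (_ : [set x | r < f1 x] = set0); last first.
      by apply/seteqP; split => x //=; rewrite ltNge (le_trans (f11 x) r1).
    rewrite (_ : [set x | r < g1 x] = set0); last first.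
      by apply/seteqP; split => x //=; rewrite ltNge (le_trans (g11 x) r1).
    by rewrite measure0 !mule0 adde0.
  apply: (@brunn_minkowski1 t _ _ _ `|B|) => //; try exact: measurable_superlevel.
  - have e0 : 0 < a * (1 - r) by rewrite mulr_gt0 ?subr_gt0.
    have [_ [x _ <-] xr] := sup_adherent e0 sf.
    exists x => /=; rewrite /f1 ltr_pdivlMl//; apply: le_lt_trans xr.
    by rewrite -/a; lra.
  - have e0 : 0 < b * (1 - r) by rewrite mulr_gt0 ?subr_gt0.
    have [_ [x _ <-] xr] := sup_adherent e0 sg.
    exists x => /=; rewrite /g1 ltr_pdivlMl//; apply: le_lt_trans xr.
    by rewrite -/b; lra.
  - move=> x /= rx; rewrite leNgt; apply/negP => xB.
    by move: rx; rewrite /f1 (fB _ (le_lt_trans (ler_norm B) xB)) mulr0 ltNge (ltW r0).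
  - move=> x /= rx; rewrite leNgt; apply/negP => xB.
    by move: rx; rewrite /g1 (gB _ (le_lt_trans (ler_norm B) xB)) mulr0 ltNge (ltW r0).
  - move=> x y /= rx ry.
    have rE : r = r `^ (1 - t) * r `^ t.
      by rewrite -powRD ?subrK ?powRr1 ?ltW// ?oner_eq0//.
    have rfg : r < f1 x `^ (1 - t) * g1 y `^ t.
      rewrite [ltLHS]rE; apply: ltr_pM; rewrite ?powR_ge0//.
        by rewrite gt0_ltr_powR// ?nnegrE ?f10 ?(ltW r0).
      by rewrite gt0_ltr_powR// ?nnegrE ?g10 ?(ltW r0).
    suff H : f1 x `^ (1 - t) * g1 y `^ t <= h1 ((1 - t) * x + t * y) by exact: lt_le_trans rfg H.
    rewrite /f1 /g1 /h1 !powRM ?invr_ge0 ?(ltW a0) ?(ltW b0)//.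
    rewrite -!powR_inv1 ?(ltW a0) ?(ltW b0) ?(ltW c0)// -!powRrM.
    have -> : c `^ (-1) = a `^ (-1 * (1 - t)) * b `^ (-1 * t).
      by rewrite /c powRM ?powR_ge0// -!powRrM ![_ * -1]mulrC.
    by rewrite mulrACA ler_wpM2l ?mulr_ge0 ?powR_ge0//.
have scale (k : R -> R) (d : R) : 0 < d -> (forall x, 0 <= k x) -> measurable_fun setT k ->
    (\int[mu]_x (d^-1 * k x)%:E = (d^-1)%:E * \int[mu]_x (k x)%:E)%E.
  move=> d0 k0 mk; under eq_integral do rewrite EFinM.
  rewrite ge0_integralZl//; first exact/measurable_EFinP.
  - by move=> x _; rewrite lee_fin.
  - by rewrite lee_fin invr_ge0 ltW.
move: key; rewrite !scale//.
have fin (k : R -> R) : (forall x, 0 <= k x <= M) -> (forall x, B < `|x| -> k x = 0) ->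
   measurable_fun setT k -> (\int[mu]_x (k x)%:E)%E \is a fin_num.
  move=> kM kB mk; rewrite ge0_fin_numE; last by apply: integral_ge0 => x _; rewrite lee_fin; case/andP: (kM x).
  apply: (@le_lt_trans _ _ (\int[mu]_(x in `[(- `|B|)%R, `|B|%R]%classic) (cst M%:E x))%E).
    rewrite [leRHS]integral_mkcond; apply: ge0_le_integral => //.
    - by move=> x _; rewrite lee_fin; case/andP: (kM x).
    - exact/measurable_EFinP.
    - by apply/(measurable_restrictT _ _).1 => //; exact: measurable_cst.
    move=> x _; rewrite patchE; case: ifPn => [_|]; first by rewrite lee_fin; case/andP: (kM x).
    rewrite notin_setE/= in_itv/= -ler_norml => /negP; rewrite -ltNge => xB.
    by rewrite kB//; apply: le_lt_trans xB; exact: ler_norm.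
  rewrite integral_cst//= lebesgue_measure_itv/=; case: ifP => _; last by rewrite mule0.
  by rewrite -EFinB -EFinM ltry.
have finf := fin f f0M fB mf; have fing := fin g g0M gB mg.
rewrite -[X in ((1 - t)%:E * (_ * X) + _)%E]fineK// -[X in (_ + t%:E * (_ * X))%E]fineK//.
set If := fine _; set Ig := fine _.
have If0 : 0 <= If by apply: fine_ge0; apply: integral_ge0 => x _; rewrite lee_fin.
have Ig0 : 0 <= Ig by apply: fine_ge0; apply: integral_ge0 => x _; rewrite lee_fin.
rewrite -!EFinM -EFinD => key.
have {}key : ((((a^-1 * If) `^ (1 - t)) * ((b^-1 * Ig) `^ t))%:E <= (c^-1)%:E * \int[mu]_x (h x)%:E)%E.
  by apply: le_trans key; rewrite lee_fin; apply: powR_AMGM => //; rewrite mulr_ge0// invr_ge0 ltW.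
have -> : (\int[mu]_x (h x)%:E = c%:E * ((c^-1)%:E * \int[mu]_x (h x)%:E))%E.
  by rewrite muleA -EFinM mulfV ?gt_eqF// mul1e.
apply: le_trans (lee_wpmul2l _ key); last by rewrite lee_fin ltW.
rewrite -EFinM lee_fin /c.
rewrite mulrACA -!powRM ?mulr_ge0 ?invr_ge0 ?(ltW a0) ?(ltW b0)//.
by rewrite !mulrA !mulfV ?gt_eqF// !mul1r.
Qed.

End prekopa_leindler.

(** * The Prekopa-Leindler inequality in several variables *)

Section bounded_iterated.
Context {R : realType}.
Local Notation mu := (@lebesgue_measure R).
Implicit Types (f g h : seq R -> R).

Lemma measurable_indb d (T : measurableType d) (b : T -> bool) :
  measurable [set x | b x] -> measurable_fun [set: T] (fun x => (b x)%:R : R).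
Proof.
move=> mb; apply: (@eqfun_measurable _ _ _ _ (\1_[set x | b x] : T -> R)); last exact: measurable_indic.
move=> x; rewrite indicE; case: (boolP (b x)) => bx; first by rewrite mem_set.
by rewrite memNset//; exact/negP.
Qed.

Lemma measurable_ball0 (B : R) : measurable [set x : R | `|x| <= B].
Proof.
rewrite (_ : [set x | _] = `[(- B)%R, B]%classic); first exact: measurable_itv.
by apply/seteqP; split => x /=; rewrite in_itv/= ler_norml.
Qed.

Definition sbox (B : R) (s : seq R) : bool := all (fun x => `|x| <= B) s.

(** Boundedness with support in a cube is inherited by slices and partial integrals, so an induction
    on the dimension stays in this class, and all integrals are finite. *)
Definition bsupp (M B : R) (n : nat) f :=
  [/\ (forall s, 0 <= f s), smeas n (EFin \o f) &
      forall s, size s = n -> f s <= M * (sbox B s)%:R].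

Definition rint (n : nat) f : R := fine (iint n (EFin \o f)).

Lemma rint_ge0 n f : (forall s, 0 <= f s) -> 0 <= rint n f.
Proof. by move=> f0; apply/fine_ge0/iint_ge0 => s; rewrite lee_fin. Qed.

Lemma integral_ball_cst (B c : R) : 0 <= B -> 0 <= c ->
  (\int[mu]_x (c * (`|x| <= B)%R%:R)%:E = (c * (2 * B))%:E)%E.
Proof.
move=> B0 c0.
transitivity (\int[mu]_x (c%:E * (\1_(`[(- B)%R, B]%classic) x)%:E))%E.
  apply: eq_integral => x _; rewrite indicE -EFinM; congr ((c * _%:R)%:E).
  by rewrite mem_setE in_itv/= ler_norml.
rewrite ge0_integralZl//; last by apply/measurable_EFinP/measurable_indic; exact: measurable_itv.
rewrite integral_indic//= setIT lebesgue_measure_itv/= lte_fin EFinM; congr (_ * _)%E.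
case: ltP => h; first by rewrite -EFinB; congr (_%:E); lra.
by congr (_%:E); lra.
Qed.

Lemma bsupp_cons (M B : R) n f x : 0 <= M -> bsupp M B n.+1 f ->
  bsupp (M * (`|x| <= B)%R%:R) B n (fun s => f (x :: s)).
Proof.
move=> M0 [f0 mf fM]; split => //.
  exact: (smeas_cons x mf).
move=> s sn; apply: le_trans (fM _ _) _; first by rewrite /= sn.
by rewrite /= -mulrA -natrM mulnb.
Qed.

Lemma bsupp_le M M' B n f : M <= M' -> bsupp M B n f -> bsupp M' B n f.
Proof.
move=> MM [f0 mf fM]; split => // s sn; apply: le_trans (fM _ sn) _.
by rewrite ler_wpM2r.
Qed.

Lemma iint_le_box (M B : R) n f : 0 <= M -> 0 <= B -> bsupp M B n f ->
  (iint n (EFin \o f) <= (M * (2 * B) ^+ n)%:E)%E.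
Proof.
move=> + B0; elim: n M f => [|n IH] M f M0 bf.
  by case: bf => _ _ /(_ [::] erefl) /=; rewrite lee_fin expr0.
apply: (@le_trans _ _ (\int[mu]_x ((M * (2 * B) ^+ n) * (`|x| <= B)%R%:R)%:E)%E).
  case: (bf) => f0 mf fM.
  apply: ge0_le_integral => //.
  - by move=> x _; apply: iint_ge0 => s; rewrite lee_fin.
  - by apply: measurable_iint_cons => // s; rewrite lee_fin.
  - apply/measurable_EFinP; apply: measurable_funM => //.
    exact: measurable_indb (measurable_ball0 B).
  move=> x _; rewrite mulrAC; apply: IH; first by rewrite mulr_ge0.
  exact: bsupp_cons.
rewrite integral_ball_cst// ?mulr_ge0 ?exprn_ge0 ?mulr_ge0//.
by rewrite lee_fin exprSr -mulrA.
Qed.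

Lemma rintE (M B : R) n f : 0 <= M -> 0 <= B -> bsupp M B n f ->
  ((rint n f)%:E = iint n (EFin \o f))%E.
Proof.
move=> M0 B0 bf; rewrite /rint fineK// ge0_fin_numE.
  by apply: le_lt_trans (iint_le_box M0 B0 bf) _; rewrite ltry.
by apply: iint_ge0 => s; case: bf => f0 _ _; rewrite lee_fin.
Qed.

Lemma rint_le_box (M B : R) n f : 0 <= M -> 0 <= B -> bsupp M B n f ->
  rint n f <= M * (2 * B) ^+ n.
Proof.
by move=> M0 B0 bf; rewrite -lee_fin (rintE M0 B0 bf); exact: iint_le_box.
Qed.

Lemma measurable_rint_cons n f : (forall s, 0 <= f s) -> smeas n.+1 (EFin \o f) ->
  measurable_fun setT (fun x => rint n (fun s => f (x :: s))).
Proof.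
move=> f0 mf.
apply: (@measurableT_comp _ _ _ _ _ _ fine _ (fun x => iint n (fun s => (f (x :: s))%:E))); first exact: fine_measurable.
by apply: (measurable_iint_cons (f := EFin \o f)) => // s; rewrite lee_fin.
Qed.

Lemma rint_cons (M B : R) n f : 0 <= M -> 0 <= B -> bsupp M B n.+1 f ->
  (\int[mu]_x (rint n (fun s => f (x :: s)))%:E = (rint n.+1 f)%:E)%E.
Proof.
move=> M0 B0 bf; rewrite (rintE M0 B0 bf)/=; apply: eq_integral => x _.
by rewrite (@rintE (M * (`|x| <= B)%R%:R) B) ?mulr_ge0//; exact: bsupp_cons.
Qed.

Definition scomb (t : R) (s u : seq R) : seq R := [seq (1 - t) * p.1 + t * p.2 | p <- zip s u].

(** By induction, the partial integrals over all variables but the first satisfy the pointwise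
    hypothesis of the one-dimensional inequality. *)
Lemma prekopa_leindler (t : R) n f g h (M B : R) : 0 <= M -> 0 <= B -> 0 < t < 1 ->
  bsupp M B n f -> bsupp M B n g -> bsupp M B n h ->
  (forall s u, size s = n -> size u = n -> f s `^ (1 - t) * g u `^ t <= h (scomb t s u)) ->
  rint n f `^ (1 - t) * rint n g `^ t <= rint n h.
Proof.
move=> M0 B0 t01; elim: n M M0 f g h => [|n IH] M M0 f g h bf bg bh fgh; first exact: (fgh [::] [::]).
have [f0 mf fM] := bf; have [g0 mg gM] := bg; have [h0 mh hM] := bh.
have bc k x : bsupp M B n.+1 k -> bsupp M B n (fun s => k (x :: s)).
  move=> bk; apply: bsupp_le (bsupp_cons x M0 bk).
  by rewrite -[leRHS]mulr1 ler_wpM2l// lern1; case: (_ <= _).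
have Bn0 : 0 <= M * (2 * B) ^+ n by rewrite mulr_ge0 ?exprn_ge0 ?mulr_ge0.
have bnd k x : bsupp M B n.+1 k -> 0 <= rint n (fun s => k (x :: s)) <= M * (2 * B) ^+ n.
  move=> bk; have := bc _ x bk => bkx; rewrite rint_ge0 ?(rint_le_box M0 B0)//.
  by case: bkx.
have van k x : bsupp M B n.+1 k -> B < `|x| -> rint n (fun s => k (x :: s)) = 0.
  move=> bk xB; apply/eqP; rewrite eq_le rint_ge0 ?andbT; last by case: bk.
  have := rint_le_box _ B0 (bsupp_cons x M0 bk).
  by rewrite (ltNge B) in xB; rewrite (negbTE xB) mulr0 mul0r; apply.
have := @prekopa_leindler1 R t (fun x => rint n (fun s => f (x :: s)))
  (fun x => rint n (fun s => g (x :: s))) (fun x => rint n (fun s => h (x :: s)))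
  (M * (2 * B) ^+ n) B t01 (measurable_rint_cons f0 mf) (measurable_rint_cons g0 mg)
  (measurable_rint_cons h0 mh).
rewrite (rint_cons M0 B0 bf) (rint_cons M0 B0 bg) (rint_cons M0 B0 bh)/= lee_fin.
apply => //.
- by move=> x; exact: bnd.
- by move=> x; exact: bnd.
- by move=> x; apply: rint_ge0.
- by move=> x; exact: van.
- by move=> x; exact: van.
move=> x y; apply: (IH M M0 (fun s => f (x :: s)) (fun s => g (y :: s)) (fun s => h ((1 - t) * x + t * y :: s))); try exact: bc.
by move=> s u sn un; apply: (fgh (x :: s) (y :: u)); rewrite /= ?sn ?un.
Qed.

End bounded_iterated.

(** * Quantitative regularity of log-concave densities *)

Section log_concave.
Context {R : realType}.
Local Notation mu := (@lebesgue_measure R).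

Definition log_concave (p : R -> R) :=
  forall t x y : R, 0 < t < 1 -> p x `^ (1 - t) * p y `^ t <= p ((1 - t) * x + t * y).

Variable p : R -> R.
Hypothesis p0 : forall x, 0 <= p x.
Hypothesis mp : measurable_fun setT p.
Hypothesis lcp : log_concave p.

(** [x + d] and [y] are the convex combinations of [x] and [y + d] with weights [t] and [1 - t]
    exchanged; the two inequalities are multiplied. *)
Lemma log_concave4 x y d : x <= y -> 0 <= d -> p (y + d) * p x <= p y * p (x + d).
Proof.
rewrite le_eqVlt => /predU1P[->|xy]; first by rewrite mulrC.
rewrite le_eqVlt => /predU1P[<-|d0]; first by rewrite !addr0.
pose t := d / (y + d - x).
have D0 : 0 < y + d - x by lra.
have t01 : 0 < t < 1.
  by rewrite /t divr_gt0//= ltr_pdivrMr// mul1r; lra.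
have t01' : 0 < 1 - t < 1 by case/andP: t01 => ? ?; apply/andP; split; lra.
have h1 := lcp x (y + d) t01; have h2 := lcp x (y + d) t01'.
have e1 : (1 - t) * x + t * (y + d) = x + d by rewrite /t; field; rewrite gt_eqF.
have e2 : (1 - (1 - t)) * x + (1 - t) * (y + d) = y by rewrite /t; field; rewrite gt_eqF.
rewrite e1 in h1; rewrite e2 in h2.
apply: le_trans (ler_pM _ _ h2 h1); rewrite ?mulr_ge0 ?powR_ge0//.
have pw a : 0 <= a -> a `^ (1 - t) * a `^ t = a.
  by move=> a0; rewrite -powRD ?subrK ?powRr1// oner_eq0.
have -> : 1 - (1 - t) = t by lra.
by rewrite mulrACA [p x `^ t * _]mulrC pw// [p (y + d) `^ _ * _]pw// mulrC.
Qed.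

(** If [p y < th * p x] with [y = x + d], then by [log_concave4] the ratio only gets worse to the
    right: [p (z + d) <= th * p z] for all [z >= x]. The mass beyond [y] would then be at most [th]
    times the mass beyond [x]. *)
Lemma log_concave_right_mass (x l th : R) : 0 <= th <= 1 ->
  (\int[mu]_(y in `[x, +oo[) (p y)%:E <= 1)%E ->
  (th%:E < \int[mu]_(y in `[(x + l)%R, +oo[) (p y)%:E)%E ->
  forall y, x <= y <= x + l -> th * p x <= p y.
Proof.
move=> /andP[th0 th1] J1 Jth y /andP[xy yl].
rewrite leNgt; apply/negP => pyx.
have px : 0 < p x.
  rewrite lt_neqAle p0 andbT; apply/negP => /eqP px; move: pyx.
  by rewrite -px mulr0 ltNge p0.
pose d := y - x.
have d0 : 0 <= d by rewrite subr_ge0.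
have H z : x <= z -> p (z + d) <= th * p z.
  move=> xz; rewrite -(ler_pM2r px); apply: le_trans (log_concave4 xz d0) _.
  by rewrite -mulrA mulrCA ler_wpM2l// /d addrC subrK ltW.
have : (\int[mu]_(y in `[(x + l)%R, +oo[) (p y)%:E <= th%:E)%E.
  apply: (@le_trans _ _ (\int[mu]_(z in `[y, +oo[) (p z)%:E)%E).
    apply: ge0_subset_integral => //.
    - by apply/measurable_EFinP; exact: measurable_funTS.
    - by move=> z _; rewrite lee_fin.
    - by move=> z /=; rewrite !in_itv/= !andbT; apply: le_trans.
  apply: (@le_trans _ _ (\int[mu]_(z in `[x, +oo[) (th * p z)%:E)%E); last first.
    under eq_integral do rewrite EFinM.
    rewrite ge0_integralZl//.
    - by rewrite -[leRHS]mule1 lee_wpmul2l// lee_fin.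
    - by apply/measurable_EFinP; exact: measurable_funTS.
    - by move=> z _; rewrite lee_fin.
  rewrite [leLHS]integral_mkcond [leRHS]integral_mkcond.
  rewrite -[leLHS](ge0_integral_shift d); last 2 first.
  - by move=> z; rewrite patchE; case: ifP => // _; rewrite lee_fin.
  - by apply/(measurable_restrictT _ _).1 => //; apply/measurable_EFinP; exact: measurable_funTS.
  apply: ge0_le_integral => //.
  - by move=> z _; rewrite patchE; case: ifP => // _; rewrite lee_fin.
  - apply: measurable_shift.
    by apply/(measurable_restrictT _ _).1 => //; apply/measurable_EFinP; exact: measurable_funTS.
  - apply/(measurable_restrictT _ _).1 => //; apply/measurable_EFinP; apply: measurable_funTS.
    exact: measurable_funM.
  move=> z _; rewrite !patchE !mem_setE !in_itv/= !andbT.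
  have -> : (y <= z + d) = (x <= z) by rewrite /d; apply/idP/idP => h; lra.
  by case: ifP => // xz; rewrite lee_fin; exact: H.
by rewrite leNgt Jth.
Qed.

Lemma log_concave_point_mass (x l th : R) : 0 <= th <= 1 -> 0 <= l ->
  (\int[mu]_(y in `[x, +oo[) (p y)%:E <= 1)%E ->
  (th%:E < \int[mu]_(y in `[(x + l)%R, +oo[) (p y)%:E)%E ->
  ((th * l * p x)%:E <= \int[mu]_(y in `[x, (x + l)%R]) (p y)%:E)%E.
Proof.
move=> th01 l0 J1 Jth; have H := log_concave_right_mass th01 J1 Jth.
apply: (@le_trans _ _ (\int[mu]_(y in `[x, (x + l)%R]%classic) (cst (th * p x)%:E y))%E).
  rewrite integral_cst//= lebesgue_measure_itv/= lte_fin ltrDl.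
  case: ltP => [l1|l1].
    rewrite [leRHS](_ : _ = (th * l * p x)%:E) ?lexx//.
    by rewrite -EFinD -EFinM; congr (_%:E); ring.
  have -> : l = 0 by apply/eqP; rewrite eq_le l0 l1.
  by rewrite mulr0 mul0r mule0.
apply: ge0_le_integral => //.
- by move=> y _; rewrite lee_fin mulr_ge0//; case/andP: th01.
- by apply/measurable_EFinP; exact: measurable_funTS.
Qed.

(** The mass to the right yields [p (x + l) >= th * p x] and [p x <= 1 / (th * l)]. Log-concavity
    between [x] and [x + l] gives [p y >= th ^ t * p x] with [t = (y - x) / l], and
    [th ^ t >= 1 + t ln th]. *)
Lemma log_concave_drop (x y l th : R) : 0 < th < 1 -> 0 < l ->
  (\int[mu]_z (p z)%:E <= 1)%E ->
  (th%:E < \int[mu]_(z in `[(x + l)%R, +oo[) (p z)%:E)%E ->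
  x < y < x + l -> p x - p y <= - ln th / (th * l ^+ 2) * (y - x).
Proof.
move=> /andP[th0 th1] l0 J1 Jth /andP[xy yl].
have sub (A : set R) : measurable A -> (\int[mu]_(z in A) (p z)%:E <= 1)%E.
  move=> mA; apply: le_trans J1; apply: ge0_subset_integral => //.
  - exact/measurable_EFinP.
  - by move=> z _; rewrite lee_fin.
have th01 : 0 <= th <= 1 by rewrite !ltW.
have J1' : (\int[mu]_(z in `[x, +oo[) (p z)%:E <= 1)%E by apply: sub; exact: measurable_itv.
have pl : th * p x <= p (x + l).
  by apply: (log_concave_right_mass th01 J1' Jth); rewrite lexx lerDl ltW.
have px : p x <= (th * l)^-1.
  rewrite -[leRHS]mul1r ler_pdivlMr ?mulr_gt0// mulrC -lee_fin.
  apply: le_trans (log_concave_point_mass th01 (ltW l0) J1' Jth) (sub _ _); exact: measurable_itv.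
pose t := (y - x) / l.
have t01 : 0 < t < 1 by rewrite /t divr_gt0 ?subr_gt0//= ltr_pdivrMr// mul1r; lra.
have py : th `^ t * p x <= p y.
  have := lcp x (x + l) t01.
  have -> : (1 - t) * x + t * (x + l) = y by rewrite /t; field; rewrite gt_eqF.
  apply: le_trans.
  apply: (@le_trans _ _ (p x `^ (1 - t) * (th * p x) `^ t)).
    rewrite powRM ?(ltW th0)// mulrCA -powRD ?subrK ?powRr1//.
    by rewrite oner_eq0.
  rewrite ler_wpM2l ?powR_ge0//; apply: ge0_ler_powR => //.
  - by case/andP: t01 => /ltW.
  - by rewrite nnegrE mulr_ge0// ltW.
  - by rewrite nnegrE.
have th' : 1 + t * ln th <= th `^ t.
  by rewrite /powR gt_eqF//; exact: expR_ge1Dx.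
have lnth : ln th < 0 by apply: ln_lt0; rewrite th0.
have t0 : 0 <= t by case/andP: t01 => /ltW.
have -> : - ln th / (th * l ^+ 2) * (y - x) = - (t * ln th) * (th * l)^-1.
  by rewrite /t; field; rewrite !gt_eqF.
apply: (@le_trans _ _ (- (t * ln th) * p x)).
  apply: (@le_trans _ _ (p x - th `^ t * p x)); first by rewrite lerD2l lerN2.
  have : (1 + t * ln th) * p x <= th `^ t * p x by rewrite ler_wpM2r.
  lra.
by rewrite ler_wpM2l// oppr_ge0 mulr_ge0_le0// ltW.
Qed.

End log_concave.

Lemma log_concave_opp {R : realType} (p : R -> R) : log_concave p -> log_concave (fun x => p (- x)).
Proof.
move=> lcp t x y t01; have := lcp t (- x) (- y) t01.
by rewrite !mulrN -opprD.
Qed.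

(** An increase of [p] is a drop of the reflected density, which is why mass is required on both
    sides. The constant involves [p] only through the lower bound [th] for these masses. *)
Lemma log_concave_lipschitz {R : realType} (p : R -> R) (a b l th : R) :
  (forall x, 0 <= p x) -> measurable_fun setT p -> log_concave p ->
  0 < th < 1 -> 0 < l ->
  (\int[lebesgue_measure]_z (p z)%:E <= 1)%E ->
  (th%:E < \int[lebesgue_measure]_(z in `[b, +oo[) (p z)%:E)%E ->
  (th%:E < \int[lebesgue_measure]_(z in `]-oo, a]) (p z)%:E)%E ->
  forall x y, a + l <= x -> x + l <= b -> a + l <= y -> y + l <= b -> `|x - y| < l ->
  `|p x - p y| <= - ln th / (th * l ^+ 2) * `|x - y|.
Proof.
move=> p0 mp lcp th01 l0 J1 Jb Ja.
have Jr x : x + l <= b -> (th%:E < \int[lebesgue_measure]_(z in `[(x + l)%R, +oo[) (p z)%:E)%E.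
  move=> xb; apply: lt_le_trans Jb _; apply: ge0_subset_integral => //.
  - by apply/measurable_EFinP; exact: measurable_funTS.
  - by move=> z _; rewrite lee_fin.
  - by move=> z /=; rewrite !in_itv/= !andbT; exact: le_trans.
have mq : measurable_fun setT (fun x : R => p (- x)) by apply: measurableT_comp.
have Jl x : a + l <= x -> (th%:E < \int[lebesgue_measure]_(z in `[(- x + l)%R, +oo[) (p (- z))%:E)%E.
  move=> xb; apply: lt_le_trans Ja _.
  rewrite [leLHS]integral_mkcond [leRHS]integral_mkcond -[leLHS]ge0_integral_opp; last 2 first.
  - by move=> z; rewrite patchE; case: ifP => // _; rewrite lee_fin.
  - by apply/(measurable_restrictT _ _).1 => //; apply/measurable_EFinP; exact: measurable_funTS.
  apply: ge0_le_integral => //.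
  - by move=> z _; rewrite patchE; case: ifP => // _; rewrite lee_fin.
  - apply: measurable_reflect.
    by apply/(measurable_restrictT _ _).1 => //; apply/measurable_EFinP; exact: measurable_funTS.
  - by apply/(measurable_restrictT _ _).1 => //; apply/measurable_EFinP; exact: measurable_funTS.
  move=> z _; rewrite !patchE !mem_setE !in_itv/= !andbT.
  case: ifP => [za|_]; last by case: ifP => // _; rewrite lee_fin.
  by rewrite ifT//; lra.
have Jq : (\int[lebesgue_measure]_z (p (- z))%:E <= 1)%E.
  by rewrite (@ge0_integral_opp R (fun z => (p z)%:E))//; exact/measurable_EFinP.
have drop x y : a + l <= x -> x + l <= b -> a + l <= y -> y + l <= b -> `|x - y| < l ->
    p x - p y <= - ln th / (th * l ^+ 2) * `|x - y|.
  move=> xa xb ya yb xyl; have [xy|xy|->] := ltgtP x y.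
  - rewrite ltr0_norm ?subr_lt0// opprB in xyl *.
    apply: log_concave_drop => //; first exact: Jr.
    by rewrite xy/=; lra.
  - rewrite gtr0_norm ?subr_gt0// in xyl *.
    have := @log_concave_drop R _ (fun z => p0 (- z)) mq (log_concave_opp lcp) (- x) (- y) l th th01 l0 Jq (Jl _ xa).
    rewrite !opprK [- y + x]addrC; apply.
    by apply/andP; split; lra.
  - by rewrite !subrr normr0 mulr0.
move=> x y xa xb ya yb xyl; rewrite ler_norml drop// andbT lerNl opprB.
by rewrite distrC drop// distrC.
Qed.

(** * Points on a circle *)

Section sine_facts.
Context {R : realType}.
Implicit Types x y : R.

Lemma sin_tangent x y : 0 <= x <= pi -> 0 <= y <= pi -> sin y <= sin x + cos x * (y - x).
Proof.
move=> /andP[x0 xp] /andP[y0 yp].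
have ler_cos (u v : R) : 0 <= u -> u <= v -> v <= pi -> cos v <= cos u.
  move=> u0 uv vp; rewrite leNgt; apply/negP.
  rewrite ltr_cos ?in_itv/= ?u0 ?(le_trans u0 uv) ?vp ?(le_trans uv vp)//.
  by rewrite ltNge uv.
have mvt (u v : R) : u <= v -> exists2 c, u <= c <= v & sin v - sin u = cos c * (v - u).
  move=> uv; have := @MVT_segment R sin cos u v uv.
  case.
    exact/continuous_subspaceT/continuous_sin.
  by move=> c; rewrite in_itv/= => uc E; exists c.
have [xy|yx] := leP x y.
  have [c /andP[xc cy] E] := mvt _ _ xy.
  have : cos c * (y - x) <= cos x * (y - x).
    by rewrite ler_wpM2r ?subr_ge0//; apply: ler_cos => //; exact: le_trans yp.
  lra.
have [c /andP[xc cy] E] := mvt _ _ (ltW yx).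
have : cos x * (x - y) <= cos c * (x - y).
  by rewrite ler_wpM2r ?subr_ge0 ?(ltW yx)//; apply: ler_cos => //; exact: le_trans xc.
lra.
Qed.

Lemma sin_concave t x y : 0 <= t <= 1 -> 0 <= x <= pi -> 0 <= y <= pi ->
  (1 - t) * sin x + t * sin y <= sin ((1 - t) * x + t * y).
Proof.
move=> /andP[t0 t1] x0 y0.
have z0 : 0 <= (1 - t) * x + t * y <= pi.
  case/andP: x0 => x0 xp; case/andP: y0 => y0 yp; apply/andP; split.
    by rewrite addr_ge0// mulr_ge0// subr_ge0.
  have h1 : (1 - t) * x <= (1 - t) * pi by rewrite ler_wpM2l// subr_ge0.
  have h2 : t * y <= t * pi by rewrite ler_wpM2l.
  lra.
have := sin_tangent z0 x0; have := sin_tangent z0 y0.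
set z := (1 - t) * x + t * y; move=> hy hx.
have h1 : (1 - t) * sin x <= (1 - t) * (sin z + cos z * (x - z)) by rewrite ler_wpM2l// subr_ge0.
have h2 : t * sin y <= t * (sin z + cos z * (y - z)) by rewrite ler_wpM2l.
have : (1 - t) * (sin z + cos z * (x - z)) + t * (sin z + cos z * (y - z)) = sin z.
  by rewrite /z; ring.
lra.
Qed.

Lemma sin_scale c x : 0 <= c <= 1 -> 0 <= x <= pi -> c * sin x <= sin (c * x).
Proof.
move=> c01 x0; have p0 : 0 <= (0 : R) <= pi by rewrite lexx pi_ge0.
by have := sin_concave c01 p0 x0; rewrite sin0 !mulr0 !add0r.
Qed.

Lemma sin_le_id x : 0 <= x <= pi -> sin x <= x.
Proof.
move=> x0; have p0 : 0 <= (0 : R) <= pi by rewrite lexx pi_ge0.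
by have := sin_tangent p0 x0; rewrite sin0 cos0 mul1r subr0 add0r.
Qed.

Lemma mul_cos_le_sin x : 0 <= x <= pi -> x * cos x <= sin x.
Proof.
move=> x0; have p0 : 0 <= (0 : R) <= pi by rewrite lexx pi_ge0.
have := sin_tangent x0 p0; rewrite sin0 sub0r mulrN; lra.
Qed.

Lemma sin_jordan x : 0 <= x <= pi / 2 -> 2 / pi * x <= sin x.
Proof.
move=> /andP[x0 xp]; have pp := @pi_gt0 R.
have c01 : 0 <= 2 / pi * x <= 1.
  rewrite mulr_ge0 ?divr_ge0// ?(ltW pp)//= -ler_pdivlMl ?divr_gt0// invf_div mulr1//.
have h : 0 <= (pi / 2 : R) <= pi by rewrite divr_ge0 ?(ltW pp)//=; lra.
have := sin_scale c01 h; rewrite sin_pihalf mulr1.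
have pn : (pi : R) != 0 by rewrite gt_eqF.
have e : (2 / pi : R) * (pi / 2) = 1 by rewrite mulrA divfK// divff// pnatr_eq0.
have E : 2 / pi * x * (pi / 2) = x by rewrite mulrAC e mul1r.
by rewrite E.
Qed.

(* [sin a sin b = sin ((a+b)/2)^2 - sin ((a-b)/2)^2] quantifies the concavity of
   [ln sin]. *)
Lemma sin_midpoint x y : 0 < x < pi -> 0 < y < pi ->
  sin x * sin y <= sin ((x + y) / 2) ^+ 2 * expR (- ((x - y) / (x + y)) ^+ 2).
Proof.
move=> /andP[x0 xp] /andP[y0 yp].
pose u := (x + y) / 2; pose v := (x - y) / 2.
have -> : x = u + v by rewrite /u /v; field.
have -> : y = u - v by rewrite /u /v; field.
have u0 : 0 < u by rewrite /u; lra.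
have up : u < pi by rewrite /u; lra.
rewrite sinD sinB.
have -> : (u + v + (u - v)) / 2 = u by field.
have -> : (u + v - (u - v)) / (u + v + (u - v)) = v / u.
  by field; rewrite !gt_eqF//; lra.
have -> : (sin u * cos v + cos u * sin v) * (sin u * cos v - cos u * sin v) = sin u ^+ 2 - sin v ^+ 2.
  by have := cos2sin2 u; have := cos2sin2 v => hv hu; ring: hv hu.
have su : 0 < sin u by apply: sin_gt0_pi; rewrite u0.
have c01 : 0 <= `|v| / u <= 1.
  rewrite divr_ge0 ?(ltW u0)//= ler_pdivrMr// mul1r /u /v ler_norml; lra.
have h : `|v| / u * sin u <= `|sin v|.
  have := sin_scale c01 (_ : 0 <= u <= pi); rewrite (ltW u0) (ltW up) => /(_ isT)/le_trans; apply.
  rewrite -mulrA mulVf ?gt_eqF// mulr1.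
  have [v0|v0] := leP 0 v; first by rewrite ger0_norm// ler_norm.
  by rewrite ltr0_norm// sinN -normrN ler_norm.
have h2 : (v / u) ^+ 2 * sin u ^+ 2 <= sin v ^+ 2.
  rewrite -[leRHS]real_normK ?num_real//.
  have nE (a : R) : (a / u) ^+ 2 = (`|a| / u) ^+ 2 by rewrite !exprMn real_normK ?num_real.
  rewrite nE -exprMn.
  by rewrite ler_pXn2r ?nnegrE// mulr_ge0 ?(ltW su)//; case/andP: c01.
apply: (@le_trans _ _ (sin u ^+ 2 * (1 - (v / u) ^+ 2))); first lra.
rewrite ler_wpM2l ?exprn_ge0 ?(ltW su)//.
exact: expR_ge1Dx.
Qed.

End sine_facts.

(** * Chord lengths as functions of the arc distance *)

Section hchord.
Context {R : realType}.
Variable m : nat.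
Local Notation n := (m.+1%:R : R).

(* The circle carries [m.+1] points and has length [period], so that the mean
   density of points is [1 / (2 pi)]. *)
Definition period : R := 2 * pi * n.

(* Half of the Euclidean distance between two points of the unit circle at arc
   distance [x / n], cut off outside [0 < x < period]. *)
Definition hchord (x : R) : R := if 0 < x < period then sin (x / (2 * n)) else 0.

Let n0 : 0 < n := ltr0Sn _ _.
Let n20 : 0 < 2 * n. Proof. by rewrite mulr_gt0. Qed.

Lemma period_gt0 : 0 < period.
Proof. by rewrite /period !mulr_gt0// pi_gt0. Qed.

Lemma hchord_arg x : 0 < x < period -> 0 < x / (2 * n) < pi.
Proof.
move=> /andP[x0 xp]; rewrite divr_gt0//= ltr_pdivrMr//.
by move: xp; rewrite /period; lra.
Qed.

Lemma hchord_gt0 x : 0 < x < period -> 0 < hchord x.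
Proof. by move=> xp; rewrite /hchord xp; apply/sin_gt0_pi/hchord_arg. Qed.

Lemma hchord_eq0 x : ~~ (0 < x < period) -> hchord x = 0.
Proof. by move=> xp; rewrite /hchord (negbTE xp). Qed.

Lemma hchord_neq0 x : hchord x != 0 -> 0 < x < period.
Proof. by apply: contraR => /hchord_eq0 ->. Qed.

Lemma hchord_ge0 x : 0 <= hchord x.
Proof.
have [/hchord_gt0/ltW//|/hchord_eq0 ->//] := boolP (0 < x < period).
Qed.

Lemma hchord_le1 x : hchord x <= 1.
Proof. by rewrite /hchord; case: ifP => // _; exact: sin_le1. Qed.

Lemma hchord_sym x : hchord (period - x) = hchord x.
Proof.
rewrite /hchord; have -> : (0 < period - x < period) = (0 < x < period).
  by apply/idP/idP => /andP[? ?]; apply/andP; split; lra.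
case: ifP => // _.
have -> : (period - x) / (2 * n) = - (x / (2 * n) - pi).
  by rewrite /period; field; rewrite gt_eqF.
rewrite sinN.
by have /eqP := sinDpi (x / (2 * n) - pi); rewrite subrK => /eqP ->.
Qed.

(** Concavity of the sine with AM-GM; outside of the period the left side vanishes. *)
Lemma hchord_lc : log_concave hchord.
Proof.
move=> t x y /[dup] t01 /andP[t0 t1].
have [xp|/hchord_eq0 ->] := boolP (0 < x < period); last first.
  by rewrite powR0 ?mul0r ?hchord_ge0// gt_eqF// subr_gt0.
have [yp|/hchord_eq0 ->] := boolP (0 < y < period); last first.
  by rewrite powR0 ?mulr0 ?hchord_ge0// gt_eqF.
apply: le_trans (powR_AMGM (hchord_ge0 _) (hchord_ge0 _) t01) _.
have t1' : 0 < 1 - t by rewrite subr_gt0.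
have zp : 0 < (1 - t) * x + t * y < period.
  case/andP: xp => x0 xp; case/andP: yp => y0 yp.
  rewrite addr_gt0 ?mulr_gt0//=.
  have h1 : (1 - t) * x < (1 - t) * period by rewrite ltr_pM2l.
  have h2 : t * y < t * period by rewrite ltr_pM2l.
  lra.
rewrite /hchord xp yp zp.
have /andP[x0' xp'] := hchord_arg xp; have /andP[y0' yp'] := hchord_arg yp.
have := @sin_concave R t (x / (2 * n)) (y / (2 * n)).
rewrite (ltW t0) (ltW t1) (ltW x0') (ltW xp') (ltW y0') (ltW yp') => /(_ isT isT isT).
by rewrite !mulrA -mulrDl.
Qed.

Lemma hchord_qc x y z : x <= z <= y -> Num.min (hchord x) (hchord y) <= hchord z.
Proof.
move=> /andP[xz zy].
have [->|zx] := eqVneq z x; first by rewrite ge_min lexx.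
have [->|zyn] := eqVneq z y; first by rewrite ge_min lexx orbT.
have xz' : x < z by rewrite lt_neqAle eq_sym zx.
have zy' : z < y by rewrite lt_neqAle zyn.
pose t := (z - x) / (y - x).
have t01 : 0 < t < 1.
  have D : 0 < y - x by lra.
  rewrite /t; apply/andP; split; first by rewrite divr_gt0// subr_gt0.
  by rewrite ltr_pdivrMr// mul1r; lra.
have := hchord_lc x y t01.
have -> : (1 - t) * x + t * y = z.
  by rewrite /t; field; rewrite gt_eqF// subr_gt0 (lt_trans xz').
apply: le_trans.
set a := Num.min _ _.
have a0 : 0 <= a by rewrite le_min !hchord_ge0.
have ax : a <= hchord x by rewrite ge_min lexx.
have ay : a <= hchord y by rewrite ge_min lexx orbT.
have -> : a = a `^ (1 - t) * a `^ t by rewrite -powRD ?subrK ?powRr1// oner_eq0.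
case/andP: t01 => t0 t1.
apply: ler_pM; rewrite ?powR_ge0//; apply: ge0_ler_powR; rewrite ?nnegrE ?hchord_ge0//.
- by rewrite subr_ge0 ltW.
- exact: ltW.
Qed.

Lemma hchord_scale c x : 0 < c <= 1 -> 0 < x < period -> c * hchord x <= hchord (c * x).
Proof.
move=> /andP[c0 c1] xp; have /andP[x0 xp'] := xp.
have cxp : 0 < c * x < period.
  by rewrite mulr_gt0//= (le_lt_trans _ xp')// ler_piMl// ltW.
rewrite /hchord xp cxp -mulrA; have /andP[x0' xp''] := hchord_arg xp.
by apply: sin_scale; rewrite ?(ltW c0)// !ltW.
Qed.

Lemma measurable_hchord : measurable_fun setT hchord.
Proof.
apply: measurable_fun_ifT => //.
  by apply: measurable_and => //; apply: measurable_fun_ltr.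
apply: measurableT_comp; first by apply: continuous_measurable_fun; exact: continuous_sin.
exact: measurable_funM.
Qed.

Lemma hchord_midpoint x y : 0 < x < period -> 0 < y < period ->
  hchord x * hchord y <= hchord ((x + y) / 2) ^+ 2 * expR (- ((x - y) / (x + y)) ^+ 2).
Proof.
move=> xp yp; have zp : 0 < (x + y) / 2 < period.
  by case/andP: xp => ? ?; case/andP: yp => ? ?; lra.
rewrite /hchord xp yp zp.
have := sin_midpoint (hchord_arg xp) (hchord_arg yp).
have -> : (x / (2 * n) + y / (2 * n)) / 2 = (x + y) / 2 / (2 * n) by field; rewrite gt_eqF.
have -> //: (x / (2 * n) - y / (2 * n)) / (x / (2 * n) + y / (2 * n)) = (x - y) / (x + y).
case/andP: xp => x0 _; case/andP: yp => y0 _.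
by field; rewrite !gt_eqF// ?addr_gt0// ?mulr_gt0//; nra.
Qed.

(* Derivative of [ln hchord] at [k] lattice steps. *)
Definition slope (k : nat) : R := cos (pi * k%:R / n) / sin (pi * k%:R / n) / (2 * n).

Let latarg k : (0 < k < m.+1)%N -> 0 < pi * k%:R / n < (pi : R).
Proof.
move=> /andP[k0 km]; have pp := @pi_gt0 R.
rewrite divr_gt0 ?mulr_gt0 ?ltr0n//= ltr_pdivrMr// ltr_pM2l// ltr_nat//.
Qed.

Lemma lat_range k : (0 < k < m.+1)%N -> 0 < 2 * (pi : R) * k%:R < period.
Proof.
move=> /andP[k0 km]; have pp := @pi_gt0 R.
by rewrite !mulr_gt0 ?ltr0n//= /period ltr_pM2l ?mulr_gt0// ltr_nat.
Qed.

Lemma hchord_lat k : (0 < k < m.+1)%N -> hchord (2 * pi * k%:R) = sin (pi * k%:R / n).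
Proof.
move=> km; rewrite /hchord lat_range//; congr sin.
by field; rewrite gt_eqF.
Qed.

Lemma hchord_lat_gt0 k : (0 < k < m.+1)%N -> 0 < hchord (2 * pi * k%:R).
Proof. by move=> km; apply/hchord_gt0/lat_range. Qed.

(** The tangent inequality for [ln sin] at a lattice distance, in multiplicative form: the tangent
    to the sine followed by [1 + u <= exp u]. *)
Lemma hchord_tangent k x : (0 < k < m.+1)%N ->
  hchord x <= hchord (2 * pi * k%:R) * expR (slope k * (x - 2 * pi * k%:R)).
Proof.
move=> km.
have [xp|/hchord_eq0 ->] := boolP (0 < x < period); last first.
  by rewrite mulr_ge0 ?expR_ge0 ?hchord_ge0.
rewrite (hchord_lat km) /hchord xp.
have /andP[b0 bp] := latarg km; have /andP[x0 xp'] := hchord_arg xp.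
have sb : 0 < sin (pi * k%:R / n) by apply: sin_gt0_pi; rewrite b0 bp.
have := @sin_tangent R (pi * k%:R / n) (x / (2 * n)); rewrite (ltW b0) (ltW bp) (ltW x0) (ltW xp') => /(_ isT isT)/le_trans; apply.
apply: le_trans (_ : _ <= sin (pi * k%:R / n) * (1 + slope k * (x - 2 * pi * k%:R))) _.
  rewrite le_eqVlt; apply/orP; left; apply/eqP; rewrite /slope; field.
  by rewrite !gt_eqF.
by rewrite ler_wpM2l ?(ltW sb)//; exact: expR_ge1Dx.
Qed.

Lemma slope_anti k : (0 < k < m.+1)%N -> slope (m.+1 - k) = - slope k.
Proof.
move=> /andP[k0 km]; rewrite /slope natrB; last exact: ltnW.
have -> : pi * (n - k%:R) / n = - (pi * k%:R / n - pi) by field; rewrite gt_eqF.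
rewrite cosN sinN.
have /eqP := sinDpi (pi * k%:R / n - pi); rewrite subrK => /eqP ->.
have /eqP := cosDpi (pi * k%:R / n - pi); rewrite subrK => /eqP ->.
by rewrite invrN !mulrN !mulNr opprK.
Qed.

(** For a short arc the tangent is very lossy. With [b = pi k / n] and [a = x / (2n)], the true
    value is at most [a <= Lam / (2n)], while Jordan's inequality gives [sin b >= 2k / n]; the
    quotient of these bounds is [Lam / (4k)]. The factor [e] pays for the exponential, whose
    exponent is at least [-1]. *)
Lemma hchord_tangent_short k x Lam : (0 < k)%N -> (k.*2 <= m.+1)%N -> 0 < Lam -> x <= Lam ->
  hchord x <= hchord (2 * pi * k%:R) * expR (slope k * (x - 2 * pi * k%:R)) * (expR 1 * Lam / (4 * k%:R)).
Proof.
move=> k0 k2 L0 xL.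
have km : (0 < k < m.+1)%N by lia.
have k2' : (k * 2 <= m.+1)%N by rewrite muln2.
have k0' : 0 < k%:R :> R by rewrite ltr0n.
have rhs0 : 0 <= hchord (2 * pi * k%:R) * expR (slope k * (x - 2 * pi * k%:R)) * (expR 1 * Lam / (4 * k%:R)).
  by rewrite !mulr_ge0 ?expR_ge0 ?hchord_ge0 ?invr_ge0 ?mulr_ge0 ?ltW.
have [xp|/hchord_eq0 -> //] := boolP (0 < x < period).
rewrite (hchord_lat km) /hchord xp.
have /andP[b0 bp] := latarg km; have /andP[x0 xp'] := hchord_arg xp.
have pp : 0 < (pi : R) by exact: pi_gt0.
set b := pi * k%:R / n in b0 bp *; set a := x / (2 * n) in x0 xp' *.
have b2 : b <= pi / 2.
  rewrite /b ler_pdivrMr// mulrAC -mulrA ler_pM2l// ler_pdivlMr//.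
  by rewrite -natrM ler_nat.
have sb : 0 < sin b by apply: sin_gt0_pi; rewrite b0 bp.
have cb : 0 <= cos b by apply: cos_ge0_pihalf; rewrite b2 andbT; lra.
have E : slope k * (x - 2 * pi * k%:R) = cos b / sin b * (a - b).
  have -> : 2 * pi * k%:R = b * (2 * n) by rewrite /b mulrCA mulfVK ?gt_eqF// mulrA.
  by rewrite /slope -/b /a; field; rewrite !gt_eqF.
rewrite E.
(* [b cot b <= 1], and [a cot b >= 0] because at most half of the circle is spanned. *)
have h1 : -1 <= cos b / sin b * (a - b).
  have e1 : b * (cos b / sin b) <= 1.
    by rewrite mulrA ler_pdivrMr// mul1r mul_cos_le_sin// !ltW.
  have e2 : 0 <= cos b / sin b * a by apply: mulr_ge0; [apply: divr_ge0 => //; exact: ltW|exact: ltW].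
  lra.
have h2 : 1 <= expR (cos b / sin b * (a - b)) * expR 1.
  by rewrite -expRD -[leLHS]expR0 ler_expR; lra.
have h3 : sin a <= a by apply: sin_le_id; rewrite !ltW.
have h4 : a <= Lam / (2 * n) by rewrite ler_wpM2r// invr_ge0 ltW.
have h5 : 2 * k%:R / n <= sin b.
  have := @sin_jordan R b; rewrite (ltW b0) b2 => /(_ isT); apply: le_trans.
  by rewrite /b !mulrA divfK ?gt_eqF.
apply: (le_trans h3); apply: (le_trans h4).
have -> : sin b * expR (cos b / sin b * (a - b)) * (expR 1 * Lam / (4 * k%:R)) =
   (expR (cos b / sin b * (a - b)) * expR 1) * (sin b * Lam / (4 * k%:R)) by ring.
apply: (@le_trans _ _ (sin b * Lam / (4 * k%:R))).
  apply: (@le_trans _ _ (2 * k%:R / n * Lam / (4 * k%:R))).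
    rewrite le_eqVlt; apply/orP; left; apply/eqP; field.
    by rewrite !gt_eqF.
  rewrite ler_pM2r ?invr_gt0 ?mulr_gt0// ler_pM2r//.
rewrite ler_peMl// !mulr_ge0 ?invr_ge0 ?mulr_ge0// ltW//.
Qed.

End hchord.

(** * The product of the chord lengths and its maximum *)

Section vandermonde.
Context {R : realType}.
Variable m : nat.
Local Notation hchord := (@hchord R m).
Local Notation period := (@period R m).
Implicit Types s u : seq R.

Definition pt s (i : nat) : R := nth 0 (0 :: s) i.

(* Vanishes unless [0 < s_1 < ... < s_m < period]. *)
Definition vdm s : R := \prod_(j < m.+1) \prod_(i < j) hchord (pt s j - pt s i).

Definition lat : seq R := [seq 2 * pi * k%:R | k <- iota 1 m].

(** Normalised by the value at equidistant points, which is the maximum by [weight_le1]. Powers of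
    [weight] therefore decrease in the exponent, and the contraction towards [lat] produces no extra
    constant. *)
Definition weight s : R := vdm s / vdm lat.

Lemma size_lat : size lat = m. Proof. by rewrite size_map size_iota. Qed.

Lemma pt_lat i : (i <= m)%N -> pt lat i = 2 * pi * i%:R.
Proof.
case: i => [|i] im /=; first by rewrite mulr0.
by rewrite /pt /= (nth_map 0%N) ?size_iota// nth_iota// add1n.
Qed.

Lemma vdm_ge0 s : 0 <= vdm s.
Proof. by apply: prodr_ge0 => j _; apply: prodr_ge0 => i _; exact: hchord_ge0. Qed.

Lemma vdm_lat_gt0 : 0 < vdm lat.
Proof.
apply: prodr_gt0 => j _; apply: prodr_gt0 => i _.
have ij := ltn_ord i; have jm := ltn_ord j.
rewrite !pt_lat; try by lia.
rewrite -mulrBr -natrB; last by lia.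
by apply: hchord_lat_gt0; lia.
Qed.

Lemma vdm_le1 s : vdm s <= 1.
Proof.
apply: prodr_ile1 => j _; apply/andP; split.
  by apply: prodr_ge0 => i _; exact: hchord_ge0.
by apply: prodr_ile1 => i _; rewrite hchord_ge0 hchord_le1.
Qed.

Lemma vdm_neq0 s i j : vdm s != 0 -> (i < j <= m)%N -> 0 < pt s j - pt s i < period.
Proof.
move=> v0 /andP[ij jm]; apply: hchord_neq0; apply: contra_neq v0 => a0.
have jm' : (j < m.+1)%N by [].
by rewrite /vdm (bigD1 (Ordinal jm'))//= (bigD1 (Ordinal ij))//= a0 !mul0r.
Qed.

Lemma vdm_box s : size s = m -> vdm s != 0 -> all (fun x => 0 < x < period) s.
Proof.
move=> sm v0; apply/(all_nthP 0) => i im.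
have := @vdm_neq0 s 0 i.+1 v0; by rewrite /pt/= subr0; apply; rewrite /= -sm.
Qed.

Lemma pt_comb t s u i : size s = size u -> (i <= size s)%N ->
  pt (scomb t s u) i = (1 - t) * pt s i + t * pt u i.
Proof.
move=> su im; case: i im => [|i] im; first by rewrite /pt/= !mulr0 addr0.
rewrite /pt /= (nth_map (0, 0)) ?size_zip -?su ?minnn//.
by rewrite nth_zip.
Qed.

Lemma vdm_lc t s u : size s = m -> size u = m -> 0 < t < 1 ->
  vdm s `^ (1 - t) * vdm u `^ t <= vdm (scomb t s u).
Proof.
move=> sm um t01; rewrite /vdm.
have pw (k : nat) (F : 'I_k -> R) r : (forall i, 0 <= F i) ->
    (\prod_(i < k) F i) `^ r = \prod_(i < k) F i `^ r.
  elim: k F => [|k IH] F F0; first by rewrite !big_ord0 powR1.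
  by rewrite !big_ord_recl powRM ?prodr_ge0// IH.
rewrite !pw; try by move=> j; apply: prodr_ge0 => i _; exact: hchord_ge0.
rewrite -big_split/=; apply: ler_prod => j _; apply/andP; split.
  by rewrite mulr_ge0 ?powR_ge0.
rewrite !pw; try by move=> i; exact: hchord_ge0.
rewrite -big_split/=; apply: ler_prod => i _; apply/andP; split.
  by rewrite mulr_ge0 ?powR_ge0.
have ij := ltn_ord i; have jm := ltn_ord j.
rewrite !pt_comb ?sm ?um//; try by lia.
have -> : (1 - t) * pt s j + t * pt u j - ((1 - t) * pt s i + t * pt u i) =
   (1 - t) * (pt s j - pt s i) + t * (pt u j - pt u i) by ring.
exact: hchord_lc.
Qed.

Lemma smeas_pt i : measurable_fun [set: m.-tuple R] (fun s : m.-tuple R => pt s i).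
Proof.
case: i => [|i]; first exact: measurable_cst.
exact: measurable_nth.
Qed.

Lemma measurable_vdm : measurable_fun [set: m.-tuple R] (fun s : m.-tuple R => vdm s).
Proof.
apply: measurable_prod => j _; apply: measurable_prod => i _.
apply: measurableT_comp; first exact: measurable_hchord.
by apply: measurable_funB; exact: smeas_pt.
Qed.

Lemma weight_ge0 s : 0 <= weight s.
Proof. by rewrite divr_ge0 ?vdm_ge0. Qed.

Lemma measurable_weight : measurable_fun [set: m.-tuple R] (fun s : m.-tuple R => weight s).
Proof. by apply: measurable_funM => //; exact: measurable_vdm. Qed.

Lemma weight_lat : weight lat = 1.
Proof. by rewrite /weight divff// gt_eqF// vdm_lat_gt0. Qed.

Lemma weight_lc t s u : size s = m -> size u = m -> 0 < t < 1 ->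
  weight s `^ (1 - t) * weight u `^ t <= weight (scomb t s u).
Proof.
move=> sm um t01; rewrite /weight.
have v0 := vdm_lat_gt0; rewrite !powRM ?vdm_ge0 ?invr_ge0 ?(ltW v0)//.
rewrite mulrACA -[X in _ * X]powRD; last by rewrite subrK oner_eq0.
rewrite subrK powRr1 ?invr_ge0 ?(ltW v0)// ler_wpM2r ?invr_ge0 ?(ltW v0)//.
exact: vdm_lc.
Qed.

Local Notation slope := (@slope R m).

Lemma sum_slope0 : \sum_(1 <= k < m.+1) slope k = 0.
Proof.
set S := \sum_(_ <= _ < _) _.
suff : S = - S by lra.
rewrite {1}/S big_nat_rev/= /S -sumrN big_nat [RHS]big_nat; apply: eq_bigr => k km.
by rewrite add1n subSS -slope_anti//; congr slope; lia.
Qed.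

Let partial j : (j <= m)%N ->
  \sum_(1 <= l < j.+1) slope l = \sum_(1 <= l < (m - j).+1) slope l.
Proof.
move=> jm.
have E : \sum_(1 <= l < (m - j).+1) slope l = - \sum_(j.+1 <= l < m.+1) slope l.
  rewrite -sumrN; transitivity (\sum_(j.+1 <= l < m.+1) slope (m.+1 - l)).
    transitivity (\sum_(1 + j <= l < m.+1) slope (l - j)).
      by rewrite big_addn -subSn//; apply: eq_bigr => l _; rewrite addnK.
    rewrite [RHS]big_nat_rev/= big_nat [RHS]big_nat.
    by apply: eq_bigr => l lm; congr slope; lia.
  by rewrite big_nat [RHS]big_nat; apply: eq_bigr => l lm; rewrite slope_anti//; lia.
have := sum_slope0; rewrite (@big_cat_nat _ _ _ j.+1)//= E => h.
by apply/eqP; rewrite -addr_eq0 h.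
Qed.

(* The sum of the tangents at the lattice vanishes because [slope] is
   antisymmetric. *)
Lemma sum_slope_pairs (y : nat -> R) :
  \sum_(j < m.+1) \sum_(i < j) slope (j - i) * (y j - y i) = 0.
Proof.
transitivity (\sum_(j < m.+1) ((\sum_(1 <= l < j.+1) slope l) * y j)
   - \sum_(j < m.+1) ((\sum_(1 <= l < (m - j).+1) slope l) * y j)); last first.
  rewrite -sumrB big1// => j _; rewrite partial ?subrr//.
  by rewrite -ltnS.
transitivity (\sum_(j < m.+1) \sum_(i < j) slope (j - i) * y j
   - \sum_(j < m.+1) \sum_(i < j) slope (j - i) * y i).
  rewrite -sumrB; apply: eq_bigr => j _; rewrite -sumrB; apply: eq_bigr => i _.
  by rewrite mulrBr.
congr (_ - _).
  apply: eq_bigr => j _; rewrite -mulr_suml; congr (_ * _).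
  rewrite -(big_mkord xpredT (fun i => slope (j - i))) big_nat_rev/= big_add1/= big_nat [RHS]big_nat.
  by apply: eq_bigr => i ij; congr slope; lia.
transitivity (\sum_(j < m.+1) \sum_(i < m.+1 | (i < j)%N) slope (j - i) * y i).
  apply: eq_bigr => j _.
  by rewrite (big_ord_widen m.+1 (fun i => slope (j - i) * y i))// ltnW.
rewrite (exchange_big_dep xpredT)//=; apply: eq_bigr => i _.
rewrite -mulr_suml; congr (_ * _).
have im : (i <= m)%N by rewrite -ltnS.
rewrite -subSn// -(big_mkord (fun j => (i < j)%N) (fun j => slope (j - i))).
rewrite (@big_cat_nat _ _ _ i.+1)//= big_nat_cond big1 ?add0r; last first.
  by move=> j /andP[/andP[_ h1] h2]; lia.
rewrite big_nat_cond -add1n big_addn big_nat_cond [RHS]big_nat_cond.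
apply: eq_big => [k|k /andP[/andP[k0 kn] _]]; last by congr slope; lia.
by apply/idP/idP => ?; lia.
Qed.

(** The restriction to at most half of the circle is the range of [hchord_tangent_short]. Such pairs
    are atypical when [K] is large, since equidistant points more than [K] steps apart are more than
    [2 pi K] away from each other. *)
Definition close_pairs (K : nat) (Lam : R) s : nat :=
  \sum_(j < m.+1) \sum_(i < j) ((K < j - i)%N && ((j - i).*2 <= m.+1)%N && (pt s j - pt s i <= Lam)%R).

(** Multiply the tangent inequalities over all pairs. The exponentials cancel by [sum_slope_pairs],
    and each close pair, being more than [K] steps apart, contributes a further factor at most
    [e Lam / (4 K)]. *)
Lemma weight_le_close K Lam s : 0 < Lam -> (0 < K)%N -> expR 1 * Lam <= 4 * K%:R ->
  weight s <= (expR 1 * Lam / (4 * K%:R)) ^+ close_pairs K Lam s.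
Proof.
move=> L0 K0 LK; set q := _ / _.
have K0' : 0 < K%:R :> R by rewrite ltr0n.
have q0 : 0 <= q by rewrite /q divr_ge0 ?mulr_ge0 ?expR_ge0 ?(ltW L0) ?(ltW K0').
have q1 : q <= 1 by rewrite /q ler_pdivrMr ?mulr_gt0// mul1r.
rewrite /weight ler_pdivrMr ?vdm_lat_gt0//.
pose c (i j : nat) : nat := (K < j - i)%N && ((j - i).*2 <= m.+1)%N && (pt s j - pt s i <= Lam).
pose e (i j : nat) := expR (slope (j - i) * ((pt s j - 2 * pi * j%:R) - (pt s i - 2 * pi * i%:R))).
have E1 : \prod_(j < m.+1) \prod_(i < j) e i j = 1.
  rewrite -[RHS]expR0 -(sum_slope_pairs (fun j => pt s j - 2 * pi * j%:R)) expR_sum.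
  by apply: eq_bigr => j _; rewrite expR_sum.
have -> : q ^+ close_pairs K Lam s * vdm lat =
    \prod_(j < m.+1) \prod_(i < j) (q ^+ c i j * hchord (pt lat j - pt lat i) * e i j).
  transitivity (q ^+ close_pairs K Lam s * vdm lat * \prod_(j < m.+1) \prod_(i < j) e i j).
    by rewrite E1 mulr1.
  rewrite /close_pairs -prodrXr /vdm -!big_split/=.
  apply: eq_bigr => j _; rewrite -prodrXr -!big_split/=.
  by apply: eq_bigr.
rewrite /vdm; apply: ler_prod => j _; apply/andP; split.
  by apply: prodr_ge0 => i _; exact: hchord_ge0.
apply: ler_prod => i _; rewrite hchord_ge0/= {E1}/e /c.
have ij := ltn_ord i; have jm := ltn_ord j.
rewrite !pt_lat; try by lia.
set k := (j - i)%N; have km : (0 < k < m.+1)%N by rewrite /k; lia.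
have -> : 2 * pi * j%:R - 2 * pi * i%:R = 2 * pi * k%:R :> R.
  by rewrite /k natrB ?mulrBr// ltnW.
have -> : pt s j - 2 * pi * j%:R - (pt s i - 2 * pi * i%:R) = (pt s j - pt s i) - 2 * pi * k%:R.
  by rewrite /k natrB ?(ltnW ij)//; ring.
case: andP => [[/andP[Kk k2] xL]|_]; last first.
  by rewrite expr0 mul1r; exact: hchord_tangent.
rewrite expr1 -mulrA mulrC; apply: le_trans (hchord_tangent_short _ k2 L0 xL) _; first by lia.
rewrite ler_wpM2l ?mulr_ge0 ?expR_ge0 ?hchord_ge0//.
rewrite /q ler_wpM2l ?mulr_ge0 ?expR_ge0 ?(ltW L0)// lef_pV2 ?posrE ?mulr_gt0 ?ltr0n//; last by lia.
by rewrite ler_pM2l// ler_nat ltnW.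
Qed.

(** The case [K = 1], [Lam = 4 / e] of the previous bound, where the factor per close pair is
    exactly 1. *)
Lemma weight_le1 s : weight s <= 1.
Proof.
have e0 : 0 < expR 1 :> R by exact: expR_gt0.
have L0 : 0 < 4 / expR 1 :> R by rewrite divr_gt0.
have := @weight_le_close 1 (4 / expR 1) s L0 isT.
rewrite mulr1 mulrC divfK ?gt_eqF// lexx => /(_ isT)/le_trans; apply.
by rewrite divff ?expr1n.
Qed.

End vandermonde.

(** * The circular gas pinned at the origin *)

Section box_integral.
Context {R : realType}.

Lemma smeas_sbox B n : smeas n (fun s : seq R => ((sbox B s)%:R : R)%:E).
Proof.
apply/measurable_EFinP.
apply: (@eqfun_measurable _ _ _ _ (fun t : n.-tuple R => \prod_(i < n) ((`|nth 0 t i| <= B)%R%:R : R))).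
  move=> t; rewrite /sbox; case: (boolP (all _ _)) => [/(all_nthP 0) H|].
    rewrite big1// => i _; rewrite H//; first by rewrite size_tuple.
  move=> /allPn[x xt /negbTE H].
  have ni : (index x t < n)%N by have := xt; rewrite -index_mem size_tuple.
  by rewrite (bigD1 (Ordinal ni))//= nth_index// H mul0r.
apply: measurable_prod => i _.
apply: (measurableT_comp (measurable_indb (measurable_ball0 B))).
exact: measurable_nth.
Qed.

Lemma iint_sbox B n : 0 <= B ->
  (iint n (fun s : seq R => ((sbox B s)%:R : R)%:E) = ((2 * B) ^+ n)%:E)%E.
Proof.
move=> B0; elim: n => [|n IH] /=; first by rewrite expr0.
transitivity (\int[lebesgue_measure]_x (((2 * B) ^+ n * (`|x| <= B)%R%:R)%:E))%E.
  apply: eq_integral => x _.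
  transitivity (iint n (fun s => ((`|x| <= B)%R%:R)%:E * ((sbox B s)%:R : R)%:E)%E).
    by apply: eq_iint => s _; rewrite -EFinM -natrM mulnb.
  rewrite iintZ//; first by rewrite IH -EFinM mulrC.
  exact: smeas_sbox.
by rewrite integral_ball_cst ?exprn_ge0 ?mulr_ge0// exprSr.
Qed.

End box_integral.

Section gas.
Context {R : realType}.
Variable m : nat.
Local Notation hchord := (@hchord R m).
Local Notation period := (@period R m).
Local Notation lat := (@lat R m).
Local Notation vdm := (@vdm R m).
Local Notation weight := (@weight R m).
Implicit Types (f g : seq R -> R) (b : R).

Lemma weight_neq0 s : size s = m -> weight s != 0 -> vdm s != 0.
Proof. by move=> _; apply: contra_neq; rewrite /weight => ->; rewrite mul0r. Qed.

Lemma weight_sbox s : size s = m -> weight s <= (sbox period s)%:R.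
Proof.
move=> sm; have [->//|w0] := eqVneq (weight s) 0.
have /allP H := vdm_box sm (weight_neq0 sm w0).
rewrite /sbox (_ : all _ _) ?weight_le1//; apply/allP => x /H /andP[x0 xp].
by rewrite ger0_norm ltW.
Qed.

Definition gibbs b s : R := weight s `^ b.

Lemma gibbs_ge0 b s : 0 <= gibbs b s. Proof. exact: powR_ge0. Qed.

Lemma gibbs_le1 b s : 0 <= b -> gibbs b s <= 1.
Proof. move=> b0; apply: (@le_trans _ _ (1 `^ b)); last by rewrite powR1.
by rewrite ge0_ler_powR ?nnegrE ?weight_ge0 ?weight_le1. Qed.

Lemma gibbs_neq0 b s : gibbs b s != 0 -> 0 < b -> weight s != 0.
Proof. by move=> + b0; apply: contra_neq => w0; rewrite /gibbs w0 powR0// gt_eqF. Qed.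

Lemma gibbs_sbox b s : 0 < b -> size s = m -> gibbs b s <= (sbox period s)%:R.
Proof.
move=> b0 sm; have [->//|g0] := eqVneq (gibbs b s) 0.
have := weight_sbox sm; case: (sbox _ _) => [_|]; first by rewrite gibbs_le1// ltW.
move=> w0; case/negP: (gibbs_neq0 g0 b0).
by rewrite eq_le w0 weight_ge0.
Qed.

Lemma measurable_gibbs b : measurable_fun [set: m.-tuple R] (fun s : m.-tuple R => gibbs b s).
Proof.
apply: (measurableT_comp (measurable_powR b)).
exact: measurable_weight.
Qed.

(** Non-negativity keeps all manipulations of integrals within Tonelli's theorem; boundedness keeps
    the values real. *)
Definition obs f := [/\ (forall s, 0 <= f s), smeas m (EFin \o f) & exists M, forall s, size s = m -> f s <= M].

Lemma obs_bsupp b f : 0 < b -> obs f ->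
  exists2 M, 0 <= M & bsupp M period m (fun s => gibbs b s * f s).
Proof.
move=> b0 [f0 mf [M fM]]; have M0 : 0 <= M by apply: le_trans (f0 (nseq m 0)) (fM _ _); rewrite size_nseq.
exists M => //; split.
- by move=> s; rewrite mulr_ge0 ?gibbs_ge0.
- apply/measurable_EFinP; apply: measurable_funM; first exact: measurable_gibbs.
  exact/measurable_EFinP.
- move=> s sm; rewrite mulrC; apply: ler_pM; rewrite ?gibbs_ge0 ?fM//.
  exact: gibbs_sbox.
Qed.

Lemma obs_cst c : 0 <= c -> obs (fun=> c).
Proof. by move=> c0; split => //; [exact: measurable_cst|exists c]. Qed.

Lemma obsD f g : obs f -> obs g -> obs (fun s => f s + g s).
Proof.
move=> [f0 mf [M fM]] [g0 mg [N gN]]; split.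
- by move=> s; rewrite addr_ge0.
- by apply/measurable_EFinP; apply: measurable_funD; exact/measurable_EFinP.
- by exists (M + N) => s sm; rewrite lerD ?fM ?gN.
Qed.

Lemma obsM f g : obs f -> obs g -> obs (fun s => f s * g s).
Proof.
move=> [f0 mf [M fM]] [g0 mg [N gN]]; split.
- by move=> s; rewrite mulr_ge0.
- by apply/measurable_EFinP; apply: measurable_funM; exact/measurable_EFinP.
- by exists (M * N) => s sm; rewrite ler_pM ?fM ?gN.
Qed.

Lemma obs_sum (I : Type) (r : seq I) (P : pred I) (F : I -> seq R -> R) :
  (forall i, obs (F i)) -> obs (fun s => \sum_(i <- r | P i) F i s).
Proof.
move=> H; elim: r => [|i r IH].
  rewrite (_ : (fun _ => _) = (fun=> 0)); first exact: obs_cst.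
  by apply/funext => s; rewrite big_nil.
rewrite (_ : (fun _ => _) = (fun s => (if P i then F i s else 0) + \sum_(j <- r | P j) F j s)).
  by apply: obsD => //; case: (P i) => //; exact: obs_cst.
by apply/funext => s; rewrite big_cons; case: (P i); rewrite ?add0r.
Qed.

Lemma obs_comp (phi : R -> R) (X : seq R -> R) : measurable_fun setT phi ->
  (forall x, 0 <= phi x) -> (exists M, forall x, phi x <= M) ->
  measurable_fun [set: m.-tuple R] (fun s : m.-tuple R => X s) -> obs (phi \o X).
Proof.
move=> mphi phi0 [M phiM] mX; split.
- by move=> s; exact: phi0.
- by apply/measurable_EFinP; exact: (measurableT_comp mphi mX).
- by exists M => s _; exact: phiM.
Qed.

Lemma obs_expR f c : obs f -> obs (fun s => expR (c * f s)).
Proof.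
move=> [f0 mf [M fM]]; split.
- by move=> s; exact: expR_ge0.
- apply/measurable_EFinP; apply: (measurableT_comp (@measurable_expR R)).
  by apply: measurable_funM => //; exact/measurable_EFinP.
- exists (expR (`|c| * M)) => s sm; rewrite ler_expR.
  apply: le_trans (_ : `|c| * f s <= _); last by rewrite ler_wpM2l// fM.
  by rewrite ler_wpM2r// ler_norm.
Qed.

Lemma measurable_ptB i j : measurable_fun [set: m.-tuple R] (fun s : m.-tuple R => pt s j - pt s i).
Proof. by apply: measurable_funB; exact: smeas_pt. Qed.

Definition Zgas b : R := rint m (gibbs b).
Definition Ex b f : R := rint m (fun s => gibbs b s * f s) / Zgas b.

Lemma gibbs_bsupp b : 0 < b -> bsupp 1 period m (gibbs b).
Proof.
move=> b0; split; first by move=> s; exact: gibbs_ge0.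
- by apply/measurable_EFinP; exact: measurable_gibbs.
- by move=> s sm; rewrite mul1r; exact: gibbs_sbox.
Qed.

Let period0 : 0 <= period := ltW (period_gt0 m).

Lemma rint_le M B N C f g : 0 <= M -> 0 <= B -> 0 <= N -> 0 <= C ->
  bsupp M B m f -> bsupp N C m g ->
  (forall s, size s = m -> f s <= g s) -> rint m f <= rint m g.
Proof.
move=> M0 B0 N0 C0 bf bg fg; rewrite -lee_fin (rintE M0 B0 bf) (rintE N0 C0 bg).
case: bf => f0 mf _; case: bg => g0 mg _.
by apply: le_iint => // s; rewrite lee_fin//; exact: fg.
Qed.

Lemma periodE : period = 2 * pi * m%:R + 2 * pi.
Proof. by rewrite /period -[m.+1%:R]natr1 mulrDr mulr1. Qed.

(** If every point is within 1 of its lattice position, then all arcs, measured either way around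
    the circle, are at least [2 pi - 2 > 0]. So [gibbs] is bounded below on a translated cube. *)
Lemma Zgas_gt0 b : 0 < b -> 0 < Zgas b.
Proof.
move=> b0; pose eps : R := Num.min (hchord (2 * pi - 2)) (hchord (period - (2 * pi - 2))).
have pi2 : 2 <= (pi : R) by exact: pi_ge2.
case: (posnP m) => [m0|m0].
  rewrite /Zgas /rint m0 /=.
  have : gibbs b lat = 1 by rewrite /gibbs weight_lat powR1.
  rewrite (_ : lat = [::]); last by apply: size0nil; rewrite size_lat.
  by rewrite /= => ->.
have r1 : 0 < 2 * (pi : R) - 2 < period.
  have : 1 < m.+1%:R :> R by rewrite ltr1n.
  by rewrite /period; nra.
have eps0 : 0 < eps.
  by rewrite /eps hchord_sym minxx; apply: hchord_gt0.
have eps1 : eps <= 1 by rewrite /eps hchord_sym minxx hchord_le1.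
pose c := \prod_(j < m.+1) \prod_(i < j) eps.
have c0 : 0 < c by apply: prodr_gt0 => j _; apply: prodr_gt0.
pose T (i : nat) (x : R) := 1 * x + 2 * pi * i.+1%:R.
have Tlow s : size s = m -> c `^ b * (sbox 1 s)%:R <= gibbs b (amap T s).
  move=> sm; case: (boolP (sbox 1 s)) => [/allP s1|_]; last by rewrite mulr0 gibbs_ge0.
  rewrite mulr1 /gibbs ge0_ler_powR ?nnegrE ?weight_ge0 ?(ltW b0) ?(ltW c0)//.
  rewrite /weight ler_pdivlMr ?vdm_lat_gt0//.
  apply: (@le_trans _ _ c); first by rewrite ler_piMr ?(ltW c0)// vdm_le1.
  apply: ler_prod => j _; apply/andP; split; first by apply: prodr_ge0 => *; exact: ltW.
  apply: ler_prod => i _; rewrite (ltW eps0)/=.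
  have ij := ltn_ord i; have jm := ltn_ord j.
  have ptT k : (k <= m)%N -> `|pt (amap T s) k - 2 * pi * k%:R| <= 1.
    case: k => [|k] km; first by rewrite /pt/= mulr0 subr0 normr0.
    rewrite /pt /= nth_amap ?sm// /T mul1r addrK.
    by apply: s1; rewrite mem_nth// sm.
  suff key : 2 * pi - 2 <= pt (amap T s) j - pt (amap T s) i <= period - (2 * pi - 2).
    by apply: hchord_qc key.
  have jk : 1 <= (j%:R - i%:R : R) by rewrite -natrB ?(ltnW ij)// ler1n subn_gt0.
  have jk' : j%:R - i%:R <= m%:R :> R.
    by rewrite -natrB ?(ltnW ij)// ler_nat; lia.
  have := ptT i (ltnW (leq_trans ij jm)); have := ptT j jm.
  rewrite !ler_norml => /andP[j1 j2] /andP[i1 i2].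
  have h1 : 2 * pi * 1 <= 2 * pi * (j%:R - i%:R) :> R by rewrite ler_wpM2l//; lra.
  have h2 : 2 * pi * (j%:R - i%:R) <= 2 * pi * m%:R :> R by rewrite ler_wpM2l//; lra.
  rewrite mulrBr in h1 h2.
  rewrite periodE.
  move: h1 h2 j1 j2 i1 i2 pi2; move: (pi : R) (pt _ j) (pt _ i) => p y x.
  by move=> h1 h2 j1 j2 i1 i2 pi2; apply/andP; split; lra.
have bT : bsupp 1 period m (gibbs b) := gibbs_bsupp b0.
rewrite -lte_fin (rintE ler01 period0 bT).
have := @iint_amap_ge R m (EFin \o gibbs b) 1 T ler01 _ _ _ _.
rewrite expr1n mul1e => H.
have Hmain : (iint m ((EFin \o gibbs b) \o amap T) <= iint m (EFin \o gibbs b))%E.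
  apply: H => //.
  - by move=> i; exact: measurable_affine.
  - by move=> i h h0 mh; rewrite ge0_integral_affine.
  - by move=> s; rewrite lee_fin gibbs_ge0.
  - by apply/measurable_EFinP; exact: measurable_gibbs.
apply: lt_le_trans Hmain.
have E : iint m (fun s => (c `^ b)%:E * ((sbox 1 s)%:R : R)%:E)%E = (c `^ b * (2 * 1) ^+ m)%:E.
  rewrite iintZ ?powR_ge0// ?iint_sbox// ?EFinM//; exact: smeas_sbox.
have p0 : (0 < c `^ b * (2 * 1) ^+ m)%R by rewrite mulr_gt0 ?powR_gt0 ?exprn_gt0.
apply: (@lt_le_trans _ _ (c `^ b * (2 * 1) ^+ m)%:E); first by rewrite lte_fin.
rewrite -E; apply: le_iint.
- by move=> s; rewrite -EFinM lee_fin mulr_ge0 ?powR_ge0.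
- by move=> s; rewrite lee_fin gibbs_ge0.
- apply: emeasurable_funM; [exact: measurable_cst|exact: smeas_sbox].
- apply: (@smeas_amap R m (EFin \o gibbs b) T).
    by move=> i; exact: measurable_affine.
  by apply/measurable_EFinP; exact: measurable_gibbs.
- by move=> s sm; rewrite -EFinM lee_fin /=; exact: Tlow.
Qed.

Lemma Ex_ge0 b f : (forall s, 0 <= f s) -> 0 <= Ex b f.
Proof.
move=> f0; rewrite /Ex divr_ge0// rint_ge0// => s; rewrite ?mulr_ge0 ?gibbs_ge0//.
Qed.

Lemma Ex_le b f g : 0 < b -> obs f -> obs g ->
  (forall s, size s = m -> weight s != 0 -> f s <= g s) -> Ex b f <= Ex b g.
Proof.
move=> b0 of_ og fg; rewrite ler_pM2r ?invr_gt0 ?Zgas_gt0//.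
have [M M0 bf] := obs_bsupp b0 of_; have [N N0 bg] := obs_bsupp b0 og.
apply: (rint_le M0 period0 N0 period0 bf bg) => s sm.
have [->|g0] := eqVneq (gibbs b s) 0; first by rewrite !mul0r.
by rewrite ler_wpM2l ?gibbs_ge0// fg//; exact: gibbs_neq0 g0 b0.
Qed.

Lemma eq_Ex b f g : 0 < b -> (forall s, size s = m -> weight s != 0 -> f s = g s) -> Ex b f = Ex b g.
Proof.
move=> b0 fg; rewrite /Ex /rint; congr (fine _ / _); apply: eq_iint => s sm /=.
have [->|g0] := eqVneq (gibbs b s) 0; first by rewrite !mul0r.
by rewrite fg//; exact: gibbs_neq0 g0 b0.
Qed.

Lemma ExD b f g : 0 < b -> obs f -> obs g -> Ex b (fun s => f s + g s) = Ex b f + Ex b g.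
Proof.
move=> b0 of_ og; rewrite /Ex -mulrDl; congr (_ / _).
have [M M0 bf] := obs_bsupp b0 of_; have [N N0 bg] := obs_bsupp b0 og.
have [K K0 bfg] := obs_bsupp b0 (obsD of_ og).
apply: EFin_inj; rewrite EFinD (rintE M0 period0 bf) (rintE N0 period0 bg) (rintE K0 period0 bfg).
case: bf => f0 mf _; case: bg => g0 mg _; rewrite -iintD//; try by move=> s; rewrite lee_fin.
by apply: eq_iint => s _ /=; rewrite mulrDr.
Qed.

Lemma ExZ b c f : 0 < b -> 0 <= c -> obs f -> Ex b (fun s => c * f s) = c * Ex b f.
Proof.
move=> b0 c0 of_; rewrite /Ex mulrA; congr (_ / _).
have [M M0 bf] := obs_bsupp b0 of_.
have [K K0 bfg] := obs_bsupp b0 (obsM (obs_cst c0) of_).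
apply: EFin_inj; rewrite EFinM (rintE M0 period0 bf) (rintE K0 period0 bfg).
case: bf => f0 mf _; rewrite -iintZ//; try by move=> s; rewrite lee_fin.
by apply: eq_iint => s _ /=; rewrite mulrCA.
Qed.

Lemma Ex_cst b c : 0 < b -> 0 <= c -> Ex b (fun=> c) = c.
Proof.
move=> b0 c0; have := ExZ b0 c0 (obs_cst ler01); rewrite (_ : (fun _ => _) = (fun=> c)); last first.
  by apply/funext => s; rewrite mulr1.
move=> ->; rewrite /Ex (_ : (fun _ => _) = gibbs b); last by apply/funext => s; rewrite mulr1.
by rewrite divff ?mulr1// gt_eqF// Zgas_gt0.
Qed.

Lemma Ex_sum (I : Type) (r : seq I) (P : pred I) (F : I -> seq R -> R) b : 0 < b ->
  (forall i, obs (F i)) ->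
  Ex b (fun s => \sum_(i <- r | P i) F i s) = \sum_(i <- r | P i) Ex b (F i).
Proof.
move=> b0 oF; elim: r => [|i r IH].
  rewrite big_nil (_ : (fun _ => _) = (fun=> 0)) ?Ex_cst//.
  by apply/funext => s; rewrite big_nil.
rewrite big_cons; case: ifP => Pi.
  rewrite -IH -ExD//; last exact: obs_sum.
  by congr Ex; apply/funext => s; rewrite big_cons Pi.
by rewrite -IH; congr Ex; apply/funext => s; rewrite big_cons Pi.
Qed.

(** Integrate the tangent to the exponential at the mean. The sign of [c] is distinguished only to
    place each term on the side where it is a non-negative observable. *)
Lemma Ex_jensen b f c : 0 < b -> obs f -> expR (c * Ex b f) <= Ex b (fun s => expR (c * f s)).
Proof.
move=> b0 of_; set mu := Ex b f; have mu0 : 0 <= mu by apply: Ex_ge0; case: of_.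
have e0 : 0 <= expR (c * mu) by exact: expR_ge0.
have tan s : expR (c * mu) * (1 + (c * f s - c * mu)) <= expR (c * f s).
  have -> : c * f s = c * mu + (c * f s - c * mu) by ring.
  rewrite expRD ler_wpM2l// (_ : c * mu + _ - _ = c * f s - c * mu); last by ring.
  exact: expR_ge1Dx.
have oe := obs_expR c of_.
have oc x : 0 <= x -> obs (fun=> x) by exact: obs_cst.
have [c0|c0] := leP 0 c.
- have c1 : 0 <= expR (c * mu) * (c * mu) by apply: mulr_ge0 => //; exact: mulr_ge0.
  have c2 : 0 <= expR (c * mu) * c by apply: mulr_ge0.
  have h : Ex b (fun s => expR (c * mu) + expR (c * mu) * c * f s) <=
      Ex b (fun s => expR (c * f s) + expR (c * mu) * (c * mu)).
    apply: Ex_le => //.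
    + by apply: obsD; [exact: oc|apply: obsM => //; exact: oc].
    + by apply: obsD => //; exact: oc.
    + by move=> s _ _; have := tan s; lra.
  rewrite (ExD b0 (oc _ e0) (obsM (oc _ c2) of_)) (ExZ b0 c2 of_) (ExD b0 oe (oc _ c1)) !Ex_cst// in h.
  by move: h; rewrite -/mu; lra.
- have c0' : 0 <= - c by rewrite oppr_ge0 ltW.
  have c1 : 0 <= expR (c * mu) + expR (c * mu) * (- c * mu).
    by apply: addr_ge0 => //; apply: mulr_ge0 => //; exact: mulr_ge0.
  have c2 : 0 <= expR (c * mu) * - c by apply: mulr_ge0.
  have h : Ex b (fun s => expR (c * mu) + expR (c * mu) * (- c * mu)) <=
      Ex b (fun s => expR (c * f s) + expR (c * mu) * (- c) * f s).
    apply: Ex_le => //; first exact: oc.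
    + by apply: obsD => //; apply: obsM => //; exact: oc.
    + by move=> s _ _; have := tan s; lra.
  rewrite (ExD b0 oe (obsM (oc _ c2) of_)) (ExZ b0 c2 of_) !Ex_cst// in h.
  by move: h; rewrite -/mu; lra.
Qed.

(* Contracting towards the lattice: by log-concavity of [weight],
   [weight ((1-t) s + t lat) >= weight s ^ (1-t)]. *)
Lemma Zgas_ratio a b : 0 < a < b -> (a / b) ^+ m * Zgas a <= Zgas b.
Proof.
move=> /andP[a0 ab]; have b0 : 0 < b by exact: lt_trans ab.
pose c := a / b.
have c0 : 0 < c by rewrite divr_gt0.
have c1 : c < 1 by rewrite /c ltr_pdivrMr// mul1r.
pose T (i : nat) (x : R) := c * x + (1 - c) * (2 * pi * i.+1%:R).
have TE s : size s = m -> amap T s = scomb (1 - c) s lat.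
  move=> sm; apply: (@eq_from_nth _ 0).
    by rewrite size_amap /scomb size_map size_zip size_lat sm minnn.
  move=> i; rewrite size_amap sm => im.
  rewrite nth_amap ?sm// /scomb (nth_map (0, 0)); last by rewrite size_zip size_lat sm minnn.
  rewrite nth_zip/= ?size_lat// (nth_map 0%N) ?size_iota// nth_iota// add1n /T.
  by rewrite subKr.
have low s : size s = m -> gibbs a s <= gibbs b (amap T s).
  move=> sm; rewrite TE// /gibbs (_ : a = c * b); last by rewrite /c divfK// gt_eqF.
  rewrite powRrM ge0_ler_powR ?nnegrE ?powR_ge0 ?weight_ge0 ?(ltW b0)//.
  have t01 : 0 < 1 - c < 1 by apply/andP; split; lra.
  have := weight_lc sm (@size_lat R m) t01.
  by rewrite weight_lat powR1 mulr1 subKr.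
have ba := gibbs_bsupp a0; have bb := gibbs_bsupp b0.
rewrite -lee_fin EFinM (rintE ler01 period0 ba) (rintE ler01 period0 bb).
apply: le_trans (@iint_amap_ge R m (EFin \o gibbs b) c T (ltW c0) _ _ _ _).
- apply: lee_wpmul2l; first by rewrite lee_fin exprn_ge0// ltW.
  apply: le_iint.
  + by move=> s; rewrite lee_fin gibbs_ge0.
  + by move=> s; rewrite lee_fin gibbs_ge0.
  + by case: ba.
  + apply: (@smeas_amap R m (EFin \o gibbs b) T); last by case: bb.
    by move=> i; exact: measurable_affine.
  + by move=> s sm; rewrite lee_fin; exact: low.
- by move=> i; exact: measurable_affine.
- by move=> i h h0 mh; rewrite ge0_integral_affine.
- by move=> s; rewrite lee_fin gibbs_ge0.
- by case: bb.
Qed.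

Lemma gibbs_le a b s : 0 < a <= b -> gibbs b s <= gibbs a s.
Proof.
move=> /andP[a0 ab]; have [w0|w0] := eqVneq (weight s) 0.
  by rewrite /gibbs w0 !powR0 ?gt_eqF// (lt_le_trans a0).
have wp : 0 < weight s by rewrite lt_neqAle eq_sym w0 weight_ge0.
by rewrite /gibbs ger_powR// wp weight_le1.
Qed.

End gas.

(** * Gaps of the gas *)

Section rotation.
Context {R : realType}.
Variable m : nat.
Local Notation hchord := (@hchord R m).
Local Notation period := (@period R m).
Local Notation vdm := (@vdm R m).
Local Notation weight := (@weight R m).
Local Notation gibbs := (@gibbs R m).
Local Notation Ex := (@Ex R m).
Implicit Types (s : seq R) (b : R).

(* The same points of the circle seen from the last one instead of from [0]. *)
Definition rotg s : seq R :=
  (period - last 0 s) :: [seq x + (period - last 0 s) | x <- take (size s).-1 s].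

Lemma size_rotg s : size s = m -> (0 < m)%N -> size (rotg s) = m.
Proof. by move=> sm m0; rewrite /= size_map size_take sm; case: m m0 => //= k _; rewrite ltnSn. Qed.

Lemma last_pt s : size s = m -> last 0 s = pt s m.
Proof. by move=> sm; rewrite -nth_last /pt sm; case: m sm => [|k] //= /size0nil ->. Qed.

Lemma pt_rotg s i : size s = m -> (i < m)%N ->
  pt (rotg s) i.+1 = pt s i + (period - pt s m).
Proof.
move=> sm im; rewrite -(last_pt sm) /pt /=.
case: i im => [|i] im /=; first by rewrite add0r.
have im' : (i < (size s).-1)%N by rewrite sm; lia.
by rewrite (nth_map 0) ?nth_take ?size_takel// leq_pred.
Qed.

(** Arcs not involving the last point are unchanged. Its arcs to the others are replaced by the
    complementary ones, and [hchord_sym] applies. *)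
Lemma vdm_rotg s : size s = m -> vdm (rotg s) = vdm s.
Proof.
move=> sm; case: (posnP m) => [m0|m0].
  by rewrite /vdm m0 !big_ord_recl !big_ord0.
rewrite /vdm big_ord_recl big_ord0 mul1r.
under eq_bigr => j _.
  rewrite big_ord_recl /= -[bump 0 j]/(j.+1) pt_rotg// [pt (rotg s) 0]/pt /= subr0.
  rewrite (_ : pt s j + (period - pt s m) = period - (pt s m - pt s j)); last by ring.
  rewrite hchord_sym.
  under eq_bigr => i _.
    rewrite -[bump 0 i]/(i.+1) pt_rotg ?(ltn_trans (ltn_ord i) (ltn_ord j))//.
    rewrite (_ : _ - _ = pt s j - pt s i); last by ring.
    over.
  over.
by rewrite big_split /= mulrC big_ord_recr.
Qed.

Lemma smeas_rotg f : (0 < m)%N -> smeas m f -> smeas m (f \o rotg).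
Proof.
move=> m0 mf; apply: smeas_map mf _ _; first by move=> s sm; exact: size_rotg.
move=> i im; apply: (@eqfun_measurable _ _ _ _ (fun s : m.-tuple R => pt s i + (period - pt s m))).
  move=> s; have := pt_rotg (size_tuple s) im; rewrite {1}/pt /= => <-//.
by apply: measurable_funD; [exact: smeas_pt|apply: measurable_funB => //; exact: smeas_pt].
Qed.

(** With the last coordinate [z] singled out, the rotation translates the other coordinates by
    [period - z] and replaces [z] by [period - z]; both preserve Lebesgue measure. *)
Lemma iint_rotg f : (0 < m)%N -> (forall s, (0 <= f s)%E) -> smeas m f ->
  iint m (f \o rotg) = iint m f.
Proof.
move=> m0 f0 mf; have mfr := smeas_rotg m0 mf.
have [k mk] : exists k, m = k.+1 by case: m m0 => // k _; exists k.
rewrite mk in mf mfr *; rewrite (iint_ins (leqnn k))//; last by move=> s; exact: f0.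
transitivity (\int[lebesgue_measure]_z iint k (fun s => f ((period - z)%R :: s)))%E; last first.
  rewrite (@ge0_integral_reflect _ period (fun z => iint k (fun s => f (z :: s))))//.
    by move=> z; exact: iint_ge0.
  exact: measurable_iint_cons.
apply: eq_integral => z _.
transitivity (iint k ((fun s => f ((period - z) :: s)) \o amap (fun _ x => 1 * x + (period - z)))).
  apply: eq_iint => s sk /=; congr f; rewrite amap_cst /ins take_oversize ?drop_oversize ?sk// cats1.
  rewrite /rotg last_rcons size_rcons /= -cats1 take_size_cat//.
  by congr (_ :: _); apply: eq_map => x; rewrite mul1r.
have := @iint_amap R k (fun s => f ((period - z) :: s)) 1 (fun _ x => 1 * x + (period - z)) ler01.
rewrite expr1n mul1e => -> //.
- by move=> _; exact: measurable_affine.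
- by move=> _ h h0 mh; rewrite ge0_integral_affine.
- exact: smeas_cons.
Qed.

Lemma Ex_rotg b f : (0 < m)%N -> 0 < b -> obs m f -> Ex b (f \o rotg) = Ex b f.
Proof.
move=> m0 b0 of_; rewrite /Ex /rint; congr (fine _ / _).
transitivity (iint m ((EFin \o (fun s => gibbs b s * f s)) \o rotg)).
  by apply: eq_iint => s sm /=; rewrite /gibbs /weight vdm_rotg.
have [M M0 [g0 mg _]] := obs_bsupp b0 of_.
by rewrite iint_rotg// => s; rewrite lee_fin.
Qed.

Definition test1 (phi : R -> R) :=
  [/\ measurable_fun setT phi, (forall x, 0 <= phi x) & exists M, forall x, phi x <= M].

Lemma obs_gap phi i j : test1 phi -> obs m (fun s => phi (pt s j - pt s i)).
Proof. by case=> mphi phi0 phiM; apply: (@obs_comp R m phi (fun s => pt s j - pt s i)) => //; exact: measurable_ptB. Qed.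

Lemma obs_pt phi i : test1 phi -> obs m (fun s => phi (pt s i)).
Proof. by case=> mphi phi0 phiM; apply: (@obs_comp R m phi (fun s => pt s i)) => //; exact: smeas_pt. Qed.

Lemma test1_reflect phi c : test1 phi -> test1 (fun x => phi (c - x)).
Proof.
case=> mphi phi0 [M phiM]; split => //; last by exists M.
by apply: (measurableT_comp mphi); apply: measurable_funB.
Qed.

(** Each rotation shifts the indices by one, so the law of a gap of [k] steps does not depend on its
    starting point, and the gap starting at the pinned point is [X_k]. *)
Lemma Ex_gap b phi i k : 0 < b -> test1 phi -> (i + k <= m)%N ->
  Ex b (fun s => phi (pt s (i + k) - pt s i)) = Ex b (fun s => phi (pt s k)).
Proof.
move=> b0 tphi; elim: i => [|i IH] ikm.
  by congr Ex; apply/funext => s; rewrite add0n /pt /= subr0.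
have m0 : (0 < m)%N by lia.
rewrite -IH; last by lia.
rewrite -(Ex_rotg m0 b0 (obs_gap _ _ tphi)); apply: eq_Ex => // s sm _ /=.
rewrite addSn !pt_rotg//; try by lia.
by congr phi; ring.
Qed.

(* [period - X_k] is a gap of [m.+1 - k] steps around the circle. *)
Lemma Ex_gap_wrap b phi k : 0 < b -> test1 phi -> (0 < k <= m)%N ->
  Ex b (fun s => phi (period - pt s k)) = Ex b (fun s => phi (pt s (m.+1 - k))).
Proof.
move=> b0 tphi /andP[k0 km]; have m0 : (0 < m)%N by lia.
rewrite -(Ex_rotg m0 b0 (obs_pt _ tphi)).
have kmk : (m - k + k <= m)%N by lia.
rewrite -(Ex_gap b0 (test1_reflect period tphi) kmk) subnK//.
apply: eq_Ex => // s sm _ /=.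
rewrite (_ : (m.+1 - k)%N = (m - k).+1) ?pt_rotg//; try by lia.
by congr phi; ring.
Qed.

End rotation.

(** * Tail bounds for the number of points in a window *)

Section tails.
Context {R : realType}.
Variable m : nat.
Local Notation period := (@period R m).
Local Notation weight := (@weight R m).
Local Notation gibbs := (@gibbs R m).
Local Notation Ex := (@Ex R m).
Local Notation Zgas := (@Zgas R m).
Implicit Types (s : seq R) (b : R).

Definition cdf b k x : R := Ex b (fun s => (pt s k <= x)%R%:R).

Lemma test1_indb (A : pred R) : measurable [set x | A x] -> test1 (fun x => (A x)%:R : R).
Proof.
move=> mA; split; first exact: measurable_indb.
- by move=> x; exact: ler0n.
- by exists 1 => x; rewrite lern1; case: (A x).
Qed.

Lemma measurable_le_itv (x : R) : measurable [set y : R | y <= x].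
Proof.
rewrite (_ : [set _ | _] = `]-oo, x]%classic); first exact: measurable_itv.
by apply/seteqP; split => y /=; rewrite in_itv.
Qed.

Lemma measurable_ge_itv (x : R) : measurable [set y : R | x <= y].
Proof.
rewrite (_ : [set _ | _] = `[x, +oo[%classic); first exact: measurable_itv.
by apply/seteqP; split => y /=; rewrite in_itv/= andbT.
Qed.

Lemma measurable_gt_itv (x : R) : measurable [set y : R | x < y].
Proof.
rewrite (_ : [set _ | _] = `]x, +oo[%classic); first exact: measurable_itv.
by apply/seteqP; split => y /=; rewrite in_itv/= andbT.
Qed.

Lemma test1_le x : test1 (fun y : R => (y <= x)%R%:R : R).
Proof. by apply: (@test1_indb (fun y => y <= x)); exact: measurable_le_itv. Qed.

Lemma test1_ge x : test1 (fun y : R => (x <= y)%R%:R : R).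
Proof. by apply: (@test1_indb (fun y => x <= y)); exact: measurable_ge_itv. Qed.

Lemma test1_gt x : test1 (fun y : R => (x < y)%R%:R : R).
Proof. by apply: (@test1_indb (fun y => x < y)); exact: measurable_gt_itv. Qed.

Lemma weight_pt s i j : weight s != 0 -> size s = m -> (i <= j <= m)%N -> pt s i <= pt s j.
Proof.
move=> w0 sm /andP[]; rewrite leq_eqVlt => /orP[/eqP->//|ij] jm.
have := @vdm_neq0 R m s i j (weight_neq0 sm w0); rewrite ij jm => /(_ isT) /andP[h _].
by rewrite -subr_ge0 ltW.
Qed.

Lemma weight_pt_period s i : weight s != 0 -> size s = m -> (i <= m)%N -> pt s i < period.
Proof.
move=> w0 sm; case: i => [|i] im; first by rewrite /pt /=; exact: period_gt0.
have := @vdm_neq0 R m s 0 i.+1 (weight_neq0 sm w0); rewrite im => /(_ isT) /andP[_].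
by rewrite [pt s 0]/pt /= subr0.
Qed.

Lemma cdf_mono b k l x : 0 < b -> (k <= l <= m)%N -> cdf b l x <= cdf b k x.
Proof.
move=> b0 /andP[kl lm]; apply: Ex_le => //; try by apply: obs_pt (test1_le x).
move=> s sm w0; rewrite ler_nat; have := weight_pt w0 sm (_ : (k <= l <= m)%N).
rewrite kl lm => /(_ isT) h; case: (leP (pt s l) x) => // lx.
by rewrite (le_trans h lx).
Qed.

Lemma cdf_ge0 b k x : 0 <= cdf b k x.
Proof. by apply: Ex_ge0 => s; exact: ler0n. Qed.

(** Markov's inequality through stationarity: [q = m / K], rounded down, consecutive gaps of [K]
    steps have the law of [X_K] and fit into one period. Since [m + 1 <= 2 q K], the bound
    [period / (q M)] is at most [4 pi K / M]. *)
Lemma Ex_far b K M : 0 < b -> 0 < M -> (0 < K)%N -> (K.*2 <= m.+1)%N ->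
  Ex b (fun s => (M < pt s K)%R%:R) <= 4 * pi * K%:R / M.
Proof.
move=> b0 M0 K0 K2; pose q := (m %/ K)%N.
have qK : (q * K <= m)%N by exact: leq_trunc_div.
have qn : (m.+1 <= q * K.*2)%N.
  have : (m < q.+1 * K)%N by rewrite ltn_ceil.
  by rewrite -muln2 mulSn; move: (q * K)%N (mulnA q K 2) => y; lia.
have tM := test1_gt M.
have E : q%:R * Ex b (fun s => (M < pt s K)%R%:R) =
    Ex b (fun s => \sum_(i < q) (M < pt s (i * K + K) - pt s (i * K))%R%:R).
  rewrite Ex_sum//; last by move=> i; exact: (obs_gap _ _ _ tM).
  rewrite (eq_bigr (fun _ => Ex b (fun s => (M < pt s K)%R%:R))).
    by rewrite sumr_const card_ord -[RHS]mulr_natl.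
  move=> i _; rewrite (Ex_gap b0 tM)//.
  by have := ltn_ord i; rewrite -mulSnr => iq; apply: leq_trans qK; rewrite leq_mul2r iq orbT.
have U : q%:R * Ex b (fun s => (M < pt s K)%R%:R) <= period / M.
  have pM : 0 <= period / M by rewrite divr_ge0 ?(ltW M0) ?(ltW (period_gt0 m)).
  rewrite E -[leRHS](Ex_cst m b0 pM); apply: Ex_le => //.
  - by apply: obs_sum => i; exact: (obs_gap _ _ _ tM).
  - exact: obs_cst.
  move=> s sm w0; rewrite ler_pdivlMr// mulr_suml.
  apply: (@le_trans _ _ (\sum_(0 <= i < q) (pt s (i.+1 * K) - pt s (i * K)))).
    rewrite big_mkord; apply: ler_sum => i _.
    rewrite -mulSnr; case: (ltP M) => [h|_]; first by rewrite mul1r ltW.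
    rewrite mul0r subr_ge0 weight_pt// leq_mul2r leqnSn orbT /=.
    by apply: leq_trans qK; rewrite leq_mul2r (ltn_ord i) orbT.
  rewrite (@telescope_sumr _ 0 q (fun i => pt s (i * K)))// mul0n [pt s 0]/pt/= subr0.
  exact: ltW (weight_pt_period w0 sm qK).
have q0 : (0 < q)%N by rewrite divn_gt0// -ltnS (leq_trans _ K2)// -addnn -addn1 leq_add2l.
rewrite -(ler_pM2l (_ : 0 < q%:R)) ?ltr0n//; apply: le_trans U _.
rewrite mulrA ler_pM2r ?invr_gt0// /period.
have : m.+1%:R <= q%:R * (2 * K%:R) :> R.
  by rewrite -!natrM ler_nat (leq_trans qn)// -mul2n.
move=> h; rewrite (_ : q%:R * _ = 2 * pi * (q%:R * (2 * K%:R))); last first.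
  by move: (pi : R) => p; ring.
by rewrite ler_wpM2l// mulr_ge0// pi_ge0.
Qed.

Lemma Zgas_half b : 0 < b -> Zgas (b / 2) <= 2 ^+ m * Zgas b.
Proof.
move=> b0; have h : 0 < b / 2 < b by apply/andP; split; lra.
have := Zgas_ratio m h; rewrite (_ : b / 2 / b = 2^-1); last by field; rewrite gt_eqF.
by rewrite exprVn ler_pdivrMl ?exprn_gt0.
Qed.

Lemma close_pairsE K Lam s : ((close_pairs m K Lam s)%:R : R) =
  \sum_(j < m.+1) \sum_(i < j)
    (((K < j - i)%N && ((j - i).*2 <= m.+1)%N)%:R * (pt s j - pt s i <= Lam)%R%:R).
Proof.
rewrite /close_pairs natr_sum; apply: eq_bigr => j _; rewrite natr_sum.
by apply: eq_bigr => i _; rewrite -natrM mulnb.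
Qed.

Lemma obs_close K Lam : obs m (fun s => ((close_pairs m K Lam s)%:R : R)).
Proof.
rewrite (_ : (fun _ => _) = (fun s => \sum_(j < m.+1) \sum_(i < j)
    (((K < j - i)%N && ((j - i).*2 <= m.+1)%N)%:R * (pt s j - pt s i <= Lam)%R%:R))).
  apply: obs_sum => j; apply: obs_sum => i; apply: obsM; first exact: obs_cst.
  exact: (obs_gap _ _ _ (test1_le Lam)).
by apply/funext => s; rewrite close_pairsE.
Qed.

(** Half of the exponent [b] pays for the exponential moment: [c] is such that [q ^ (b / 2)] cancels
    [exp c] for every close pair. The other half leaves [Zgas (b / 2) <= 2 ^ m * Zgas b], and Jensen
    turns [2 ^ m <= exp m] into a linear bound on the mean. *)
Lemma Ex_close b K Lam : 0 < b -> 0 < Lam -> (0 < K)%N -> expR 1 * Lam < 4 * K%:R ->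
  b / 2 * - ln (expR 1 * Lam / (4 * K%:R)) * Ex b (fun s => (close_pairs m K Lam s)%:R) <= m%:R.
Proof.
move=> b0 L0 K0 LK; set q := _ / (4 * _); have k0 : 0 < 4 * K%:R :> R by rewrite mulr_gt0 ?ltr0n.
have q0 : 0 < q by rewrite divr_gt0// mulr_gt0 ?expR_gt0.
have q1 : q < 1 by rewrite /q ltr_pdivrMr// mul1r.
pose G s : R := (close_pairs m K Lam s)%:R.
set c := b / 2 * _.
have oG : obs m G := obs_close K Lam.
have c0 : 0 <= c by rewrite /c mulr_ge0 ?divr_ge0 ?(ltW b0)// oppr_ge0 ln_le0 ?(ltW q1).
rewrite -ler_expR; apply: le_trans (Ex_jensen c b0 oG) _.
apply: (@le_trans _ _ (2 ^+ m)); last first.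
  rewrite -[m%:R]mulr1 expRM_natl; apply: lerXn2r; rewrite ?nnegrE ?expR_ge0//.
  exact: expR_ge1Dx.
rewrite /Ex ler_pdivrMr ?Zgas_gt0//; apply: le_trans (Zgas_half b0).
have [M M0 bf] := obs_bsupp b0 (obs_expR c oG).
have b20 : 0 < b / 2 by rewrite divr_gt0.
apply: (rint_le M0 (ltW (period_gt0 m)) ler01 (ltW (period_gt0 m)) bf (gibbs_bsupp m b20)) => s sm.
rewrite /gibbs [in leLHS](_ : b = b / 2 + b / 2); last by field.
have [w0|w0] := eqVneq (weight s) 0.
  by rewrite w0 !powR0 ?mul0r// gt_eqF// addr_gt0.
have wp : 0 < weight s by rewrite lt_neqAle eq_sym w0 weight_ge0.
rewrite powRD ?w0 ?implybT// -mulrA ler_piMr ?powR_ge0//.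
have := weight_le_close m s L0 K0 (ltW LK); rewrite -/q => wq.
apply: (@le_trans _ _ ((q ^+ close_pairs m K Lam s) `^ (b / 2) * expR (c * G s))).
  by rewrite ler_wpM2r ?expR_ge0// ge0_ler_powR ?nnegrE ?(ltW b20) ?weight_ge0 ?exprn_ge0 ?(ltW q0).
rewrite -powR_mulrn ?(ltW q0)// -powRrM /powR gt_eqF// -expRD.
rewrite (_ : _ + _ = 0) ?expR0// /c /G; ring.
Qed.

(** The mean number of close pairs is at least [m / 2] times the sum: a point in the second half of
    the indices has predecessors at all step numbers up to half of the circle, and each gap has the
    law of the corresponding [X_k]. [Ex_close] then cancels the factor [m]. *)
Lemma cdf_half_sum b K Lam : 0 < b -> 0 < Lam -> (0 < K)%N -> expR 1 * Lam < 4 * K%:R ->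
  \sum_(k < m.+1 | (K < k)%N && (k.*2 <= m.+1)%N) cdf b k Lam
    <= 4 / (b * - ln (expR 1 * Lam / (4 * K%:R))).
Proof.
move=> b0 L0 K0 LK; have := Ex_close b0 L0 K0 LK; set q := _ / (4 * _).
have k0 : 0 < 4 * K%:R :> R by rewrite mulr_gt0 ?ltr0n.
have q0 : 0 < q by rewrite divr_gt0// mulr_gt0 ?expR_gt0.
have q1 : q < 1 by rewrite /q ltr_pdivrMr// mul1r.
set c := - ln q; have c0 : 0 < c by rewrite /c oppr_gt0 ln_lt0// q0 q1.
set S := \sum_(_ | _) _.
case: (posnP m) => [m0 _|m0].
  rewrite /S big1 ?divr_ge0 ?mulr_ge0 ?(ltW b0) ?(ltW c0)// => k /andP[h _].
  by have := ltn_ord k; lia.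
pose F (k : nat) := ((K < k)%N && (k.*2 <= m.+1)%N)%:R * cdf b k Lam.
have F0 k : 0 <= F k by rewrite mulr_ge0// cdf_ge0.
have SE : S = \sum_(k < m.+1) F k.
  by rewrite /S big_mkcond; apply: eq_bigr => k _; rewrite /F; case: (_ && _); rewrite ?mul1r ?mul0r.
have E : Ex b (fun s => (close_pairs m K Lam s)%:R) = \sum_(j < m.+1) \sum_(i < j) F (j - i)%N.
  transitivity (Ex b (fun s => \sum_(j < m.+1) \sum_(i < j)
    (((K < j - i)%N && ((j - i).*2 <= m.+1)%N)%:R * (pt s j - pt s i <= Lam)%R%:R))).
    by apply: eq_Ex => // s _ _; rewrite close_pairsE.
  have og i j : obs m (fun s => (((K < j - i)%N && ((j - i).*2 <= m.+1)%N)%:R * (pt s j - pt s i <= Lam)%R%:R)).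
    by apply: obsM; [exact: obs_cst|exact: (obs_gap _ _ _ (test1_le Lam))].
  rewrite Ex_sum//; last by move=> j; exact: obs_sum.
  apply: eq_bigr => j _; rewrite Ex_sum//; apply: eq_bigr => i _.
  rewrite ExZ//; last exact: (obs_gap _ _ _ (test1_le Lam)).
  have ij : (i + (j - i) <= m)%N by have := ltn_ord i; have := ltn_ord j; lia.
  have := Ex_gap b0 (test1_le Lam) ij; rewrite subnKC /= => [->//|]; exact: ltnW.
have low : m%:R / 2 * S <= Ex b (fun s => (close_pairs m K Lam s)%:R).
  rewrite E; apply: (@le_trans _ _ (\sum_(j < m.+1 | (m.+1 <= j.*2)%N) S)).
    rewrite sumr_const -[leRHS]mulr_natl ler_wpM2r//; first by rewrite SE sumr_ge0.
    rewrite ler_pdivrMr// -natrM ler_nat.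
    have [h h1 h2] : exists2 h, (m.+1 <= h.*2)%N & (h.*2 <= m.+2)%N by exists (m.+2./2); lia.
    have -> : #|[pred j : 'I_m.+1 | (m.+1 <= j.*2)%N]| = (m.+1 - h)%N.
      rewrite -sum1_card (eq_bigl (fun j : 'I_m.+1 => (h <= j)%N)); last by move=> j; rewrite inE; lia.
      by rewrite -(big_geq_mkord h m.+1 xpredT (fun=> 1%N)) sum_nat_const_nat muln1.
    by lia.
  rewrite big_mkcond /=; apply: ler_sum => j _; case: ifP => mj; last by rewrite sumr_ge0.
  rewrite SE -(big_mkord xpredT F) big_nat_recl// {1}/F mul0r add0r.
  rewrite (@big_cat_nat _ _ _ j)/=; [|by []|have := ltn_ord j; lia].
  rewrite [X in _ + X]big_nat_cond [X in _ + X]big1 ?addr0; last first.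
    move=> i; rewrite andbT => /andP[ji _]; rewrite /F (_ : _ && _ = false) ?mul0r//; lia.
  rewrite big_mkord (reindex_inj rev_ord_inj) /=; apply: ler_sum => i _.
  by rewrite subnSK.
move=> H; rewrite ler_pdivlMr ?mulr_gt0//.
have m0' : 0 < m%:R :> R by rewrite ltr0n.
have h2 : b / 2 * c * (m%:R / 2 * S) <= m%:R.
  by apply: le_trans H; rewrite ler_wpM2l// mulr_ge0 ?divr_ge0 ?(ltW b0) ?(ltW c0).
by rewrite -(ler_pM2l m0'); move: h2; lra.
Qed.

(** [cdf] decreases in the index. With [h] half of [m + 1], rounded down, the [m - h] terms beyond
    [h] are each at most the term at [h], and so is none of the [h - K] terms before. Since
    [4 K <= m + 1] gives [m - h <= 2 (h - K)], the full tail is at most three times the half sum. *)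
Lemma cdf_tail_sum b K Lam : 0 < b -> 0 < Lam -> (0 < K)%N -> expR 1 * Lam < 4 * K%:R ->
  (4 * K <= m.+1)%N ->
  \sum_(k < m.+1 | (K < k)%N) cdf b k Lam <= 12 / (b * - ln (expR 1 * Lam / (4 * K%:R))).
Proof.
move=> b0 L0 K0 LK Km; have := cdf_half_sum b0 L0 K0 LK.
set S := \sum_(_ | _) _; set c := b * _ => HS.
apply: (@le_trans _ _ (3 * S)); last by rewrite (_ : 12 / c = 3 * (4 / c)); [rewrite ler_wpM2l|ring].
have [h hm hm2] : exists2 h, (h.*2 <= m.+1)%N & (m.+1 <= h.*2.+1)%N.
  by exists m.+1./2; lia.
pose P := cdf b h Lam.
pose f k := cdf b k Lam.
have SE : S = \sum_(K.+1 <= k < h.+1) f k.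
  rewrite /S (eq_bigl (fun k : 'I_m.+1 => (k.*2 <= m.+1)%N && (K.+1 <= k)%N)); last first.
    by move=> k; rewrite andbC.
  rewrite -(big_geq_mkord K.+1 m.+1 (fun k => (k.*2 <= m.+1)%N) f).
  rewrite (@big_nat_widen _ _ _ K.+1 h.+1 m.+1); last by lia.
  by apply: eq_bigl => k /=; lia.
have TE : \sum_(k < m.+1 | (K < k)%N) f k = S + \sum_(h.+1 <= k < m.+1) f k.
  by rewrite SE -(big_geq_mkord K.+1 m.+1 xpredT f) (@big_cat_nat _ _ _ h.+1)/=; [|lia|lia].
rewrite TE (_ : 3 * S = S + 2 * S); last by ring.
rewrite lerD2l.
have h1 : (h - K)%:R * f h <= S.
  rewrite SE (_ : (h - K)%:R * f h = \sum_(K.+1 <= k < h.+1) f h); last first.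
    by rewrite sumr_const_nat subSS -[RHS]mulr_natl.
  rewrite big_nat [leRHS]big_nat; apply: ler_sum => k kh; apply: cdf_mono => //; lia.
have h2 : \sum_(h.+1 <= k < m.+1) f k <= (m - h)%:R * f h.
  rewrite (_ : (m - h)%:R * f h = \sum_(h.+1 <= k < m.+1) f h); last first.
    by rewrite sumr_const_nat subSS -[RHS]mulr_natl.
  rewrite big_nat [leRHS]big_nat; apply: ler_sum => k kh; apply: cdf_mono => //; lia.
apply: (le_trans h2); apply: (@le_trans _ _ (2 * ((h - K)%:R * f h))); last by rewrite ler_wpM2l.
rewrite mulrA -natrM ler_wpM2r ?cdf_ge0// ler_nat; lia.
Qed.

End tails.

(** * Opening gaps, and dependence on the inverse temperature *)

Section squeeze.
Context {R : realType}.

Lemma log_concave_qc (u : R -> R) : (forall x, 0 <= u x) -> log_concave u ->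
  forall x y z, x <= z <= y -> Num.min (u x) (u y) <= u z.
Proof.
move=> u0 lcu x y z /andP[xz zy].
have [->|zx] := eqVneq z x; first by rewrite ge_min lexx.
have [->|zyn] := eqVneq z y; first by rewrite ge_min lexx orbT.
have xz' : x < z by rewrite lt_neqAle eq_sym zx.
have zy' : z < y by rewrite lt_neqAle zyn.
pose t := (z - x) / (y - x); have yx : 0 < y - x by lra.
have t01 : 0 < t < 1 by rewrite /t; apply/andP; split; [rewrite divr_gt0//; lra|rewrite ltr_pdivrMr// mul1r; lra].
have -> : z = (1 - t) * x + t * y by rewrite /t; field; rewrite gt_eqF.
apply: le_trans (lcu t x y t01); case/andP: t01 => t0 t1.
set c := Num.min _ _; have c0 : 0 <= c by rewrite le_min !u0.
have [->|cn] := eqVneq c 0; first by rewrite mulr_ge0 ?powR_ge0.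
rewrite -[leLHS](powRr1 c0) -[X in c `^ X](subrK t 1) powRD ?cn ?implybT//.
by apply: ler_pM; rewrite ?powR_ge0// ge0_ler_powR ?nnegrE ?u0 ?subr_ge0 ?(ltW t0) ?(ltW t1)// ge_min lexx ?orbT.
Qed.

Lemma log_concave_prod (I : Type) (r : seq I) (u : I -> R -> R) :
  (forall i x, 0 <= u i x) -> (forall i, log_concave (u i)) ->
  log_concave (fun x => \prod_(i <- r) u i x).
Proof.
move=> u0 lcu t x y t01; elim: r => [|i r IH]; first by rewrite !big_nil !powR1 mulr1.
rewrite !big_cons; have P0 z : 0 <= \prod_(i <- r) u i z by apply: prodr_ge0.
rewrite !powRM// mulrACA; apply: ler_pM => //; try by rewrite mulr_ge0 ?powR_ge0.
exact: lcu.
Qed.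

Lemma log_concave_shift (u : R -> R) c : log_concave u -> log_concave (fun x => u (x - c)).
Proof.
move=> lcu t x y t01; apply: le_trans (lcu t _ _ t01) _.
by rewrite le_eqVlt (_ : (1 - t) * (x - c) + t * (y - c) = (1 - t) * x + t * y - c) ?eqxx//; ring.
Qed.

(** If moving from [x] halfway to [mid] lowers [u], then quasi-concavity puts the value at [mid]
    below the one at [x], and [u] cannot rise any more to the right of [mid]. *)
Lemma qc_dichotomy (u : R -> R) (mid : R) :
  (forall x y z, x <= z <= y -> Num.min (u x) (u y) <= u z) ->
  (forall x, x < mid -> u x <= u ((x + mid) / 2)) \/
  (forall x, mid < x -> u x <= u ((x + mid) / 2)).
Proof.
move=> qc; case: (pselect (forall x, x < mid -> u x <= u ((x + mid) / 2))); first by left.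
move=> /existsNP[x /not_implyP[xm /negP]]; rewrite -ltNge => lx; right => y my.
have h1 := qc x mid ((x + mid) / 2) (_ : _ <= _ <= _).
have {h1} : Num.min (u x) (u mid) <= u ((x + mid) / 2) by apply: h1; apply/andP; split; lra.
rewrite ge_min leNgt lx /= => h1.
have := qc x y mid (_ : _ <= _ <= _); rewrite (ltW xm) (ltW my) => /(_ isT).
rewrite ge_min (leNgt (u x)) (le_lt_trans h1 lx)/= => h2.
have yx : u y <= u x by rewrite (le_trans h2)// (le_trans h1)// ltW.
have := qc x y ((y + mid) / 2) (_ : _ <= _ <= _).
have -> : x <= (y + mid) / 2 <= y by apply/andP; split; lra.
by move=> /(_ isT); rewrite (min_idPr yx).
Qed.

Definition halve (A : pred R) (mid x : R) : R := if A x then (x + mid) / 2 else x.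

Section halve.
Variables (A : pred R) (mid : R).
Hypothesis mA : measurable [set x | A x].
Hypothesis hA : forall x, A ((x + mid) / 2) = A x.

Lemma measurable_halve : measurable_fun setT (halve A mid).
Proof.
apply: measurable_fun_if => //.
- by apply: (measurable_fun_bool true); rewrite setTI (_ : _ @^-1` _ = [set x | A x]).
- apply: measurable_funTS; apply: (@eqfun_measurable _ _ _ _ (fun x : R => 2^-1 * x + mid / 2)).
    by move=> x; ring.
  exact: measurable_affine.
Qed.

(** On [A], which halving the distance to [mid] preserves, this is the change of variables with
    equality; off [A] the map is the identity and the factor [1/2] is a loss. *)
Lemma integral_halve (h : R -> \bar R) : (forall x, 0 <= h x)%E -> measurable_fun setT h ->
  ((2^-1)%:E * \int[lebesgue_measure]_x h (halve A mid x) <= \int[lebesgue_measure]_x h x)%E.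
Proof.
move=> h0 mh.
have mI : measurable_fun setT (fun x => ((A x)%:R : R)%:E).
  by apply/measurable_EFinP; exact: measurable_indb.
have mJ : measurable_fun setT (fun x => ((~~ A x)%:R : R)%:E).
  apply/measurable_EFinP; apply: (@measurable_indb _ _ _ (fun x => ~~ A x)).
  rewrite (_ : [set _ | _] = ~` [set x | A x]); first exact: measurableC.
  by apply/seteqP; split => x /= /negP.
have mhI : measurable_fun setT (fun x => h x * ((A x)%:R : R)%:E)%E by exact: emeasurable_funM.
have mhJ : measurable_fun setT (fun x => h x * ((~~ A x)%:R : R)%:E)%E by exact: emeasurable_funM.
have I0 x : (0 <= h x * ((A x)%:R : R)%:E)%E by rewrite mule_ge0// lee_fin ler0n.
have J0 x : (0 <= h x * ((~~ A x)%:R : R)%:E)%E by rewrite mule_ge0// lee_fin ler0n.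
have E1 : (\int[lebesgue_measure]_x h x = \int[lebesgue_measure]_x (h x * ((A x)%:R : R)%:E) +
    \int[lebesgue_measure]_x (h x * ((~~ A x)%:R : R)%:E))%E.
  rewrite -ge0_integralD//; apply: eq_integral => x _.
  by case: (A x); rewrite /= mule1 mule0 ?adde0 ?add0e.
have E2 : (\int[lebesgue_measure]_x h (halve A mid x) =
   \int[lebesgue_measure]_x (h (2^-1 * x + mid / 2)%R * ((A (2^-1 * x + mid / 2)%R)%:R : R)%:E) +
    \int[lebesgue_measure]_x (h x * ((~~ A x)%:R : R)%:E))%E.
  rewrite -ge0_integralD//; last first.
    apply: (measurableT_comp mhI); exact: measurable_affine.
  apply: eq_integral => x _; rewrite (_ : (2^-1 * x + mid / 2)%R = ((x + mid) / 2)%R); last by ring.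
  by rewrite hA /halve; case: (A x); rewrite /= mule1 mule0 ?adde0 ?add0e.
rewrite E2 E1 ge0_muleDr ?integral_ge0//.
rewrite (@ge0_integral_affine R 2^-1 (mid / 2) (fun x => h x * ((A x)%:R : R)%:E)%E)//.
rewrite leeD2l// -[leRHS]mul1e lee_wpmul2r ?integral_ge0// lee_fin; lra.
Qed.

End halve.

Section block.
Variables (m p B : nat).
Hypothesis mE : m = (p + B)%N.
Local Notation hchord := (@hchord R m).
Local Notation period := (@period R m).
Local Notation vdm := (@vdm R m).
Local Notation gibbs := (@gibbs R m).
Implicit Types (s u : seq R) (T : R -> R) (b : R).

Lemma vdm_cat s u : size s = p -> size u = B -> vdm (s ++ u) =
  (\prod_(j < p.+1) \prod_(i < j) hchord (pt s j - pt s i)) *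
  \prod_(j < B) ((\prod_(i < p.+1) hchord (u`_j - pt s i)) * \prod_(i < j) hchord (u`_j - u`_i)).
Proof.
move=> sp uB.
have ptl i : (i < p.+1)%N -> pt (s ++ u) i = pt s i.
  by rewrite /pt -cat_cons nth_cat /= sp => ->.
have ptr i : pt (s ++ u) (p.+1 + i) = u`_i.
  by rewrite /pt -cat_cons nth_cat /= sp ltnNge leq_addr /= addKn.
rewrite /vdm -(big_mkord xpredT (fun j => \prod_(i < j) hchord (pt (s ++ u) j - pt (s ++ u) i))).
rewrite (_ : m.+1 = (p.+1 + B)%N) ?mE// big_mkord big_split_ord /=; congr (_ * _).
  apply: eq_bigr => j _; apply: eq_bigr => i _; rewrite !ptl//.
  exact: ltn_trans (ltn_ord i) (ltn_ord j).
apply: eq_bigr => j _; rewrite big_split_ord ptr /=; congr (_ * _).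
  by apply: eq_bigr => i _; rewrite ptl.
by apply: eq_bigr => i _; rewrite ptr.
Qed.

Lemma iint_catm f : iint m f = iint p (fun s => iint B (fun u => f (s ++ u))).
Proof. by rewrite mE iint_cat. Qed.

(** One factor [1/2] per pair of moved points, whose mutual distance may be halved. *)
Definition squeeze_cst : R := \prod_(j < B) \prod_(i < j) 2^-1.

Lemma squeeze_cst_gt0 : 0 < squeeze_cst.
Proof. by apply: prodr_gt0 => j _; apply: prodr_gt0. Qed.

(** The first [p] points and the pinned one stay fixed, and the interaction with them does not
    decrease by assumption. Inside the block a distance ends up between half of itself and itself,
    so quasi-concavity and [hchord_scale] bound its chord below by half of the old one. *)
Lemma vdm_squeeze T s u : size s = p -> size u = B -> vdm (s ++ u) != 0 ->
  (forall x, pt s p < x < period ->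
     \prod_(i < p.+1) hchord (x - pt s i) <= \prod_(i < p.+1) hchord (T x - pt s i)) ->
  (forall x y, pt s p < x < y -> y < period -> (y - x) / 2 <= T y - T x <= y - x) ->
  squeeze_cst * vdm (s ++ u) <= vdm (s ++ map T u).
Proof.
move=> sp uB v0 Tu TT.
have ub j : (j < B)%N -> pt s p < u`_j < period.
  move=> jB; have sz : size (s ++ u) = m by rewrite size_cat sp uB.
  have e1 : pt (s ++ u) (p + j).+1 = u`_j.
    by rewrite /pt /= nth_cat sp ltnNge leq_addr /= addKn.
  have e2 : pt (s ++ u) p = pt s p by rewrite /pt -cat_cons nth_cat /= sp ltnSn.
  have h1 : (p < (p + j).+1 <= m)%N by rewrite mE; lia.
  have h2 : (0 < (p + j).+1 <= m)%N by rewrite mE; lia.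
  have := vdm_neq0 v0 h1; have := vdm_neq0 v0 h2.
  by rewrite e1 e2 [pt _ 0]/pt /= subr0 subr_gt0 => /andP[_ ->] /andP[->].
have uinc i j : (i < j)%N -> (j < B)%N -> 0 < u`_j - u`_i < period.
  move=> ij jB; have e1 k : pt (s ++ u) (p + k).+1 = u`_k.
    by rewrite /pt /= nth_cat sp ltnNge leq_addr /= addKn.
  by rewrite -!e1; apply: vdm_neq0 => //; rewrite mE; lia.
rewrite !vdm_cat ?size_map// mulrCA ler_wpM2l//.
  by apply: prodr_ge0 => j _; apply: prodr_ge0 => i _; exact: hchord_ge0.
rewrite /squeeze_cst -big_split /=; apply: ler_prod => j _; apply/andP; split.
  rewrite !mulr_ge0//; first by apply: prodr_ge0.
  - by apply: prodr_ge0 => i _; exact: hchord_ge0.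
  - by apply: prodr_ge0 => i _; exact: hchord_ge0.
have jB := ltn_ord j; rewrite mulrCA; apply: ler_pM.
- by apply: prodr_ge0 => i _; exact: hchord_ge0.
- by rewrite mulr_ge0//; apply: prodr_ge0 => // i _; exact: hchord_ge0.
- by rewrite (nth_map 0) ?uB//; exact: Tu (ub _ jB).
rewrite -big_split /=; apply: ler_prod => i _; rewrite mulr_ge0 ?hchord_ge0//=.
have ij := ltn_ord i; have iB := ltn_trans ij jB.
rewrite !(nth_map 0) ?uB//; have h := uinc _ _ ij jB.
have /andP[i1 i2] := ub _ iB; have /andP[j1 j2] := ub _ jB.
have xy : pt s p < u`_i < u`_j by rewrite i1 -subr_gt0; case/andP: h.
have := hchord_qc m (TT _ _ xy j2); apply: le_trans.
have hs : 2^-1 * hchord (u`_j - u`_i) <= hchord ((u`_j - u`_i) / 2).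
  by rewrite [(_ - _) / 2]mulrC; apply: hchord_scale h; apply/andP; split; lra.
rewrite le_min hs /=; have := @hchord_ge0 R m (u`_j - u`_i).
by set z := hchord _; lra.
Qed.

Lemma smeas_catl a c (f : seq R -> \bar R) s : smeas (a + c) f -> size s = a ->
  smeas c (fun u => f (s ++ u)).
Proof.
move=> mf sa; apply: (smeas_map (h := cat s) mf); first by move=> u uc; rewrite size_cat sa uc.
move=> i ic; case: (ltnP i a) => ia.
  apply: (@eqfun_measurable _ _ _ _ (fun=> s`_i)); last exact: measurable_cst.
  by move=> u; rewrite nth_cat sa ia.
apply: (@eqfun_measurable _ _ _ _ (fun u : c.-tuple R => u`_(i - a))); last exact: measurable_nth.
by move=> u; rewrite nth_cat sa ltnNge ia.
Qed.

Lemma smeas_iint_cat a c (f : seq R -> \bar R) : smeas (a + c) f -> (forall s, 0 <= f s)%E ->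
  smeas a (fun s => iint c (fun u => f (s ++ u))).
Proof.
move=> mf f0; apply: (@measurable_iint _ _ (a.-tuple R) c (fun (t : a.-tuple R) u => f (t ++ u))).
  by move=> *; exact: f0.
apply: (smeas_param2 (h := fun (t : a.-tuple R) u => t ++ u) mf).
  by move=> t u uc; rewrite size_cat size_tuple uc.
move=> i ic; case: (ltnP i a) => ia.
  apply: (@eqfun_measurable _ _ _ _ (fun x : a.-tuple R * c.-tuple R => x.1`_i)).
    by move=> x; rewrite nth_cat size_tuple ia.
  by apply: (measurableT_comp (measurable_nth i)); exact: measurable_fst.
apply: (@eqfun_measurable _ _ _ _ (fun x : a.-tuple R * c.-tuple R => x.2`_(i - a))).
  by move=> x; rewrite nth_cat size_tuple ltnNge ia.
by apply: (measurableT_comp (measurable_nth (i - a))); exact: measurable_snd.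
Qed.

(** The Jacobian of [B] halvings together with the loss of weight. What matters is that it does not
    involve [m]. *)
Definition block_cst b : R := 2^-1 ^+ B * squeeze_cst `^ b.

Lemma block_cst_gt0 b : 0 < block_cst b.
Proof. by rewrite mulr_gt0 ?exprn_gt0 ?powR_gt0// squeeze_cst_gt0. Qed.

Lemma gibbs_squeeze T b s u : 0 < b -> size s = p -> size u = B -> vdm (s ++ u) != 0 ->
  (forall x, pt s p < x < period ->
     \prod_(i < p.+1) hchord (x - pt s i) <= \prod_(i < p.+1) hchord (T x - pt s i)) ->
  (forall x y, pt s p < x < y -> y < period -> (y - x) / 2 <= T y - T x <= y - x) ->
  squeeze_cst `^ b * gibbs b (s ++ u) <= gibbs b (s ++ map T u).
Proof.
move=> b0 sp uB v0 Tu TT; have k0 := squeeze_cst_gt0.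
have h : squeeze_cst * weight m (s ++ u) <= weight m (s ++ map T u).
  have := vdm_squeeze sp uB v0 Tu TT => /(ler_wpM2r (_ : 0 <= (vdm (lat m))^-1)).
  by rewrite -mulrA; apply; rewrite invr_ge0 ltW// vdm_lat_gt0.
have w0 v : 0 <= weight m v by exact: weight_ge0.
rewrite /gibbs -powRM ?(ltW k0)//; apply: ge0_ler_powR h; rewrite ?nnegrE ?(ltW b0) ?w0//.
by apply: mulr_ge0; [exact: ltW k0|exact: w0].
Qed.

Lemma block_one T (A : pred R) b s (F G : seq R -> R) mid : 0 < b -> size s = p ->
  T = halve A mid -> measurable [set x | A x] -> (forall x, A ((x + mid) / 2) = A x) ->
  (forall x, pt s p < x < period ->
     \prod_(i < p.+1) hchord (x - pt s i) <= \prod_(i < p.+1) hchord (T x - pt s i)) ->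
  (forall x y, pt s p < x < y -> y < period -> (y - x) / 2 <= T y - T x <= y - x) ->
  (forall u, 0 <= F u) -> (forall u, 0 <= G u) -> smeas B (EFin \o G) ->
  smeas B (EFin \o F) -> smeas B (fun u => (gibbs b (s ++ u))%:E) ->
  (forall u, size u = B -> vdm (s ++ u) != 0 -> F u <= G (map T u)) ->
  ((block_cst b)%:E * iint B (fun u => (gibbs b (s ++ u) * F u)%:E) <=
    iint B (fun u => (gibbs b (s ++ u) * G u)%:E))%E.
Proof.
move=> b0 sp TE mA hA Tu TT F0 G0 mG mF mg FG.
have mT : measurable_fun setT T by rewrite TE; exact: measurable_halve.
pose g u : \bar R := (gibbs b (s ++ u) * G u)%:E.
have g0 u : (0 <= g u)%E by rewrite lee_fin mulr_ge0 ?gibbs_ge0.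
have mgG : smeas B g.
  by apply/measurable_EFinP; apply: measurable_funM; exact/measurable_EFinP.
have h20 : 0 <= 2^-1 :> R by [].
apply: le_trans (iint_amap_ge h20 (fun _ => mT) _ g0 mgG); last first.
  by move=> _ h h0 mh; rewrite TE; exact: integral_halve.
rewrite /block_cst EFinM -muleA lee_wpmul2l ?lee_fin ?exprn_ge0//.
have k0 := squeeze_cst_gt0.
rewrite -iintZ ?powR_ge0//; last 2 first.
- by move=> u; rewrite lee_fin mulr_ge0 ?gibbs_ge0.
- by apply/measurable_EFinP; apply: measurable_funM; exact/measurable_EFinP.
apply: le_iint.
- by move=> u; rewrite -EFinM lee_fin mulr_ge0 ?powR_ge0// mulr_ge0 ?gibbs_ge0.
- by move=> u; exact: g0.
- apply: emeasurable_funM; first exact: measurable_cst.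
  by apply/measurable_EFinP; apply: measurable_funM; exact/measurable_EFinP.
- by apply: (@smeas_amap R B g (fun=> T)).
move=> u uB /=; rewrite amap_cst lee_fin mulrA.
have [v0|v0] := eqVneq (vdm (s ++ u)) 0.
  by rewrite {1}/gibbs /weight v0 mul0r powR0 ?gt_eqF// mulr0 mul0r mulr_ge0 ?gibbs_ge0.
apply: ler_pM; rewrite ?F0 ?mulr_ge0 ?powR_ge0 ?gibbs_ge0//; last exact: FG.
exact: gibbs_squeeze.
Qed.

Lemma pt_cat_block s u j : size s = p -> (j < B)%N -> pt (s ++ u) (p + j.+1) = u`_j.
Proof. by move=> sp jB; rewrite addnS /pt /= nth_cat sp ltnNge leq_addr /= addKn. Qed.

Lemma pt_cat_last s u : size s = p -> pt (s ++ u) p = pt s p.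
Proof. by move=> sp; rewrite /pt -cat_cons nth_cat /= sp ltnSn. Qed.

Lemma obs_opening n i j : obs n (fun s => ((period - pt s i) / 4 <= pt s j - pt s i)%R%:R).
Proof.
case: (test1_ge (0 : R)) => t1 t2 t3.
rewrite (_ : (fun _ => _) = (fun s => (0 <= pt s j - pt s i - (period - pt s i) / 4)%R%:R)); last first.
  by apply/funext => s; rewrite subr_ge0.
apply: (@obs_comp R n (fun y => (0 <= y)%R%:R) (fun s => pt s j - pt s i - (period - pt s i) / 4)) => //.
have mpt k : measurable_fun [set: n.-tuple R] (fun s : n.-tuple R => pt s k) by exact: smeas_pt.
by apply: measurable_funB; [apply: measurable_funB|apply: measurable_funM => //; apply: measurable_funB].
Qed.

Lemma obs_closing n i j : obs n (fun s => ((period - pt s i) / 4 <= period - pt s j)%R%:R).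
Proof.
case: (test1_ge (0 : R)) => t1 t2 t3.
rewrite (_ : (fun _ => _) = (fun s => (0 <= period - pt s j - (period - pt s i) / 4)%R%:R)); last first.
  by apply/funext => s; rewrite subr_ge0.
apply: (@obs_comp R n (fun y => (0 <= y)%R%:R) (fun s => period - pt s j - (period - pt s i) / 4)) => //.
have mpt k : measurable_fun [set: n.-tuple R] (fun s : n.-tuple R => pt s k) by exact: smeas_pt.
by apply: measurable_funB; [apply: measurable_funB|apply: measurable_funM => //; apply: measurable_funB].
Qed.

(* On the window between [X_p] and [period] the product of the distances to the
   remaining points is log-concave, hence nondecreasing on its left half or
   nonincreasing on its right half; squeezing the points of that half towards
   the middle opens a gap of a quarter of the window at one of its ends. *)
Lemma gap_opening b phi : 0 < b -> (0 < B)%N -> test1 phi ->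
  block_cst b * Ex m b (fun s => phi (period - pt s p)) <=
  Ex m b (fun s => phi (period - pt s p) * ((period - pt s p) / 4 <= pt s p.+1 - pt s p)%R%:R) +
  Ex m b (fun s => phi (period - pt s p) * ((period - pt s p) / 4 <= period - pt s m)%R%:R).
Proof.
move=> b0 B0 tphi.
pose w s := period - pt s p.
pose L s : R := (w s / 4 <= pt s p.+1 - pt s p)%R%:R.
pose Q s : R := (w s / 4 <= period - pt s m)%R%:R.
have owphi : obs m (fun s => phi (w s)).
  exact: (obs_pt m p (test1_reflect period tphi)).
have oL : obs m L := obs_opening m p p.+1.
have oQ : obs m Q := obs_closing m p m.
have oLQ1 := obsM owphi oL; have oLQ2 := obsM owphi oQ.
rewrite -ExD// -ExZ ?(ltW (block_cst_gt0 b))//.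
rewrite /Ex ler_pM2r ?invr_gt0 ?Zgas_gt0//.
have p0 : 0 <= period := ltW (period_gt0 m).
have [M1 M10 b1] := obs_bsupp b0 (obsM (obs_cst m (ltW (block_cst_gt0 b))) owphi).
have [M2 M20 b2] := obs_bsupp b0 (obsD oLQ1 oLQ2).
rewrite -lee_fin (rintE M10 p0 b1) (rintE M20 p0 b2).
case: b1 => f10 mf1 _; case: b2 => f20 mf2 _.
have scatm (f : seq R -> \bar R) : smeas m f -> smeas (p + B) f by rewrite -mE.
have mf1' := scatm _ mf1; have mf2' := scatm _ mf2.
rewrite !iint_catm; apply: le_iint.
- by move=> s; apply: iint_ge0 => u; rewrite lee_fin.
- by move=> s; apply: iint_ge0 => u; rewrite lee_fin.
- by apply: smeas_iint_cat => // s; rewrite lee_fin.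
- by apply: smeas_iint_cat => // s; rewrite lee_fin.
move=> s sp; set a := pt s p; pose mid := (a + period) / 2.
have scat (f : seq R -> \bar R) : smeas m f -> smeas B (fun u => f (s ++ u)).
  by move=> mf; apply: (@smeas_catl p) => //; rewrite -mE.
have obc (f : seq R -> R) : obs m f -> smeas B (EFin \o (fun u => f (s ++ u))).
  by case=> _ mf _; exact: (scat _ mf).
have bcast : smeas B (fun u => (gibbs b (s ++ u))%:E).
  by apply: (scat (EFin \o gibbs b)); apply/measurable_EFinP; exact: measurable_gibbs.
have qc := log_concave_qc (u := fun x => \prod_(i < p.+1) hchord (x - pt s i)) _ _.
have {}qc : forall x y z, x <= z <= y -> Num.min (\prod_(i < p.+1) hchord (x - pt s i))
   (\prod_(i < p.+1) hchord (y - pt s i)) <= \prod_(i < p.+1) hchord (z - pt s i).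
  apply: qc; first by move=> x; apply: prodr_ge0 => i _; exact: hchord_ge0.
  apply: (@log_concave_prod _ _ (fun (i : 'I_p.+1) x => hchord (x - pt s i))).
    by move=> i x; exact: hchord_ge0.
  by move=> i; apply: log_concave_shift; exact: hchord_lc.
have hA1 x : ((x + mid) / 2 < mid) = (x < mid) by apply/idP/idP; lra.
have hA2 x : (mid < (x + mid) / 2) = (mid < x) by apply/idP/idP; lra.
have midE : (period - a) / 4 = (mid - a) / 2 by rewrite /mid; field.
have midE' : (period - a) / 4 = (period - mid) / 2 by rewrite /mid; field.
have wE u : w (s ++ u) = period - a by rewrite /w pt_cat_last.
have phi0 x : 0 <= phi x by case: tphi.
have cstE : iint B (fun u => (EFin \o (fun s => (gibbs b s * (block_cst b * phi (w s)))%R)) (s ++ u)) =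
    ((block_cst b)%:E * iint B (fun u => (gibbs b (s ++ u) * phi (w (s ++ u)))%:E))%E.
  rewrite -iintZ ?(ltW (block_cst_gt0 b))//.
  - by apply: eq_iint => u _ /=; rewrite -EFinM mulrCA.
  - by move=> u; rewrite lee_fin mulr_ge0 ?gibbs_ge0.
  - by apply/measurable_EFinP; apply: measurable_funM; apply/measurable_EFinP => //; exact: (obc _ owphi).
rewrite cstE.
have stepG (G : seq R -> R) : obs m G -> (forall v, G v <= L v + Q v) ->
    (iint B (fun u => (gibbs b (s ++ u) * (phi (w (s ++ u)) * G (s ++ u)))%:E) <=
     iint B (fun u => (EFin \o (fun s => (gibbs b s * (phi (w s) * L s + phi (w s) * Q s))%R)) (s ++ u)))%E.
  move=> oG GLQ; apply: le_iint.
  - by move=> u; case: oG => G0 _ _; rewrite lee_fin !mulr_ge0 ?gibbs_ge0.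
  - by move=> u; rewrite lee_fin.
  - apply/measurable_EFinP; apply: measurable_funM; apply/measurable_EFinP => //.
    exact: (obc _ (obsM owphi oG)).
  - exact: (scat _ mf2).
  by move=> u _; rewrite lee_fin ler_wpM2l ?gibbs_ge0// -mulrDr ler_wpM2l.
have L0 v : 0 <= L v by exact: ler0n.
have Q0 v : 0 <= Q v by exact: ler0n.
have inwin u j : size u = B -> vdm (s ++ u) != 0 -> (j < B)%N -> a < u`_j < period.
  move=> uB v0 jB.
  have h1 : (p < (p + j.+1) <= m)%N by rewrite mE; lia.
  have h2 : (0 < (p + j.+1) <= m)%N by rewrite mE; lia.
  have := vdm_neq0 v0 h1; have := vdm_neq0 v0 h2.
  rewrite pt_cat_block// pt_cat_last// [pt _ 0]/pt /= subr0 subr_gt0 -/a.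
  by move=> /andP[_ ->] /andP[->].
case: (qc_dichotomy mid qc) => qcs.
- apply: le_trans (stepG L oL _); last by move=> v; rewrite lerDl.
  apply: (@block_one (halve (fun x => x < mid) mid) (fun x => x < mid) b s _
    (fun u => phi (w (s ++ u)) * L (s ++ u)) mid b0 sp erefl) => //.
  + rewrite (_ : [set _ | _] = `]-oo, mid[%classic); first exact: measurable_itv.
    by apply/seteqP; split => y /=; rewrite in_itv.
  + by move=> x _; rewrite /halve; case: ifP => // xm; exact: qcs.
  + by move=> x y /andP[_ xy] _; rewrite /halve; case: ltP => h1; case: ltP => h2; apply/andP; split; lra.
  + by move=> u; rewrite mulr_ge0.
  + exact: (obc _ (obsM owphi oL)).
  + exact: (obc _ owphi).
  move=> u uB v0; rewrite !wE /L; have /andP[u1 u2] := inwin u 0%N uB v0 B0.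
  rewrite -[p.+1]addn1 pt_cat_block ?size_map// pt_cat_last// -/a wE (nth_map 0) ?uB// (_ : (_ <= _ - a) = true) ?mulr1//.
  by rewrite midE /halve; case: ltP => h; lra.
- apply: le_trans (stepG Q oQ _); last by move=> v; rewrite lerDr.
  apply: (@block_one (halve (fun x => mid < x) mid) (fun x => mid < x) b s _
    (fun u => phi (w (s ++ u)) * Q (s ++ u)) mid b0 sp erefl) => //.
  + exact: measurable_gt_itv.
  + by move=> x _; rewrite /halve; case: ifP => // xm; exact: qcs.
  + by move=> x y /andP[_ xy] _; rewrite /halve; case: ltP => h1; case: ltP => h2; apply/andP; split; lra.
  + by move=> u; rewrite mulr_ge0.
  + exact: (obc _ (obsM owphi oQ)).
  + exact: (obc _ owphi).
  move=> u uB v0; rewrite !wE /Q; have jB : (B.-1 < B)%N by rewrite prednK.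
  have /andP[u1 u2] := inwin u B.-1 uB v0 jB.
  have -> : pt (s ++ [seq halve (fun x => mid < x) mid i | i <- u]) m = halve (fun x => mid < x) mid u`_B.-1.
    by rewrite mE -{1}(prednK B0) pt_cat_block// (nth_map 0) ?uB.
  rewrite wE (_ : (_ <= period - _) = true) ?mulr1//.
  by rewrite midE' /halve; case: ltP => h; lra.
Qed.

End block.

(** By rotation the window behind [X_p] with [p = m - B] has the law of [X_(B+1)], and each of its
    two end gaps has the law of [X_1]. The 4 is the opened quarter of the window and the 2 counts
    its ends. *)
Lemma hole_bound m B b x : 0 < b -> (0 < B)%N -> (B < m)%N ->
  block_cst B b * Ex m b (fun s => (4 * x <= pt s B.+1)%R%:R) <=
  2 * Ex m b (fun s => (x <= pt s 1)%R%:R) :> R.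
Proof.
move=> b0 B0 Bm; have mE : m = ((m - B) + B)%N by rewrite subnK// ltnW.
have tx := test1_ge x; have t4 := test1_ge (4 * x).
have := gap_opening mE b0 B0 t4; set p := (m - B)%N.
have p0 : (0 < p <= m)%N by rewrite /p; lia.
have -> : Ex m b (fun s => (4 * x <= period m - pt s p)%R%:R) = Ex m b (fun s => (4 * x <= pt s B.+1)%R%:R).
  by have := Ex_gap_wrap b0 t4 p0 => /= ->; rewrite (_ : (m.+1 - p)%N = B.+1)//; rewrite /p; lia.
move=> /le_trans; apply; rewrite [leRHS]mulr_natl [leRHS]mulr2n; apply: lerD.
- have h : (p + 1 <= m)%N by rewrite /p; lia.
  have := Ex_gap b0 tx h => /= <-; apply: Ex_le => //.
  + by apply: (obsM (obs_pt m p (test1_reflect (period m) t4))); apply: (obs_opening m m p p.+1).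
  + exact: (obs_gap _ _ _ tx).
  move=> s _ _; rewrite addn1 -natrM mulnb ler_nat.
  by case: (leP (4 * x)) => // h1; case: leP => // h2; rewrite (_ : x <= _)//; lra.
- have m1 : (0 < m <= m)%N by rewrite (leq_ltn_trans _ Bm)/=.
  have := Ex_gap_wrap b0 tx m1; rewrite subSnn => /= <-; apply: Ex_le => //.
  + by apply: (obsM (obs_pt m p (test1_reflect (period m) t4))); exact: (obs_closing m m p m).
  + exact: (obs_pt m m (test1_reflect (period m) tx)).
  move=> s _ _; rewrite -natrM mulnb ler_nat.
  by case: (leP (4 * x)) => // h1; case: leP => // h2; rewrite (_ : x <= _)//; lra.
Qed.

(** The same opening read from the other side: once a quarter of the window is empty at one end, the
    remaining [B] gaps occupy at most three quarters of it. *)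
Lemma squeeze_bound m B b x : 0 < b -> (0 < B)%N -> (B < m)%N ->
  block_cst B b * cdf m b B.+1 x <= 2 * cdf m b B (3 / 4 * x) :> R.
Proof.
move=> b0 B0 Bm; have mE : m = ((m - B) + B)%N by rewrite subnK// ltnW.
have tx := test1_le (3 / 4 * x); have t4 := test1_le x.
have := gap_opening mE b0 B0 t4; set p := (m - B)%N.
have p0 : (0 < p <= m)%N by rewrite /p; lia.
have -> : Ex m b (fun s => (period m - pt s p <= x)%R%:R) = cdf m b B.+1 x.
  by have := Ex_gap_wrap b0 t4 p0 => /= ->; rewrite (_ : (m.+1 - p)%N = B.+1)//; rewrite /p; lia.
move=> /le_trans; apply; rewrite [leRHS]mulr_natl [leRHS]mulr2n; apply: lerD.
- have h : (0 < p.+1 <= m)%N by rewrite /p; lia.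
  have := Ex_gap_wrap b0 tx h; rewrite (_ : (m.+1 - p.+1)%N = B)/=; last by rewrite /p; lia.
  move=> E; rewrite /cdf -E; apply: Ex_le => //.
  + by apply: (obsM (obs_pt m p (test1_reflect (period m) t4))); apply: (obs_opening m m p p.+1).
  + exact: (obs_pt m p.+1 (test1_reflect (period m) tx)).
  move=> s _ _; rewrite -natrM mulnb ler_nat.
  by case: (leP _ x) => // h1; case: leP => // h2; rewrite (_ : _ <= 3 / 4 * x)//; lra.
- have h : (p + B <= m)%N by rewrite /p; lia.
  have := Ex_gap b0 tx h; rewrite -mE /= => E; rewrite /cdf -E; apply: Ex_le => //.
  + by apply: (obsM (obs_pt m p (test1_reflect (period m) t4))); exact: (obs_closing m m p m).
  + exact: (obs_gap _ _ _ tx).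
  move=> s _ _; rewrite -natrM mulnb ler_nat.
  by case: (leP _ x) => // h1; case: leP => // h2; rewrite (_ : _ <= 3 / 4 * x)//; lra.
Qed.

End squeeze.

(** * Exponential moments of sums over gaps, and the effect of the temperature *)

Section midpoint.
Context {R : realType}.
Variable m : nat.
Local Notation hchord := (@hchord R m).
Local Notation period := (@period R m).
Local Notation vdm := (@vdm R m).
Local Notation weight := (@weight R m).
Local Notation gibbs := (@gibbs R m).
Implicit Types (s u : seq R) (b : R).

Let dev (k : nat) s u j : R :=
  ((pt s j - pt s (j - k)) - (pt u j - pt u (j - k))) /
  ((pt s j - pt s (j - k)) + (pt u j - pt u (j - k))).

(** Every pair gains a Gaussian factor in its relative difference; only the gains of the pairs [k]
    steps apart are kept. *)
Lemma weight_midpoint k s u : (0 < k)%N -> size s = m -> size u = m ->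
  weight s != 0 -> weight u != 0 ->
  weight s * weight u <=
  weight (scomb 2^-1 s u) ^+ 2 * expR (- \sum_(j < m.+1 | (k <= j)%N) dev k s u j ^+ 2).
Proof.
move=> k0 sm um ws wu; set v := scomb 2^-1 s u.
have vs := weight_neq0 sm ws; have vu := weight_neq0 um wu.
suff H : vdm s * vdm u <= vdm v ^+ 2 * expR (- \sum_(j < m.+1 | (k <= j)%N) dev k s u j ^+ 2).
  have l0 : 0 < (vdm (lat m))^-1 by rewrite invr_gt0 vdm_lat_gt0.
  move: H l0; rewrite /weight; move: (expR _) (vdm s) (vdm u) (vdm v) (_^-1) => e x y z l H l0.
  rewrite (_ : x * l * (y * l) = x * y * l ^+ 2); last by ring.
  rewrite (_ : (z * l) ^+ 2 * e = z ^+ 2 * e * l ^+ 2); last by ring.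
  by rewrite ler_pM2r// exprn_gt0.
have vE i : (i <= m)%N -> pt v i = (pt s i + pt u i) / 2.
  by move=> im; rewrite /v pt_comb ?sm ?um//; field.
have -> : expR (- \sum_(j < m.+1 | (k <= j)%N) dev k s u j ^+ 2) =
    \prod_(j < m.+1) expR (- (if (k <= j)%N then dev k s u j ^+ 2 else 0)).
  by rewrite -expR_sum big_mkcond sumrN.
rewrite /vdm -prodrXl -!big_split /=; apply: ler_prod => j _; apply/andP; split.
  by rewrite mulr_ge0//; apply: prodr_ge0 => i _; exact: hchord_ge0.
pose d (i : nat) : R := ((pt s j - pt s i) - (pt u j - pt u i)) / ((pt s j - pt s i) + (pt u j - pt u i)).
apply: (@le_trans _ _ (\prod_(i < j) (hchord (pt v j - pt v i) ^+ 2 * expR (- d i ^+ 2)))).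
  rewrite -big_split /=; apply: ler_prod => i _; rewrite mulr_ge0 ?hchord_ge0//=.
  have ij := ltn_ord i; have jm := ltn_ord j.
  have h : (i < j <= m)%N by rewrite ij -ltnS.
  have := hchord_midpoint (vdm_neq0 vs h) (vdm_neq0 vu h).
  by rewrite !vE; [|lia|lia]; rewrite (_ : _ / 2 - _ / 2 = (pt s j - pt s i + (pt u j - pt u i)) / 2)//; ring.
rewrite big_split /= prodrXl ler_wpM2l ?sqr_ge0// -expR_sum ler_expR sumrN lerN2.
case: ifP => kj; last by apply: sumr_ge0 => i _; exact: sqr_ge0.
have lt : (j - k < j)%N by rewrite ltn_subrL k0 (leq_trans k0 kj).
by rewrite (bigD1 (Ordinal lt))//= lerDl sumr_ge0// => i _; exact: sqr_ge0.
Qed.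

Variables (f : R -> R) (A : R) (k : nat).
Hypothesis tf : test1 f.
Hypothesis A0 : 0 <= A.
Hypothesis fA : forall x y, 0 < x -> 0 < y -> `|f x - f y| <= A * (`|x - y| / (x + y)).
Hypothesis k0 : (0 < k)%N.
Hypothesis km : (k <= m)%N.

(** Summing over all starting points is essential: changing the temperature costs an exponent of
    order [m], which has to be shared among about [m] terms of equal mean. *)
Definition gap_sum s : R := \sum_(j < m.+1 | (k <= j)%N) f (pt s j - pt s (j - k)).

Local Notation N := ((m.+1 - k)%:R : R).

Lemma card_gap : \sum_(j < m.+1 | (k <= j)%N) (1 : R) = N.
Proof. by rewrite -(big_geq_mkord k m.+1 xpredT (fun=> 1)) sumr_const_nat. Qed.

Lemma obs_gap_sum : obs m gap_sum.
Proof. by apply: obs_sum => j; exact: obs_gap. Qed.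

Lemma Ex_gap_sum b : 0 < b -> Ex m b gap_sum = N * Ex m b (fun s => f (pt s k)).
Proof.
move=> b0; rewrite /gap_sum Ex_sum//; last by move=> j; exact: obs_gap.
rewrite -card_gap mulr_suml; apply: eq_bigr => j kj; rewrite mul1r.
have h : (j - k + k <= m)%N by rewrite subnK// -ltnS.
by have := Ex_gap b0 tf h; rewrite subnK.
Qed.

(* Prekopa-Leindler at the midpoint: moving two configurations to their midpoint
   gains a factor [exp (- b r^2)] per pair of neighbours at relative distance [r],
   which beats the linear change of [gap_sum]. *)
Lemma gap_sum_mgf2 b c : 0 < b ->
  Ex m b (fun s => expR (c * gap_sum s)) * Ex m b (fun s => expR (- c * gap_sum s)) <=
  expR (N * ((c * A) ^+ 2 / (4 * b))).
Proof.
move=> b0; pose C := expR (N * ((c * A) ^+ 2 / (8 * b))).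
have C0 : 0 <= C by exact: expR_ge0.
have oF := obs_gap_sum.
have [M1 M10 b1] := obs_bsupp b0 (obs_expR c oF).
have [M2 M20 b2] := obs_bsupp b0 (obs_expR (- c) oF).
have [M3 M30 b3] := obs_bsupp b0 (obs_cst m C0).
pose M := M1 + (M2 + M3); have M0 : 0 <= M by rewrite !addr_ge0.
have p0 : 0 <= period := ltW (period_gt0 m).
have h12 : 0 < (2^-1 : R) < 1 by apply/andP; split; lra.
have hh : 1 - 2^-1 = 2^-1 :> R by field.
have PL := @prekopa_leindler R 2^-1 m _ _ _ M period M0 p0 h12
   (bsupp_le (_ : M1 <= M) b1) (bsupp_le (_ : M2 <= M) b2) (bsupp_le (_ : M3 <= M) b3) _.
have {PL} : rint m (fun s => gibbs b s * expR (c * gap_sum s)) `^ 2^-1 *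
      rint m (fun s => gibbs b s * expR (- c * gap_sum s)) `^ 2^-1 <= rint m (fun s => gibbs b s * C).
  rewrite -{1}hh; apply: PL; rewrite /M; [lra|lra|lra|].
  move=> s u sm um; rewrite hh.
  have [ws|ws] := eqVneq (weight s) 0.
    by rewrite {1}/gibbs ws powR0 ?gt_eqF// !mul0r powR0 ?invr_eq0// mul0r mulr_ge0 ?gibbs_ge0.
  have [wu|wu] := eqVneq (weight u) 0.
    by rewrite [X in _ * X](_ : _ = 0) ?mulr0 ?mulr_ge0 ?gibbs_ge0// /gibbs wu powR0 ?gt_eqF// !mul0r powR0 ?invr_eq0.
  set D := \sum_(j < m.+1 | (k <= j)%N) dev k s u j ^+ 2.
  have hw := weight_midpoint k0 sm um ws wu; rewrite -/D in hw.
  have key : c * gap_sum s - c * gap_sum u - b * D <= N * ((c * A) ^+ 2 / (4 * b)).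
    rewrite /gap_sum /D -card_gap mulr_suml !mulr_sumr -!sumrB; apply: ler_sum => j kj.
    rewrite mul1r.
    have jm : (j <= m)%N by rewrite -ltnS.
    have hj : (j - k < j <= m)%N by rewrite ltn_subrL k0 (leq_trans k0 kj) jm.
    have /andP[x0 _] := vdm_neq0 (weight_neq0 sm ws) hj.
    have /andP[y0 _] := vdm_neq0 (weight_neq0 um wu) hj.
    have := fA x0 y0; rewrite /dev.
    move: (pt s j - _) (pt u j - _) x0 y0 => x y x0 y0 hf.
    have xy : 0 < x + y by rewrite addr_gt0.
    set r := (x - y) / (x + y); have rE : `|x - y| / (x + y) = `|r| by rewrite /r normrM normfV (gtr0_norm xy).
    rewrite rE in hf; apply: (@le_trans _ _ (`|c| * A * `|r| - b * r ^+ 2)).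
      rewrite lerB// -mulrBr (le_trans (ler_norm _))// normrM -mulrA ler_wpM2l//.
    (* Completing the square in [|r|]: this is where the Gaussian gain beats the linear change. *)
    clearbody r; rewrite -(real_normK (num_real r)) -(real_normK (num_real (c * A))) normrM (ger0_norm A0).
    rewrite -subr_ge0 (_ : _ - _ = b * (`|r| - `|c| * A / (2 * b)) ^+ 2).
      by rewrite mulr_ge0 ?sqr_ge0// ltW.
    by field; rewrite gt_eqF.
  rewrite -powRM ?mulr_ge0 ?gibbs_ge0 ?expR_ge0// mulrACA -expRD.
  rewrite powR12_sqrt ?mulr_ge0 ?gibbs_ge0 ?expR_ge0//.
  rewrite -[leRHS]ger0_norm ?mulr_ge0 ?gibbs_ge0// -sqrtr_sqr ler_sqrt ?sqr_ge0//.
  have w2 : gibbs b s * gibbs b u <= gibbs b (scomb 2^-1 s u) ^+ 2 * expR (- (b * D)).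
    have sqE (x : R) : 0 <= x -> (x `^ b) ^+ 2 = (x ^+ 2) `^ b by move=> x0; rewrite !expr2 powRM.
    have W v : 0 <= weight v by exact: weight_ge0.
    rewrite /gibbs -(powRM _ (W s) (W u)) (sqE _ (W _)).
    rewrite (_ : expR (- (b * D)) = expR (- D) `^ b); last by rewrite -expRM mulNr mulrC.
    have W2 v : 0 <= weight v ^+ 2 by exact: sqr_ge0.
    rewrite -(powRM _ (W2 _) (expR_ge0 _)); apply: ge0_ler_powR hw; rewrite ?nnegrE ?(ltW b0)//.
      by apply: mulr_ge0; exact: W.
    by apply: mulr_ge0; [exact: W2|exact: expR_ge0].
  apply: (le_trans (ler_wpM2r (expR_ge0 _) w2)).
  rewrite -mulrA -expRD exprMn ler_wpM2l ?sqr_ge0//.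
  rewrite /C -expRM_natl ler_expR mulNr; move: key.
  rewrite (_ : (c * A) ^+ 2 / (4 * b) = 2 * ((c * A) ^+ 2 / (8 * b))); last by field; rewrite gt_eqF.
  set z := _ / _; lra.
set I1 := rint m _; set I2 := rint m _; set I3 := rint m _ => H.
have Z0 := Zgas_gt0 m b0.
have I10 : 0 <= I1 by apply: rint_ge0 => s; rewrite mulr_ge0 ?gibbs_ge0 ?expR_ge0.
have I20 : 0 <= I2 by apply: rint_ge0 => s; rewrite mulr_ge0 ?gibbs_ge0 ?expR_ge0.
have I3E : I3 = C * Zgas m b.
  by have := Ex_cst m b0 C0; rewrite /Ex -/I3 => /(congr1 (fun z => z * Zgas m b)); rewrite divfK// gt_eqF.
have : (I1 `^ 2^-1 * I2 `^ 2^-1) ^+ 2 <= (C * Zgas m b) ^+ 2.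
  by rewrite -I3E ler_sqr ?nnegrE ?mulr_ge0 ?powR_ge0//; apply: le_trans H; rewrite mulr_ge0 ?powR_ge0.
rewrite !powR12_sqrt// exprMn !sqr_sqrtr// => H2.
rewrite /Ex -/I1 -/I2 mulrACA -invfM ler_pdivrMr ?mulr_gt0//.
apply: (le_trans H2); rewrite exprMn -expr2 ler_wpM2r ?sqr_ge0//.
rewrite /C -expRM_natl ler_expR le_eqVlt; apply/orP; left; apply/eqP.
by field; rewrite gt_eqF.
Qed.

(** Divide by the second factor in [gap_sum_mgf2], which Jensen bounds from below. *)
Lemma gap_sum_mgf b c : 0 < b ->
  Ex m b (fun s => expR (c * gap_sum s)) <=
  expR (c * (N * Ex m b (fun s => f (pt s k))) + N * ((c * A) ^+ 2 / (4 * b))).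
Proof.
move=> b0; have H := gap_sum_mgf2 c b0; have J := Ex_jensen (- c) b0 obs_gap_sum.
rewrite Ex_gap_sum// in J.
rewrite expRD -ler_pdivrMl ?expR_gt0// -expRN mulrC; apply: le_trans H.
by rewrite ler_wpM2l -?mulNr// Ex_ge0// => s; exact: expR_ge0.
Qed.

Lemma Zgas_le a b : 0 < a <= b -> Zgas m a <= (b / a) ^+ m * Zgas m b :> R.
Proof.
move=> /andP[a0]; rewrite le_eqVlt => /orP[/eqP <-|ab].
  by rewrite divff ?expr1n ?mul1r// gt_eqF.
have b0 := lt_trans a0 ab.
have := @Zgas_ratio R m a b; rewrite a0 ab => /(_ isT).
by rewrite -invf_div exprVn ler_pdivrMl// exprn_gt0// divr_gt0.
Qed.

(** Jensen at [b], then passage from [b] to [a] through [gibbs_le] and [Zgas_le] at the price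
    [(b / a) ^ m], then the moment bound at [a]. Logarithms are divided by the number of terms. *)
Lemma Ex_param_lip1 a b c : 0 < a <= b ->
  c * (Ex m b (fun s => f (pt s k)) - Ex m a (fun s => f (pt s k))) <=
  m%:R / N * ln (b / a) + (c * A) ^+ 2 / (4 * a).
Proof.
move=> /andP[a0 ab]; have b0 := lt_le_trans a0 ab.
have N0 : 0 < N by rewrite ltr0n subn_gt0 ltnS.
have ba0 : 0 < b / a by rewrite divr_gt0.
have J := Ex_jensen c b0 obs_gap_sum; rewrite Ex_gap_sum// in J.
have oe := obs_expR c obs_gap_sum.
have H : Ex m b (fun s => expR (c * gap_sum s)) <= (b / a) ^+ m * Ex m a (fun s => expR (c * gap_sum s)).
  rewrite /Ex ler_pdivrMr ?Zgas_gt0//.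
  have [M1 M10 b1] := obs_bsupp b0 oe; have [M2 M20 b2] := obs_bsupp a0 oe.
  have p0 : 0 <= period := ltW (period_gt0 m).
  have h : rint m (fun s => gibbs b s * expR (c * gap_sum s)) <= rint m (fun s => gibbs a s * expR (c * gap_sum s)).
    apply: (rint_le M10 p0 M20 p0 b1 b2) => s _.
    by rewrite ler_wpM2r ?expR_ge0// gibbs_le// a0 ab.
  apply: (le_trans h).
  have : 0 <= rint m (fun s => gibbs a s * expR (c * gap_sum s)).
    by apply: rint_ge0 => s; rewrite mulr_ge0 ?gibbs_ge0 ?expR_ge0.
  have := @Zgas_le a b; rewrite a0 ab => /(_ isT).
  have := Zgas_gt0 m a0; move: (rint _ _) (_ ^+ m) (Zgas m a) (Zgas m b) => X q Za Zb Za0 hZ X0.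
  rewrite (_ : q * (X / Za) * Zb = X * (q * Zb / Za)); last by ring.
  by rewrite ler_peMr// ler_pdivlMr// mul1r.
have := le_trans J (le_trans H (ler_wpM2l (exprn_ge0 m (ltW ba0)) (gap_sum_mgf c a0))).
rewrite -{1}(lnK ba0) -expRM_natl -expRD ler_expR => h.
move: h N0; set E1 := Ex _ _ _; set E2 := Ex _ _ _; set L := ln _; set Q := _ / (4 * a).
move: N (m%:R : R) => n m' h n0; rewrite -(ler_pM2l n0).
rewrite (_ : n * (m' / n * L + Q) = m' * L + n * Q); last by field; rewrite gt_eqF.
rewrite (_ : n * (c * (E1 - E2)) = c * (n * E1) - c * (n * E2)); last by ring.
by rewrite lerBlDl addrCA addrA [in leRHS]addrC addrA (le_trans h)// le_eqVlt; apply/orP; left; apply/eqP; ring.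
Qed.

(** Both signs of [c] are used, and [m / N <= 2] because [k] is at most half of the circle. The
    parameter [c] stays free: taking it small controls the second term, after which [b / a] close to
    1 controls the first. *)
Lemma Ex_param_lip a b c : 0 < a <= b -> 0 < c -> (k.*2 <= m.+1)%N ->
  `|Ex m b (fun s => f (pt s k)) - Ex m a (fun s => f (pt s k))| <=
  2 / c * ln (b / a) + c * A ^+ 2 / (4 * a).
Proof.
move=> ab c0 k2; have /andP[a0 ab'] := ab.
have N0 : 0 < N by rewrite ltr0n subn_gt0 ltnS.
have L0 : 0 <= ln (b / a) by rewrite ln_ge0// ler_pdivlMr// mul1r.
have mN : m%:R / N <= 2 by rewrite ler_pdivrMr// -natrM ler_nat; lia.
have mL : m%:R / N * ln (b / a) <= 2 * ln (b / a) by rewrite ler_wpM2r.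
have h1 := Ex_param_lip1 c ab; have := Ex_param_lip1 (- c) ab.
rewrite [- c * A]mulNr sqrrN; move: h1; set E := _ - _ => h1 h2.
rewrite -(ler_pM2l c0) mulrDr (_ : c * (2 / c * _) = 2 * ln (b / a)); last by field; rewrite gt_eqF.
rewrite (_ : c * (c * A ^+ 2 / (4 * a)) = (c * A) ^+ 2 / (4 * a)); last by field; rewrite gt_eqF.
rewrite -{1}(gtr0_norm c0) -normrM ler_norml; apply/andP; split.
  by move: h1 h2 mL; set Q := (c * A) ^+ 2 / _; set L := ln _; set L1 := _ * L; lra.
by move: h1 h2 mL; set Q := (c * A) ^+ 2 / _; set L := ln _; set L1 := _ * L; lra.
Qed.

End midpoint.

(** * Densities of the points of the gas *)

Section density.
Context {R : realType}.
Variable m : nat.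
Local Notation mu := (@lebesgue_measure R).
Local Notation period := (@period R m).
Local Notation gibbs := (@gibbs R m).
Implicit Types (s u : seq R) (b x : R) (k : nat).

(* Density of the law of the [k]-th point. *)
Definition dens b k x : R := rint m.-1 (fun s => gibbs b (ins k.-1 x s)) / Zgas m b.

Lemma sbox_ins B k x s : sbox B (ins k x s) = (`|x| <= B) && sbox B s.
Proof. by rewrite /ins /sbox all_cat /= andbCA -all_cat cat_take_drop. Qed.

Lemma scomb_ins t k x y s u : size s = size u ->
  scomb t (ins k x s) (ins k y u) = ins k ((1 - t) * x + t * y) (scomb t s u).
Proof.
move=> su; rewrite /scomb /ins -map_take -map_drop.
have zt (T1 T2 : Type) n (s1 : seq T1) (s2 : seq T2) : take n (zip s1 s2) = zip (take n s1) (take n s2).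
  by elim: n s1 s2 => [|n IH] [|a s1] [|c s2] //=; rewrite ?IH //; case: (take _ _).
have zd (T1 T2 : Type) n (s1 : seq T1) (s2 : seq T2) : size s1 = size s2 ->
    drop n (zip s1 s2) = zip (drop n s1) (drop n s2).
  by elim: n s1 s2 => [|n IH] [|a s1] [|c s2] //= [e]; rewrite ?IH.
by rewrite zt zd// zip_cat ?map_cat//= !size_take su.
Qed.

Lemma bsupp_ins b k x : 0 < b -> (0 < k <= m)%N ->
  bsupp 1 period m.-1 (fun s => gibbs b (ins k.-1 x s)).
Proof.
move=> b0 /andP[k0 km]; have mE : m.-1.+1 = m by rewrite prednK// (leq_trans k0).
split; first by move=> s; exact: gibbs_ge0.
- apply: (@smeas_ins R m.-1 k.-1 x (EFin \o gibbs b)); first by lia.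
  by rewrite mE; case: (gibbs_bsupp m b0).
- move=> s sm; rewrite mul1r.
  have := @gibbs_sbox R m b (ins k.-1 x s) b0; rewrite size_ins sm mE => /(_ erefl).
  by move=> /le_trans; apply; rewrite ler_nat sbox_ins; case: (_ <= _); case: (sbox _ _).
Qed.

Lemma dens_ge0 b k x : 0 <= dens b k x.
Proof. by rewrite /dens mulr_ge0 ?invr_ge0 ?rint_ge0// => s; exact: gibbs_ge0. Qed.

Section fixed.
Variables (b : R) (k : nat).
Hypothesis b0 : 0 < b.
Hypothesis km : (0 < k <= m)%N.
Let p0 : 0 <= period := ltW (period_gt0 m).
Let mE : m.-1.+1 = m. Proof. by case/andP: km => k0 km'; rewrite prednK// (leq_trans k0). Qed.

Lemma measurable_dens : measurable_fun setT (dens b k).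
Proof.
apply: measurable_funM => //.
apply: (@eqfun_measurable _ _ _ _ (fun x => fine (iint m.-1 (fun s => (gibbs b (ins k.-1 x s))%:E)))).
  by [].
apply: measurableT_comp => //.
apply: (@measurable_iint _ _ R m.-1 (fun x s => (gibbs b (ins k.-1 x s))%:E)).
  by move=> x s; rewrite lee_fin gibbs_ge0.
apply: (@measurable_ins_param R m.-1 k.-1 (EFin \o gibbs b)); first by case/andP: km; lia.
by rewrite mE; case: (gibbs_bsupp m b0).
Qed.

Lemma Ex_dens (phi : R -> R) : test1 phi ->
  ((Ex m b (fun s => phi (pt s k)))%:E = \int[mu]_x (phi x * dens b k x)%:E)%E.
Proof.
move=> tphi; have Z0 := Zgas_gt0 m b0.
have of_ := obs_pt m k tphi.
have [M M0 bf] := obs_bsupp b0 of_.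
rewrite /Ex EFinM (rintE M0 p0 bf).
have iiE (f : seq R -> \bar R) : iint m f = iint m.-1.+1 f by rewrite mE.
have k1 : (k.-1 <= m.-1)%N by case/andP: km; lia.
case: bf => f0 mf _; rewrite iiE (iint_ins k1); last 2 first.
- by move=> s; rewrite lee_fin.
- by rewrite mE.
case: (tphi) => mphi phi0 _.
rewrite muleC -ge0_integralZl//; last 3 first.
- apply: (@measurable_iint _ _ R m.-1 (fun x s => (EFin \o (fun s => gibbs b s * phi (pt s k))) (ins k.-1 x s))).
    by move=> x s; rewrite lee_fin.
  by apply: measurable_ins_param => //; rewrite mE.
- by move=> x _; apply: iint_ge0 => s; rewrite lee_fin.
- by rewrite lee_fin invr_ge0 ltW.
apply: eq_integral => x _.
transitivity ((Zgas m b)^-1%:E * ((phi x)%:E * iint m.-1 (EFin \o (fun s => gibbs b (ins k.-1 x s)))))%E.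
  congr (_ * _)%E; case: (bsupp_ins x b0 km) => g0 mg _; rewrite -iintZ//.
  apply: eq_iint => s sm /=; rewrite -EFinM mulrC; congr (phi _ * _)%:E.
  case: k km k1 => // j jm j1 /=.
  by rewrite /pt /= nth_ins ?sm// ltnn eqxx.
rewrite -(rintE ler01 p0 (bsupp_ins x b0 km)) -!EFinM; congr EFin.
by rewrite /dens; ring.
Qed.

Lemma integral_dens_le1 : (\int[mu]_x (dens b k x)%:E <= 1)%E.
Proof.
have := @Ex_dens (fun=> 1); rewrite (Ex_cst m b0 ler01) => H.
rewrite H; last by split => //; exists 1.
by rewrite le_eqVlt; apply/orP; left; apply/eqP; apply: eq_integral => x _; rewrite mul1r.
Qed.

Lemma integral_dens_set (A : pred R) : measurable [set x | A x] ->
  (\int[mu]_(x in [set x | A x]) (dens b k x)%:E = (Ex m b (fun s => (A (pt s k))%:R))%:E)%E.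
Proof.
move=> mA; rewrite integral_mkcond (Ex_dens (test1_indb mA)); apply: eq_integral => x _.
rewrite patchE; case: ifPn => [/set_mem /= ->|]; first by rewrite mul1r.
by rewrite notin_setE /= => /negP/negbTE ->; rewrite mul0r.
Qed.

(** Prekopa-Leindler for the slices at [x], at [y] and at their convex combination; inserting a
    coordinate commutes with convex combinations. *)
Lemma log_concave_dens : log_concave (dens b k).
Proof.
move=> t x y t01; have Z0 := Zgas_gt0 m b0; have /andP[t0 t1] := t01.
have i0 z : 0 <= rint m.-1 (fun s => gibbs b (ins k.-1 z s)) by apply: rint_ge0 => s; exact: gibbs_ge0.
have Zi0 : 0 <= (Zgas m b)^-1 by rewrite invr_ge0 ltW.
rewrite /dens !powRM// mulrACA -powRD; last by rewrite subrK oner_eq0.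
rewrite subrK powRr1// ler_wpM2r//.
apply: (prekopa_leindler ler01 p0 t01 (bsupp_ins _ b0 km) (bsupp_ins _ b0 km) (bsupp_ins _ b0 km)).
move=> s u sm um; rewrite -scomb_ins ?sm//.
rewrite /gibbs -!powRrM ![b * _]mulrC !powRrM -powRM ?powR_ge0//.
have := @weight_lc R m t (ins k.-1 x s) (ins k.-1 y u); rewrite !size_ins sm um mE => /(_ erefl erefl t01) h.
by apply: ge0_ler_powR h; rewrite ?nnegrE ?weight_ge0 ?mulr_ge0 ?powR_ge0 ?(ltW b0).
Qed.

Lemma setge_itv x : [set y : R | x <= y] = `[x, +oo[%classic.
Proof. by apply/seteqP; split => y /=; rewrite in_itv/= andbT. Qed.

Lemma setle_itv x : [set y : R | y <= x] = `]-oo, x]%classic.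
Proof. by apply/seteqP; split => y /=; rewrite in_itv. Qed.

Lemma dens_ge_mass x : (\int[mu]_(y in `[x, +oo[) (dens b k y)%:E =
   (Ex m b (fun s => (x <= pt s k)%R%:R))%:E)%E.
Proof.
by rewrite -setge_itv (integral_dens_set (A := fun y => x <= y))//; exact: measurable_ge_itv.
Qed.

Lemma dens_le_mass x : (\int[mu]_(y in `]-oo, x]) (dens b k y)%:E = (cdf m b k x)%:E)%E.
Proof.
by rewrite -setle_itv (integral_dens_set (A := fun y => y <= x))//; exact: measurable_le_itv.
Qed.

Lemma cdf_compl x : 1 <= cdf m b k x + Ex m b (fun s => (x <= pt s k)%R%:R).
Proof.
rewrite /cdf -ExD//; [|exact: (obs_pt m k (test1_le x))|exact: (obs_pt m k (test1_ge x))].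
rewrite -[leLHS](Ex_cst m b0 ler01); apply: Ex_le => //; first exact: obs_cst.
  by apply: obsD; [exact: (obs_pt m k (test1_le x))|exact: (obs_pt m k (test1_ge x))].
by move=> s _ _; case: (leP (pt s k) x) => [|/ltW ->]; rewrite ?lerDl ?lerDr.
Qed.

(** More than half of the mass lies beyond [x + 1], so [log_concave_point_mass] with [th = 1/2] and
    [l = 1] bounds the density by twice the mass of [[x, x + 1]]. *)
Lemma dens_tail x : cdf m b k (x + 1) < 1 / 2 -> dens b k x <= 2 * cdf m b k (x + 1).
Proof.
move=> h; have c2 := cdf_compl (x + 1).
have h2 : 0 <= (1 / 2 : R) <= 1 by apply/andP; split; lra.
have J : (\int[mu]_(y in `[x, +oo[) (dens b k y)%:E <= 1)%E.
  apply: le_trans integral_dens_le1; apply: ge0_subset_integral => //.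
    by apply/measurable_EFinP; exact: measurable_dens.
  by move=> y _; rewrite lee_fin dens_ge0.
have J2 : ((1 / 2)%:E < \int[mu]_(y in `[(x + 1)%R, +oo[) (dens b k y)%:E)%E.
  by rewrite dens_ge_mass lte_fin; lra.
have := log_concave_point_mass (dens_ge0 b k) measurable_dens log_concave_dens h2 ler01 J J2.
rewrite mulr1 => h3; have : ((1 / 2 * dens b k x)%:E <= (cdf m b k (x + 1))%:E)%E.
  apply: (le_trans h3); rewrite -dens_le_mass; apply: ge0_subset_integral => //.
  - by apply/measurable_EFinP; exact: measurable_funTS measurable_dens.
  - by move=> y _; rewrite lee_fin dens_ge0.
  - by move=> y /=; rewrite !in_itv/= => /andP[].
by rewrite lee_fin; lra.
Qed.

End fixed.

End density.

(** * Triangular test functions *)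

Section hat.
Context {R : realType}.
Local Notation mu := (@lebesgue_measure R).
Implicit Types (w l x y : R).

Definition hat w l x : R := Num.max 0 (w - `|x - l|).

Lemma hat_ge0 w l x : 0 <= hat w l x.
Proof. by rewrite /hat le_max lexx. Qed.

Lemma hat_le w l x : 0 <= w -> hat w l x <= w.
Proof. by move=> w0; rewrite /hat ge_max w0/= lerBlDr lerDl. Qed.

Lemma hat_eq0 w l x : w <= `|x - l| -> hat w l x = 0.
Proof. by move=> h; rewrite /hat; apply/max_idPl; lra. Qed.

Lemma hat_lip w l x y : `|hat w l x - hat w l y| <= `|x - y|.
Proof.
have key a c : hat w l a - hat w l c <= `|a - c|.
  rewrite /hat lerBlDr ge_max; apply/andP; split; first by rewrite addr_ge0// le_max lexx.
  rewrite -lerBlDl le_max; apply/orP; right.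
  have := ler_distD a c l; rewrite (distrC c a); lra.
by rewrite ler_norml key andbT lerNl opprB distrC key.
Qed.

Lemma hat_continuous w l : continuous (hat w l).
Proof.
move=> x; apply/cvgrPdist_lt => e e0; near=> y.
apply: (le_lt_trans (hat_lip w l x y)); near: y; exact: (@nbhsx_ballx _ R^o x e e0).
Unshelve. all: by end_near. Qed.

Lemma measurable_hat w l : measurable_fun setT (hat w l).
Proof. by apply: continuous_measurable_fun; exact: hat_continuous. Qed.

Lemma test1_hat w l : 0 <= w -> test1 (hat w l).
Proof.
move=> w0; split; [exact: measurable_hat|exact: hat_ge0|].
by exists w => x; exact: hat_le.
Qed.

(** The scale-invariant Lipschitz bound that [Ex_param_lip] asks for. Let [x] be in the support. If
    [y <= l + 2w] then [x + y <= 2l + 3w]; for larger [y] the left side is at most [w], and the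
    worst case is [x = l + w], [y = l + 2w]. *)
Lemma hat_rel_lip w l x y : 0 < w -> w < l -> 0 < x -> 0 < y ->
  `|hat w l x - hat w l y| <= (2 * l + 3 * w) * (`|x - y| / (x + y)).
Proof.
move=> w0 wl x0 y0.
wlog xl : x y x0 y0 / `|x - l| < w.
  move=> H; case: (ltP `|x - l| w) => [|h1]; first exact: H.
  case: (ltP `|y - l| w) => [|h2].
    by move=> h2; rewrite distrC [`|x - y|]distrC [x + y]addrC; exact: H.
  rewrite !hat_eq0// subrr normr0 mulr_ge0// ?divr_ge0// ?addr_ge0 ?(ltW x0) ?(ltW y0)//.
    by rewrite mulr_ge0// ltW// (lt_trans w0).
  by rewrite mulr_ge0// ltW.
have xy : 0 < x + y by rewrite addr_gt0.
rewrite mulrA ler_pdivlMr//.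
move: xl; rewrite ltr_norml => /andP[xl1 xl2].
case: (leP y (l + 2 * w)) => yl.
  apply: (@le_trans _ _ (`|x - y| * (x + y))); first by rewrite ler_wpM2r ?hat_lip// ltW.
  by rewrite mulrC ler_wpM2r//; lra.
have hy : hat w l y = 0 by apply: hat_eq0; rewrite ger0_norm; lra.
rewrite hy subr0 ger0_norm ?hat_ge0// ltr0_norm ?subr_lt0; last by lra.
apply: (@le_trans _ _ (w * (x + y))); first by rewrite ler_wpM2r ?hat_le ?(ltW w0) ?(ltW xy).
rewrite -subr_ge0 (_ : _ - _ = 2 * (l + w) * (y - (l + 2 * w)) - 2 * (l + 2 * w) * (x - (l + w))); last by ring.
rewrite subr_ge0 (@le_trans _ _ 0)//; last by apply: mulr_ge0; [apply: mulr_ge0|]; lra.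
by rewrite pmulr_rle0; lra.
Qed.

Definition hat_mass w : R := fine (\int[mu]_x (hat w 0 x)%:E).

Lemma hat_shift w l x : hat w l (x + l) = hat w 0 x.
Proof. by rewrite /hat addrK subr0. Qed.

Lemma integral_hat w l : 0 < w -> (\int[mu]_x (hat w l x)%:E = (hat_mass w)%:E)%E.
Proof.
move=> w0; have mh v : measurable_fun setT (fun x => (hat w v x)%:E).
  by apply/measurable_EFinP; exact: measurable_hat.
rewrite /hat_mass -(ge0_integral_shift l)//; last by move=> x; rewrite lee_fin hat_ge0.
transitivity (\int[mu]_x (hat w 0 x)%:E)%E; first by apply: eq_integral => x _; rewrite hat_shift.
rewrite fineK// ge0_fin_numE; last by apply: integral_ge0 => x _; rewrite lee_fin hat_ge0.
apply: (@le_lt_trans _ _ (\int[mu]_x (w * (`|x| <= w)%R%:R)%:E)%E).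
  apply: ge0_le_integral => //.
  - by move=> x _; rewrite lee_fin hat_ge0.
  - exact: mh.
  - apply/measurable_EFinP; apply: measurable_funM => //.
    exact: measurable_indb (measurable_ball0 w).
  - move=> x _; rewrite lee_fin; case: (leP `|x| w) => xw; first by rewrite mulr1 hat_le// ltW.
    by rewrite mulr0 hat_eq0// subr0 ltW.
by rewrite integral_ball_cst ?(ltW w0)// ltry.
Qed.

Lemma hat_mass_gt0 w : 0 < w -> 0 < hat_mass w.
Proof.
move=> w0; have w2 : 0 <= w / 2 by lra.
have : ((w / 2 * (2 * (w / 2)))%:E <= (hat_mass w)%:E)%E.
  rewrite -(integral_hat 0 w0) -(integral_ball_cst w2 w2); apply: ge0_le_integral => //.
  - by move=> x _; rewrite lee_fin mulr_ge0.
  - apply/measurable_EFinP; apply: measurable_funM => //.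
    exact: measurable_indb (measurable_ball0 _).
  - by apply/measurable_EFinP; exact: measurable_hat.
  - move=> x _; rewrite lee_fin; case: (leP `|x| (w / 2)) => xw; last by rewrite mulr0 hat_ge0.
    by rewrite mulr1 /hat subr0 le_max; apply/orP; right; lra.
rewrite lee_fin; apply: lt_le_trans; rewrite !mulr_gt0//; lra.
Qed.

Lemma hat_average (p : R -> R) w l (v : R) : 0 < w -> (forall x, 0 <= p x) -> measurable_fun setT p ->
  (forall x, `|x - l| <= w -> `|p x - p l| <= v) ->
  `|fine (\int[mu]_x (hat w l x * p x)%:E) - hat_mass w * p l| <= hat_mass w * v.
Proof.
move=> w0 p0 mp pv.
have v0 : 0 <= v by have := pv l; rewrite !subrr normr0 => /(_ (ltW w0)).
have mh : measurable_fun setT (hat w l) by exact: measurable_hat.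
have mhp : measurable_fun setT (fun x => (hat w l x * p x)%:E).
  by apply/measurable_EFinP; exact: measurable_funM.
have cst c : 0 <= c -> (\int[mu]_x (hat w l x * c)%:E = (hat_mass w * c)%:E)%E.
  move=> c0; under eq_integral => x _ do rewrite EFinM.
  rewrite ge0_integralZr//; first by rewrite integral_hat.
    exact/measurable_EFinP.
  by move=> x _; rewrite lee_fin hat_ge0.
have M0 := hat_mass_gt0 w0.
have up : (\int[mu]_x (hat w l x * p x)%:E <= (hat_mass w * (p l + v))%:E)%E.
  rewrite -cst ?addr_ge0//; apply: ge0_le_integral => //.
  - by move=> x _; rewrite lee_fin mulr_ge0 ?hat_ge0.
  - by apply/measurable_EFinP; exact: measurable_funM.
  move=> x _; rewrite lee_fin; case: (leP `|x - l| w) => [xw|/ltW xw]; last by rewrite hat_eq0// !mul0r.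
  by rewrite ler_wpM2l ?hat_ge0//; have := pv _ xw; rewrite ler_norml => /andP[_]; lra.
have lo : ((hat_mass w * p l)%:E <= \int[mu]_x (hat w l x * p x)%:E + (hat_mass w * v)%:E)%E.
  rewrite -!cst// -ge0_integralD//; last 3 first.
  - by move=> x _; rewrite lee_fin mulr_ge0 ?hat_ge0.
  - by move=> x _; rewrite lee_fin mulr_ge0 ?hat_ge0.
  - by apply/measurable_EFinP; exact: measurable_funM.
  apply: ge0_le_integral => //.
  - by move=> x _; rewrite lee_fin mulr_ge0 ?hat_ge0.
  - by apply/measurable_EFinP; exact: measurable_funM.
  - by apply: emeasurable_funD => //; apply/measurable_EFinP; exact: measurable_funM.
  move=> x _; rewrite -EFinD lee_fin -mulrDr.
  case: (leP `|x - l| w) => [xw|/ltW xw]; last by rewrite hat_eq0// !mul0r.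
  by rewrite ler_wpM2l ?hat_ge0//; have := pv _ xw; rewrite ler_norml => /andP[]; lra.
have I0 : (0 <= \int[mu]_x (hat w l x * p x)%:E)%E.
  by apply: integral_ge0 => x _; rewrite lee_fin mulr_ge0 ?hat_ge0.
have fI : (\int[mu]_x (hat w l x * p x)%:E)%E \is a fin_num.
  by rewrite ge0_fin_numE//; exact: le_lt_trans up (ltry _).
move: up lo; rewrite -(fineK fI) -EFinD !lee_fin /= mulrDr => up lo.
by rewrite ler_norml; apply/andP; split; lra.
Qed.

End hat.

(* [lia] is slow when the context contains many hypotheses on reals. *)
Ltac nlia :=
  repeat match goal with
  | H : is_true (leq _ _) |- _ => revert H
  | H : is_true (andb (leq _ _) (leq _ _)) |- _ => revert H
  | H : @eq nat _ _ |- _ => revert H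
  end; clear; intros; lia.

(** * Bounds uniform in the number of points, and equicontinuity *)

Section equicontinuity.
Context {R : realType}.
Local Notation mu := (@lebesgue_measure R).
Implicit Types (b x y : R) (m k K : nat).

Lemma nat_above (x : R) : exists n : nat, x < n%:R.
Proof. by exists (Num.bound `|x|); apply: le_lt_trans (ler_norm x) (archi_boundP _). Qed.

Lemma tail_choice (b1 Lam eps : R) : 0 < b1 -> 0 < Lam -> 0 < eps ->
  exists K, [/\ (0 < K)%N, expR 1 * Lam < 4 * K%:R &
    forall b, b1 <= b -> 12 / (b * - ln (expR 1 * Lam / (4 * K%:R))) <= eps].
Proof.
(* Large enough for [- ln (e Lam / (4 K))] to exceed [12 / (b1 eps)]. *)
move=> b10 L0 e0; have [K hK] := nat_above (expR (1 + 12 / (b1 * eps)) * Lam).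
have E0 : 0 < expR (1 + 12 / (b1 * eps)) by exact: expR_gt0.
have K0 : (0 : R) < K%:R by apply: lt_trans hK; rewrite mulr_gt0.
have q1 : 0 < 12 / (b1 * eps) by rewrite divr_gt0 ?mulr_gt0.
have e1 : expR 1 * Lam <= expR (1 + 12 / (b1 * eps)) * Lam.
  by rewrite ler_wpM2r ?(ltW L0)// ler_expR lerDl ltW.
exists K; split; [by rewrite -(ltr0n R)|by lra|].
move=> b b1b; have b0 := lt_le_trans b10 b1b.
have k0 : 0 < 4 * K%:R :> R by rewrite mulr_gt0.
have lnb : 12 / (b1 * eps) <= - ln (expR 1 * Lam / (4 * K%:R)).
  rewrite -lnV ?posrE ?divr_gt0 ?mulr_gt0 ?expR_gt0// invf_div -ler_expR lnK ?posrE ?divr_gt0 ?mulr_gt0 ?expR_gt0//.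
  rewrite ler_pdivlMr ?mulr_gt0 ?expR_gt0// mulrA -expRD addrC.
  by apply: (le_trans (ltW hK)); lra.
have c0 : 0 < - ln (expR 1 * Lam / (4 * K%:R)) by exact: lt_le_trans lnb.
rewrite ler_pdivrMr ?mulr_gt0//.
have : 12 <= b1 * eps * - ln (expR 1 * Lam / (4 * K%:R)) by rewrite mulrC -ler_pdivrMr ?mulr_gt0.
move=> /le_trans; apply; rewrite mulrAC [leRHS]mulrC ler_wpM2r ?(ltW e0)//.
by rewrite ler_wpM2r// ltW.
Qed.

Lemma cdf_le m b k x y : 0 < b -> x <= y -> cdf m b k x <= cdf m b k y.
Proof.
move=> b0 xy; apply: Ex_le => //; [exact: (obs_pt m k (test1_le x))|exact: (obs_pt m k (test1_le y))|].
by move=> s _ _; rewrite ler_nat; case: (leP _ x) => // h; rewrite (le_trans h xy).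
Qed.

Lemma cdf_tail_small (b1 Lam eps : R) : 0 < b1 -> 0 < Lam -> 0 < eps ->
  exists K N, (0 < K)%N /\ forall m, (N <= m)%N -> forall b, b1 <= b ->
    \sum_(k < m.+1 | (K < k)%N) cdf m b k Lam <= eps.
Proof.
move=> b10 L0 e0; have [K [K0 LK H]] := tail_choice b10 L0 e0.
exists K, (4 * K)%N; split => // m Nm b b1b.
by apply: le_trans (H _ b1b); apply: cdf_tail_sum => //; [exact: lt_le_trans b1b|nlia].
Qed.

Lemma cdf_tail_term m b K k x (eps : R) :
  \sum_(j < m.+1 | (K < j)%N) cdf m b j x <= eps -> (K < k <= m)%N -> cdf m b k x <= eps.
Proof.
move=> H /andP[Kk km]; apply: le_trans H; have km' : (k < m.+1)%N by [].
by rewrite (bigD1 (Ordinal km'))//= lerDl sumr_ge0// => j _; exact: cdf_ge0.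
Qed.

Lemma block_cst_anti B b c : b <= c -> block_cst B c <= block_cst B b :> R.
Proof.
move=> bc; rewrite /block_cst ler_wpM2l ?exprn_ge0// ger_powR// squeeze_cst_gt0/=.
by apply: prodr_ile1 => j _; rewrite prodr_ge0//=; apply: prodr_ile1 => i _; apply/andP; split; lra.
Qed.

(** The tail bound provides a [K] with [P(X_(K+1) >= 4 X) >= 1/2], and [hole_bound] transfers this
    to [X_1], hence to every later point. The constant is taken at [b2] because [block_cst]
    decreases in the temperature parameter. *)
Lemma hole_lower (b1 b2 X : R) : 0 < b1 -> 0 < X ->
  exists th N, 0 < th /\ forall m, (N <= m)%N -> forall b, b1 <= b <= b2 ->
    forall k, (0 < k <= m)%N -> th <= Ex m b (fun s => (X <= pt s k)%R%:R).
Proof.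
move=> b10 X0; have X4 : 0 < 4 * X by lra.
have e2 : (0 : R) < 2^-1 by [].
have [K [N [K0 H]]] := cdf_tail_small b10 X4 e2.
exists (block_cst K b2 / 4), (maxn N K.+1); split.
  by rewrite divr_gt0 ?block_cst_gt0.
move=> m; rewrite geq_max => /andP[Nm Km] b /andP[b1b bb2] k /andP[k0 km].
have b0 := lt_le_trans b10 b1b.
have c1 := cdf_tail_term (H m Nm b b1b) (_ : (K < K.+1 <= m)%N).
have {c1} c1 : cdf m b K.+1 (4 * X) <= 2^-1 by apply: c1; rewrite ltnSn.
have c2 := cdf_compl m K.+1 b0 (4 * X).
have h := hole_bound X b0 K0 Km.
have h2 : block_cst K b2 * 2^-1 <= block_cst K b * Ex m b (fun s => (4 * X <= pt s K.+1)%R%:R).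
  apply: ler_pM => //; [exact: ltW (block_cst_gt0 _ _)|exact: block_cst_anti|lra].
apply: (@le_trans _ _ (Ex m b (fun s => (X <= pt s 1)%R%:R))); first by lra.
apply: Ex_le => //; [exact: (obs_pt m 1 (test1_ge X))|exact: (obs_pt m k (test1_ge X))|].
move=> s sm w0; rewrite ler_nat; case: (leP X (pt s 1)) => // h1.
by rewrite (le_trans h1)//; apply: (weight_pt w0 sm); rewrite k0 km.
Qed.

(** Each squeeze exchanges one more point for a window larger by [4/3]. Geometric growth of the
    window must outrun linear growth of the index for [Ex_far] to apply. *)
Lemma pow43_big (c d : R) : 0 < c -> exists j : nat, d + j%:R <= c * (4 / 3) ^+ j.
Proof.
move=> c0; have [i hi] := nat_above (9 * (`|d| + 2) / c + 1).
(* An even exponent: the square of Bernoulli's inequality grows quadratically in [i]. *)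
exists (2 * i)%N; have i1 : 1 <= i%:R :> R.
  apply: ltW; apply: le_lt_trans hi; rewrite lerDr divr_ge0 ?mulr_ge0 ?addr_ge0// ltW//.
have bern : 1 + i%:R / 3 <= (4 / 3 : R) ^+ i.
  elim: (i) => [|n IH]; first by rewrite mul0r addr0 expr0.
  rewrite exprS -natr1; have n0 : 0 <= n%:R :> R by []; move: IH n0; move: (_ ^+ n) (n%:R : R) => z v; lra.
rewrite mulnC exprM natrM.
have z0 : i%:R / 3 <= (4 / 3 : R) ^+ i by lra.
have z2 : (i%:R / 3) ^+ 2 <= ((4 / 3 : R) ^+ i) ^+ 2 by rewrite ler_sqr ?nnegrE ?exprn_ge0 ?divr_ge0//; lra.
apply: (@le_trans _ _ (c * (i%:R / 3) ^+ 2)); last by rewrite ler_wpM2l// ltW.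
have h1 : (`|d| + 2) <= c * i%:R / 9.
  have : 9 * (`|d| + 2) / c <= i%:R by lra.
  by rewrite ler_pdivrMr// [i%:R * c]mulrC; lra.
have h2 : (`|d| + 2) * i%:R <= c * i%:R / 9 * i%:R by rewrite ler_wpM2r//; lra.
have h3 : `|d| <= `|d| * i%:R by rewrite ler_peMr.
have := ler_norm d; rewrite (_ : c * (i%:R / 3) ^+ 2 = c * i%:R / 9 * i%:R); last by field.
rewrite mulrDl in h2; lra.
Qed.

(** [squeeze_bound] iterated: [K + j] points in a window of length [(4/3)^j y] are compressed one
    step at a time. *)
Lemma left_iter (b2 y : R) K j : (0 < K)%N -> exists2 c : R, 0 < c &
  forall m b, (K + j <= m)%N -> 0 < b <= b2 -> c * cdf m b (K + j) ((4 / 3) ^+ j * y) <= cdf m b K y.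
Proof.
move=> K0; elim: j => [|j [c c0 IH]].
  by exists 1 => // m b _ _; rewrite mul1r addn0 expr0 mul1r.
exists (c * (block_cst (K + j) b2 / 2)).
  by rewrite mulr_gt0// divr_gt0// block_cst_gt0.
move=> m b; rewrite addnS => Km /andP[b0 bb2].
apply: le_trans (IH m b (ltnW Km) _); last by rewrite b0.
rewrite -mulrA ler_wpM2l ?(ltW c0)//.
have KJ : (0 < K + j)%N by rewrite addn_gt0 K0.
have := squeeze_bound ((4 / 3) ^+ j.+1 * y) b0 KJ Km.
rewrite (_ : 3 / 4 * ((4 / 3) ^+ j.+1 * y) = (4 / 3) ^+ j * y); last by rewrite exprS; field.
move=> h; rewrite mulrAC ler_pdivrMr// [leRHS]mulrC; apply: le_trans h.
by rewrite ler_wpM2r ?cdf_ge0// block_cst_anti.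
Qed.

(** Choose [j] with [8 pi (K + j) <= (4/3)^j y]. Then [Ex_far] says that [X_(K+j)] is below
    [(4/3)^j y] with probability at least [1/2], and [left_iter] brings this down to [X_K <= y]. *)
Lemma left_lower (b1 b2 y : R) K : 0 < b1 -> 0 < y -> (0 < K)%N ->
  exists th N, 0 < th /\ forall m, (N <= m)%N -> forall b, b1 <= b <= b2 ->
    forall k, (0 < k <= K)%N -> th <= cdf m b k y.
Proof.
move=> b10 y0 K0; have pi0 : 0 < (pi : R) := pi_gt0 R.
have cy : 0 < y / (8 * pi) by rewrite divr_gt0// mulr_gt0.
have [j hj] := pow43_big K%:R cy.
have [c c0 H] := left_iter b2 y j K0.
exists (c / 2), (2 * (K + j))%N; split; first by rewrite divr_gt0.
move=> m Nm b /andP[b1b bb2] k /andP[k0 kK]; have b0 := lt_le_trans b10 b1b.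
apply: (@le_trans _ _ (cdf m b K y)); last by apply: cdf_mono => //; nlia.
apply: le_trans (H m b _ _); [|nlia|by rewrite b0].
rewrite ler_wpM2l ?(ltW c0)//.
set M := _ * y; have M0 : 0 < M by rewrite mulr_gt0 ?exprn_gt0.
have KJ : (0 < K + j)%N by rewrite addn_gt0 K0.
have far := @Ex_far R m b (K + j) M b0 M0 KJ (_ : ((K + j).*2 <= m.+1)%N).
have {}far : Ex m b (fun s => (M < pt s (K + j))%R%:R) <= 2^-1.
  apply: le_trans (far _) _; first by nlia.
  rewrite ler_pdivrMr// /M natrD.
  move: hj; rewrite (_ : y / (8 * pi) * (4 / 3) ^+ j = M / (8 * pi)); last by rewrite /M; ring.
  rewrite ler_pdivlMr ?mulr_gt0// -/M; move: (M) (pi : R) (K%:R : R) (j%:R : R) => M' p u v; lra.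
have : 1 <= cdf m b (K + j) M + Ex m b (fun s => (M < pt s (K + j))%R%:R).
  rewrite /cdf -ExD//; [|exact: (obs_pt m _ (test1_le M))|exact: (obs_pt m _ (test1_gt M))].
  rewrite -[leLHS](Ex_cst m b0 ler01); apply: Ex_le => //; first exact: obs_cst.
    by apply: obsD; [exact: (obs_pt m _ (test1_le M))|exact: (obs_pt m _ (test1_gt M))].
  by move=> s _ _; case: (leP (pt s (K + j)) M) => ?; rewrite ?lerDl ?lerDr.
by lra.
Qed.

(** [hole_lower] and [left_lower] supply the masses beyond [x2 + l] and before [x1 - l]; the margin
    [l = x1 / 2] keeps the latter point positive. *)
Lemma dens_lip (b1 b2 x1 x2 : R) K : 0 < b1 -> 0 < x1 -> x1 <= x2 -> (0 < K)%N ->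
  exists (C l : R) N, [/\ 0 <= C, 0 < l & forall m, (N <= m)%N -> forall b, b1 <= b <= b2 ->
    forall k, (0 < k <= K)%N -> forall x y, x1 <= x <= x2 -> x1 <= y <= x2 -> `|x - y| < l ->
    `|dens m b k x - dens m b k y| <= C * `|x - y|].
Proof.
move=> b10 x10 x12 K0; pose l := x1 / 2; have l0 : 0 < l by rewrite /l; lra.
have X0 : 0 < x2 + l by rewrite addr_gt0//; lra.
have y0 : 0 < x1 - l by rewrite /l; lra.
have [t1 [N1 [t10 H1]]] := hole_lower b2 b10 X0.
have [t2 [N2 [t20 H2]]] := left_lower b2 b10 y0 K0.
(* Halved because [log_concave_lipschitz] needs strict inequalities for the masses. *)
pose th := Num.min (2^-1) (Num.min t1 t2) / 2.
have th1 : 0 < Num.min (2^-1) (Num.min t1 t2) by rewrite !lt_min t10 t20 invr_gt0 ltr0n.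
have thh : th < Num.min (2^-1) (Num.min t1 t2) by rewrite /th; lra.
have th0 : 0 < th by rewrite /th; lra.
move: thh; rewrite !lt_min => /andP[thh /andP[tt1 tt2]].
have th01 : 0 < th < 1 by rewrite th0/=; lra.
clearbody th.
exists (- ln th / (th * l ^+ 2)), l, (maxn (maxn N1 N2) K); split => //.
  by apply: divr_ge0; [rewrite oppr_ge0 ln_le0//; lra|apply: mulr_ge0; [exact: ltW|exact: sqr_ge0]].
move=> m; rewrite !geq_max => /andP[/andP[N1m N2m] Km] b bb k /andP[k0 kK] x y /andP[xa xb] /andP[ya yb] xy.
have b0 : 0 < b by apply: lt_le_trans b10 _; case/andP: bb.
have km : (0 < k <= m)%N by rewrite k0 (leq_trans kK).
have kK' : (0 < k <= K)%N by rewrite k0.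
apply: (@log_concave_lipschitz R (dens m b k) (x1 - l) (x2 + l) l th) => //; rewrite ?subrK ?lerD2r//.
- exact: dens_ge0.
- exact: measurable_dens.
- exact: log_concave_dens.
- exact: integral_dens_le1.
- by rewrite dens_ge_mass// lte_fin (lt_le_trans tt1)// H1.
- by rewrite dens_le_mass// lte_fin (lt_le_trans tt2)// H2.
Qed.

(** The density is replaced by its average against a narrow hat, at an error controlled by
    [dens_lip]. The average is a mean of a function of [X_k], to which [Ex_param_lip] applies. *)
Lemma dens_cont_b (b1 b2 x1 x2 eps : R) K : 0 < b1 -> 0 < x1 -> x1 <= x2 -> (0 < K)%N -> 0 < eps ->
  exists (del : R) N, 0 < del /\ forall m, (N <= m)%N -> forall b c, b1 <= b <= b2 -> b1 <= c <= b2 ->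
    `|b - c| < del -> forall k, (0 < k <= K)%N -> forall x, x1 <= x <= x2 ->
    `|dens m b k x - dens m c k x| <= eps.
Proof.
move=> b10 x10 x12 K0 e0.
have h1 : 0 < x1 / 2 by lra.
have h12 : x1 / 2 <= x2 + x1 / 2 by lra.
have [C [l [N [C0 l0 H]]]] := dens_lip b2 b10 h1 h12 K0.
(* Keeps the hat where [dens_lip] holds and makes the averaging error at most [eps / 8]. *)
pose w := Num.min (l / 2) (Num.min (x1 / 4) (eps / (8 * (C + 1)))).
have C1 : 0 < 8 * (C + 1) by rewrite mulr_gt0//; lra.
have w0 : 0 < w by rewrite !lt_min !divr_gt0.
have wl : w < l by rewrite /w !gt_min; apply/orP; left; lra.
have wx : w < x1 / 2 by rewrite /w !gt_min; apply/orP; right; apply/orP; left; lra.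
have wC : C * w <= eps / 8.
  apply: (@le_trans _ _ ((C + 1) * w)); first by rewrite ler_wpM2r ?(ltW w0)//; lra.
  rewrite mulrC -ler_pdivlMr; last by lra.
  rewrite (_ : eps / 8 / (C + 1) = eps / (8 * (C + 1))); last by field; rewrite gt_eqF//; lra.
  by rewrite /w !ge_min lexx !orbT.
pose A := 2 * x2 + 3 * w; have A0 : 0 < A by rewrite /A; lra.
pose I := hat_mass w; have I0 : 0 < I := hat_mass_gt0 w0.
(* Makes the quadratic term of [Ex_param_lip] at most [eps I / 4]; [del] then does the same for the
   logarithmic term. *)
pose c0 := eps * I * b1 / A ^+ 2; have c00 : 0 < c0 by rewrite /c0 divr_gt0 ?exprn_gt0// !mulr_gt0.
pose del := eps * I * c0 * b1 / 8; have del0 : 0 < del.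
  by apply: divr_gt0 => //; apply: mulr_gt0 => //; apply: mulr_gt0 => //; exact: mulr_gt0.
exists del, (maxn N K.*2); split => // m; rewrite geq_max => /andP[Nm Km].
have main b c : b1 <= b <= b2 -> b1 <= c <= b2 -> b <= c -> c - b < del ->
    forall k, (0 < k <= K)%N -> forall x, x1 <= x <= x2 -> `|dens m c k x - dens m b k x| <= eps.
  move=> bb cc bc bcd k kK x xx.
  have kk := kK; case/andP: kk => k0 k1; case/andP: (xx) => xa xb.
  have b0 : 0 < b by apply: lt_le_trans b10 _; case/andP: bb.
  have cp : 0 < c by exact: lt_le_trans bc.
  have km : (0 < k <= m)%N by rewrite k0 (leq_trans k1)//; nlia.
  have k2 : (k.*2 <= m.+1)%N by nlia.
  have th : test1 (hat w x) by apply: test1_hat; exact: ltW.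
  have avg d : b1 <= d <= b2 -> `|Ex m d (fun s => hat w x (pt s k)) - I * dens m d k x| <= I * (C * w).
    move=> dd; have d0 : 0 < d by apply: lt_le_trans b10 _; case/andP: dd.
    have := @hat_average R (dens m d k) w x (C * w) w0 (dens_ge0 m d k) (measurable_dens d0 km).
    rewrite -Ex_dens//=; apply=> z zx.
    apply: le_trans (_ : C * `|z - x| <= _); last by rewrite ler_wpM2l.
    apply: H => //; [|by apply/andP; split; lra|exact: le_lt_trans wl].
    by move: zx; rewrite ler_norml => /andP[? ?]; apply/andP; split; lra.
  have fA u v : 0 < u -> 0 < v -> `|hat w x u - hat w x v| <= A * (`|u - v| / (u + v)).
    move=> u0 v0; have wx' : w < x by lra.
    apply: le_trans (hat_rel_lip w0 wx' u0 v0) _.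
    by rewrite ler_wpM2r ?divr_ge0 ?addr_ge0 ?(ltW u0) ?(ltW v0)// /A; lra.
  have bc' : 0 < b <= c by rewrite b0.
  have := Ex_param_lip th (ltW A0) fA k0 (_ : (k <= m)%N) bc' c00 k2.
  case/andP: (km) => _ -> /(_ isT) E4.
  have hb := avg b bb; have hc := avg c cc.
  have lnb : ln (c / b) <= del / b1.
    rewrite (_ : c / b = 1 + (c - b) / b); last by field; rewrite gt_eqF.
    apply: (@le_trans _ _ ((c - b) / b)).
      rewrite -ler_expR lnK ?posrE; first exact: expR_ge1Dx.
      by rewrite ltr_wpDr// divr_ge0 ?subr_ge0// ltW.
    by apply: ler_pM; rewrite ?invr_ge0 ?subr_ge0 ?(ltW b0) ?(ltW bcd)// lef_pV2 ?posrE//; case/andP: bb.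
  have s1 : 2 / c0 * ln (c / b) <= eps * I / 4.
    apply: (@le_trans _ _ (2 / c0 * (del / b1))); first by rewrite ler_wpM2l// divr_ge0// ltW.
    rewrite le_eqVlt; apply/orP; left; apply/eqP; rewrite /del; field.
    by rewrite !gt_eqF.
  have s2 : c0 * A ^+ 2 / (4 * b) <= eps * I / 4.
    have -> : c0 * A ^+ 2 = eps * I * b1 by rewrite /c0 divfK// expf_eq0 gt_eqF.
    rewrite ler_pdivrMr ?mulr_gt0// (_ : eps * I / 4 * (4 * b) = eps * I * b); last by field.
    by apply: ler_wpM2l; [apply: mulr_ge0; exact: ltW|case/andP: bb].
  have wCI : I * (C * w) <= I * (eps / 8) by rewrite ler_wpM2l// ltW.
  rewrite -(ler_pM2l I0) -{1}(gtr0_norm I0) -normrM mulrBr.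
  move: hb hc E4 s1 s2 wCI; move: (Ex m b _) (Ex m c _) (I * dens m b k x) (I * dens m c k x) => p q r s.
  move: (2 / c0 * _) (c0 * A ^+ 2 / _) (I * (C * w)) => z1 z2 z3.
  rewrite !ler_norml => /andP[? ?] /andP[? ?] /andP[? ?] ? ? ?.
  by apply/andP; split; lra.
move=> b c bb cc bcd k kK x xx; case: (leP b c) => bc.
  by rewrite distrC main//; move: bcd; rewrite distrC ger0_norm ?subr_ge0.
by rewrite main ?(ltW bc)//; move: bcd; rewrite ger0_norm ?subr_ge0 ?(ltW bc).
Qed.

(** The intensity at [x] of the other points, seen from a point at the origin; index 0 is the pinned
    point itself. *)
Definition gasR m b x : R := \sum_(k < m.+1 | (0 < k)%N) dens m b k x.

Lemma dens_tail_sum (b1 x2 eps : R) : 0 < b1 -> 0 < x2 -> 0 < eps ->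
  exists K N, (0 < K)%N /\ forall m, (N <= m)%N -> forall b, b1 <= b -> forall x, x <= x2 ->
    \sum_(k < m.+1 | (K < k)%N) dens m b k x <= eps.
Proof.
move=> b10 x20 e0; have x21 : 0 < x2 + 1 by lra.
(* [1/4] meets the condition of [dens_tail], and [eps / 2] absorbs its factor 2. *)
have e0' : 0 < Num.min (1 / 4) (eps / 2) by rewrite lt_min !divr_gt0.
have [K [N [K0 H]]] := cdf_tail_small b10 x21 e0'.
exists K, N; split => // m Nm b b1b x xx2.
have b0 := lt_le_trans b10 b1b; have h := H m Nm b b1b.
have [h1 h2] : \sum_(k < m.+1 | (K < k)%N) cdf m b k (x2 + 1) <= 1 / 4 /\
    \sum_(k < m.+1 | (K < k)%N) cdf m b k (x2 + 1) <= eps / 2.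
  by move: h; rewrite le_min => /andP[].
apply: (@le_trans _ _ (2 * \sum_(k < m.+1 | (K < k)%N) cdf m b k (x2 + 1))); last by lra.
rewrite mulr_sumr; apply: ler_sum => k Kk.
have km : (0 < k <= m)%N by have := ltn_ord k; nlia.
have Kkm : (K < k <= m)%N by have := ltn_ord k; nlia.
have c1 := cdf_tail_term h1 Kkm.
have c2 : cdf m b k (x + 1) <= cdf m b k (x2 + 1) by apply: cdf_le => //; lra.
apply: le_trans (dens_tail b0 km _) _; [lra|].
by rewrite ler_wpM2l.
Qed.

Theorem gasR_equicont (b1 b2 x1 x2 eps : R) : 0 < b1 -> 0 < x1 -> x1 <= x2 -> 0 < eps ->
  exists (del : R) N, 0 < del /\ forall m, (N <= m)%N -> forall b c x y,
    b1 <= b <= b2 -> b1 <= c <= b2 -> x1 <= x <= x2 -> x1 <= y <= x2 ->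
    `|b - c| < del -> `|x - y| < del -> `|gasR m b x - gasR m c y| <= eps.
Proof.
move=> b10 x10 x12 e0; have x20 : 0 < x2 by exact: lt_le_trans x12.
have e4 : 0 < eps / 4 by lra.
have [K [N1 [K0 H1]]] := dens_tail_sum b10 x20 e4.
have K0' : 0 < K%:R :> R by rewrite ltr0n.
have [C [l [N2 [C0 l0 H2]]]] := dens_lip b2 b10 x10 x12 K0.
have eK : 0 < eps / (4 * K%:R) by rewrite divr_gt0 ?mulr_gt0.
have [d1 [N3 [d10 H3]]] := dens_cont_b b2 b10 x10 x12 K0 eK.
pose d := Num.min (Num.min d1 l) (eps / (4 * K%:R * (C + 1))).
have CK : 0 < 4 * K%:R * (C + 1) by rewrite mulr_gt0 ?mulr_gt0//; lra.
have d0 : 0 < d by rewrite !lt_min d10 l0 divr_gt0.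
exists d, (maxn (maxn N1 N2) (maxn N3 K)); split => // m; rewrite !geq_max.
move=> /andP[/andP[N1m N2m] /andP[N3m Km]] b c x y bb cc xx yy bcd xyd.
have [bd xl xC] : [/\ `|b - c| < d1, `|x - y| < l & (C + 1) * `|x - y| <= eps / (4 * K%:R)].
  move: bcd xyd; rewrite !lt_min => /andP[/andP[-> _] _] /andP[/andP[_ ->] h]; split => //.
  rewrite mulrC -ler_pdivlMr; last by lra.
  apply: (le_trans (ltW h)); rewrite le_eqVlt; apply/orP; left; apply/eqP; field.
  by rewrite !gt_eqF//; lra.
have split_sum (f : nat -> R) : \sum_(k < m.+1 | (0 < k)%N) f k =
    \sum_(1 <= k < K.+1) f k + \sum_(k < m.+1 | (K < k)%N) f k :> R.
  rewrite -(big_geq_mkord 1 m.+1 xpredT f) -(big_geq_mkord K.+1 m.+1 xpredT f).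
  by rewrite (@big_cat_nat _ _ _ K.+1)//; nlia.
have tb z e : z <= x2 -> b1 <= e <= b2 -> 0 <= \sum_(k < m.+1 | (K < k)%N) dens m e k z <= eps / 4.
  move=> zx /andP[eb _]; rewrite H1// andbT; apply: sumr_ge0 => k _; exact: dens_ge0.
rewrite /gasR (split_sum (fun k => dens m b k x)) (split_sum (fun k => dens m c k y)).
have /andP[xa xb] := xx; have /andP[ya yb] := yy.
have := tb x b xb bb; have := tb y c yb cc.
set T1 := \sum_(_ < _ | _) _; set T2 := \sum_(_ < _ | _) _ => /andP[t1 t2] /andP[t3 t4].
have main : `|\sum_(1 <= k < K.+1) dens m b k x - \sum_(1 <= k < K.+1) dens m c k y| <= eps / 2.
  rewrite -sumrB; apply: le_trans (ler_norm_sum _ _ _) _.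
  apply: (@le_trans _ _ (\sum_(1 <= k < K.+1) eps / (2 * K%:R))).
    rewrite big_nat [leRHS]big_nat; apply: ler_sum => k kK.
    have kK' : (0 < k <= K)%N by nlia.
    have a1 := H2 m N2m b bb k kK' x y xx yy xl.
    have a2 := H3 m N3m b c bb cc bd k kK' y yy.
    have a3 : C * `|x - y| <= (C + 1) * `|x - y| by rewrite ler_wpM2r//; lra.
    have a4 : eps / (2 * K%:R) = eps / (4 * K%:R) + eps / (4 * K%:R) by field; rewrite gt_eqF.
    have := ler_distD (dens m b k y) (dens m b k x) (dens m c k y); lra.
  rewrite sumr_const_nat subn1 /= -[leLHS]mulr_natl le_eqVlt; apply/orP; left; apply/eqP; field.
  by rewrite gt_eqF.
move: main; set S1 := \sum_(_ <= _ < _) _; set S2 := \sum_(_ <= _ < _) _.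
by rewrite !ler_norml => /andP[? ?]; apply/andP; split; lra.
Qed.

End equicontinuity.

(** * The circular ensemble seen from one of its points *)

Section symmetric.
Context {R : realType}.
Local Notation mu := (@lebesgue_measure R).
Implicit Types (s t : seq R) (q : R -> R -> R).

(** Symmetry expressed by bringing one entry to the front, the form in which [iint_ins] consumes
    it. *)
Definition isym (T : Type) (f : seq R -> T) := forall k x s, f (ins k x s) = f (x :: s).

Lemma isym_cons T (f : seq R -> T) x : isym f -> isym (fun s => f (x :: s)).
Proof.
move=> sf k y s; rewrite -[x :: ins k y s]/(ins k.+1 y (x :: s)) sf.
by have := sf 1%N y (x :: s); rewrite /ins /= take0 drop0 => ->.
Qed.

Lemma perm_ins k x s : perm_eq (ins k x s) (x :: s).
Proof. by rewrite /ins perm_catC /= perm_cons perm_catC cat_take_drop. Qed.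

Lemma uniq_ins k x s : uniq (ins k x s) = (x \notin s) && uniq s.
Proof. by rewrite (perm_uniq (perm_ins k x s)). Qed.

Lemma ins_sorted_uniq (x : R) s : sorted <%R s -> x \notin s ->
  \sum_(k < (size s).+1) (sorted <%R (ins k x s) : nat) = 1%N.
Proof.
elim: s => [|y s IH] /=; first by rewrite big_ord_recl big_ord0.
move=> ys; rewrite inE negb_or => /andP[xy xs].
have sy : forall z, z \in s -> y < z by apply/allP; exact: (order_path_min lt_trans ys).
have ss := path_sorted ys.
rewrite big_ord_recl [ins ord0 x (y :: s)]/ins /= ys andbT.
have [lt|ge|e] := ltgtP x y; last by rewrite e eqxx in xy.
  rewrite big1 ?addn0// => k _; rewrite /ins /= -/(ins k x s).
  apply/eqP; rewrite eqb0; apply/negP => h.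
  have := order_path_min lt_trans h; rewrite (perm_all _ (perm_ins k x s)) /= => /andP[yx _].
  by have := lt_trans lt yx; rewrite ltxx.
apply: (eq_trans (add0n _)); rewrite -(IH ss xs); apply: eq_bigr => k _; congr nat_of_bool.
rewrite [(0 + k)%N]add0n -/(ins k x s) path_sortedE; last exact: lt_trans.
by rewrite (perm_all _ (perm_ins k x s)) /= ge (introT allP sy).
Qed.

Lemma sorted_ins_sub k x s : sorted <%R (ins k x s) -> sorted <%R s && (x \notin s).
Proof.
move=> h; apply/andP; split.
  have ss : subseq s (ins k x s).
    by rewrite -{1}(cat_take_drop k s) /ins cat_subseq// subseq_cons.
  exact: (subseq_sorted lt_trans ss h).
by have := sorted_uniq lt_trans ltxx h; rewrite uniq_ins => /andP[].
Qed.

Lemma smeas_sorted n : smeas n (fun s => ((sorted <%R s)%:R : R)%:E).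
Proof.
apply/measurable_EFinP.
apply: (@eqfun_measurable _ _ _ _ (fun t : n.-tuple R => \prod_(i < n.-1) ((t`_i < t`_i.+1)%R%:R : R))).
  move=> t; case: (boolP (sorted _ _)) => [/(sortedP 0) h|].
    by rewrite big1// => i _; rewrite h// size_tuple; have := ltn_ord i; lia.
  move=> /(sortedP 0) h; have [i ni] : exists i, ~ ((i.+1 < size t)%N -> t`_i < t`_i.+1).
    by apply/existsNP => h'; apply: h.
  move: ni => /not_implyP[it /negP/negbTE nlt].
  have it' : (i < n.-1)%N by move: it; rewrite size_tuple; lia.
  by rewrite (bigD1 (Ordinal it'))//= nlt mul0r.
apply: measurable_prod => i _; apply: measurable_indb.
rewrite (_ : [set _ | _] = [set` [pred t : n.-tuple R | t`_i < t`_i.+1]]); last by [].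
have := @measurable_fun_ltr _ _ R setT (fun t : n.-tuple R => t`_i) (fun t : n.-tuple R => t`_i.+1).
move=> /(_ (measurable_nth _) (measurable_nth _)) h.
have := h measurableT [set true] I; rewrite setTI.
by congr measurable; apply/seteqP; split.
Qed.

(** Induction on [n]. With the other coordinates sorted, exactly one insertion position of [x] sorts
    the whole sequence ([ins_sorted_uniq]); by [iint_ins] the [n + 1] positions give equal
    integrals, which turns [n!] into [(n+1)!]. Repeated entries have no sorted insertion, hence the
    assumption that [f] vanishes there. *)
Lemma iint_symmetrize n (f : seq R -> \bar R) : (forall s, 0 <= f s)%E -> smeas n f -> isym f ->
  (forall s, ~~ uniq s -> f s = 0%E) ->
  iint n f = ((n`!)%:R%:E * iint n (fun s => f s * ((sorted <%R s)%:R : R)%:E))%E.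
Proof.
elim: n f => [|n IH] f f0 mf sf uf; first by rewrite /= fact0 mul1e mule1.
pose h s := (f s * ((sorted <%R s)%:R : R)%:E)%E.
have h0 s : (0 <= h s)%E by rewrite mule_ge0// lee_fin ler0n.
have mh : smeas n.+1 h by apply: emeasurable_funM => //; exact: smeas_sorted.
transitivity (\int[mu]_x ((n`!)%:R%:E * iint n (fun s => \sum_(k < n.+1) h (ins k x s))))%E.
  apply: eq_integral => x _; rewrite [LHS]IH//; last 3 first.
  - exact: smeas_cons.
  - exact: isym_cons.
  - by move=> s us; apply: uf; rewrite /= negb_and us orbT.
  congr (_ * _)%E; apply: eq_iint => s sn; rewrite /h.
  case: (boolP (x \in s)) => xs.
    rewrite uf ?mul0e; last by rewrite /= xs.
    by rewrite big1// => k _; rewrite sf uf ?mul0e//= xs.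
  under eq_bigr => k _ do rewrite sf.
  rewrite -ge0_sume_distrr; last by move=> k _; rewrite lee_fin ler0n.
  congr (_ * _)%E; rewrite sumEFin; congr EFin; rewrite -natr_sum; congr (_%:R).
  case: (boolP (sorted _ s)) => ss; first by rewrite -sn ins_sorted_uniq.
  rewrite big1// => k _; apply/eqP; rewrite eqb0; apply: contra ss => /sorted_ins_sub.
  by case/andP.
have mhk (k : 'I_n.+1) x : smeas n (fun s => h (ins k x s)).
  by apply: smeas_ins => //; rewrite -ltnS.
have mi (k : 'I_n.+1) : measurable_fun setT (fun x => iint n (fun s => h (ins k x s))).
  apply: (@measurable_iint _ _ R n (fun x s => h (ins k x s))); first by move=> x s; exact: h0.
  by apply: measurable_ins_param => //; rewrite -ltnS.
transitivity (\int[mu]_x ((n`!)%:R%:E * \sum_(k < n.+1) iint n (fun s => h (ins k x s))))%E.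
  apply: eq_integral => x _; congr (_ * _)%E; rewrite iint_sum//.
rewrite ge0_integralZl//; last 2 first.
- exact: emeasurable_sum.
- by move=> x _; apply: sume_ge0 => k _; exact: iint_ge0.
rewrite ge0_integral_sum//; last by move=> k x _; exact: iint_ge0.
rewrite (eq_bigr (fun=> iint n.+1 h)); last first.
  by move=> k _; rewrite (iint_ins (k := k))// -ltnS.
have i0 : (0 <= iint n.+1 h)%E by exact: iint_ge0.
rewrite (_ : (\sum_(k < n.+1) iint n.+1 h = n.+1%:R%:E * iint n.+1 h)%E); last first.
  rewrite -(mul1e (iint n.+1 h)) muleA mule1 -ge0_sume_distrl; last by move=> *; rewrite lee_fin.
  by congr (_ * _)%E; rewrite sumEFin; congr EFin; rewrite sumr_const card_ord.
by rewrite muleA -EFinM -natrM factS mulnC.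
Qed.

Fixpoint pairw q s : R := if s is x :: s' then (\prod_(y <- s') q x y) * pairw q s' else 1.

Lemma pairwE q s : pairw q s = \prod_(j < size s) \prod_(i < j) q s`_i s`_j.
Proof.
elim: s => [|x s IH] /=; first by rewrite big_ord0.
rewrite big_ord_recl big_ord0 mul1r IH.
under [RHS]eq_bigr => j _ do rewrite big_ord_recl /=.
rewrite [RHS]big_split /=; congr (_ * _).
by rewrite (big_nth 0) big_mkord.
Qed.

Lemma pairwM q1 q2 s : pairw (fun x y => q1 x y * q2 x y) s = pairw q1 s * pairw q2 s.
Proof. by elim: s => [|x s IH] /=; rewrite ?mulr1// IH big_split /= mulrACA. Qed.

Lemma pairw_ge0 q s : (forall x y, 0 <= q x y) -> 0 <= pairw q s.
Proof. by move=> q0; elim: s => [|x s IH] //=; rewrite mulr_ge0// prodr_ge0. Qed.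

Lemma pairw_le1 q s : (forall x y, 0 <= q x y <= 1) -> pairw q s <= 1.
Proof.
move=> q1; elim: s => [|x s IH] //=; apply: mulr_ile1 => //.
- by apply: prodr_ge0 => y _; case/andP: (q1 x y).
- by apply: pairw_ge0 => a b; case/andP: (q1 a b).
- exact: prodr_ile1.
Qed.

Lemma pairw_map q (h : R -> R) s : pairw q (map h s) = pairw (fun x y => q (h x) (h y)) s.
Proof. by elim: s => [|x s IH] //=; rewrite IH big_map. Qed.

Lemma eq_pairw q1 q2 s : (forall x y, x \in s -> y \in s -> q1 x y = q2 x y) ->
  pairw q1 s = pairw q2 s.
Proof.
elim: s => [|x s IH] //= h; rewrite IH; last by move=> a b sa sb; apply: h; rewrite inE ?sa ?sb orbT.
by congr (_ * _); apply: eq_big_seq => y sy; apply: h; rewrite inE ?eqxx ?sy ?orbT.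
Qed.

Lemma pairw_isym q : (forall x y, q x y = q y x) -> isym (pairw q).
Proof.
move=> qC k x s; rewrite /ins; elim: s k => [|y s IH] [|k] //=.
rewrite -/(ins k x s) in IH *; rewrite (perm_big _ (perm_ins k x s)) /= big_cons IH /=.
by rewrite big_cons qC; ring.
Qed.

Lemma pairw_uniq q s : (forall x, q x x = 0) -> ~~ uniq s -> pairw q s = 0.
Proof.
move=> qx; elim: s => [|x s IH] //=; rewrite negb_and negbK => /orP[xs|/IH ->]; last by rewrite mulr0.
by rewrite (big_rem x)//= qx !mul0r.
Qed.

Lemma pairw_powR q b s : (forall x y, 0 <= q x y) ->
  pairw (fun x y => q x y `^ b) s = pairw q s `^ b.
Proof.
move=> q0; elim: s => [|x s IH] /=; first by rewrite powR1.
rewrite IH powRM ?prodr_ge0 ?pairw_ge0//; congr (_ * _).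
elim: s {IH} => [|y s IH]; first by rewrite !big_nil powR1.
by rewrite !big_cons IH powRM// prodr_ge0.
Qed.

Lemma measurable_pairw q n : measurable_fun setT (fun p : R * R => q p.1 p.2) ->
  measurable_fun [set: n.-tuple R] (fun s : n.-tuple R => pairw q s).
Proof.
move=> mq; apply: (@eqfun_measurable _ _ _ _ (fun s : n.-tuple R => \prod_(j < n) \prod_(i < j) q s`_i s`_j)).
  by move=> s; rewrite pairwE size_tuple.
apply: measurable_prod => j _; apply: measurable_prod => i _.
apply: (measurableT_comp (f := fun p : R * R => q p.1 p.2) (g := fun s : n.-tuple R => (s`_i, s`_j)) mq).
by apply/measurable_fun_pairP; split; exact: measurable_nth.
Qed.

End symmetric.

(** * The circle as a fundamental interval, and the change of the reference point *)

Section circle.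
Context {R : realType}.
Variable m : nat.
Local Notation mu := (@lebesgue_measure R).
Local Notation n := (m.+1%:R : R).
Local Notation hchord := (@hchord R m).
Local Notation period := (@period R m).
Local Notation vdm := (@vdm R m).
Implicit Types (s t u z : seq R) (x y : R).

Definition halfp : R := pi * n.

Lemma periodD : period = halfp + halfp.
Proof. by rewrite /period /halfp -mulrA mulr_natl mulr2n. Qed.

Lemma halfp_gt0 : 0 < halfp.
Proof. by rewrite /halfp mulr_gt0 ?pi_gt0// ltr0Sn. Qed.

Definition incube x : bool := - halfp <= x < halfp.
Definition cube u : bool := all incube u.

(** The same half chord as [hchord], but symmetric and periodic, hence usable for unordered points
    anywhere on the line. *)
Definition qsin x y : R := `|sin ((x - y) / (2 * n))|.

Let n0 : 0 < n := ltr0Sn _ _.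

Lemma qsin_ge0 x y : 0 <= qsin x y. Proof. exact: normr_ge0. Qed.

Lemma qsinC x y : qsin x y = qsin y x.
Proof. by rewrite /qsin -opprB mulNr sinN normrN. Qed.

Lemma qsin_le1 x y : qsin x y <= 1.
Proof. by rewrite /qsin ler_norml sin_geN1 sin_le1. Qed.

Lemma qsin0 x : qsin x x = 0.
Proof. by rewrite /qsin subrr mul0r sin0 normr0. Qed.

Lemma qsin_shift x y c : qsin (x - c) (y - c) = qsin x y.
Proof. by rewrite /qsin opprB addrA subrK. Qed.

Lemma qsin_period x y : qsin (x + period) y = qsin x y.
Proof.
rewrite /qsin (_ : (x + period - y) / (2 * n) = (x - y) / (2 * n) + pi); last first.
  rewrite /period; move: (pi : R) (n) n0 => p k k0; field; rewrite gt_eqF//.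
by rewrite sinDpi normrN.
Qed.

Lemma qsin_hchord x y : 0 <= y - x < period -> qsin x y = hchord (y - x).
Proof.
move=> /andP[h0 hp]; rewrite qsinC /qsin; have [->|yx] := eqVneq (y - x) 0.
  by rewrite mul0r sin0 normr0 hchord_eq0// ltxx.
have h : 0 < y - x < period by rewrite lt_neqAle eq_sym yx h0 hp.
rewrite /hchord h ger0_norm// ltW// sin_gt0_pi//; exact: hchord_arg.
Qed.

Lemma chord_qsin x y : chord (x / n) (y / n) = 2 * qsin x y.
Proof.
rewrite /chord; have -> : (cos (x / n) - cos (y / n)) ^+ 2 + (sin (x / n) - sin (y / n)) ^+ 2 =
    (2 * sin ((x - y) / (2 * n))) ^+ 2.
  have e : x / n - y / n = (x - y) / (2 * n) + (x - y) / (2 * n) by field; rewrite gt_eqF.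
  have := cosB (x / n) (y / n); rewrite e cosD => h.
  have h1 := cos2Dsin2 (x / n); have h2 := cos2Dsin2 (y / n); have h3 := cos2Dsin2 ((x - y) / (2 * n)).
  move: h h1 h2 h3; move: (cos _) (sin _) (cos _) (sin _) (cos _) (sin _) => a b c d e' f; nra.
by rewrite sqrtr_sqr normrM ger0_norm.
Qed.

(* Position of [y] seen from [x] on the circle; outside of the fundamental domain
   it is extended to a measure preserving map of the line. *)
Definition exch x y : R :=
  if - halfp <= y < x then y + (period - x) else if x <= y < halfp then y - x else y + halfp.

Lemma exch_in x y : incube x -> incube y -> exch x y = y - x \/ exch x y = y - x + period.
Proof.
rewrite /incube /exch => /andP[x1 x2] /andP[y1 y2]; rewrite y1 y2 andbT /=.
by case: ltP => xy; [right; ring|left].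
Qed.

Lemma exch_range x y : incube x -> (0 <= exch x y < period) = incube y.
Proof.
rewrite /incube /exch periodD => /andP[x1 x2]; case: ifP => [/andP[y1 y2]|h1].
  by rewrite y1 /= (lt_trans y2 x2); apply/andP; split; lra.
case: ifP => [/andP[y1 y2]|h2]; first by rewrite y2 (le_trans x1 y1); apply/andP; split; lra.
apply/idP/idP => /andP[a1 a2]; last first.
  by move: h1 h2; rewrite a1 a2 andbT /=; case: ltP.
by apply/andP; split; lra.
Qed.

Lemma qsin_exch x y y' : incube x -> incube y -> incube y' ->
  qsin (exch x y) (exch x y') = qsin y y'.
Proof.
move=> hx hy hy'; have pr a c : qsin a (c + period) = qsin a c by rewrite qsinC qsin_period qsinC.
by case: (exch_in hx hy) => ->; case: (exch_in hx hy') => ->; rewrite ?qsin_period ?pr qsin_shift.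
Qed.

Lemma qsin_exch0 x y : incube x -> incube y -> qsin 0 (exch x y) = qsin x y.
Proof.
move=> hx hy; rewrite qsinC; case: (exch_in hx hy) => ->; rewrite ?qsin_period.
  by rewrite -(subrr x) qsin_shift qsinC.
by rewrite -(subrr x) qsin_shift qsinC.
Qed.

Lemma measurable_incube : measurable [set x | incube x].
Proof.
rewrite (_ : [set _ | _] = `[- halfp, halfp[%classic); first exact: measurable_itv.
by apply/seteqP; split => x /=; rewrite in_itv.
Qed.

Lemma measurable_exch x : measurable_fun setT (exch x).
Proof.
have mi a b : measurable_fun [set: R] (fun y : R => a <= y < b).
  apply: (measurable_fun_bool true); rewrite setTI.
  rewrite (_ : _ @^-1` _ = `[a, b[%classic); first exact: measurable_itv.
  by apply/seteqP; split => y /=; rewrite in_itv.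
have m1 := mi (- halfp) x; have m2 := mi x halfp.
have m3 : measurable_fun setT (fun y => if x <= y < halfp then y - x else y + halfp).
  by apply: (measurable_fun_if measurableT m2); apply: measurable_funTS;
    [apply: measurable_funB|apply: measurable_funD].
apply: (measurable_fun_if measurableT m1); apply: measurable_funTS => //.
by apply: measurable_funD.
Qed.

(** The map is a translation on each of three pieces, [[-halfp, x)], [[x, halfp)] and the rest.
    Their images, described by [J1], [J2] and [J3], again partition the line. *)
Lemma integral_exch x (h : R -> \bar R) : incube x -> (forall y, 0 <= h y)%E -> measurable_fun setT h ->
  (\int[mu]_y h (exch x y) = \int[mu]_y h y)%E.
Proof.
move=> hx h0 mh; have /andP[x1 x2] := hx.
have AB y : (- halfp <= y < x) ==> ~~ (x <= y < halfp).
  by apply/implyP => /andP[_ yx]; rewrite leNgt yx.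
pose J1 (c : R) := (halfp - x <= c < period); pose J2 (c : R) := (0 <= c < halfp - x).
pose J3 (c : R) := ~~ (0 <= c < period).
have B1 y : J1 (y + (period - x)) = (- halfp <= y < x).
  by rewrite /J1 periodD; apply/idP/idP => /andP[? ?]; apply/andP; split; lra.
have B2 y : J2 (y - x) = (x <= y < halfp).
  by rewrite /J2; apply/idP/idP => /andP[? ?]; apply/andP; split; lra.
have B3 y : J3 (y + halfp) = ~~ (- halfp <= y < x) && ~~ (x <= y < halfp).
  rewrite -negb_or /J3 periodD; congr (~~ _); apply/idP/idP => [/andP[y1 y2]|/orP[]/andP[y1 y2]].
  - by case: (ltP y x) => h1; apply/orP; [left|right]; apply/andP; split => //; lra.
  - by apply/andP; split; lra.
  - by apply/andP; split; lra.
have mb (a b : R) : measurable_fun [set: R] (fun y : R => ((a <= y < b)%R%:R : R)%:E).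
  apply/measurable_EFinP; apply: (@measurable_indb _ _ _ (fun y => a <= y < b)).
  rewrite (_ : [set _ | _] = `[a, b[%classic); first exact: measurable_itv.
  by apply/seteqP; split => y /=; rewrite in_itv.
have mb3 : measurable_fun [set: R] (fun y : R => ((J3 y)%:R : R)%:E).
  apply: (@eqfun_measurable _ _ _ _ (fun y => 1 - ((0 <= y < period)%R%:R : R)%:E)%E).
    by move=> y; rewrite /J3; case: (_ && _); rewrite /= ?subr0 -EFinB ?subrr ?subr0.
  by apply: emeasurable_funB.
pose F (J : pred R) y := (h y * ((J y)%:R : R)%:E)%E.
have F0 J y : (0 <= F J y)%E by rewrite mule_ge0// lee_fin ler0n.
have m1 : measurable_fun setT (F J1) by apply: emeasurable_funM => //; exact: mb.
have m2 : measurable_fun setT (F J2) by apply: emeasurable_funM => //; exact: mb.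
have m3 : measurable_fun setT (F J3) by exact: emeasurable_funM.
have E1 : (\int[mu]_y h y = \int[mu]_y F J1 y + (\int[mu]_y F J2 y + \int[mu]_y F J3 y))%E.
  rewrite -!ge0_integralD//; [|by move=> y _; rewrite adde_ge0|exact: emeasurable_funD].
  apply: eq_integral => y _; rewrite /F.
  have [J12 J3E] : ~~ (J1 y && J2 y) /\ J3 y = ~~ (J1 y || J2 y).
    split; first by rewrite /J1 /J2; apply/negP => /andP[/andP[h1 _] /andP[_]]; rewrite ltNge h1.
    rewrite /J3; congr (~~ _); rewrite /J1 /J2 periodD.
    apply/idP/idP => [/andP[y1 y2]|/orP[]/andP[y1 y2]].
    - by case: (ltP y (halfp - x)) => h1; apply/orP; [right|left]; apply/andP; split.
    - by apply/andP; split; lra.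
    - by apply/andP; split; lra.
  move: J12; rewrite J3E; case: (J1 y) => /= [/negbTE ->|_]; first by rewrite /= mule1 !mule0 !adde0.
  by case: (J2 y); rewrite /= mule1 !mule0 ?adde0 !add0e.
have ms J d : measurable_fun setT (F J) -> measurable_fun setT (fun y => F J (y + d)).
  by move=> mF; exact: measurable_shift.
rewrite E1 -(ge0_integral_shift (period - x) (F0 J1) m1) -(ge0_integral_shift (- x) (F0 J2) m2).
rewrite -(ge0_integral_shift halfp (F0 J3) m3).
rewrite -!ge0_integralD//; try exact: ms; last 2 first.
- by move=> y _; rewrite adde_ge0.
- by apply: emeasurable_funD; exact: ms.
apply: eq_integral => y _; rewrite /F B1 B2 B3 /exch; have := AB y.
case: (- halfp <= y < x) => [/negbTE|_]; first by move=> ->; rewrite /= mule1 !mule0 !adde0.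
by case: (x <= y < halfp); rewrite /= mule1 !mule0 ?adde0 !add0e.
Qed.

Definition dropi (i : nat) u := take i u ++ drop i.+1 u.

Lemma dropi_ins i x s : (i <= size s)%N -> dropi i (ins i x s) = s.
Proof.
move=> im; rewrite /dropi /ins; have ti : size (take i s) = i by rewrite size_takel.
rewrite take_size_cat// drop_cat ti ltnNge leqnSn /= subSnn /= drop0.
exact: cat_take_drop.
Qed.

Definition cweight b u : R := pairw qsin u `^ b.

Lemma cweight_ge0 b u : 0 <= cweight b u. Proof. exact: powR_ge0. Qed.

Lemma cweight_le1 b u : 0 <= b -> cweight b u <= 1.
Proof.
move=> b0; apply: (@le_trans _ _ (1 `^ b)); last by rewrite powR1.
have q0 : 0 <= pairw qsin u by apply: pairw_ge0; exact: qsin_ge0.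
rewrite ge0_ler_powR ?nnegrE//; apply: pairw_le1 => x y.
by rewrite qsin_ge0 qsin_le1.
Qed.

Lemma cweight_isym b : isym (cweight b).
Proof. by move=> k x s; rewrite /cweight pairw_isym//; exact: qsinC. Qed.

Lemma cweight_uniq b u : 0 < b -> ~~ uniq u -> cweight b u = 0.
Proof. by move=> b0 uu; rewrite /cweight pairw_uniq ?powR0 ?gt_eqF//; exact: qsin0. Qed.

Lemma measurable_qsin : measurable_fun setT (fun p : R * R => qsin p.1 p.2).
Proof.
apply: measurableT_comp => //; apply: measurableT_comp.
  by apply: continuous_measurable_fun; exact: continuous_sin.
by apply: measurable_funM => //; apply: measurable_funB.
Qed.

Lemma measurable_cweight b k : measurable_fun [set: k.-tuple R] (fun s : k.-tuple R => cweight b s).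
Proof.
apply: (measurableT_comp (measurable_powR b)); apply: measurable_pairw; exact: measurable_qsin.
Qed.

Lemma smeas_all (A : pred R) k : measurable [set x | A x] ->
  smeas k (fun s => ((all A s)%:R : R)%:E).
Proof.
move=> mA; apply/measurable_EFinP.
apply: (@eqfun_measurable _ _ _ _ (fun t : k.-tuple R => \prod_(i < k) ((A t`_i)%:R : R))).
  move=> t; case: (boolP (all _ _)) => [/(all_nthP 0) H|].
    by rewrite big1// => i _; rewrite H ?size_tuple.
  move=> /allPn[x xt /negbTE H].
  have ni : (index x t < k)%N by have := xt; rewrite -index_mem size_tuple.
  by rewrite (bigD1 (Ordinal ni))//= nth_index// H mul0r.
apply: measurable_prod => i _.
apply: (measurableT_comp (measurable_indb mA)); exact: measurable_nth.
Qed.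

Lemma all_isym (A : pred R) : isym (all A).
Proof. by move=> k x s; rewrite (perm_all _ (perm_ins k x s)). Qed.

Definition inper x : bool := 0 <= x < period.

(** For sorted points in one period every [qsin] is an [hchord]. Otherwise the left side is 0, and
    so is [vdm], which vanishes unless the points are increasing and inside the period. *)
Lemma cweight_vdm b z : 0 < b -> size z = m ->
  cweight b (0 :: z) * (all inper z)%:R * (sorted <%R z)%:R = vdm z `^ b.
Proof.
move=> b0 zm; case: (boolP (all inper z && sorted <%R z)) => [/andP[rz sz]|h].
  rewrite rz sz !mulr1 /cweight pairwE /= zm; congr (_ `^ _).
  rewrite /vdm; apply: eq_bigr => j _; apply: eq_bigr => i _; rewrite -/(pt z i) -/(pt z j).
  apply: qsin_hchord; have ij := ltn_ord i; have jm := ltn_ord j.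
  have rg k : (k <= m)%N -> 0 <= pt z k < period.
    case: k => [|k] km; first by rewrite /pt /= lexx; exact: period_gt0.
    by move/allP: rz => /(_ z`_k); apply; rewrite mem_nth// zm.
  have im : (i <= m)%N by rewrite ltnW// (leq_trans ij).
  have /andP[i1 i2] := rg i im; have /andP[j1 j2] := rg j jm.
  have le k l : (k < l)%N -> (l <= m)%N -> pt z k <= pt z l.
    case: k l => [|k] [|l]// kl lm; first by have /andP[] := rg l.+1 lm.
    apply: ltW; rewrite /pt /=; apply: (sorted_ltn_nth lt_trans 0 sz) => //; rewrite inE zm//.
    exact: ltn_trans lm.
  have {}le := le _ _ ij jm.
  by apply/andP; split; [rewrite subr_ge0|move: i1 j2; lra].
rewrite -mulrA -natrM mulnb (negbTE h) mulr0; have [->|v0] := eqVneq (vdm z) 0.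
  by rewrite powR0// gt_eqF.
case/negP: h; apply/andP; split.
  have := vdm_box zm v0; apply: sub_all => x /andP[x0 x1].
  by rewrite /inper (ltW x0) x1.
apply/(sortedP 0) => i; rewrite zm => im.
have h : (i.+1 < i.+2 <= m)%N by rewrite ltnSn.
by have := vdm_neq0 v0 h; rewrite /pt /= subr_gt0 => /andP[].
Qed.

(** With the first point fixed at [x], the others are re-expressed relative to it by [exch], which
    preserves the measure and all mutual distances; ordering them costs [m!] and turns the weight
    into [vdm]. *)
Lemma palm_fixed b x (G g : seq R -> R) : 0 < b -> incube x ->
  (forall z, 0 <= g z) -> smeas m (EFin \o g) -> isym g ->
  (forall s, size s = m -> cube s -> G s = g (map (exch x) s)) ->
  iint m (fun s => (G s * cweight b (x :: s) * (cube s)%:R)%:E) =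
  ((m`!)%:R%:E * iint m (fun z => (g z * vdm z `^ b)%:E))%E.
Proof.
move=> b0 hx g0 mg sg Gg.
pose h z : \bar R := (g z * (cweight b (0 :: z) * (all inper z)%:R))%:E.
have h0 z : (0 <= h z)%E by rewrite lee_fin !mulr_ge0 ?cweight_ge0.
have mcw : smeas m (EFin \o (fun z => cweight b (0 :: z))).
  have := @smeas_cons R m (EFin \o cweight b) 0 (_ : smeas m.+1 _); apply.
  by apply/measurable_EFinP; exact: measurable_cweight.
have mper : measurable [set x | inper x].
  rewrite (_ : [set _ | _] = `[0, period[%classic); first exact: measurable_itv.
  by apply/seteqP; split => y /=; rewrite in_itv.
have mh : smeas m h.
  apply/measurable_EFinP; apply: measurable_funM; first exact/measurable_EFinP.
  apply: measurable_funM; first exact/measurable_EFinP.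
  by apply/measurable_EFinP; exact: smeas_all.
transitivity (iint m (h \o amap (fun=> exch x))).
  apply: eq_iint => s sm; rewrite /h /= amap_cst all_map.
  have -> : all (preim (exch x) inper) s = cube s.
    by apply: eq_all => y /=; rewrite /inper exch_range.
  case: (boolP (cube s)) => cs; last by rewrite !mulr0.
  rewrite !mulr1 (Gg _ sm cs); congr (_ * _)%:E; rewrite /cweight /=; congr (_ `^ _).
  rewrite big_map pairw_map; congr (_ * _).
    by apply: eq_big_seq => y ys; rewrite qsin_exch0//; exact: (allP cs).
  by apply: eq_pairw => y y' ys ys'; rewrite qsin_exch//; exact: (allP cs).
have := @iint_amap R m h 1 (fun=> exch x) ler01 (fun=> measurable_exch x) _ h0 mh.
rewrite expr1n mul1e => -> ; last by move=> _ k k0 mk; rewrite mul1e integral_exch.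
rewrite iint_symmetrize//.
- congr (_ * _)%E; apply: eq_iint => z zm; rewrite /h -EFinM -mulrA.
  by rewrite cweight_vdm.
- move=> k y s; rewrite /h sg all_isym; congr (_ * (_ * _))%:E.
  exact: (isym_cons 0 (@cweight_isym b)).
- move=> z uz; rewrite /h cweight_uniq ?mul0r ?mulr0//.
  by rewrite /= negb_and uz orbT.
Qed.

End circle.

(** * The Palm formula for the circular ensemble *)

Section palm.
Context {R : realType}.
Variables (m : nat) (b : R).
Hypothesis b0 : 0 < b.
Local Notation mu := (@lebesgue_measure R).
Local Notation n := (m.+1%:R : R).
Local Notation period := (@period R m).
Local Notation halfp := (@halfp R m).
Local Notation vdm := (@vdm R m).
Local Notation incube := (@incube R m).
Local Notation cube := (@cube R m).
Local Notation cweight := (@cweight R m b).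
Implicit Types (s t u z : seq R) (x y : R) (f : seq R -> R).

Definition cden u : R := cweight u * (cube u)%:R.
Definition cmean f : R := rint m.+1 (fun u => f u * cden u) / rint m.+1 cden.

Lemma cden_ge0 u : 0 <= cden u.
Proof. by rewrite mulr_ge0 ?cweight_ge0. Qed.

Lemma cden_sbox u : cden u <= (sbox halfp u)%:R.
Proof.
rewrite /cden; case: (boolP (cube u)) => [/allP cu|_]; last by rewrite mulr0.
rewrite (_ : sbox halfp u) ?mulr1 ?cweight_le1 ?(ltW b0)//; apply/allP => x /cu /andP[x1 x2].
by rewrite ler_norml x1 ltW.
Qed.

Lemma measurable_cden k : measurable_fun [set: k.-tuple R] (fun u : k.-tuple R => cden u).
Proof.
apply: measurable_funM; first exact: measurable_cweight.
by apply/measurable_EFinP; apply: smeas_all; exact: measurable_incube.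
Qed.

Lemma cden_bsupp f : obs m.+1 f -> exists2 M, 0 <= M & bsupp M halfp m.+1 (fun u => f u * cden u).
Proof.
move=> [f0 mf [M fM]]; have M0 : 0 <= M by apply: le_trans (f0 (nseq m.+1 0)) (fM _ _); rewrite size_nseq.
exists M => //; split.
- by move=> u; rewrite mulr_ge0 ?cden_ge0.
- apply/measurable_EFinP; apply: measurable_funM; first exact/measurable_EFinP.
  exact: measurable_cden.
- by move=> u um; apply: ler_pM; rewrite ?cden_ge0 ?cden_sbox ?fM.
Qed.

(** The partition function before the normalisation of [weight]. *)
Definition vnorm : R := Zgas m b * vdm (lat m) `^ b.

Lemma vnorm_gt0 : 0 < vnorm.
Proof. by rewrite mulr_gt0 ?Zgas_gt0// powR_gt0// vdm_lat_gt0. Qed.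

Lemma iint_vdm g : obs m g ->
  iint m (fun z => (g z * vdm z `^ b)%:E) = (Ex m b g * vnorm)%:E.
Proof.
move=> og; have [M M0 bg] := obs_bsupp b0 og.
have p0 : 0 <= period := ltW (period_gt0 m).
have l0 : 0 < vdm (lat m) by exact: vdm_lat_gt0.
transitivity ((vdm (lat m) `^ b)%:E * iint m (EFin \o (fun s => (gibbs m b s * g s)%R)))%E.
  case: (bg) => g0 mg _; rewrite -iintZ ?powR_ge0//.
  apply: eq_iint => z _ /=; rewrite -EFinM; congr EFin.
  rewrite mulrA -powRM ?weight_ge0 ?(ltW l0)// /weight mulrC; congr (_ `^ _ * _).
  by rewrite mulrC divfK// gt_eqF.
rewrite -(rintE M0 p0 bg) -EFinM; congr EFin.
by rewrite /vnorm /Ex mulrA divfK ?gt_eqF ?Zgas_gt0// mulrC.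
Qed.

Section formula.
Variables (phi : R -> R) (G g : R -> seq R -> R).
Hypothesis phi0 : forall x, 0 <= phi x.
Hypothesis G0 : forall x u, 0 <= G x u.
Hypothesis g0 : forall x z, 0 <= g x z.
Hypothesis mG : forall i, (i <= m)%N ->
  smeas m.+1 (EFin \o (fun u => phi u`_i * G u`_i (dropi i u))).
Hypothesis og : forall x, incube x -> phi x != 0 -> obs m (g x).
Hypothesis sg : forall x, incube x -> phi x != 0 -> isym (g x).
Hypothesis Gg : forall x, incube x -> phi x != 0 -> forall s, size s = m -> cube s ->
  G x s = g x (map (exch m x) s).

(** A sum over the points of the configuration, where [G] sees the chosen point and the remaining
    ones. *)
Definition palm_sum u : R := \sum_(i < m.+1) phi u`_i * G u`_i (dropi i u).

(** All [m + 1] terms have the same integral: [iint_ins] makes the chosen point the outer variable,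
    symmetry moves it to the front, and [palm_fixed] evaluates the inner integral. *)
Lemma iint_palm : iint m.+1 (fun u => (palm_sum u * cden u)%:E) =
  ((n * ((m`!)%:R * vnorm))%:E *
   \int[mu]_x (phi x * (incube x)%:R * Ex m b (g x))%:E)%E.
Proof.
pose F i u : \bar R := (phi u`_i * G u`_i (dropi i u) * cden u)%:E.
have F0 i u : (0 <= F i u)%E.
  by rewrite lee_fin; apply: mulr_ge0; [apply: mulr_ge0|exact: cden_ge0].
have mF i : (i <= m)%N -> smeas m.+1 (F i).
  move=> im; apply/measurable_EFinP; apply: measurable_funM; last exact: measurable_cden.
  by apply/measurable_EFinP; exact: mG.
have c0 : 0 <= (m`!)%:R * vnorm by rewrite mulr_ge0// ltW// vnorm_gt0.
have H i x : (i <= m)%N -> iint m (fun s => F i (ins i x s)) =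
   (((m`!)%:R * vnorm)%:E * (phi x * (incube x)%:R * Ex m b (g x))%:E)%E.
  move=> im; transitivity (iint m (fun s => (phi x * (incube x)%:R)%:E *
      (G x s * cweight (x :: s) * (cube s)%:R)%:E)%E).
    apply: eq_iint => s sm; rewrite /F nth_ins ?sm// ltnn eqxx dropi_ins ?sm//.
    rewrite /cden cweight_isym -EFinM; congr EFin.
    by rewrite /cube all_isym /= -mulnb natrM; ring.
  have [h|h] := boolP (incube x && (phi x != 0)); last first.
    have -> : phi x * (incube x)%:R = 0.
      by move: h; rewrite negb_and negbK => /orP[/negbTE ->|/eqP ->]; rewrite ?mulr0 ?mul0r.
    rewrite mul0r mule0 -[RHS](@iint_cst0 R m); apply: eq_iint => s _; rewrite mul0e//.
  case/andP: h => hx px.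
  have [_ mg _] := og hx px.
  have pf := palm_fixed b0 hx (g0 x) mg (sg hx px) (Gg hx px).
  rewrite iint_vdm in pf; last exact: og.
  rewrite hx mulr1 iintZ//.
  - by rewrite pf -!EFinM; congr EFin; ring.
  - by move=> s; rewrite lee_fin; apply: mulr_ge0 => //; apply: mulr_ge0 => //; exact: cweight_ge0.
  have ms : smeas m (fun s => F i (ins i x s)) by apply: smeas_ins => //; exact: mF.
  apply: (@eqfun_measurable _ _ _ _ (fun s : m.-tuple R => ((phi x)^-1)%:E * F i (ins i x s))%E); last first.
    by apply: emeasurable_funM => //; exact: measurable_cst.
  move=> s; rewrite /F nth_ins ?size_tuple// ltnn eqxx dropi_ins ?size_tuple//.
  rewrite /cden cweight_isym -EFinM; congr EFin.
  by rewrite /cube all_isym /= hx /= -/(cube s); field.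
have iE i : (i <= m)%N -> iint m.+1 (F i) =
    (((m`!)%:R * vnorm)%:E * \int[mu]_x (phi x * (incube x)%:R * Ex m b (g x))%:E)%E.
  move=> im; rewrite (iint_ins im (F0 i) (mF i im)).
  have mJ : measurable_fun setT (fun x => (phi x * (incube x)%:R * Ex m b (g x))%:E).
    have mI : measurable_fun setT (fun x => iint m (fun s => F i (ins i x s))).
      apply: (@measurable_iint _ _ R m (fun x s => F i (ins i x s))); first by move=> x s; exact: F0.
      by apply: measurable_ins_param => //; exact: mF.
    apply: (@eqfun_measurable _ _ _ _ (fun x => (((m`!)%:R * vnorm)^-1)%:E * iint m (fun s => F i (ins i x s)))%E).
      move=> x; rewrite H// -EFinM; congr EFin.
      rewrite mulrA mulVf ?mul1r// gt_eqF// mulr_gt0 ?vnorm_gt0// ltr0n; exact: fact_gt0.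
    by apply: emeasurable_funM => //; exact: measurable_cst.
  rewrite -ge0_integralZl//; last first.
    by move=> x _; rewrite lee_fin; apply: mulr_ge0; [apply: mulr_ge0 => //|exact: Ex_ge0].
  by apply: eq_integral => x _; rewrite H.
transitivity (iint m.+1 (fun u => \sum_(i < m.+1) F i u)%E).
  by apply: eq_iint => u _; rewrite /palm_sum mulr_suml -sumEFin.
rewrite (_ : (fun u => _) = (fun u => \sum_(i <- index_enum 'I_m.+1) F i u)%E)//.
rewrite iint_sum//; last by move=> i; apply: mF; rewrite -ltnS.
rewrite (eq_bigr (fun=> iint m.+1 (F 0%N))); last by move=> i _; rewrite !iE// -ltnS.
rewrite EFinM -muleA -(iE 0%N)//.
have i0 : (0 <= iint m.+1 (F 0%N))%E by exact: iint_ge0.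
rewrite -(mul1e (iint m.+1 (F 0%N))) muleA mule1 -ge0_sume_distrl; last by move=> *; rewrite lee_fin.
by congr (_ * _)%E; rewrite sumEFin; congr EFin; rewrite sumr_const card_ord.
Qed.

End formula.

(** The Palm formula with all functions equal to 1, where the sum is the number of points. *)
Lemma iint_cden : iint m.+1 (EFin \o cden) = (period * ((m`!)%:R * vnorm))%:E.
Proof.
have one (T : Type) : isym (fun _ : seq R => (1 : R)) by [].
have H := @iint_palm (fun=> 1) (fun _ _ => 1) (fun _ _ => 1) (fun=> ler01) (fun _ _ => ler01) (fun _ _ => ler01)
  (fun i im => _) (fun _ _ _ => obs_cst m ler01) (fun _ _ _ => one R) (fun _ _ _ _ _ _ => erefl).
have pre : nat -> smeas m.+1 (EFin \o (fun=> 1 * 1 : R)) by move=> _; exact: measurable_cst.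
have {pre}H := H pre.
have n0 : 0 < n := ltr0Sn R m.
have Dfin : (iint m.+1 (EFin \o cden))%E \is a fin_num.
  have [M M0 bD] := cden_bsupp (obs_cst m.+1 ler01).
  have := rintE M0 (ltW (halfp_gt0 m)) bD.
  rewrite (_ : EFin \o (fun u => 1 * cden u) = EFin \o cden); last by apply/funext => u /=; rewrite mul1r.
  by move=> <-.
have E1 : iint m.+1 (fun u => (palm_sum (fun=> 1) (fun _ _ => 1) u * cden u)%:E) = (n%:E * iint m.+1 (EFin \o cden))%E.
  rewrite -iintZ//.
  - apply: eq_iint => u _; rewrite -EFinM /palm_sum; congr (_ * _)%:E.
    by rewrite (eq_bigr (fun=> 1)) ?sumr_const ?card_ord// => i _; rewrite mulr1.
  - by move=> u; rewrite lee_fin cden_ge0.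
  - by apply/measurable_EFinP; exact: measurable_cden.
rewrite E1 in H.
have E2 : (\int[mu]_x (1 * (incube x)%:R * Ex m b (fun=> 1%R))%:E = period%:E)%E.
  rewrite (Ex_cst m b0 ler01).
  transitivity (\int[mu]_(x in `[(- halfp)%R, halfp[%classic) (cst 1%E x))%E.
    rewrite [RHS]integral_mkcond; apply: eq_integral => x _.
    rewrite patchE mem_setE in_itv/= mul1r mulr1 /incube.
    by case: (_ && _).
  rewrite integral_cst//= mul1e lebesgue_measure_itv/= lte_fin ifT; last first.
    by rewrite -subr_gt0 opprK -periodD period_gt0.
  by rewrite -EFinB opprK -periodD.
rewrite E2 -(fineK Dfin) in H; rewrite -(fineK Dfin); congr EFin.
by apply: (mulfI (lt0r_neq0 n0)); apply: EFin_inj; rewrite EFinM H -EFinM; congr EFin; ring.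
Qed.

Lemma rint_cden : rint m.+1 cden = period * ((m`!)%:R * vnorm).
Proof. by rewrite /rint iint_cden. Qed.

Lemma rint_cden_gt0 : 0 < rint m.+1 cden.
Proof.
by rewrite rint_cden mulr_gt0 ?period_gt0// mulr_gt0 ?vnorm_gt0// ltr0n fact_gt0.
Qed.

(** Dividing by [iint_cden], everything cancels but [(m + 1) / period], which is the density
    [1 / (2 pi)]. *)
Lemma cmean_palm phi G g : (forall x, 0 <= phi x) -> (forall x u, 0 <= G x u) ->
  (forall x z, 0 <= g x z) ->
  (forall i, (i <= m)%N -> smeas m.+1 (EFin \o (fun u => phi u`_i * G u`_i (dropi i u)))) ->
  (forall x, incube x -> phi x != 0 -> obs m (g x)) ->
  (forall x, incube x -> phi x != 0 -> isym (g x)) ->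
  (forall x, incube x -> phi x != 0 -> forall s, size s = m -> cube s ->
     G x s = g x (map (exch m x) s)) ->
  obs m.+1 (palm_sum phi G) -> (forall x, ~~ incube x -> phi x = 0) ->
  ((cmean (palm_sum phi G))%:E = ((2 * pi)^-1)%:E * \int[mu]_x (phi x * Ex m b (g x))%:E)%E.
Proof.
move=> phi0 G0 g0 mG og sg Gg oP pin.
have H := iint_palm phi0 G0 g0 mG og sg Gg.
have [M M0 bP] := cden_bsupp oP.
have n0 : 0 < n := ltr0Sn R m.
rewrite /cmean EFinM (rintE M0 (ltW (halfp_gt0 m)) bP) /comp H rint_cden.
have v0 := vnorm_gt0; have f0 : (0 : R) < (m`!)%:R by rewrite ltr0n fact_gt0.
rewrite muleAC -EFinM; congr (_ * _)%E; last first.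
  apply: eq_integral => x _; case: (boolP (incube x)) => hx; first by rewrite mulr1.
  by rewrite pin// !mul0r.
congr EFin; rewrite /period; have p0 := pi_gt0 R; move: (pi : R) p0 (m.+1%:R : R) n0 => p p0 k k0.
by field; rewrite !gt_eqF.
Qed.

Lemma cmean_le f g : obs m.+1 f -> obs m.+1 g ->
  (forall u, size u = m.+1 -> uniq u -> cube u -> f u <= g u) -> cmean f <= cmean g.
Proof.
move=> of_ og fg; rewrite /cmean ler_pM2r ?invr_gt0 ?rint_cden_gt0//.
have [M M0 bf] := cden_bsupp of_; have [N N0 bg] := cden_bsupp og.
have h0 : 0 <= halfp := ltW (halfp_gt0 m).
apply: (rint_le M0 h0 N0 h0 bf bg) => u um.
have [->|d0] := eqVneq (cden u) 0; first by rewrite !mulr0.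
apply: ler_wpM2r; first exact: cden_ge0.
apply: fg => //.
  by apply: contra_neqT d0 => uu; rewrite /cden cweight_uniq ?mul0r.
by apply: contra_neqT d0 => /negbTE cu; rewrite /cden cu mulr0.
Qed.

Lemma cmeanD f g : obs m.+1 f -> obs m.+1 g -> cmean (fun u => f u + g u) = cmean f + cmean g.
Proof.
move=> of_ og; rewrite /cmean -mulrDl; congr (_ / _).
have [M M0 bf] := cden_bsupp of_; have [N N0 bg] := cden_bsupp og.
have [K K0 bfg] := cden_bsupp (obsD of_ og).
have h0 : 0 <= halfp := ltW (halfp_gt0 m).
apply: EFin_inj; rewrite EFinD (rintE M0 h0 bf) (rintE N0 h0 bg) (rintE K0 h0 bfg).
case: bf => f0 mf _; case: bg => g0 mg _; rewrite -iintD//; try by move=> s; rewrite lee_fin.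
by apply: eq_iint => s _ /=; rewrite mulrDl.
Qed.

Lemma cmeanZ c f : 0 <= c -> obs m.+1 f -> cmean (fun u => c * f u) = c * cmean f.
Proof.
move=> c0 of_; rewrite /cmean mulrA; congr (_ / _).
have [M M0 bf] := cden_bsupp of_.
have [K K0 bfg] := cden_bsupp (obsM (obs_cst m.+1 c0) of_).
have h0 : 0 <= halfp := ltW (halfp_gt0 m).
apply: EFin_inj; rewrite EFinM (rintE M0 h0 bf) (rintE K0 h0 bfg).
case: bf => f0 mf _; rewrite -iintZ//; try by move=> s; rewrite lee_fin.
by apply: eq_iint => s _; rewrite /= -EFinM; congr EFin; rewrite -mulrA.
Qed.

(** Boundedness makes every inner integral finite, so taking real parts at each stage, as
    [angle_integral] does, loses nothing. *)
Lemma angle_integralE k (f : seq R -> R) M : (forall s, 0 <= f s) ->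
  (forall s, size s = k -> f s <= M) -> smeas k (EFin \o f) ->
  angle_integral (fun t : k.-tuple R => f t) =
  rint k (fun s => f s * (all (fun x => - pi <= x < pi) s)%:R).
Proof.
have mpi : measurable [set x : R | - pi <= x < pi].
  rewrite (_ : [set _ | _] = `[- pi, pi[%classic); first exact: measurable_itv.
  by apply/seteqP; split => x /=; rewrite in_itv.
have bs j (f' : seq R -> R) : (forall s, 0 <= f' s) -> (forall s, size s = j -> f' s <= M) -> smeas j (EFin \o f') ->
    bsupp M pi j (fun s => f' s * (all (fun x => - pi <= x < pi) s)%:R).
  move=> f0 fM mf; split.
  - by move=> s; rewrite mulr_ge0//; case/andP: (fM s).
  - apply/measurable_EFinP; apply: measurable_funM; first exact/measurable_EFinP.
    by apply/measurable_EFinP; exact: smeas_all.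
  - move=> s sj; apply: ler_pM => //; first exact: fM.
    rewrite ler_nat; case: (boolP (all _ _)) => // /allP h.
    rewrite (_ : sbox pi s)//; apply/allP => x /h /andP[x1 x2]; by rewrite ler_norml x1 ltW.
elim: k f => [|k IH] f f0 fM mf; first by rewrite /rint /= mulr1.
have M0 : 0 <= M by apply: le_trans (f0 (nseq k.+1 0)) (fM _ _); rewrite size_nseq.
have p0 : 0 <= (pi : R) := pi_ge0 R.
rewrite [LHS]/= /Rintegral.
rewrite (_ : integral _ _ _ = (rint k.+1 (fun s => f s * (all (fun x => - pi <= x < pi) s)%:R))%:E)//.
rewrite -(rint_cons M0 p0 (bs _ _ f0 fM mf)) integral_mkcond; apply: eq_integral => x _.
rewrite patchE mem_setE in_itv/=; case: ifPn => hx; last first.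
  rewrite (_ : (fun s => _) = (fun=> 0)).
    by rewrite /rint (_ : EFin \o _ = (fun=> 0%E))// iint_cst0.
  by apply/funext => s; rewrite /= mulr0.
congr EFin; rewrite /=; apply: (IH (fun s => f (x :: s))); [by move=> s|by move=> s sk; apply: fM; rewrite /= sk|].
exact: (smeas_cons x mf).
Qed.

(** The scaling [u = n theta] and the constant relating the two weights cancel between numerator and
    denominator. Agreement is required only without repetitions, since a function of the set of
    points does not see multiplicities and repeated points have weight 0. *)
Lemma circular_meanE (F f : seq R -> R) : obs m.+1 f ->
  (forall th, uniq th -> F th = f [seq n * x | x <- th]) ->
  circular_mean b (fun th : m.+1.-tuple R => F th) = cmean f.
Proof.
move=> of_ Ff; have n0 : 0 < n := ltr0Sn R m.
(* One factor 2 per pair from [chord_qsin], raised to the power [b]; the value depends only on the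
   number of points. *)
pose K := pairw (fun _ _ : R => 2) (nseq m.+1 0) `^ b.
have two k : 0 < pairw (fun _ _ : R => 2) (nseq k 0).
  by elim: k => [|k IH] //=; rewrite mulr_gt0// prodr_gt0.
have K0 : 0 < K by rewrite powR_gt0.
have pc th : pairw (fun _ _ : R => 2) th = pairw (fun _ _ : R => 2) (nseq (size th) 0).
  by elim: th => [|x th IH] //=; rewrite IH !big_const_seq !count_predT size_nseq.
have WE (th : m.+1.-tuple R) : circular_weight b th = K * cweight [seq n * x | x <- th].
  rewrite /circular_weight /cweight pairw_map /K.
  transitivity (pairw (fun x y => chord x y `^ b) th).
    rewrite pairwE size_tuple (exchange_big_dep xpredT)//=; apply: eq_bigr => j _.
    rewrite -(big_mkord xpredT (fun i => chord th`_i th`_j `^ b)) (big_nat_widen _ _ m.+1); last first.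
      exact: ltnW.
    by rewrite big_mkord; apply: eq_bigr => i ij; rewrite !(tnth_nth 0).
  have chord0 (x y : R) : 0 <= chord x y by exact: sqrtr_ge0.
  rewrite pairw_powR// -powRM; last 2 first.
  - exact: ltW.
  - by apply: pairw_ge0 => x y; exact: qsin_ge0.
  congr (_ `^ _); have := pc th; rewrite size_tuple => <-; rewrite -pairwM; apply: eq_pairw => x y _ _.
  by rewrite -chord_qsin ![n * _]mulrC !mulfK ?gt_eqF.
pose c := K / n ^+ m.+1; have c0 : 0 < c by rewrite divr_gt0// exprn_gt0.
have main (f' F' : seq R -> R) : obs m.+1 f' -> (forall th, uniq th -> F' th = f' [seq n * x | x <- th]) ->
    angle_integral (fun th : m.+1.-tuple R => F' th * circular_weight b th) = c * rint m.+1 (fun u => f' u * cden u).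
  move=> of' Ff'.
  pose h th := f' [seq n * x | x <- th] * (K * cweight [seq n * x | x <- th]).
  have [f0 mf [M fM]] := of'; have M0 : 0 <= M by apply: le_trans (f0 (nseq m.+1 0)) (fM _ _); rewrite size_nseq.
  pose T (_ : nat) (x : R) := n * x + 0.
  have TE th : amap T th = [seq n * x | x <- th].
    by rewrite amap_cst; apply: eq_map => x; rewrite addr0.
  have mT i : measurable_fun setT (T i) by exact: measurable_affine.
  have mfc : smeas m.+1 (fun u => (f' u * (K * cweight u))%:E).
    apply/measurable_EFinP; apply: measurable_funM; first exact/measurable_EFinP.
    by apply: measurable_funM => //; exact: measurable_cweight.
  have -> : (fun th : m.+1.-tuple R => F' th * circular_weight b th) = (fun th : m.+1.-tuple R => h th).
    apply/funext => th; rewrite WE /h; case: (boolP (uniq th)) => uth; first by rewrite Ff'.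
    rewrite cweight_uniq ?mulr0//; rewrite map_inj_uniq//; apply: mulfI; exact: lt0r_neq0.
  rewrite (@angle_integralE m.+1 h (M * K)); last 3 first.
  - by move=> th; rewrite /h !mulr_ge0 ?cweight_ge0 ?(ltW K0).
  - move=> th thm; rewrite /h; apply: ler_pM => //.
    + by rewrite mulr_ge0 ?cweight_ge0 ?(ltW K0).
    + by apply: fM; rewrite size_map.
    by rewrite ler_piMr ?(ltW K0)// cweight_le1// ltW.
  - apply: (@eqfun_measurable _ _ _ _ (fun t : m.+1.-tuple R => ((fun u => (f' u * (K * cweight u))%:E) \o amap T) t)).
      by move=> t; rewrite /= TE.
    exact: (smeas_amap mT mfc).
  have [N N0 bf] := cden_bsupp of'.
  apply: (mulfI (lt0r_neq0 (exprn_gt0 m.+1 n0))); rewrite mulrA [_ * c](_ : _ = K); last first.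
    by rewrite /c mulrC divfK// expf_eq0 gt_eqF.
  have h0 : 0 <= halfp := ltW (halfp_gt0 m).
  rewrite /rint.
  have := @iint_amap R m.+1 (fun u => (K * (f' u * cden u))%:E) n T (ltW n0) mT _ _ _.
  have -> : iint m.+1 (EFin \o (fun s => h s * (all (fun x => - pi <= x < pi) s)%:R)) =
     iint m.+1 ((fun u => (K * (f' u * cden u))%:E) \o amap T).
    apply: eq_iint => s _ /=; congr EFin; rewrite TE /h /cden /cube all_map.
    rewrite (_ : all (preim _ _) s = all (fun x => - pi <= x < pi) s); first by ring.
    apply: eq_all => x /=; rewrite /incube /halfp -mulNr [n * x]mulrC.
    by rewrite ler_pM2r// ltr_pM2r.
  have fK : iint m.+1 (fun u => (K * (f' u * cden u))%:E) = (K * rint m.+1 (fun u => f' u * cden u))%:E.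
    rewrite EFinM (rintE N0 h0 bf); case: bf => g0 mg _; rewrite -iintZ ?(ltW K0)//.
  rewrite fK => H; have {}H := H _ _ _; set I := iint _ _ in H *.
  have HI : ((n ^+ m.+1)%:E * I)%E = (K * rint m.+1 (fun u => f' u * cden u))%:E.
    apply: H.
    - by move=> i k k0 mk; rewrite /T ge0_integral_affine.
    - by move=> u; rewrite lee_fin mulr_ge0 ?(ltW K0)// mulr_ge0// cden_ge0.
    - apply/measurable_EFinP; apply: measurable_funM => //; case: bf => _ mg _; exact/measurable_EFinP.
  have np : (((n ^+ m.+1)^-1)%:E * ((n ^+ m.+1)%:E * I) = I)%E.
    by rewrite muleA -EFinM mulVf ?mul1e// expf_eq0 gt_eqF.
  by rewrite -np HI -EFinM /= mulrA mulfV ?mul1r// expf_eq0 gt_eqF.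
rewrite /circular_mean (main _ _ of_ Ff).
have := main (fun=> 1) (fun=> 1) (obs_cst m.+1 ler01) (fun _ _ => erefl).
rewrite (_ : (fun u => 1 * cden u) = cden); last by apply/funext => u; rewrite mul1r.
rewrite (_ : (fun th : m.+1.-tuple R => 1 * circular_weight b th) = (fun th : m.+1.-tuple R => circular_weight b th)); last first.
  by apply/funext => u; rewrite mul1r.
move=> ->; rewrite /cmean invfM mulrACA divff ?mul1r// gt_eqF//.
Qed.

End palm.

(** * Truncated linear statistics *)

Section statistics.
Context {R : realType}.
Variables (m : nat) (b : R).
Hypothesis b0 : 0 < b.
Local Notation mu := (@lebesgue_measure R).
Local Notation halfp := (@halfp R m).
Local Notation period := (@period R m).
Implicit Types (s t u z : seq R) (x y : R) (f : R -> R).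

Definition lin f u : R := \sum_(y <- u) f y.

Lemma lin_ge0 f u : (forall x, 0 <= f x) -> 0 <= lin f u.
Proof. by move=> f0; apply: sumr_ge0. Qed.

Lemma lin_le f u c : (forall x, f x <= c) -> lin f u <= c * (size u)%:R.
Proof.
move=> fc; rewrite /lin; elim: u => [|x u IH]; first by rewrite big_nil mulr0.
by rewrite big_cons /= -natr1 mulrDr mulr1 addrC lerD.
Qed.

Lemma lin_isym f : isym (lin f).
Proof. by move=> k x s; rewrite /lin (perm_big _ (perm_ins k x s)). Qed.

Lemma lin_map f (h : R -> R) s : lin f (map h s) = lin (fun y => f (h y)) s.
Proof. by rewrite /lin big_map. Qed.

Lemma lin_count (A : pred R) u : lin (fun x => (A x)%:R) u = (count A u)%:R.
Proof. by rewrite /lin; elim: u => [|x u IH]; rewrite ?big_nil// big_cons IH -natrD. Qed.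

Lemma size_dropi i u : (i < size u)%N -> (size (dropi i u)).+1 = size u.
Proof. by move=> iu; rewrite /dropi size_cat size_take size_drop iu; nlia. Qed.

Lemma lin_dropi f i u : (i < size u)%N -> lin f u = f u`_i + lin f (dropi i u).
Proof.
move=> iu; rewrite /lin /dropi -{1}(cat_take_drop i u) (drop_nth 0 iu) !big_cat big_cons /=.
by rewrite addrCA.
Qed.

Lemma lin_nth f k u : size u = k -> lin f u = \sum_(j < k) f u`_j.
Proof. by move=> uk; rewrite /lin (big_nth 0) big_mkord uk. Qed.

Lemma lin_pt f z : size z = m -> lin f z = \sum_(k < m.+1 | (0 < k)%N) f (pt z k).
Proof.
move=> zm; rewrite (lin_nth f zm) [RHS]big_mkcond big_ord_recl /= add0r.
by apply: eq_bigr.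
Qed.

Lemma measurable_lin_dropi f k i : measurable_fun setT f -> (i <= k)%N ->
  measurable_fun [set: k.+1.-tuple R] (fun u : k.+1.-tuple R => lin f (dropi i u)).
Proof.
move=> mf ik; apply: (@eqfun_measurable _ _ _ _ (fun u : k.+1.-tuple R => \sum_(j < k.+1) f u`_j - f u`_i)).
  move=> u; rewrite -(lin_nth f (size_tuple u)) (@lin_dropi f i u) ?size_tuple//.
  by rewrite addrC addKr.
have mfn j : measurable_fun [set: k.+1.-tuple R] (fun u : k.+1.-tuple R => f u`_j).
  by apply: (measurableT_comp mf); exact: measurable_nth.
by apply: measurable_funB => //; apply: measurable_sum.
Qed.

Lemma obs_palm phi (G : R -> seq R -> R) c D : (forall x, 0 <= phi x <= c) ->
  (forall x s, 0 <= G x s) -> (forall x s, size s = m -> G x s <= D) ->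
  (forall i, (i <= m)%N -> smeas m.+1 (EFin \o (fun u => phi u`_i * G u`_i (dropi i u)))) ->
  obs m.+1 (palm_sum m phi G).
Proof.
move=> phic G0 GD mG; split.
- by move=> u; apply: sumr_ge0 => i _; rewrite mulr_ge0//; case/andP: (phic u`_i).
- apply/measurable_EFinP; apply: measurable_sum => i.
  by apply/measurable_EFinP; apply: mG; rewrite -ltnS.
- exists (\sum_(i < m.+1) c * D) => u um; apply: ler_sum => i _.
  have /andP[h1 h2] := phic u`_i; apply: ler_pM => //; apply: GD.
  by apply/eqP; rewrite -eqSS size_dropi ?um.
Qed.

Lemma eq_cmean (f g : seq R -> R) : (forall u, size u = m.+1 -> uniq u -> f u = g u) ->
  cmean m b f = cmean m b g.
Proof.
move=> fg; rewrite /cmean /rint; congr (fine _ / _); apply: eq_iint => u um /=.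
case: (boolP (uniq u)) => uu; first by rewrite fg.
by rewrite /cden cweight_uniq ?mul0r ?mulr0.
Qed.

Section pair.
Variables (phi psi : R -> R) (c p1 p2 q1 q2 : R).
Hypothesis mphi : measurable_fun setT phi.
Hypothesis mpsi : measurable_fun setT psi.
Hypothesis phic : forall x, 0 <= phi x <= c.
Hypothesis psic : forall x, 0 <= psi x <= c.
Hypothesis phiE : forall x, phi x != 0 -> p1 <= x <= p2.
Hypothesis psiE : forall x, psi x != 0 -> q1 <= x <= q2.
Hypothesis p12 : p1 <= p2.
Hypothesis pq : p2 < q1.
Hypothesis q12 : q1 <= q2.
Hypothesis hp1 : - halfp <= p1.
Hypothesis hp2 : q2 < halfp.

Let c0 : 0 <= c. Proof. by have /andP[h1 h2] := phic 0; exact: le_trans h1 h2. Qed.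
Let psi0 x : 0 <= psi x. Proof. by case/andP: (psic x). Qed.
Let phi0 x : 0 <= phi x. Proof. by case/andP: (phic x). Qed.

Ltac slra := move: p12 pq q12 hp1 hp2; lra.

Lemma window_incube x : p1 <= x <= p2 -> incube m x.
Proof. by move=> /andP[x1 x2]; apply/andP; split; slra. Qed.

(** The window of [psi] lies to the right of that of [phi] inside the fundamental interval. If
    [y < x], then [psi y = 0], and the wrapped position [y + period] is beyond the window. *)
Lemma psi_exch x y : p1 <= x <= p2 -> incube m y -> psi (x + exch m x y) = psi y.
Proof.
move=> /andP[x1 x2] /andP[y1 y2]; rewrite /exch y1 y2 andbT /=; case: ltP => xy.
  have -> : psi y = 0 by apply/eqP; apply: contraT => /psiE /andP[? ?]; slra.
  apply/eqP; apply: contraT => /psiE /andP[_]; rewrite periodD => h; exfalso; move: h; slra.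
by rewrite addrC subrK.
Qed.

Definition pair_stat u : R := lin phi u * lin psi u.
Definition trunc_stat (K L : R) u : R := Num.min (lin phi u) K * Num.min (lin psi u) L.

Let phipsi x : phi x * psi x = 0.
Proof.
have [->|p] := eqVneq (phi x) 0; first by rewrite mul0r.
have [->|q] := eqVneq (psi x) 0; first by rewrite mulr0.
by have /andP[? ?] := phiE p; have /andP[? ?] := psiE q; slra.
Qed.

(** The supports being disjoint, a point counted by [phi] contributes nothing to the sum of [psi],
    so [psi] may be summed over the remaining points. *)
Lemma pair_palm u : size u = m.+1 -> pair_stat u = palm_sum m phi (fun _ s => lin psi s) u.
Proof.
move=> um; rewrite /pair_stat (lin_nth phi um) mulr_suml; apply: eq_bigr => i _.
by rewrite (@lin_dropi psi i u) ?um// mulrDr phipsi add0r.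
Qed.

Definition over L u : R := Num.max 0 (lin psi u - L).

Lemma over_palm L u : size u = m.+1 ->
  lin phi u * over L u = palm_sum m phi (fun _ s => over L s) u.
Proof.
move=> um; rewrite (lin_nth phi um) mulr_suml; apply: eq_bigr => i _; rewrite /over.
have [->|p] := eqVneq (phi u`_i) 0; first by rewrite !mul0r.
have q : psi u`_i = 0 by have := phipsi u`_i => /eqP; rewrite mulf_eq0 (negbTE p) /= => /eqP.
by rewrite (@lin_dropi psi i u) ?um// q add0r.
Qed.

Lemma smeas_palm_lin i : (i <= m)%N ->
  smeas m.+1 (EFin \o (fun u => phi u`_i * lin psi (dropi i u))).
Proof.
move=> im; apply/measurable_EFinP; apply: measurable_funM; last exact: measurable_lin_dropi.
by apply: (measurableT_comp mphi); exact: measurable_nth.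
Qed.

Lemma smeas_palm_over L i : (i <= m)%N ->
  smeas m.+1 (EFin \o (fun u => phi u`_i * over L (dropi i u))).
Proof.
move=> im; apply/measurable_EFinP; apply: measurable_funM.
  by apply: (measurableT_comp mphi); exact: measurable_nth.
by apply: measurable_maxr => //; apply: measurable_funB => //; exact: measurable_lin_dropi.
Qed.

Lemma over_ge0 L u : 0 <= over L u. Proof. by rewrite /over le_max lexx. Qed.

Lemma lin_size_le u k : size u = k -> lin psi u <= c * k%:R.
Proof. by move=> <-; apply: lin_le => x; case/andP: (psic x). Qed.

Lemma over_le L u k : 0 <= L -> size u = k -> over L u <= c * k%:R.
Proof.
move=> L0 uk; rewrite /over ge_max mulr_ge0//= lerBlDr (le_trans (lin_size_le uk))//.
by rewrite lerDl.
Qed.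

Lemma test1_psi_shift x : test1 (fun y => psi (x + y)).
Proof.
split; [|by move=> y; exact: psi0|by exists c => y; case/andP: (psic (x + y))].
apply: (measurableT_comp mpsi); exact: measurable_funD.
Qed.

Lemma obs_lin_shift x : obs m (lin (fun y => psi (x + y))).
Proof.
split; first by move=> z; apply: lin_ge0 => y; exact: psi0.
- apply: (@eqfun_measurable _ _ _ _ (fun z : m.-tuple R => (\sum_(j < m) psi (x + z`_j))%:E)).
    by move=> z; rewrite -(lin_nth (fun y => psi (x + y)) (size_tuple z)).
  apply/measurable_EFinP; apply: measurable_sum => j.
  case: (test1_psi_shift x) => mt _ _; apply: (measurableT_comp mt); exact: measurable_nth.
- by exists (c * m%:R) => z <-; apply: lin_le => y; case/andP: (psic (x + y)).
Qed.

Lemma obs_over_shift L x : 0 <= L -> obs m (fun z => Num.max 0 (lin (fun y => psi (x + y)) z - L)).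
Proof.
move=> L0; have [l0 ml [M lM]] := obs_lin_shift x; split.
- by move=> z; rewrite le_max lexx.
- apply/measurable_EFinP; apply: measurable_maxr => //; apply: measurable_funB => //.
  exact/measurable_EFinP.
- exists M => z zm; rewrite ge_max (le_trans (l0 z) (lM z zm))/=.
  by rewrite lerBlDr (le_trans (lM z zm))// lerDl.
Qed.

Lemma lin_exch x s : p1 <= x <= p2 -> cube m s ->
  lin psi s = lin (fun y => psi (x + y)) (map (exch m x) s).
Proof.
move=> hx /allP cs; rewrite lin_map /lin; apply: eq_big_seq => y ys.
by rewrite psi_exch//; exact: cs.
Qed.

Lemma Ex_lin x : ((Ex m b (lin (fun y => psi (x + y))))%:E =
  \int[mu]_y (psi (x + y) * gasR m b y)%:E)%E.
Proof.
have tp := test1_psi_shift x; have [mt _ _] := tp.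
rewrite (_ : Ex m b _ = Ex m b (fun z => \sum_(k < m.+1 | (0 < k)%N) psi (x + pt z k))); last first.
  by apply: eq_Ex => // z zm _; rewrite lin_pt.
rewrite Ex_sum//; last by move=> k; exact: (obs_pt m k tp).
rewrite -sumEFin big_mkcond/=.
transitivity (\sum_(k < m.+1) \int[mu]_y (if (0 < k)%N then (psi (x + y) * dens m b k y)%:E else 0))%E.
  apply: eq_bigr => k _; case: ifP => k0; last by rewrite integral0.
  have km : (0 < k <= m)%N by rewrite k0 -ltnS ltn_ord.
  by rewrite (Ex_dens b0 km tp).
rewrite -ge0_integral_sum//.
- apply: eq_integral => y _; rewrite -big_mkcond /= sumEFin; congr EFin.
  by rewrite /gasR mulr_sumr.
- move=> k; have [k0|_] := boolP (0 < k)%N; last exact: measurable_cst.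
  have km : (0 < k <= m)%N by rewrite k0 -ltnS ltn_ord.
  by apply/measurable_EFinP; apply: measurable_funM => //; exact: measurable_dens.
- by move=> k y _; case: ifP => // _; rewrite lee_fin mulr_ge0// dens_ge0.
Qed.

(** The first [K] points contribute at most [c K <= L]. Each later one contributes at most [c], and
    only if it is within [q2 - p1] of the pinned point. *)
Lemma Ex_over K L x : p1 <= x -> 0 <= L -> c * K%:R <= L ->
  Ex m b (fun z => Num.max 0 (lin (fun y => psi (x + y)) z - L)) <=
  c * \sum_(k < m.+1 | (K < k)%N) cdf m b k (q2 - p1).
Proof.
move=> xp L0 cK; have oc k := obs_pt m k (test1_le (q2 - p1)).
rewrite mulr_sumr (_ : \sum_(_ | _) _ = Ex m b (fun z => \sum_(k < m.+1 | (K < k)%N) c * (pt z k <= q2 - p1)%R%:R)); last first.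
  rewrite Ex_sum//; last by move=> k; apply: obsM => //; exact: obs_cst.
  by apply: eq_bigr => k _; rewrite ExZ.
apply: Ex_le => //; first exact: obs_over_shift.
  by apply: obs_sum => k; apply: obsM => //; exact: obs_cst.
move=> z zm w0; rewrite ge_max; apply/andP; split.
  by apply: sumr_ge0 => k _; rewrite mulr_ge0.
rewrite (lin_pt _ zm) lerBlDl (bigID (fun k : 'I_m.+1 => (k <= K)%N))/=.
apply: lerD.
  apply: le_trans cK; apply: (@le_trans _ _ (\sum_(k < m.+1 | (0 < k)%N && (k <= K)%N) c)).
    by apply: ler_sum => k _; case/andP: (psic (x + pt z k)).
  rewrite sumr_const -[leLHS]mulr_natr ler_wpM2l// ler_nat.
  rewrite -sum1_card -(big_mkord (fun k => (0 < k)%N && (k <= K)%N) (fun=> 1%N)).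
  apply: (@leq_trans (\sum_(1 <= k < K.+1) 1)%N); last by rewrite sum_nat_const_nat subn1 muln1.
  case: (leqP m.+1 K.+1) => h.
    rewrite [leqRHS](@big_cat_nat _ _ _ m.+1)//= [leqLHS]big_ltn_cond//= -[leqLHS]addn0; apply: leq_add => //.
    rewrite big_nat_cond [leqRHS]big_nat; rewrite (eq_bigl (fun i => 1 <= i < m.+1)%N)//; move=> i; nlia.
  rewrite (@big_cat_nat _ _ _ K.+1)//=; last exact: ltnW.
  rewrite [X in (_ + X)%N]big_nat_cond [X in (_ + X)%N]big1 ?addn0; last by move=> i; nlia.
  rewrite big_ltn_cond//= big_nat_cond [leqRHS]big_nat (eq_bigl (fun i => 1 <= i < K.+1)%N)//; move=> i; nlia.
rewrite (eq_bigl (fun k : 'I_m.+1 => (K < k)%N)); last by move=> k; rewrite -ltnNge; nlia.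
apply: ler_sum => k _; case: (leP (pt z k)) => h; first by rewrite mulr1; case/andP: (psic (x + pt z k)).
rewrite mulr0 (_ : psi _ = 0)//; apply/eqP; apply: contraT => /psiE /andP[_ h2]; slra.
Qed.

(** Counting to the right only makes the count a function of gaps in one direction, to be compared
    with [X_K]. *)
Definition right_count x s : nat := count (fun y => x < y <= p2) s.

Lemma count_exch x s : p1 <= x <= p2 -> cube m s ->
  right_count x s = count (fun y => 0 < y <= p2 - x) (map (exch m x) s).
Proof.
move=> /andP[x1 x2] /allP cs; rewrite /right_count count_map; apply: eq_in_count => y /cs /andP[y1 y2].
rewrite /= /exch y1 y2 andbT /=; case: (ltP y x) => xy.
  rewrite (_ : (x < y) && (_ <= p2) = false); last by rewrite ltNge (ltW xy).
  apply/esym/negbTE; rewrite negb_and -!ltNge -leNgt periodD; apply/orP; right; slra.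
by apply/idP/idP => /andP[? ?]; apply/andP; split; slra.
Qed.

Lemma Ex_count K x : p1 <= x -> (0 < K <= m)%N ->
  Ex m b (fun z => ((K <= count (fun y => (0 < y <= p2 - x)%R) z)%N)%:R) <= cdf m b K (p2 - p1).
Proof.
move=> xp /andP[K0 Km].
have oC : obs m (fun z => ((K <= count (fun y => (0 < y <= p2 - x)%R) z)%N)%:R).
  split => //; last by exists 1 => z _; rewrite lern1 leq_b1.
  apply: (@eqfun_measurable _ _ _ _ (fun z : m.-tuple R => ((K%:R <= \sum_(j < m) ((0 < z`_j <= p2 - x)%R)%:R :> R)%R%:R : R)%:E)).
    move=> z; rewrite -(lin_nth (fun y => (0 < y <= p2 - x)%R%:R) (size_tuple z)).
    by rewrite (lin_count (fun y => 0 < y <= p2 - x)) ler_nat.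
  apply/measurable_EFinP; case: (test1_ge (K%:R : R)) => mt _ _; apply: (measurableT_comp mt).
  have mb : measurable_fun setT (fun y : R => ((0 < y <= p2 - x)%R)%:R : R).
    apply: (@measurable_indb _ _ _ (fun y => 0 < y <= p2 - x)).
    rewrite (_ : [set _ | _] = `]0, p2 - x]%classic); first exact: measurable_itv.
    by apply/seteqP; split => y /=; rewrite in_itv.
  by apply: measurable_sum => j; apply: (measurableT_comp mb); exact: measurable_nth.
apply: Ex_le => //; first exact: (obs_pt m K (test1_le _)).
move=> z zm w0; rewrite ler_nat; case: (leP (pt z K)) => [_|h]; first exact: leq_b1.
rewrite leqn0 eqb0 -ltnNge.
suff : (count (fun y => 0 < y <= p2 - x) z)%:R < K%:R :> R by rewrite ltr_nat.
rewrite -lin_count lin_pt//.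
apply: (@le_lt_trans _ _ (\sum_(k < m.+1 | (0 < k)%N && (k < K)%N) 1)).
  rewrite [leRHS]big_mkcondr /=; apply: ler_sum => k k0; case: ltnP => kK; first by rewrite lern1; case: (_ && _).
  rewrite (_ : (0 < pt z k <= p2 - x) = false)//; apply/negbTE; rewrite negb_and -!ltNge; apply/orP; right.
  have := weight_pt w0 zm (_ : (K <= k <= m)%N); rewrite kK -ltnS ltn_ord => /(_ isT).
  by move: h; slra.
rewrite sumr_const ltr_nat -sum1_card.
apply: (@leq_ltn_trans (\sum_(k < K | (0 < k)%N) 1)%N).
  rewrite -(big_mkord (fun k => (0 < k)%N && (k < K)%N) (fun=> 1%N)).
  by rewrite -(big_mkord (fun k => (0 < k)%N) (fun=> 1%N)) (big_nat_widen _ K m.+1)// ltnW// ltnS.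
case: K K0 {Km oC h} => // K _.
rewrite big_mkcond big_ord_recl /= add0n ltnS.
by rewrite sum_nat_const card_ord muln1.
Qed.

(** All the selected points but the leftmost one lie to the right of it, so there are at most
    [K - 1] others. *)
Lemma size_top_le (w : seq R) (K : nat) (A : pred R) : uniq w ->
  (forall x, x \in w -> A x -> (count (fun y => (x < y)%R) w < K)%N) -> (count A w <= K)%N.
Proof.
move=> uw H; rewrite -size_filter; set a := seq.filter A w.
case: (posnP (size a)) => [->//|a0].
have [x0 x0a minx] : exists2 x0, x0 \in a & forall y, y \in a -> x0 <= y.
  elim: a a0 => // x a IH _; case: (posnP (size a)) => [/size0nil ->|/IH [y ya hy]].
    by exists x; rewrite ?inE// => y; rewrite inE => /eqP ->.
  case: (leP x y) => xy.
    exists x; rewrite ?inE ?eqxx// => z; rewrite inE => /orP[/eqP ->//|/hy].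
    exact: le_trans.
  exists y; rewrite ?inE ?ya ?orbT// => z; rewrite inE => /orP[/eqP ->|/hy//].
  exact: ltW.
move: (x0a); rewrite mem_filter => /andP[Ax0 x0w].
have := H _ x0w Ax0; apply: leq_trans; rewrite -size_filter.
have -> : size a = (size (rem x0 a)).+1 by rewrite size_rem// prednK.
rewrite ltnS; apply: uniq_leq_size; first by rewrite rem_uniq// filter_uniq.
move=> y; rewrite mem_rem_uniq ?filter_uniq// !inE => /andP[yx ya].
rewrite mem_filter lt_neqAle eq_sym yx minx//=.
by move: ya; rewrite mem_filter => /andP[].
Qed.

Definition winb x : R := (p1 <= x <= p2)%R%:R.

(** Of the points in the window, at most [K] have fewer than [K] points of the window to their
    right. So the excess over [K] is bounded by the number of the other points, a sum to which the
    Palm formula applies. *)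
Lemma excess_palm K u : size u = m.+1 -> uniq u ->
  Num.max 0 (lin phi u - c * K%:R) <=
  c * palm_sum m winb (fun x s => ((K <= right_count x s)%N)%:R) u.
Proof.
move=> um uu; pose W x := p1 <= x <= p2.
have P0 : 0 <= palm_sum m winb (fun x s => ((K <= right_count x s)%N)%:R) u.
  by apply: sumr_ge0 => i _; rewrite mulr_ge0.
rewrite ge_max mulr_ge0//=.
have PE : palm_sum m winb (fun x s => ((K <= right_count x s)%N)%:R) u =
    (count (fun x => W x && (K <= right_count x u)%N) u)%:R.
  rewrite -lin_count (lin_nth _ um); apply: eq_bigr => i _; rewrite /winb -/(W _) -natrM mulnb.
  congr (_%:R); congr (_ && (_ <= _)%N); have := lin_dropi (fun y => ((u`_i < y <= p2)%R)%:R) (_ : (i < size u)%N).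
  rewrite um => /(_ (ltn_ord i)); rewrite !lin_count ltxx /= add0r => /eqP; rewrite eqr_nat => /eqP.
  by rewrite /right_count => ->.
have linc : lin phi u <= c * (count W u)%:R.
  rewrite -lin_count /lin mulr_sumr; apply: ler_sum => x _.
  have [->|p] := eqVneq (phi x) 0; first by rewrite mulr_ge0.
  by rewrite /W (phiE p) mulr1; case/andP: (phic x).
rewrite PE lerBlDr (le_trans linc)// -mulrDr ler_wpM2l// -natrD ler_nat.
have cnt : (count (fun x => W x && (right_count x u < K)%N) u <= K)%N.
  have -> : count (fun x => W x && (right_count x u < K)%N) u =
            count (fun x => (right_count x u < K)%N) (seq.filter W u).
    by rewrite count_filter; apply: eq_count => x /=; rewrite andbC.
  apply: size_top_le; first exact: filter_uniq.
  move=> x; rewrite mem_filter => /andP[Wx _] h; apply: leq_ltn_trans h.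
  rewrite count_filter /right_count; apply: sub_count => y /= /andP[xy /andP[_ ->]].
  by rewrite xy.
have -> : count W u = (count (fun x => W x && (K <= right_count x u)%N) u +
    count (fun x => W x && (right_count x u < K)%N) u)%N.
  elim: (u) {2 4}u => //= x v IH w; rewrite (IH w); case: (W x) => //=.
  by case: ltnP => h /=; rewrite ?add0n ?add1n ?addn1 ?addnS// addSn.
by rewrite leq_add2l.
Qed.

Lemma obs_lin k f : measurable_fun setT f -> (forall x, 0 <= f x <= c) -> obs k (lin f).
Proof.
move=> mf fc; split; first by move=> u; apply: lin_ge0 => y; case/andP: (fc y).
- apply: (@eqfun_measurable _ _ _ _ (fun u : k.-tuple R => (\sum_(j < k) f u`_j)%:E)).
    by move=> u; rewrite -(lin_nth f (size_tuple u)).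
  apply/measurable_EFinP; apply: measurable_sum => j.
  by apply: (measurableT_comp mf); exact: measurable_nth.
- by exists (c * k%:R) => u <-; apply: lin_le => y; case/andP: (fc y).
Qed.

Lemma obs_min k (f : seq R -> R) L : 0 <= L -> obs k f -> obs k (fun u => Num.min (f u) L).
Proof.
move=> L0 [f0 mf [M fM]]; split; first by move=> u; rewrite le_min f0.
- by apply/measurable_EFinP; apply: measurable_minr => //; exact/measurable_EFinP.
- by exists M => u uk; rewrite ge_min fM.
Qed.

Lemma obs_excess k (f : seq R -> R) L : 0 <= L -> obs k f -> obs k (fun u => Num.max 0 (f u - L)).
Proof.
move=> L0 [f0 mf [M fM]]; split; first by move=> u; rewrite le_max lexx.
- apply/measurable_EFinP; apply: measurable_maxr => //; apply: measurable_funB => //.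
  exact/measurable_EFinP.
- exists M => u uk; rewrite ge_max (le_trans (f0 u) (fM u uk))/=.
  by rewrite lerBlDr (le_trans (fM u uk))// lerDl.
Qed.

Let oL := obs_lin m.+1 mphi phic.
Let oP := obs_lin m.+1 mpsi psic.

Lemma obs_pair : obs m.+1 pair_stat.
Proof. exact: obsM. Qed.

Lemma obs_trunc K L : 0 <= K -> 0 <= L -> obs m.+1 (trunc_stat K L).
Proof. by move=> K0 L0; apply: obsM; exact: obs_min. Qed.

Lemma trunc_le_pair K L : 0 <= K -> 0 <= L ->
  cmean m b (trunc_stat K L) <= cmean m b pair_stat.
Proof.
move=> K0 L0; apply: cmean_le => //; [exact: obs_trunc|exact: obs_pair|].
move=> u um _ _; have l0 := lin_ge0 u phi0; have s0 := lin_ge0 u psi0.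
by rewrite /trunc_stat /pair_stat ler_pM ?le_min ?l0 ?s0 ?K0 ?L0 ?ge_min ?lexx.
Qed.

Lemma pi2_inv : 0 <= (2 * (pi : R))^-1 <= 1.
Proof.
have p_2 : 2 <= (pi : R) by exact: pi_ge2.
by rewrite invr_ge0 mulr_ge0 ?pi_ge0//= invf_le1 ?mulr_gt0 ?pi_gt0//; move: (pi : R) p_2 => p; lra.
Qed.

Lemma cmean_pair : ((cmean m b pair_stat)%:E =
  ((2 * pi)^-1)%:E * \int[mu]_x (phi x * Ex m b (lin (fun y => psi (x + y))))%:E)%E.
Proof.
have D0 x s : size s = m -> lin psi s <= c * m%:R by exact: lin_size_le.
have l0 (f : R -> R) s : (forall y, 0 <= f y) -> 0 <= lin f s by exact: lin_ge0.
rewrite (eq_cmean (fun u um _ => pair_palm um)) (cmean_palm b0 (g := fun x z => lin (fun y => psi (x + y)) z))//.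
- by move=> x s; exact: l0.
- by move=> x z; apply: l0 => y.
- exact: smeas_palm_lin.
- by move=> x _ _; exact: obs_lin_shift.
- by move=> x _ _; exact: lin_isym.
- by move=> x _ /phiE hx s _ cs; exact: lin_exch.
- by apply: (obs_palm phic (D := c * m%:R)) => //; [move=> x s; exact: l0|exact: smeas_palm_lin].
- by move=> x; apply: contraNeq => /phiE; exact: window_incube.
Qed.

(** The prefactor [1 / (2 pi)] is simply bounded by 1. *)
Lemma window_integral (h : R -> R) (D : R) : 0 <= D -> (forall x, 0 <= h x) ->
  (forall x, p1 <= x <= p2 -> h x <= D) -> (forall x, ~~ (p1 <= x <= p2) -> h x = 0) ->
  measurable_fun setT h -> (((2 * pi)^-1)%:E * \int[mu]_x (h x)%:E <= (D * (p2 - p1))%:E)%E.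
Proof.
move=> D0 h0 hD hE mh; have /andP[i0 i1] := pi2_inv.
have I0 : (0 <= \int[mu]_x (h x)%:E)%E by apply: integral_ge0 => x _; rewrite lee_fin.
apply: (@le_trans _ _ (\int[mu]_x (h x)%:E)%E).
  by rewrite -[leRHS]mul1e lee_wpmul2r// lee_fin.
apply: (@le_trans _ _ (\int[mu]_(x in `[p1, p2]%classic) (cst D%:E x))%E).
  rewrite [leRHS]integral_mkcond; apply: ge0_le_integral => //.
  - by move=> x _; rewrite lee_fin.
  - exact/measurable_EFinP.
  - by apply/(measurable_restrictT _ _).1.
  - move=> x _; rewrite patchE mem_setE in_itv/=; case: ifPn => hx; first by rewrite lee_fin hD.
    by rewrite lee_fin hE.
rewrite integral_cst//= lebesgue_measure_itv/= lte_fin; case: ltP => p12'.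
  by rewrite -EFinB -EFinM.
by rewrite mule0 lee_fin mulr_ge0//; slra.
Qed.

Lemma measurable_Ex (g : R -> seq R -> R) : (forall x z, 0 <= g x z) ->
  measurable_fun [set: R * m.-tuple R] (fun p => g p.1 p.2) ->
  measurable_fun setT (fun x => Ex m b (g x)).
Proof.
move=> g0 mg; apply: measurable_funM => //; apply: measurableT_comp => //.
apply: (@measurable_iint _ _ R m (fun x z => (gibbs m b z * g x z)%:E)).
  by move=> x z; rewrite lee_fin mulr_ge0 ?gibbs_ge0.
apply/measurable_EFinP; apply: measurable_funM => //.
apply: (measurableT_comp (f := fun s : m.-tuple R => gibbs m b s) (g := fun p : R * m.-tuple R => p.2)).
  exact: measurable_gibbs.
exact: measurable_snd.
Qed.

Lemma cmean_over K L : 0 <= L -> c * K%:R <= L ->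
  cmean m b (fun u => lin phi u * over L u) <=
  c ^+ 2 * (p2 - p1) * \sum_(k < m.+1 | (K < k)%N) cdf m b k (q2 - p1).
Proof.
move=> L0 cK; set S := \sum_(_ | _) _.
have S0 : 0 <= S by apply: sumr_ge0 => k _; exact: cdf_ge0.
pose g x z := Num.max 0 (lin (fun y => psi (x + y)) z - L).
have g0 x z : 0 <= g x z by rewrite le_max lexx.
rewrite -lee_fin (eq_cmean (fun u um _ => over_palm L um)) (cmean_palm b0 (g := g))//.
- rewrite (_ : c ^+ 2 * (p2 - p1) * S = c * (c * S) * (p2 - p1)); last by ring.
  apply: window_integral.
  + by rewrite mulr_ge0// mulr_ge0.
  + by move=> x; rewrite mulr_ge0// Ex_ge0.
  + move=> x /andP[x1 _]; apply: ler_pM => //; first exact: Ex_ge0.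
      by case/andP: (phic x).
    exact: Ex_over.
  + by move=> x hx; have [->|/phiE h] := eqVneq (phi x) 0; [rewrite mul0r|rewrite h in hx].
  + apply: measurable_funM => //; apply: measurable_Ex => //; apply: measurable_maxr => //; apply: measurable_funB => //.
    apply: (@eqfun_measurable _ _ _ _ (fun p : R * m.-tuple R => \sum_(j < m) psi (p.1 + p.2`_j))).
      by move=> p; rewrite -(lin_nth (fun y => psi (p.1 + y)) (size_tuple p.2)).
    apply: measurable_sum => j; apply: (measurableT_comp mpsi); apply: measurable_funD => //.
    by apply: (measurableT_comp (measurable_nth j)); exact: measurable_snd.
- by move=> x s; exact: over_ge0.
- exact: smeas_palm_over.
- by move=> x _ _; exact: obs_over_shift.
- by move=> x _ _ k y s; rewrite /g lin_isym.
- by move=> x _ /phiE hx s _ cs; rewrite /over /g (lin_exch hx cs).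
- apply: (obs_palm phic (D := c * m%:R)) => //; [by move=> x s; exact: over_ge0| |exact: smeas_palm_over].
  by move=> x s; exact: over_le.
- by move=> x; apply: contraNeq => /phiE; exact: window_incube.
Qed.

Lemma measurable_winb : measurable_fun setT winb.
Proof.
apply: (@measurable_indb _ _ _ (fun x => p1 <= x <= p2)).
rewrite (_ : [set _ | _] = `[p1, p2]%classic); first exact: measurable_itv.
by apply/seteqP; split => y /=; rewrite in_itv.
Qed.

Lemma measurable_between (a d : R) : measurable_fun setT (fun p : R * R => (p.1 + a < p.2 <= d)%R%:R : R).
Proof.
apply: (@eqfun_measurable _ _ _ _ (fun p : R * R => (0 < p.2 - p.1 - a)%R%:R * (p.2 <= d)%R%:R : R)).
  by move=> p; rewrite -natrM mulnb; congr ((_ && _)%:R); apply/idP/idP; lra.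
apply: measurable_funM.
  case: (test1_gt (0 : R)) => mt _ _; apply: (measurableT_comp mt).
  by apply: measurable_funB => //; apply: measurable_funB.
by case: (test1_le d) => mt _ _; apply: (measurableT_comp mt).
Qed.

Lemma cmean_excess K : (0 < K <= m)%N ->
  cmean m b (fun u => Num.max 0 (lin phi u - c * K%:R)) <= c * (p2 - p1) * cdf m b K (p2 - p1).
Proof.
move=> Km; have cK0 : 0 <= c * K%:R by rewrite mulr_ge0.
pose G x s : R := ((K <= right_count x s)%N)%:R.
pose g x z : R := ((K <= count (fun y => (0 < y <= p2 - x)%R) z)%N)%:R.
have w01 x : 0 <= winb x <= 1 by rewrite /winb lern1 leq_b1 ler0n.
have wE x : winb x != 0 -> p1 <= x <= p2 by rewrite /winb pnatr_eq0 eqb0 negbK.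
have mG i : (i <= m)%N -> smeas m.+1 (EFin \o (fun u => winb u`_i * G u`_i (dropi i u))).
  move=> im; apply/measurable_EFinP; apply: measurable_funM.
    by apply: (measurableT_comp measurable_winb); exact: measurable_nth.
  apply: (@eqfun_measurable _ _ _ _ (fun u : m.+1.-tuple R => (K%:R <= \sum_(j < m.+1) (u`_i < u`_j <= p2)%R%:R :> R)%R%:R : R)).
    move=> u; rewrite -(lin_nth (fun y => (u`_i < y <= p2)%R%:R) (size_tuple u)).
    rewrite (@lin_dropi _ i u) ?size_tuple// ltxx /= add0r (lin_count (fun y => u`_i < y <= p2)).
    by rewrite ler_nat.
  case: (test1_ge (K%:R : R)) => mt _ _; apply: (measurableT_comp mt).
  apply: measurable_sum => j.
  have := measurable_between 0 p2 => mb.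
  apply: (@eqfun_measurable _ _ _ _ (fun u : m.+1.-tuple R => ((u`_i + 0 < u`_j <= p2)%R)%:R : R)).
    by move=> u; rewrite addr0.
  apply: (measurableT_comp (f := fun p : R * R => (p.1 + 0 < p.2 <= p2)%R%:R : R) (g := fun u : m.+1.-tuple R => (u`_i, u`_j)) mb).
  by apply/measurable_fun_pairP; split; exact: measurable_nth.
have oP' : obs m.+1 (palm_sum m winb G).
  by apply: (obs_palm w01 (D := 1)) => // x s _; rewrite lern1 leq_b1.
apply: (@le_trans _ _ (c * cmean m b (palm_sum m winb G))).
  rewrite -cmeanZ//; apply: cmean_le => //.
  - exact: obs_excess.
  - by apply: obsM => //; exact: obs_cst.
  - by move=> u um uu _; exact: excess_palm.
rewrite -mulrA ler_wpM2l// mulrC -lee_fin (cmean_palm b0 (g := g))//.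
- apply: window_integral.
  + exact: cdf_ge0.
  + by move=> x; rewrite mulr_ge0 ?Ex_ge0//; case/andP: (w01 x).
  + move=> x hx; rewrite /winb hx mul1r; case/andP: hx => xp _; exact: Ex_count.
  + by move=> x /negbTE hx; rewrite /winb hx mul0r.
  + apply: measurable_funM; first exact: measurable_winb.
    apply: measurable_Ex => //.
    apply: (@eqfun_measurable _ _ _ _ (fun p : R * m.-tuple R => (K%:R <= \sum_(j < m) (0 < p.2`_j <= p2 - p.1)%R%:R :> R)%R%:R : R)).
      move=> p; rewrite -(lin_nth (fun y => (0 < y <= p2 - p.1)%R%:R) (size_tuple p.2)).
      by rewrite (lin_count (fun y => 0 < y <= p2 - p.1)) ler_nat.
    case: (test1_ge (K%:R : R)) => mt _ _; apply: (measurableT_comp mt).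
    apply: measurable_sum => j.
    apply: (@eqfun_measurable _ _ _ _ (fun p : R * m.-tuple R => (0 < p.2`_j)%R%:R * (p.2`_j + p.1 <= p2)%R%:R : R)).
      by move=> p; rewrite -natrM mulnb lerBrDr.
    have mj : measurable_fun setT (fun p : R * m.-tuple R => p.2`_j).
      by apply: (measurableT_comp (measurable_nth j)); exact: measurable_snd.
    apply: measurable_funM.
      by case: (test1_gt (0 : R)) => mt' _ _; apply: (measurableT_comp mt').
    by case: (test1_le p2) => mt' _ _; apply: (measurableT_comp mt'); exact: measurable_funD.
- move=> x _ _; split => //; last by exists 1 => z _; rewrite lern1 leq_b1.
  apply: (@eqfun_measurable _ _ _ _ (fun z : m.-tuple R => ((K%:R <= \sum_(j < m) ((0 < z`_j <= p2 - x)%R)%:R :> R)%R%:R : R)%:E)).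
    move=> z; rewrite -(lin_nth (fun y => (0 < y <= p2 - x)%R%:R) (size_tuple z)).
    by rewrite (lin_count (fun y => 0 < y <= p2 - x)) ler_nat.
  apply/measurable_EFinP; case: (test1_ge (K%:R : R)) => mt _ _; apply: (measurableT_comp mt).
  have mb : measurable_fun setT (fun y : R => ((0 < y <= p2 - x)%R)%:R : R).
    apply: (@measurable_indb _ _ _ (fun y => 0 < y <= p2 - x)).
    rewrite (_ : [set _ | _] = `]0, p2 - x]%classic); first exact: measurable_itv.
    by apply/seteqP; split => y /=; rewrite in_itv.
  by apply: measurable_sum => j; apply: (measurableT_comp mb); exact: measurable_nth.
- by move=> x _ _ k y s; rewrite /g (elimT seq.permP (perm_ins k y s)).
- by move=> x _ /wE hx s _ cs; rewrite /G /g count_exch.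
- by move=> x; apply: contraNeq => /wE; exact: window_incube.
Qed.

(** For non-negative [x], [y], the product [x y] is at most [min(x, L2) min(y, L) + x (y - L)^+ + L
    (x - L2)^+]. The means of the last two terms are bounded by [cmean_over] and [cmean_excess],
    with tails that are uniform in [m]. *)
Lemma pair_le_trunc K K2 : (0 < K2 <= m)%N ->
  cmean m b pair_stat <= cmean m b (trunc_stat (c * K2%:R) (c * K%:R)) +
    (c ^+ 2 * (p2 - p1) * \sum_(k < m.+1 | (K < k)%N) cdf m b k (q2 - p1) +
     c * K%:R * (c * (p2 - p1) * cdf m b K2 (p2 - p1))).
Proof.
move=> K2m; have k0 : 0 <= c * K%:R by rewrite mulr_ge0.
have k20 : 0 <= c * K2%:R by rewrite mulr_ge0.
have ot := obs_trunc k20 k0.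
have oo : obs m.+1 (fun u => lin phi u * over (c * K%:R) u) by apply: obsM => //; exact: obs_excess.
have oe := obs_excess k20 oL.
have oce : obs m.+1 (fun u => c * K%:R * Num.max 0 (lin phi u - c * K2%:R)).
  by apply: obsM => //; exact: obs_cst.
apply: (@le_trans _ _ (cmean m b (fun u => trunc_stat (c * K2%:R) (c * K%:R) u +
   (lin phi u * over (c * K%:R) u + c * K%:R * Num.max 0 (lin phi u - c * K2%:R))))).
  apply: cmean_le => //; [exact: obs_pair|by apply: obsD => //; exact: obsD|].
  move=> u _ _ _; rewrite /pair_stat /trunc_stat /over.
  have l0 := lin_ge0 u phi0; have s0 := lin_ge0 u psi0.
  move: (lin phi u) (lin psi u) l0 s0 k0 k20; move: (c * K%:R) (c * K2%:R) => L L2 x y x0 y0 L0 L20.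
  case: (leP x L2) => h1; case: (leP y L) => h2.
  - by rewrite lerDl addr_ge0// mulr_ge0// le_max lexx.
  - rewrite -[leLHS]addr0 (_ : x * y = x * L + x * (y - L)); last by ring.
    rewrite -addrA lerD2l addr0 -[leLHS]addr0 lerD//; last by rewrite mulr_ge0// le_max lexx.
    by rewrite ler_wpM2l// le_max lexx orbT.
  - rewrite (_ : x * y = L2 * y + (x - L2) * y); last by ring.
    rewrite lerD2l -[leLHS]add0r lerD//; first by rewrite mulr_ge0// le_max lexx.
    rewrite mulrC; apply: ler_pM => //; first by lra.
    by rewrite le_max lexx orbT.
  - rewrite (_ : x * y = L2 * L + (x * (y - L) + L * (x - L2))); last by ring.
    by rewrite lerD2l lerD// ler_wpM2l// le_max lexx orbT.
rewrite cmeanD//; last exact: obsD.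
rewrite lerD2l cmeanD// cmeanZ//; apply: lerD; first exact: cmean_over.
by rewrite ler_wpM2l// cmean_excess.
Qed.

End pair.
End statistics.

(** * Linear statistics of configurations *)

Section configurations.
Context {R : realType}.
Local Notation mu := (@lebesgue_measure R).
Implicit Types (S A B : set R) (f g : R -> R) (s : seq R).

Lemma lf_points S (r : R) : locally_finite S ->
  exists2 s : seq R, uniq s & [set` s] = S `&` `[- r, r].
Proof.
move=> lS; have /finite_seqP[s sE] := lS (- r) r.
exists (undup s); first exact: undup_uniq.
by rewrite sE; apply/seteqP; split=> x /=; rewrite mem_undup.
Qed.

Lemma linear_statistic_seq f S s : uniq s -> [set` s] `<=` S ->
  (forall x, S x -> f x != 0 -> x \in s) -> linear_statistic f S = lin f s.
Proof.
move=> us sS h; rewrite /linear_statistic -(fsbig_widen [set` s])//.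
  by rewrite -fsbig_seq.
move=> x [Sx xs] /=; apply/eqP; apply: contraT => fx; exfalso; exact: xs (h _ Sx fx).
Qed.

Lemma npoints_seq B S s : uniq s -> [set` s] `<=` S ->
  (forall x, S x -> B x -> x \in s) -> npoints S B = (lin \1_B s)%:E.
Proof.
move=> us sS h; pose t := seq.filter (fun x => x \in B) s.
have SE : S `&` B = [set` t].
  apply/seteqP; split => x /=.
    by move=> [Sx Bx]; rewrite mem_filter mem_set//= h.
  by rewrite mem_filter => /andP[/set_mem Bx xs]; split => //; exact: sS.
have ft : finite_set [set` t] by exact: finite_seq.
have E : fset_set [set` t] = finmap.seq_fset tt t.
  apply/finmap.fsetP => x; rewrite in_fset_set// finmap.seq_fsetE.
  by apply/idP/idP; rewrite inE.
rewrite /npoints SE /counting asboolT// E finmap.size_seq_fset undup_id ?filter_uniq//.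
rewrite size_filter -lin_count; congr EFin; exact: eq_bigr.
Qed.

Lemma linear_statistic_ge0 f S : (forall x, 0 <= f x) -> 0 <= linear_statistic f S.
Proof. by move=> f0; apply: fsumr_ge0. Qed.

Definition trunc_lin f g (a b : R) S : R :=
  Num.min (linear_statistic f S) a * Num.min (linear_statistic g S) b.

Lemma trunc_lin_ge0 f g (a b : R) S : (forall x, 0 <= f x) -> (forall x, 0 <= g x) ->
  0 <= a -> 0 <= b -> 0 <= trunc_lin f g a b S.
Proof. by move=> f0 g0 a0 b0; rewrite mulr_ge0// le_min linear_statistic_ge0. Qed.

Lemma trunc_lin_le f g (a b : R) S : (forall x, 0 <= f x) -> (forall x, 0 <= g x) ->
  0 <= a -> 0 <= b -> trunc_lin f g a b S <= a * b.
Proof.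
by move=> f0 g0 a0 b0; rewrite ler_pM ?le_min ?linear_statistic_ge0 ?a0 ?b0 ?ge_min ?lexx ?orbT.
Qed.

Lemma min_lip (a x y : R) : `|Num.min x a - Num.min y a| <= `|x - y|.
Proof.
rewrite ler_norml; case: (leP x a) => h1; case: (leP y a) => h2;
  case: (ger0P (x - y)) => h3; apply/andP; split; lra.
Qed.

(** Truncation is 1-Lipschitz in each linear statistic and bounds the factor multiplying the other
    increment, so the product is controlled by two test functions. *)
Lemma trunc_lin_vague f g (a b : R) : (forall x, 0 <= f x) -> (forall x, 0 <= g x) ->
  0 <= a -> 0 <= b -> continuous_compact_support f -> continuous_compact_support g ->
  vaguely_continuous (trunc_lin f g a b).
Proof.
move=> f0 g0 a0 b0 cf cg S _ e e0.
have ab0 : 0 < a + b + 1 by lra.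
exists 2%N, (fun i => if i == ord0 then f else g), (e / (a + b + 1)); split.
- by rewrite divr_gt0.
- by move=> i; case: ifP.
- move=> S' _ h; have := h ord0; have := h (lift ord0 ord0); rewrite /= => hg hf.
  have := min_lip a (linear_statistic f S') (linear_statistic f S).
  have := min_lip b (linear_statistic g S') (linear_statistic g S).
  have : 0 <= Num.min (linear_statistic f S) a <= a.
    by rewrite le_min linear_statistic_ge0 ?a0 ?ge_min ?lexx ?orbT.
  have : 0 <= Num.min (linear_statistic g S') b <= b.
    by rewrite le_min linear_statistic_ge0 ?b0 ?ge_min ?lexx ?orbT.
  rewrite /trunc_lin; move: (Num.min _ _) (Num.min _ _) (Num.min _ _) (Num.min _ _).
  move=> f' g' f1 g1 /andP[g0' gb] /andP[f0' fa] hg1 hf1.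
  have {}hg1 := le_lt_trans hg1 hg; have {}hf1 := le_lt_trans hf1 hf.
  have -> : f' * g1 - f1 * g' = (f' - f1) * g1 + f1 * (g1 - g') by ring.
  apply: le_lt_trans (ler_normD _ _) _; rewrite !normrM (ger0_norm g0') (ger0_norm f0').
  have d0 : 0 < e / (a + b + 1) by rewrite divr_gt0.
  apply: (@le_lt_trans _ _ (e / (a + b + 1) * b + a * (e / (a + b + 1)))).
    by apply: lerD; apply: ler_pM => //; exact: ltW.
  rewrite [X in _ + X]mulrC -mulrDr -[ltRHS](divfK (lt0r_neq0 ab0)).
  by rewrite ltr_pM2l//; lra.
Qed.

Lemma circular_mean_trunc m (beta : R) f g (a b c : R) : 0 < beta -> 0 <= a -> 0 <= b ->
  measurable_fun setT f -> measurable_fun setT g ->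
  (forall x, 0 <= f x <= c) -> (forall x, 0 <= g x <= c) ->
  circular_mean beta (fun th : m.+1.-tuple R => trunc_lin f g a b (scaled_angles th)) =
  cmean m beta (trunc_stat f g a b).
Proof.
move=> b0 a0 b0' mf mg fc gc.
rewrite -(circular_meanE b0 (F := fun th => trunc_lin f g a b [set m.+1%:R * x | x in [set` th]]))//.
  exact: (obs_trunc m mf mg fc gc).
move=> th uth; rewrite /trunc_lin /trunc_stat.
have E h : linear_statistic h [set m.+1%:R * x | x in [set` th]] = lin h [seq m.+1%:R * x | x <- th].
  have n0' : m.+1%:R != 0 :> R by rewrite pnatr_eq0.
  apply: linear_statistic_seq.
  - by rewrite map_inj_uniq//; exact: mulfI.
  - by move=> x /= /mapP[y yt ->]; exists y.
  - by move=> x /= [y yt <-] _; apply/mapP; exists y.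
by rewrite !E.
Qed.

Lemma circular_trunc_cvg (beta : R) (d : measure_display) (T : measurableType d)
    (P : probability T R) (Xi : T -> set R) f g (a b c : R) :
  circular_limit beta P Xi -> 0 < beta -> 0 <= a -> 0 <= b ->
  continuous_compact_support f -> continuous_compact_support g ->
  (forall x, 0 <= f x <= c) -> (forall x, 0 <= g x <= c) ->
  (cmean m beta (trunc_stat f g a b))%:E @[m --> \oo] -->
    (\int[P]_w (trunc_lin f g a b (Xi w))%:E)%E.
Proof.
move=> cl b0 a0 b0' cf cg fc gc.
have f0 x : 0 <= f x by case/andP: (fc x).
have g0 x : 0 <= g x by case/andP: (gc x).
have bd : exists M : R, forall S, `|trunc_lin f g a b S| <= M.
  exists (a * b) => S; rewrite ger0_norm ?trunc_lin_le//; exact: trunc_lin_ge0.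
have := cl _ (trunc_lin_vague f0 g0 a0 b0' cf cg) bd.
have mf (h : R -> R) : continuous_compact_support h -> measurable_fun setT h.
  by case=> ch _; exact: continuous_measurable_fun.
(* [cmean m] concerns [m.+1] points, so the sequence is shifted by one. *)
move=> h; rewrite -(cvg_shiftS _) in h.
apply: cvg_trans h; apply: near_eq_cvg; near=> m.
by rewrite /= -(circular_mean_trunc m b0 a0 b0' (mf _ cf) (mf _ cg) fc gc).
Unshelve. all: by end_near.
Qed.

Lemma sum_leq_minn N k : (\sum_(i < N) (i < k))%N = minn N k.
Proof. by elim: N => [|N IH]; rewrite ?big_ord0 ?min0n// big_ord_recr /= IH; nlia. Qed.

Section measurability.
Variables (d : measure_display) (T : measurableType d) (Xi : T -> set R).
Hypothesis spp : simple_point_process Xi.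
Variables (f : R -> R) (c r : R).
Hypothesis mf : measurable_fun setT f.
Hypothesis fc : forall x, 0 <= f x <= c.
Hypothesis fr : forall x, r < `|x| -> f x = 0.

(** This is [(j+1) f] rounded down, divided by [j+1], written as a sum of indicators of level sets.
    Its linear statistic is a finite combination of counts, whose measurability is part of the
    definition of a point process. *)
Let stair (j : nat) x : R := \sum_(i < (Num.truncn (j.+1%:R * c)).+1) j.+1%:R^-1 * \1_[set y | i.+1%:R <= j.+1%:R * f y] x.

Let stair_near j x : f x - j.+1%:R^-1 <= stair j x <= f x.
Proof.
have /andP[f0 f1] := fc x; have j0 : 0 < j.+1%:R :> R by [].
have y0 : 0 <= j.+1%:R * f x by rewrite mulr_ge0.
have E : stair j x = j.+1%:R^-1 * (Num.truncn (j.+1%:R * f x))%:R.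
  rewrite /stair -mulr_sumr; congr (_ * _).
  rewrite -[in RHS](@minn_idPr (Num.truncn (j.+1%:R * c)).+1 (Num.truncn (j.+1%:R * f x)) _); last first.
    by apply: leqW; apply: le_truncn; rewrite ler_wpM2l.
  rewrite -sum_leq_minn natr_sum; apply: eq_bigr => i _.
  rewrite indicE mem_setE; congr (_%:R); apply: congr1; rewrite truncn_ge_nat//.
have /andP[h1 h2] := truncn_itv y0.
rewrite E; apply/andP; split; last by rewrite ler_pdivrMl.
rewrite -[X in X - _](mulKf (lt0r_neq0 j0)) -[X in _ - X]mulr1 -mulrBr ler_pM2l ?invr_gt0//.
by rewrite lerBlDr natr1 ltW.
Qed.

Lemma stair_supp j x : stair j x != 0 -> x \in `[- r, r].
Proof.
have /andP[h1 h2] := stair_near j x.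
move=> s0; rewrite in_itv/=; rewrite -ler_norml leNgt; apply/negP => /fr fx.
have : 0 <= stair j x by apply: sumr_ge0 => i _; rewrite mulr_ge0 ?invr_ge0.
by move=> s1; move/eqP: s0; apply; apply/eqP; rewrite eq_le s1 -[X in _ <= X]fx h2.
Qed.

Lemma measurable_linear_statistic : measurable_fun setT (fun w => linear_statistic f (Xi w)).
Proof.
have [lf mN] := spp.
apply: (@measurable_fun_cvg _ _ _ _ (fun j w => linear_statistic (stair j) (Xi w))).
- move=> j; apply: (@eqfun_measurable _ _ _ _ (fun w => \sum_(i < (Num.truncn (j.+1%:R * c)).+1)
     j.+1%:R^-1 * fine (npoints (Xi w) [set y | i.+1%:R <= j.+1%:R * f y]))).
    move=> w; have [s us sE] := lf_points r (lf w).
    have sS : [set` s] `<=` Xi w by rewrite sE => x [].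
    rewrite (@linear_statistic_seq (stair j) _ _ us sS); last first.
      move=> x Xx /stair_supp xr; suff : [set` s] x by [].
      by rewrite sE.
    rewrite /lin exchange_big; apply: eq_bigr => i _.
    rewrite (@npoints_seq _ _ _ us sS) /=; last first.
      move=> x Xx fx; suff : [set` s] x by [].
      rewrite sE; split => //=; rewrite in_itv/= -ler_norml leNgt; apply/negP => /fr f0.
      by move: fx => /=; rewrite f0 mulr0 leNgt ltr0n.
    by rewrite /lin mulr_sumr.
  apply: measurable_sum => i; apply: measurable_funM => //.
  apply: measurableT_comp => //; apply: mN.
  have -> : [set y | i.+1%:R <= j.+1%:R * f y] = (fun y => j.+1%:R * f y) @^-1` `[i.+1%:R, +oo[.
    by apply/seteqP; split => y /=; rewrite in_itv/= andbT.
  rewrite -[X in measurable X]setTI; apply: measurable_funM => //.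
- move=> w _; have [s us sE] := lf_points r (lf w).
  have sS : [set` s] `<=` Xi w by rewrite sE => x [].
  have ins g : (forall x, g x != 0 -> x \in `[- r, r]) -> linear_statistic g (Xi w) = lin g s.
    move=> gr; apply: linear_statistic_seq => // x Xx /gr xr.
    by suff : [set` s] x by []; rewrite sE.
  rewrite (ins f); last first.
    move=> x; apply: contraNT; rewrite in_itv/= -ler_norml -ltNge => /fr ->; exact: eqxx.
  apply: (@cvg_trans _ (lin (stair j) s @[j --> \oo])).
    by apply: near_eq_cvg; near=> j; rewrite ins//; exact: stair_supp.
  apply/cvgrPdist_le => e e0; have [k ke] := nat_above ((size s)%:R / e).
  near=> j; rewrite /lin -sumrB; apply: le_trans (ler_norm_sum _ _ _) _.
  have j0 : 0 < j.+1%:R :> R by [].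
  apply: (@le_trans _ _ (\sum_(x <- s) j.+1%:R^-1)).
    apply: ler_sum => x _; have /andP[h1 h2] := stair_near j x.
    by rewrite ger0_norm ?subr_ge0// lerBlDr -lerBlDl.
  have -> : \sum_(x <- s) j.+1%:R^-1 = (size s)%:R / j.+1%:R :> R.
    by rewrite big_const_seq count_predT iter_addr_0 mulr_natl.
  rewrite ler_pdivrMr// -ler_pdivrMl// mulrC (le_trans (ltW ke))// ler_nat.
  by apply: leqW; near: j; exact: nbhs_infty_ge.
Unshelve. all: by end_near.
Qed.

End measurability.

End configurations.

Lemma mct (R : realType) (d : measure_display) (T : measurableType d)
    (P : measure T R) (h_ : nat -> T -> \bar R) (h : T -> \bar R) :
  (forall n, measurable_fun setT (h_ n)) -> (forall n x, 0 <= h_ n x)%E ->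
  (forall n x, h_ n x <= h_ n.+1 x)%E -> (forall x, h_ n x @[n --> \oo] --> h x) ->
  (\int[P]_x h_ n x)%E @[n --> \oo] --> (\int[P]_x h x)%E.
Proof.
move=> mh h0 hS hh.
rewrite (_ : (\int[P]_x h x)%E = (\int[P]_x limn (h_ ^~ x))%E); last first.
  by apply: eq_integral => x _; apply/esym/cvg_lim => //; exact: hh.
by apply: cvg_monotone_convergence => // x _; apply/nondecreasing_seqP => n; exact: hS.
Qed.

(** * The limiting pair density *)

Section pair_functional.
Context {R : realType}.
Local Notation mu := (@lebesgue_measure R).
Implicit Types (f g G : R -> R).

(* [G y] stands for the density of a pair of points at distance [y]. *)
Definition corr f g G : \bar R :=
  (\int[mu]_x ((f x)%:E * \int[mu]_y (g (x + y)%R * G y)%:E))%E.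

Lemma measurable_corr_prod g G : measurable_fun setT g -> measurable_fun setT G ->
  measurable_fun [set: R * R] (fun p : R * R => (g (p.1 + p.2) * G p.2)%:E).
Proof.
move=> mg mG; apply/measurable_EFinP; apply: measurable_funM.
  by apply: (measurableT_comp mg); apply: measurable_funD.
by apply: (measurableT_comp mG); exact: measurable_snd.
Qed.

Lemma measurable_corr_inner g G : measurable_fun setT g -> measurable_fun setT G ->
  (forall x, 0 <= g x) -> (forall x, 0 <= G x) ->
  measurable_fun setT (fun x : R => \int[mu]_y (g (x + y)%R * G y)%:E)%E.
Proof.
move=> mg mG g0 G0.
apply: (@measurable_fun_fubini_tonelli_F _ _ _ _ _ mu (fun p : R * R => (g (p.1 + p.2)%R * G p.2)%:E)).
- exact: measurable_corr_prod.
- by move=> p; rewrite lee_fin mulr_ge0.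
Qed.

Lemma measurable_corr_fun f g G : measurable_fun setT f -> measurable_fun setT g ->
  measurable_fun setT G -> (forall x, 0 <= g x) -> (forall x, 0 <= G x) ->
  measurable_fun setT (fun x : R => (f x)%:E * \int[mu]_y (g (x + y)%R * G y)%:E)%E.
Proof.
move=> mf mg mG g0 G0; apply: emeasurable_funM; last exact: measurable_corr_inner.
exact/measurable_EFinP.
Qed.

Lemma corr_fun_ge0 f g G x : (forall x, 0 <= f x) -> (forall x, 0 <= g x) -> (forall x, 0 <= G x) ->
  (0 <= (f x)%:E * \int[mu]_y (g (x + y)%R * G y)%:E)%E.
Proof.
move=> f0 g0 G0; apply: mule_ge0; first by rewrite lee_fin.
by apply: integral_ge0 => y _; rewrite lee_fin mulr_ge0.
Qed.

Lemma corr_ge0 f g G : (forall x, 0 <= f x) -> (forall x, 0 <= g x) -> (forall x, 0 <= G x) ->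
  (0 <= corr f g G)%E.
Proof. by move=> f0 g0 G0; apply: integral_ge0 => x _; exact: corr_fun_ge0. Qed.

Variables (f g : R -> R) (p1 p2 q1 q2 Mf Mg : R).
Hypothesis mf : measurable_fun setT f.
Hypothesis mg : measurable_fun setT g.
Hypothesis f0 : forall x, 0 <= f x.
Hypothesis g0 : forall x, 0 <= g x.
Hypothesis fE : forall x, f x != 0 -> p1 <= x <= p2.
Hypothesis gE : forall x, g x != 0 -> q1 <= x <= q2.
Hypothesis fM : (\int[mu]_x (f x)%:E = Mf%:E)%E.
Hypothesis gM : (\int[mu]_x (g x)%:E = Mg%:E)%E.

Lemma le_corr G1 G2 : measurable_fun setT G1 -> measurable_fun setT G2 ->
  (forall x, 0 <= G1 x) -> (forall x, 0 <= G2 x) ->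
  (forall y, q1 - p2 <= y <= q2 - p1 -> G1 y <= G2 y) -> (corr f g G1 <= corr f g G2)%E.
Proof.
move=> m1 m2 G10 G20 G12; apply: ge0_le_integral => //.
- by move=> x _; exact: corr_fun_ge0.
- exact: measurable_corr_fun.
- exact: measurable_corr_fun.
- move=> x _; have [->|/fE fx] := eqVneq (f x) 0; first by rewrite !mul0e.
  apply: lee_wpmul2l; first by rewrite lee_fin.
  apply: ge0_le_integral => //.
  + by move=> y _; rewrite lee_fin mulr_ge0.
  + by apply/measurable_EFinP; apply: measurable_funM => //; apply: (measurableT_comp mg); exact: measurable_funD.
  + by apply/measurable_EFinP; apply: measurable_funM => //; apply: (measurableT_comp mg); exact: measurable_funD.
  + move=> y _; rewrite lee_fin; have [->|/gE gy] := eqVneq (g (x + y)) 0; first by rewrite !mul0r.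
    apply: ler_wpM2l => //; apply: G12.
    by move: fx gy => /andP[? ?] /andP[? ?]; apply/andP; split; lra.
Qed.

Lemma corr_addc G (e : R) : measurable_fun setT G -> (forall x, 0 <= G x) -> 0 <= e ->
  (corr f g (fun y => (G y + e)%R) = corr f g G + (e * (Mf * Mg))%:E)%E.
Proof.
move=> mG G0 e0; rewrite /corr.
transitivity (\int[mu]_x ((f x)%:E * \int[mu]_y (g (x + y)%R * G y)%:E + (e * Mg)%:E * (f x)%:E))%E; last first.
  rewrite ge0_integralD//=.
  - rewrite ge0_integralZl//=.
    + by rewrite fM -EFinM; congr (_ + _%:E)%E; ring.
    + exact/measurable_EFinP.
    + by move=> x _; rewrite lee_fin.
    + rewrite lee_fin mulr_ge0// -lee_fin -gM; apply: integral_ge0 => x _; rewrite lee_fin//.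
  - by move=> x _; exact: corr_fun_ge0.
  - exact: measurable_corr_fun.
  - move=> x _; apply: mule_ge0; rewrite lee_fin// mulr_ge0// -lee_fin -gM.
    by apply: integral_ge0 => y _; rewrite lee_fin.
  - by apply: emeasurable_funM => //; exact/measurable_EFinP.
apply: eq_integral => x _; rewrite [X in (_ + X)%E]muleC.
have mgx : measurable_fun setT (fun y => g (x + y)).
  by apply: (measurableT_comp mg); exact: measurable_funD.
have gMx : (\int[mu]_y (g (x + y)%R)%:E = Mg%:E)%E.
  rewrite -gM -(@ge0_integral_shift _ x (fun y => (g y)%:E))//; last exact/measurable_EFinP.
  by apply: eq_integral => y _; rewrite addrC.
transitivity ((f x)%:E * \int[mu]_y ((g (x + y)%R * G y)%:E + e%:E * (g (x + y)%R)%:E))%E.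
  by congr (_ * _)%E; apply: eq_integral => y _; rewrite -EFinM -EFinD; congr EFin; ring.
rewrite ge0_integralD//=.
- rewrite ge0_integralZl//=.
  + rewrite gMx -EFinM ge0_muleDr//; last first.
      rewrite lee_fin mulr_ge0// -lee_fin -gM; apply: integral_ge0 => y _; rewrite lee_fin//.
    by apply: integral_ge0 => y _; rewrite lee_fin mulr_ge0.
  + exact/measurable_EFinP.
  + by move=> y _; rewrite lee_fin.
- by move=> y _; rewrite lee_fin mulr_ge0.
- by apply/measurable_EFinP; exact: measurable_funM.
- by move=> y _; rewrite -EFinM lee_fin mulr_ge0.
- by apply: emeasurable_funM => //; exact/measurable_EFinP.
Qed.

(** Only values of [G] at differences of the two supports matter, so closeness there suffices. *)
Lemma corr_close G1 G2 (e : R) : measurable_fun setT G1 -> measurable_fun setT G2 ->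
  (forall x, 0 <= G1 x) -> (forall x, 0 <= G2 x) -> 0 <= e ->
  (forall y, q1 - p2 <= y <= q2 - p1 -> G1 y <= G2 y + e) ->
  (corr f g G1 <= corr f g G2 + (e * (Mf * Mg))%:E)%E.
Proof.
move=> m1 m2 G10 G20 e0 G12; rewrite -corr_addc//; apply: le_corr => //.
- exact: measurable_funD.
- by move=> x; exact: addr_ge0.
Qed.

Lemma corr_cst (r : R) : 0 <= r -> corr f g (fun=> r) = (r * (Mf * Mg))%:E.
Proof.
move=> r0; have -> : (fun=> r) = (fun y : R => cst 0 y + r) :> (R -> R) by apply/funext => y /=; rewrite add0r.
rewrite corr_addc// (_ : corr f g (cst 0) = 0%E) ?add0e//.
apply: integral0_eq => x _; rewrite integral0_eq ?mule0// => y _.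
by rewrite /= mulr0.
Qed.

End pair_functional.

Lemma gasR_ge0 (R : realType) m (b x : R) : 0 <= gasR m b x.
Proof. by apply: sumr_ge0 => k _; exact: dens_ge0. Qed.

Lemma measurable_gasR (R : realType) m (b : R) : 0 < b -> measurable_fun setT (gasR m b).
Proof.
move=> b0; rewrite [gasR m b](_ : _ = fun x => \sum_(k < m.+1) if (0 < k)%N then dens m b k x else 0); last first.
  by apply/funext => x; rewrite /gasR big_mkcond.
apply: measurable_sum => k; case: (boolP (0 < k)%N) => k0; last exact: measurable_cst.
by apply: measurable_dens => //; rewrite k0 -ltnS ltn_ord.
Qed.

Section pair_limit.
Context {R : realType}.
Local Notation mu := (@lebesgue_measure R).

(* [(2 pi)^-1] is the density of the points. *)
Definition gasr m (b x : R) : R := (2 * pi)^-1 * gasR m b x.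

Lemma gasr_ge0 m b x : 0 <= gasr m b x.
Proof. by rewrite mulr_ge0 ?gasR_ge0//; case/andP: (@pi2_inv R). Qed.

Lemma measurable_gasr m b : 0 < b -> measurable_fun setT (gasr m b).
Proof. by move=> b0; apply: measurable_funM => //; exact: measurable_gasR. Qed.

Lemma gasr_equicont (b1 b2 x1 x2 e : R) : 0 < b1 -> 0 < x1 -> x1 <= x2 -> 0 < e ->
  exists (del : R) N, 0 < del /\ forall m, (N <= m)%N -> forall b c x y,
    b1 <= b <= b2 -> b1 <= c <= b2 -> x1 <= x <= x2 -> x1 <= y <= x2 ->
    `|b - c| < del -> `|x - y| < del -> `|gasr m b x - gasr m c y| <= e.
Proof.
move=> b10 x10 x12 e0; have [del [N [d0 H]]] := gasR_equicont b2 b10 x10 x12 e0.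
exists del, N; split => // m Nm b c x y hb hc hx hy bc xy.
have /andP[i0 i1] := @pi2_inv R.
rewrite -mulrBr normrM (ger0_norm i0) -[leRHS]mul1r; apply: ler_pM => //.
exact: H.
Qed.

Definition paircor (b l : R) : R := if 0 < l then limn (fun m => gasr m b l) else 0.

Definition gas_cvg (b : R) : Prop := forall l : R, 0 < l -> cvgn (fun m => gasr m b l).

Lemma gasr_cvg b l : gas_cvg b -> 0 < l -> gasr m b l @[m --> \oo] --> paircor b l.
Proof. by move=> gc l0; rewrite /paircor l0; exact: gc. Qed.

Lemma paircor_ge0 b l : gas_cvg b -> 0 <= paircor b l.
Proof.
move=> gc; rewrite /paircor; case: ltP => // l0.
by apply: limr_ge; [exact: gc|near=> m; exact: gasr_ge0].
Unshelve. all: by end_near. Qed.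

Lemma paircor_equicont (b1 b2 x1 x2 e : R) : 0 < b1 -> 0 < x1 -> x1 <= x2 -> 0 < e ->
  exists2 del : R, 0 < del & forall b c x y, gas_cvg b -> gas_cvg c ->
    b1 <= b <= b2 -> b1 <= c <= b2 -> x1 <= x <= x2 -> x1 <= y <= x2 ->
    `|b - c| < del -> `|x - y| < del -> `|paircor b x - paircor c y| <= e.
Proof.
move=> b10 x10 x12 e0; have [del [N [d0 H]]] := gasr_equicont b2 b10 x10 x12 e0.
exists del => // b c x y gb gc hb hc hx hy bc xy.
have x0 : 0 < x by case/andP: hx => h _; exact: lt_le_trans h.
have y0 : 0 < y by case/andP: hy => h _; exact: lt_le_trans h.
have cv : `|gasr m b x - gasr m c y| @[m --> \oo] --> `|paircor b x - paircor c y|.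
  by apply: cvg_norm; apply: cvgB; exact: gasr_cvg.
rewrite -(cvg_lim _ cv)//; apply: limr_le; first by apply/cvg_ex; eexists; exact: cv.
by near=> m; apply: H => //; near: m; exact: nbhs_infty_ge.
Unshelve. all: by end_near. Qed.

Lemma measurable_paircor (b : R) : 0 < b -> gas_cvg b -> measurable_fun setT (paircor b).
Proof.
move=> b0 gc.
apply: (@measurable_fun_cvg _ _ _ _ (fun m (x : R) => (0 < x)%R%:R * gasr m b x)).
  move=> m; apply: measurable_funM; last exact: measurable_gasr.
  by case: (test1_gt (0 : R)).
move=> x _; rewrite /paircor; case: ltP => x0.
  by under eq_fun do rewrite mul1r; exact: gc.
by under eq_fun do rewrite mul0r; exact: cvg_cst.
Qed.

(* A finite net and the equicontinuity upgrade pointwise convergence. *)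
Lemma paircor_unif (b x1 x2 e : R) : 0 < b -> gas_cvg b -> 0 < x1 -> x1 <= x2 -> 0 < e ->
  exists N, forall m, (N <= m)%N -> forall x, x1 <= x <= x2 -> `|gasr m b x - paircor b x| <= e.
Proof.
move=> b0 gc x10 x12 e0; have e3 : 0 < e / 3 by rewrite divr_gt0.
have [del1 [N1 [d1 H1]]] := gasr_equicont b b0 x10 x12 e3.
have [del2 d2 H2] := paircor_equicont b b0 x10 x12 e3.
pose h := Num.min del1 del2 / 2.
have h0 : 0 < h by rewrite divr_gt0// lt_min d1.
have hd1 : h < del1 by rewrite ltr_pdivrMr// gt_min; apply/orP; left; lra.
have hd2 : h < del2 by rewrite ltr_pdivrMr// gt_min; apply/orP; right; lra.
have net k : exists N, forall m, (N <= m)%N -> forall i, (i < k)%N ->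
    `|gasr m b (x1 + i%:R * h) - paircor b (x1 + i%:R * h)| <= e / 3.
  elim: k => [|k [N HN]]; first by exists 0%N.
  have z0 : 0 < x1 + k%:R * h by rewrite ltr_pwDl// mulr_ge0// ltW.
  have /cvgrPdist_le /(_ _ e3) [N' _ HN'] := gasr_cvg gc z0.
  exists (maxn N N') => m; rewrite geq_max => /andP[m1 m2] i; rewrite ltnS leq_eqVlt => /orP[/eqP->|ik].
    by rewrite distrC; exact: HN'.
  exact: HN.
have [k hk] := nat_above ((x2 - x1) / h).
have [N HN] := net k.
exists (maxn N1 N) => m; rewrite geq_max => /andP[m1 m2] x hx.
have /andP[hx1 hx2] := hx.
have y0 : 0 <= (x - x1) / h by rewrite mulr_ge0 ?invr_ge0 ?(ltW h0)// subr_ge0.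
have /andP[] := truncn_itv y0; set i := Num.truncn _ => i1 i2.
have ik : (i < k)%N.
  rewrite -(ltr_nat R); apply: (le_lt_trans i1); apply: le_lt_trans hk.
  by rewrite ler_pM2r ?invr_gt0// lerB.
have z1 : x1 + i%:R * h <= x by rewrite -lerBrDl -ler_pdivlMr.
have z2 : x < x1 + i%:R * h + h.
  by rewrite -addrA -[X in x1 + (_ + X)]mul1r -mulrDl natr1 -ltrBlDl -ltr_pdivrMr.
have hz : x1 <= x1 + i%:R * h <= x2 by rewrite lerDl mulr_ge0 ?(ltW h0)//= (le_trans z1).
have xz : `|x - (x1 + i%:R * h)| < h by rewrite ger0_norm ?subr_ge0// ltrBlDl.
have bb : b <= b <= b by rewrite lexx.
have bb0 del : 0 < del -> `|b - b| < del by rewrite subrr normr0.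
have := HN m m2 i ik; have := H1 m m1 b b x _ bb bb hx hz (bb0 _ d1) (lt_trans xz hd1).
have := H2 b b x _ gc gc bb bb hx hz (bb0 _ d2) (lt_trans xz hd2).
move: (gasr m b x) (paircor b x) (gasr m b _) (paircor b _) => u v u' v'.
rewrite !ler_norml => /andP[? ?] /andP[? ?] /andP[? ?]; apply/andP; split; lra.
Qed.

Lemma halfp_gt (x : R) : exists N, forall m, (N <= m)%N -> x < halfp m.
Proof.
have [N xN] := nat_above x; exists N => m Nm; apply: (lt_le_trans xN).
rewrite /halfp; have p2 := pi_ge2 R.
apply: (@le_trans _ _ (m.+1%:R)); first by rewrite ler_nat leqW.
rewrite -[leLHS]mul1r; apply: ler_pM => //; move: (pi : R) p2 => p; lra.
Qed.

Variables (b : R) (d : measure_display) (T : measurableType d) (P : probability T R) (Xi : T -> set R).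
Hypothesis b0 : 0 < b.
Hypothesis cl : circular_limit b P Xi.
Hypothesis spp : simple_point_process Xi.

Section windows.
Variables (phi psi : R -> R) (c p1 p2 q1 q2 Mf Mg : R).
Hypothesis cphi : continuous phi.
Hypothesis cpsi : continuous psi.
Hypothesis phic : forall x, 0 <= phi x <= c.
Hypothesis psic : forall x, 0 <= psi x <= c.
Hypothesis phiE : forall x, phi x != 0 -> p1 <= x <= p2.
Hypothesis psiE : forall x, psi x != 0 -> q1 <= x <= q2.
Hypothesis p12 : p1 < p2.
Hypothesis pq : p2 < q1.
Hypothesis q12 : q1 <= q2.

Let mphi : measurable_fun setT phi. Proof. exact: continuous_measurable_fun. Qed.
Let mpsi : measurable_fun setT psi. Proof. exact: continuous_measurable_fun. Qed.
Let c0 : 0 <= c. Proof. by have /andP[h1 h2] := phic 0; exact: le_trans h1 h2. Qed.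

Lemma window_support (f : R -> R) (a e : R) : continuous f -> (forall x, f x != 0 -> a <= x <= e) ->
  continuous_compact_support f.
Proof.
move=> cf fE; split => //; exists (Num.max `|a| `|e|) => x; rewrite gt_max => /andP[h1 h2].
apply/eqP; apply: contraT => /fE /andP[ax xe]; move: h1 h2.
case: (ger0P x); case: (ger0P a); case: (ger0P e); lra.
Qed.

Lemma windows_in_cube : exists N, forall m, (N <= m)%N -> - halfp m <= p1 /\ q2 < halfp m.
Proof.
have [N1 H1] := halfp_gt (- p1); have [N2 H2] := halfp_gt q2.
exists (maxn N1 N2) => m; rewrite geq_max => /andP[h1 h2].
by rewrite H2// lerNl ltW// H1.
Qed.

(** The truncation levels are chosen before [m]. This replaces the uniform integrability that
    convergence in law alone does not give. *)
Lemma trunc_pair_approx (e : R) : 0 < e -> exists A B N, [/\ 0 <= A, 0 <= B &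
  forall m, (N <= m)%N -> cmean m b (trunc_stat phi psi A B) <= cmean m b (pair_stat phi psi) <=
    cmean m b (trunc_stat phi psi A B) + e].
Proof.
move=> e0; have pp0 : 0 < p2 - p1 by rewrite subr_gt0.
have qp0 : 0 < q2 - p1 by move: p12 pq q12; lra.
pose C := c ^+ 2 * (p2 - p1); have C0 : 0 <= C by rewrite mulr_ge0 ?sqr_ge0// ltW.
have e1 : 0 < e / 2 / (C + 1) by rewrite divr_gt0 ?divr_gt0//; lra.
have [K [N1 [K0 H1]]] := cdf_tail_small b0 qp0 e1.
pose C2 := c * K%:R * (c * (p2 - p1)).
have C20 : 0 <= C2 by rewrite mulr_ge0 ?mulr_ge0 ?(ltW pp0).
have e2 : 0 < e / 2 / (C2 + 1) by rewrite divr_gt0 ?divr_gt0//; lra.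
have [K' [N2 [K0' H2]]] := cdf_tail_small b0 pp0 e2.
have [N3 H3] := windows_in_cube.
exists (c * K'.+1%:R), (c * K%:R), (maxn (maxn N1 N2) (maxn N3 K'.+1)); split; [by rewrite mulr_ge0|by rewrite mulr_ge0|].
move=> m; rewrite !geq_max => /andP[/andP[h1 h2] /andP[h3 h4]].
have [hp1 hp2] := H3 m h3.
rewrite (trunc_le_pair m b0 mphi mpsi phic psic) ?mulr_ge0//=.
have := (@pair_le_trunc _ _ _ b0 _ _ _ _ _ _ _ mphi mpsi phic psic phiE psiE (ltW p12) pq q12 hp1 hp2 K K'.+1); rewrite /= h4 => /(_ isT) hle.
apply: (le_trans hle); rewrite lerD2l.
have {}H1 := H1 m h1 b (lexx b); have {}H2 := H2 m h2 b (lexx b).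
have {}H2 := cdf_tail_term H2 (_ : (K' < K'.+1 <= m)%N).
rewrite leqnn h4 in H2; have {}H2 := H2 isT.
have frac (D : R) : 0 <= D -> D * (e / 2 / (D + 1)) <= e / 2.
  move=> D0; have D1 : 0 < D + 1 by lra.
  by rewrite mulrA ler_pdivrMr// mulrC ler_wpM2l//; lra.
rewrite [leRHS](splitr e); apply: lerD.
  by apply: le_trans (frac C C0); apply: ler_wpM2l.
by apply: le_trans (frac C2 C20); rewrite mulrA; apply: ler_wpM2l.
Qed.

Let phi0 x : 0 <= phi x. Proof. by case/andP: (phic x). Qed.
Let psi0 x : 0 <= psi x. Proof. by case/andP: (psic x). Qed.

Lemma measurable_window_statistic (f : R -> R) (a e : R) : continuous f ->
  (forall x, 0 <= f x <= c) -> (forall x, f x != 0 -> a <= x <= e) ->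
  measurable_fun setT (fun w => linear_statistic f (Xi w)).
Proof.
move=> cf fc fE; have [_ [r fr]] := window_support cf fE.
exact: (measurable_linear_statistic spp (continuous_measurable_fun cf) fc fr).
Qed.

Lemma measurable_trunc_lin (A B : R) : measurable_fun setT (fun w => trunc_lin phi psi A B (Xi w)).
Proof.
apply: measurable_funM; apply: measurable_minr => //.
  exact: measurable_window_statistic phic phiE.
exact: measurable_window_statistic psic psiE.
Qed.

Lemma trunc_mean_cvg (A B : R) : 0 <= A -> 0 <= B ->
  exists2 t : R, (\int[P]_w (trunc_lin phi psi A B (Xi w))%:E = t%:E)%E &
    cmean m b (trunc_stat phi psi A B) @[m --> \oo] --> t.
Proof.
move=> A0 B0.
have := circular_trunc_cvg cl b0 A0 B0 (window_support cphi phiE) (window_support cpsi psiE) phic psic.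
set I := (\int[P]_w _)%E => h.
have I0 : (0 <= I)%E by apply: integral_ge0 => w _; rewrite lee_fin trunc_lin_ge0.
have I1 : (I <= (A * B)%:E)%E.
  apply: (@le_trans _ _ (\int[P]_w (cst (A * B)%:E w))%E).
    apply: ge0_le_integral => //.
    - by move=> w _; rewrite lee_fin trunc_lin_ge0.
    - by apply/measurable_EFinP; exact: measurable_trunc_lin.
    - by move=> w _; rewrite lee_fin trunc_lin_le.
  by rewrite integral_cst//= probability_setT mule1.
have If : I \is a fin_num by rewrite ge0_fin_numE// (le_lt_trans I1)// ltry.
exists (fine I); first by rewrite fineK.
have := @fine_cvg _ _ _ _ (fun m => (cmean m b (trunc_stat phi psi A B))%:E) (fine I); apply; rewrite fineK//; exact: h.
Qed.

(** The truncated means converge by the assumed convergence in law, and the truncation error is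
    uniform in the number of points. *)
Lemma pair_mean_cauchy (e : R) : 0 < e -> exists N, forall m n, (N <= m)%N -> (N <= n)%N ->
  `|cmean m b (pair_stat phi psi) - cmean n b (pair_stat phi psi)| <= e.
Proof.
move=> e0; have e3 : 0 < e / 4 by lra.
have [A [B [N1 [A0 B0 H1]]]] := trunc_pair_approx e3.
have [t _ /cvgrPdist_le /(_ _ e3) [N2 _ H2]] := trunc_mean_cvg A0 B0.
exists (maxn N1 N2) => m n; rewrite !geq_max => /andP[h1 h2] /andP[h3 h4].
move: (H1 m h1) (H1 n h3) (H2 m h2) (H2 n h4); rewrite /=.
move: (cmean m b _) (cmean n b _) (cmean m b _) (cmean n b _) => x1 x2 x3 x4.
rewrite !ler_norml => /andP[? ?] /andP[? ?] /andP[? ?] /andP[? ?]; apply/andP; split; lra.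
Qed.

Lemma pair_mean_corr : exists N, forall m, (N <= m)%N ->
  (cmean m b (pair_stat phi psi))%:E = corr phi psi (gasr m b).
Proof.
have [N H] := windows_in_cube; exists N => m /H[hp1 hp2].
rewrite (cmean_pair b0 mphi mpsi phic psic phiE psiE (ltW p12) pq q12 hp1 hp2).
rewrite /corr -ge0_integralZl//=.
- apply: eq_integral => x _; rewrite [in LHS]EFinM (Ex_lin m b0 mpsi psic).
  rewrite muleCA; congr (_ * _)%E; rewrite -ge0_integralZl//=.
  + by apply: eq_integral => y _; rewrite -EFinM /gasr; congr EFin; ring.
  + apply/measurable_EFinP; apply: measurable_funM; last exact: measurable_gasR.
    by apply: (measurableT_comp mpsi); exact: measurable_funD.
  + by move=> y _; rewrite lee_fin mulr_ge0// gasR_ge0.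
  + by rewrite lee_fin; case/andP: (@pi2_inv R).
- apply/measurable_EFinP; apply: measurable_funM => //.
  apply: (@measurable_Ex _ m b (fun x z => lin (fun y => psi (x + y)) z)).
    by move=> x z; exact: lin_ge0.
  apply: (@eqfun_measurable _ _ _ _ (fun p : R * m.-tuple R => \sum_(j < m) psi (p.1 + p.2`_j))).
    by move=> p; rewrite -(lin_nth (fun y => psi (p.1 + y)) (size_tuple p.2)).
  apply: measurable_sum => j; apply: (measurableT_comp mpsi); apply: measurable_funD => //.
  by apply: (measurableT_comp (measurable_nth j)); exact: measurable_snd.
- by move=> x _; rewrite lee_fin mulr_ge0//; apply: Ex_ge0 => z; apply: lin_ge0.
- by rewrite lee_fin; case/andP: (@pi2_inv R).
Qed.

End windows.

Lemma hat_window (w l x : R) : hat w l x != 0 -> l - w <= x <= l + w.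
Proof.
move=> h; have : `|x - l| < w by rewrite ltNge; apply/negP => /hat_eq0 e; rewrite e eqxx in h.
by rewrite ltr_norml => /andP[? ?]; apply/andP; split; lra.
Qed.

(** For hats around 0 and around [l], the pair mean is the squared hat mass times [gasr m b l], up
    to the oscillation of [gasr] on the differences of the supports, which equicontinuity makes
    small uniformly in [m]. Since the pair means are Cauchy, so is [gasr m b l]. *)
Lemma circular_gas_cvg : gas_cvg b.
Proof.
move=> l l0; apply/cauchy_cvgP; apply: cauchy_exP => e' e'0; pose e := e' / 2.
have e0 : 0 < e by rewrite divr_gt0.
suff [N H] : exists N, forall m n, (N <= m)%N -> (N <= n)%N -> `|gasr m b l - gasr n b l| <= e.
  exists (gasr N b l); exists N => // m /= Nm; rewrite /ball/=.
  by apply: (le_lt_trans (H N m (leqnn _) Nm)); rewrite /e; lra.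
have e3 : 0 < e / 3 by rewrite divr_gt0.
have l2 : 0 < l / 2 by lra.
have l22 : l / 2 <= 2 * l by lra.
have [del [N1 [d0 H1]]] := gasr_equicont b b0 l2 l22 e3.
(* [l / 4] separates the two hats and keeps the differences in [[l/2, 2l]]; [del / 4] keeps the
   differences within [del] of [l]. *)
pose w := Num.min (l / 4) (del / 4).
have w0 : 0 < w by rewrite lt_min !divr_gt0.
have wl : w <= l / 4 by rewrite ge_min lexx.
have wd : w <= del / 4 by rewrite ge_min lexx orbT.
clearbody w.
have hc z x : 0 <= hat w z x <= w by rewrite hat_ge0 hat_le// ltW.
have p12 : 0 - w < 0 + w by lra.
have pq : 0 + w < l - w by lra.
have q12 : l - w <= l + w by lra.
have [N2 H2] := pair_mean_corr (@hat_continuous _ w 0) (@hat_continuous _ w l) (hc 0) (hc l) (@hat_window w 0) (@hat_window w l) p12 pq q12.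
pose M := hat_mass w; have M0 : 0 < M by exact: hat_mass_gt0.
have e4 : 0 < e / 3 * (M * M) by rewrite !mulr_gt0.
have [N3 H3] := pair_mean_cauchy (@hat_continuous _ w 0) (@hat_continuous _ w l) (hc 0) (hc l) (@hat_window w 0) (@hat_window w l) p12 pq q12 e4.
have key m : (N1 <= m)%N -> (N2 <= m)%N ->
    gasr m b l * (M * M) - e / 3 * (M * M) <= cmean m b (pair_stat (hat w 0) (hat w l)) <= gasr m b l * (M * M) + e / 3 * (M * M).
  move=> m1 m2; have r0 := gasr_ge0 m b l.
  have near y : l - w - (0 + w) <= y <= l + w - (0 - w) -> `|gasr m b l - gasr m b y| <= e / 3.
    move=> /andP[y1 y2]; have ly : `|l - y| < del by rewrite ltr_norml; apply/andP; split; lra.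
    by apply: H1 => //; rewrite ?lexx ?subrr ?normr0//; apply/andP; split; lra.
  have C := corr_close (measurable_hat w 0) (measurable_hat w l) (@hat_ge0 _ w 0) (@hat_ge0 _ w l)
     (@hat_window w 0) (@hat_window w l) (integral_hat 0 w0) (integral_hat l w0).
  have CC := corr_cst (measurable_hat w 0) (measurable_hat w l) (@hat_ge0 _ w 0) (@hat_ge0 _ w l)
     (integral_hat 0 w0) (integral_hat l w0) r0.
  apply/andP; split.
    rewrite lerBlDr -lee_fin EFinD (H2 m m2) -CC; apply: C => //.
    - exact: measurable_gasr.
    - by move=> x; exact: gasr_ge0.
    - exact: ltW.
    - by move=> y /near; rewrite ler_norml => /andP[h1 h2]; lra.
  rewrite -lee_fin EFinD (H2 m m2) -CC; apply: C => //.
  - exact: measurable_gasr.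
  - by move=> x; exact: gasr_ge0.
  - exact: ltW.
  - by move=> y /near; rewrite ler_norml => /andP[h1 h2]; lra.
exists (maxn (maxn N1 N2) N3) => m n; rewrite !geq_max => /andP[/andP[m1 m2] m3] /andP[/andP[n1 n2] n3].
have MM : 0 < M * M by rewrite mulr_gt0.
rewrite -[leLHS](mulfK (lt0r_neq0 MM)) ler_pdivrMr//.
rewrite -[X in _ * X <= _](gtr0_norm MM) -normrM mulrBl.
have := key m m1 m2; have := key n n1 n2; have := H3 m n m3 n3; clear.
rewrite !ler_norml.
move: (gasr m b l * _) (gasr n b l * _) (cmean m b _) (cmean n b _) => u v u' v'.
have -> : e * (M * M) = 3 * (e / 3 * (M * M)) by rewrite mulrA; congr (_ * _); field.
move: (e / 3 * _) => t => /andP[? ?] /andP[? ?] /andP[? ?]; apply/andP; split; lra.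
Qed.

Section moments.
Variables (phi psi : R -> R) (c p1 p2 q1 q2 : R).
Hypothesis cphi : continuous phi.
Hypothesis cpsi : continuous psi.
Hypothesis phic : forall x, 0 <= phi x <= c.
Hypothesis psic : forall x, 0 <= psi x <= c.
Hypothesis phiE : forall x, phi x != 0 -> p1 <= x <= p2.
Hypothesis psiE : forall x, psi x != 0 -> q1 <= x <= q2.
Hypothesis p12 : p1 < p2.
Hypothesis pq : p2 < q1.
Hypothesis q12 : q1 <= q2.

Let mphi : measurable_fun setT phi. Proof. exact: continuous_measurable_fun. Qed.
Let mpsi : measurable_fun setT psi. Proof. exact: continuous_measurable_fun. Qed.
Let phi0 x : 0 <= phi x. Proof. by case/andP: (phic x). Qed.
Let psi0 x : 0 <= psi x. Proof. by case/andP: (psic x). Qed.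

Lemma window_mass (f : R -> R) (a e : R) : measurable_fun setT f -> (forall x, 0 <= f x <= c) ->
  (forall x, f x != 0 -> a <= x <= e) ->
  exists2 M : R, 0 <= M & (\int[mu]_x (f x)%:E = M%:E)%E.
Proof.
move=> mf fc fE; have f0 x : 0 <= f x by case/andP: (fc x).
have I0 : (0 <= \int[mu]_x (f x)%:E)%E by apply: integral_ge0 => x _; rewrite lee_fin.
suff If : (\int[mu]_x (f x)%:E < +oo)%E.
  exists (fine (\int[mu]_x (f x)%:E)%E); first exact: fine_ge0.
  by rewrite fineK// ge0_fin_numE.
apply: (@le_lt_trans _ _ (\int[mu]_(x in `[a, e]%classic) (cst c%:E x))%E).
  rewrite [leRHS]integral_mkcond; apply: ge0_le_integral => //.
  - by move=> x _; rewrite lee_fin.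
  - exact/measurable_EFinP.
  - by apply/(measurable_restrictT _ _).1.
  - move=> x _; rewrite patchE mem_setE in_itv/=; case: ifPn => hx.
      by rewrite lee_fin; case/andP: (fc x).
    rewrite lee_fin; have [->//|/fE h] := eqVneq (f x) 0; by rewrite h in hx.
rewrite integral_cst//= lebesgue_measure_itv/= lte_fin; case: (ltP a e) => _; last by rewrite mule0 ltry.
by rewrite -EFinB -EFinM ltry.
Qed.

(** [paircor_unif] on the compact interval of possible differences, which is away from 0 because the
    windows are separated. *)
Lemma pair_mean_limit : exists2 C : R, corr phi psi (paircor b) = C%:E &
  cmean m b (pair_stat phi psi) @[m --> \oo] --> C.
Proof.
have gc := circular_gas_cvg.
have [Mf Mf0 fM] := window_mass mphi phic phiE.
have [Mg Mg0 gM] := window_mass mpsi psic psiE.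
have [N2 H2] := pair_mean_corr cphi cpsi phic psic phiE psiE p12 pq q12.
have MM : 0 < Mf * Mg + 1 by rewrite ltr_wpDl// mulr_ge0.
have key (e : R) : 0 < e -> exists N, forall m, (N <= m)%N ->
    (corr phi psi (paircor b) <= (cmean m b (pair_stat phi psi) + e)%:E)%E /\
    ((cmean m b (pair_stat phi psi))%:E <= corr phi psi (paircor b) + e%:E)%E.
  move=> e0; pose e' := e / (Mf * Mg + 1); have e'0 : 0 < e' by rewrite divr_gt0.
  have e'M : e' * (Mf * Mg) <= e.
    by rewrite /e' mulrAC ler_pdivrMr// ler_pM2l// lerDl.
  have x1 : 0 < q1 - p2 by rewrite subr_gt0.
  have x12 : q1 - p2 <= q2 - p1 by move: p12 q12; lra.
  have [N1 H1] := paircor_unif b0 gc x1 x12 e'0.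
  have C := corr_close mphi mpsi phi0 psi0 phiE psiE fM gM.
  exists (maxn N1 N2) => m; rewrite geq_max => /andP[m1 m2]; split.
    rewrite EFinD (H2 m m2); apply: (@le_trans _ _ (corr phi psi (gasr m b) + (e' * (Mf * Mg))%:E)%E).
      apply: C => //.
      - exact: measurable_paircor.
      - exact: measurable_gasr.
      - by move=> x; exact: paircor_ge0.
      - by move=> x; exact: gasr_ge0.
      - exact: ltW.
      - by move=> y /(H1 m m1); rewrite ler_norml => /andP[h1 h2]; lra.
    by apply: leeD2l; rewrite lee_fin.
  rewrite (H2 m m2); apply: (@le_trans _ _ (corr phi psi (paircor b) + (e' * (Mf * Mg))%:E)%E).
    apply: C => //.
    - exact: measurable_gasr.
    - exact: measurable_paircor.
    - by move=> x; exact: gasr_ge0.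
    - by move=> x; exact: paircor_ge0.
    - exact: ltW.
    - by move=> y /(H1 m m1); rewrite ler_norml => /andP[h1 h2]; lra.
  by apply: leeD2l; rewrite lee_fin.
have Cf : corr phi psi (paircor b) \is a fin_num.
  rewrite ge0_fin_numE; last by apply: corr_ge0 => // x; exact: paircor_ge0.
  have [N H] := key 1 ltr01; have [h _] := H N (leqnn N).
  by apply: (le_lt_trans h); rewrite ltry.
exists (fine (corr phi psi (paircor b))); first by rewrite fineK.
apply/cvgrPdist_le => e e0; have [N H] := key e e0; exists N => // m /= Nm.
have [] := H m Nm; rewrite -(fineK Cf) -EFinD !lee_fin => h1 h2.
by rewrite ler_norml; apply/andP; split; lra.
Qed.

(** Truncated moments are at most the limit, and monotone convergence removes the truncation.
    Conversely, a truncation that is uniformly good in [m] has a moment within [e] of the limit. *)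
Lemma pair_moment :
  (\int[P]_w (linear_statistic phi (Xi w) * linear_statistic psi (Xi w))%:E = corr phi psi (paircor b))%E.
Proof.
have [C -> Cv] := pair_mean_limit.
have tle (A B : R) : 0 <= A -> 0 <= B -> (\int[P]_w (trunc_lin phi psi A B (Xi w))%:E <= C%:E)%E.
  move=> A0 B0; have [t -> tv] := trunc_mean_cvg cphi cpsi phic psic phiE psiE A0 B0.
  rewrite lee_fin; apply: (ler_cvg_to tv Cv).
  by exists 0%N => // m _; exact: (trunc_le_pair m b0 mphi mpsi phic psic).
have mt A B := measurable_trunc_lin cphi cpsi phic psic phiE psiE A B.
have l0 w := linear_statistic_ge0 (Xi w) phi0.
have s0 w := linear_statistic_ge0 (Xi w) psi0.
have mX : measurable_fun setT (fun w => (linear_statistic phi (Xi w) * linear_statistic psi (Xi w))%:E).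
  apply/measurable_EFinP; apply: measurable_funM.
    exact: (measurable_window_statistic cphi phic phiE).
  exact: (measurable_window_statistic cpsi psic psiE).
apply/eqP; rewrite eq_le; apply/andP; split.
  have cv : (\int[P]_w (trunc_lin phi psi n%:R n%:R (Xi w))%:E)%E @[n --> \oo] -->
      (\int[P]_w (linear_statistic phi (Xi w) * linear_statistic psi (Xi w))%:E)%E.
    apply: mct.
    - by move=> n; apply/measurable_EFinP; exact: mt.
    - by move=> n w; rewrite lee_fin trunc_lin_ge0.
    - move=> n w; rewrite lee_fin; have nS : n%:R <= n.+1%:R :> R by rewrite ler_nat.
      have mm (x : R) : Num.min x n%:R <= Num.min x n.+1%:R by rewrite le_min !ge_min lexx nS orbT.
      by apply: ler_pM => //; rewrite le_min ?l0 ?s0 ler0n.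
    - move=> w; have [N hN] := nat_above (Num.max (linear_statistic phi (Xi w)) (linear_statistic psi (Xi w))).
      apply: cvg_near_cst; exists N => // n /= Nn; congr EFin.
      have : Num.max (linear_statistic phi (Xi w)) (linear_statistic psi (Xi w)) <= n%:R.
        by apply: (le_trans (ltW hN)); rewrite ler_nat.
      by rewrite ge_max /trunc_lin => /andP[/min_idPl -> /min_idPl ->].
  rewrite -(cvg_lim _ cv)//; apply: lime_le; first by apply/cvg_ex; eexists; exact: cv.
  by exists 0%N => // n _; exact: tle.
apply/lee_addgt0Pr => e e0.
have [A [B [N [A0 B0 H]]]] := trunc_pair_approx cphi cpsi phic psic phiE psiE p12 pq q12 e0.
have [t tE tv] := trunc_mean_cvg cphi cpsi phic psic phiE psiE A0 B0.
apply: (@le_trans _ _ (t%:E + e%:E)%E).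
  rewrite -EFinD lee_fin; apply: (ler_cvg_to Cv (cvgD tv (cvg_cst e))).
  by exists N => // m /= /H/andP[].
apply: leeD2r; rewrite -tE; apply: ge0_le_integral => //.
- by move=> w _; rewrite lee_fin trunc_lin_ge0.
- by apply/measurable_EFinP; exact: mt.
- by move=> w _; rewrite lee_fin ler_pM ?le_min ?l0 ?s0 ?A0 ?B0 ?ge_min ?lexx.
Qed.

End moments.

End pair_limit.

(** * Second moments of counts of Borel sets *)

Lemma fatou_le (R : realType) (d : measure_display) (T : measurableType d)
    (P : {measure set T -> \bar R}) (f_ : nat -> T -> \bar R) (f : T -> \bar R) (C : \bar R) :
  (forall n, measurable_fun setT (f_ n)) -> (forall n x, 0 <= f_ n x)%E ->
  (forall x, f_ n x @[n --> \oo] --> f x) -> (forall n, \int[P]_x f_ n x <= C)%E ->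
  (\int[P]_x f x <= C)%E.
Proof.
move=> mf f0 ff fC.
rewrite (eq_integral (fun x => limn_einf (f_ ^~ x))); last first.
  by move=> x _; have [-> _] := cvg_limn_einf_sup (ff x).
apply: (le_trans (fatou P measurableT mf (fun n x _ => f0 n x))).
rewrite limn_einf_lim; apply: lime_le; first exact: is_cvg_einfs.
exists 0%N => // n _; apply: le_trans (fC n).
by apply: ereal_inf_lbound; exists n => /=.
Qed.

Section cells.
Context {R : realType} (r : nat).
Implicit Types (x y : R) (k i j : nat).

Definition cell k i : set R := `[- r%:R + i%:R / k.+1%:R, - r%:R + i.+1%:R / k.+1%:R[%classic.
Definition far i j : bool := (i.+1 < j)%N || (j.+1 < i)%N.
Definition ncell k : nat := (r.*2 * k.+1)%N.
Definition cidx k x : nat := Num.truncn ((x + r%:R) * k.+1%:R).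
Definition far_pairs k : seq (nat * nat) :=
  [seq q <- [seq (i, j) | i <- iota 0 (ncell k), j <- iota 0 (ncell k)] | far q.1 q.2].
(** On the bounded region this is the indicator that [x] and [y] lie in cells that are neither equal
    nor adjacent, written as a sum of products so that it turns into products of counts. *)
Definition farfun k x y : R := \sum_(q <- far_pairs k) \1_(cell k q.1) x * \1_(cell k q.2) y.

Lemma in_cell k i x : - r%:R <= x -> \1_(cell k i) x = (i == cidx k x)%:R :> R.
Proof.
move=> rx; rewrite indicE mem_setE in_itv/=; congr (_%:R); apply: congr1.
have k0 : 0 < k.+1%:R :> R by [].
have y0 : 0 <= (x + r%:R) * k.+1%:R by rewrite mulr_ge0// -lerBlDr sub0r.
rewrite ![- r%:R + _]addrC lerBlDr ltrBrDr ler_pdivrMr// ltr_pdivlMr//.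
have /andP[h1 h2] := truncn_itv y0.
apply/idP/eqP => [/andP[i1 i2]|->]; last by rewrite h1.
apply/eqP; rewrite eqn_leq /cidx truncn_ge_nat// i1/= -ltnS -(ltr_nat R).
exact: le_lt_trans h1 i2.
Qed.

Lemma cidx_lt k x : - r%:R <= x < r%:R -> (cidx k x < ncell k)%N.
Proof.
move=> /andP[x1 x2]; have y0 : 0 <= (x + r%:R) * k.+1%:R by rewrite mulr_ge0// -lerBlDr sub0r.
have /andP[h1 _] := truncn_itv y0; rewrite -(ltr_nat R); apply: (le_lt_trans h1).
rewrite /ncell natrM ltr_pM2r// -addnn natrD; lra.
Qed.

Lemma farfunE k x y : - r%:R <= x < r%:R -> - r%:R <= y < r%:R ->
  farfun k x y = (far (cidx k x) (cidx k y))%:R.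
Proof.
move=> hx hy; have /andP[x1 _] := hx; have /andP[y1 _] := hy.
transitivity ((count_mem (cidx k x, cidx k y) (far_pairs k))%:R : R).
  rewrite /farfun; elim: (far_pairs k) => [|q s IH]; first by rewrite big_nil.
  by rewrite big_cons IH !in_cell//= natrD -natrM mulnb; congr (_%:R + _); case: q.
rewrite count_uniq_mem.
  rewrite mem_filter /= (_ : _ \in _ = true) ?andbT//.
  by apply/allpairsP; exists (cidx k x, cidx k y); rewrite !mem_iota /= !add0n !cidx_lt.
by apply: filter_uniq; apply: allpairs_uniq; rewrite ?iota_uniq// => -[? ?] [? ?].
Qed.

Lemma far_cells k x y : - r%:R <= x -> - r%:R <= y -> 2 <= `|x - y| * k.+1%:R ->
  far (cidx k x) (cidx k y).
Proof.
wlog xy : x y / x <= y.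
  move=> H x1 y1 h; case: (leP x y) => xy; first exact: H.
  by rewrite /far orbC; apply: H => //; [exact: ltW|rewrite distrC].
move=> x1 y1; rewrite distrC ger0_norm ?subr_ge0// => h; apply/orP; left.
have x0 : 0 <= (x + r%:R) * k.+1%:R by rewrite mulr_ge0// -lerBlDr sub0r.
have y0 : 0 <= (y + r%:R) * k.+1%:R by rewrite mulr_ge0// -lerBlDr sub0r.
have /andP[h1 h2] := truncn_itv x0; have /andP[h3 h4] := truncn_itv y0.
rewrite -/(cidx k x) -/(cidx k y) in h1 h2 h3 h4.
rewrite -ltnS -(ltr_nat R) -[_.+2]addn2 natrD.
apply: le_lt_trans h4; move: h h1; rewrite mulrBl !mulrDl.
move: (y * _) (x * _) (r%:R * _) ((cidx k x)%:R) => u v w z; lra.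
Qed.

Lemma farfun_cvg x y : - r%:R <= x < r%:R -> - r%:R <= y < r%:R -> x != y ->
  \forall k \near \oo, farfun k x y = 1.
Proof.
move=> hx hy xy; have xy0 : 0 < `|x - y| by rewrite normr_gt0 subr_eq0.
have [N hN] := nat_above (2 / `|x - y|); exists N => // k /= Nk.
rewrite farfunE// far_cells//; [by case/andP: hx|by case/andP: hy|].
rewrite mulrC -ler_pdivrMr// (le_trans (ltW hN))// ler_nat; exact: leqW.
Qed.

Lemma farfun_ge0 k x y : 0 <= farfun k x y.
Proof. by apply: sumr_ge0 => q _; apply: mulr_ge0. Qed.

Lemma farfun_le1 k x y : - r%:R <= x < r%:R -> - r%:R <= y < r%:R -> farfun k x y <= 1.
Proof. by move=> hx hy; rewrite farfunE// lern1 leq_b1. Qed.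

Lemma measurable_cell k i : measurable (cell k i).
Proof. exact: measurable_itv. Qed.

End cells.

(** * From separated open windows to disjoint Borel sets *)

Section borel_extension.
Context {R : realType}.

(** Uniqueness of measures on the intersection-stable generator of open intervals, for set functions
    that are not yet packaged as measures. *)
Lemma borel_ext (m1 m2 : set R -> \bar R) :
  (forall A, 0 <= m1 A)%E -> (forall A, 0 <= m2 A)%E -> m1 set0 = 0%E -> m2 set0 = 0%E ->
  (forall F, (forall i, measurable (F i)) -> trivIset setT F ->
     m1 (\bigcup_i F i) = \sum_(i <oo) m1 (F i))%E ->
  (forall F, (forall i, measurable (F i)) -> trivIset setT F ->
     m2 (\bigcup_i F i) = \sum_(i <oo) m2 (F i))%E ->
  (forall a c : R, m1 `]a, c[%classic = m2 `]a, c[%classic) ->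
  (forall A, measurable A -> (m1 A < +oo)%E) ->
  forall A, measurable A -> m1 A = m2 A.
Proof.
move=> m10 m20 m1e m2e s1 s2 m12 m1f A mA.
have S1 : semi_sigma_additive m1.
  by move=> F mF tF _; rewrite s1//; apply: is_cvg_nneseries => *; exact: m10.
have S2 : semi_sigma_additive m2.
  by move=> F mF tF _; rewrite s2//; apply: is_cvg_nneseries => *; exact: m20.
pose M1 : {measure set R -> \bar R} := HB.pack m1 (isMeasure.Build _ _ _ m1 m1e m10 S1).
pose M2 : {measure set R -> \bar R} := HB.pack m2 (isMeasure.Build _ _ _ m2 m2e m20 S2).
suff : M1 A = M2 A by [].
have m12' B : @RGenOpens.G R B -> M1 B = M2 B by move=> [a [c ->]]; exact: m12.
pose g (n : nat) : set R := `]- n%:R, n%:R[%classic.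
have m1f' k : (M1 (g k) < +oo)%E by apply: m1f; exact: measurable_itv.
apply: (@measure_unique _ R R (@RGenOpens.G R) g _ _ _ _ M1 M2 m12' m1f' A mA).
- exact: RGenOpens.measurableE.
- move=> _ _ [a [c ->]] [a' [c' ->]]; exists (Num.max a a'), (Num.min c c').
  by apply/seteqP; split => x /=; rewrite !in_itv/= gt_max lt_min; [case=> /andP[-> ->] /andP[-> ->]|
    move=> /andP[/andP[-> ->] /andP[-> ->]]].
- by move=> n; eexists; eexists.
- apply/seteqP; split => // x _; have [n xn] := nat_above `|x|.
  by exists n => //; rewrite /g /= in_itv/= -ltr_norml.
Qed.

Implicit Types (S A B : set R).

Lemma lf_measurable S : locally_finite S -> measurable S.
Proof.
move=> lS; have -> : S = \bigcup_n (S `&` `[- n%:R, n%:R]).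
  apply/seteqP; split => [x Sx|x [n _ []]//]; have [n xn] := nat_above `|x|.
  by exists n => //; split => //=; rewrite in_itv/= -ler_norml ltW.
apply: bigcupT_measurable => n; apply: countable_measurable => //.
exact/finite_set_countable.
Qed.

Lemma npoints_ge0 S A : (0 <= npoints S A)%E.
Proof. by rewrite /npoints /counting; case: ifPn; rewrite ?lee_fin// lee_pinfty. Qed.

Lemma npoints_bigcup S F : locally_finite S -> (forall i, measurable (F i)) -> trivIset setT F ->
  (npoints S (\bigcup_i F i) = \sum_(i <oo) npoints S (F i))%E.
Proof.
move=> lS mF tF; have mS := lf_measurable lS.
rewrite /npoints setI_bigcupr; apply: (@measure_semi_bigcup _ _ _ (@counting R R)).
- by move=> i; exact: measurableI.
- exact: trivIset_setIl.
- by apply: bigcupT_measurable => i; exact: measurableI.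
Qed.

Lemma npoints_cvg S F : locally_finite S -> (forall i : nat, measurable (F i)) ->
  (forall i, F i `<=` F i.+1) -> npoints S (F i) @[i --> \oo] --> npoints S (\bigcup_i F i).
Proof.
move=> lS mF tF; have mS := lf_measurable lS.
rewrite /npoints setI_bigcupr; apply: (nondecreasing_cvg_mu (mu := @counting R R)).
- by move=> i; exact: measurableI.
- by apply: bigcupT_measurable => i; exact: measurableI.
- by apply/nondecreasing_seqP => n; apply/subsetPset; apply: setIS.
Qed.

Lemma npoints_le S A B : locally_finite S -> measurable A -> measurable B ->
  A `<=` B -> (npoints S A <= npoints S B)%E.
Proof.
move=> lS mA mB AB; have mS := lf_measurable lS.
apply: (le_measure (@counting R R)); [apply/mem_set; exact: measurableI|apply/mem_set; exact: measurableI|exact: setIS].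
Qed.

Section kernel.
Local Notation mu := (@lebesgue_measure R).
Variable (h : R -> R -> R).
Hypothesis h0 : forall x y, 0 <= h x y.
Hypothesis hC : forall x y, h x y = h y x.
Hypothesis mh : measurable_fun [set: R * R] (fun p : R * R => h p.1 p.2).

Definition dens2 A B : \bar R := (\int[mu]_(x in A) \int[mu]_(y in B) (h x y)%:E)%E.

Let cut A B (p : R * R) : \bar R := (\1_A p.1 * \1_B p.2 * h p.1 p.2)%:E.

Lemma dens2_ge0 A B : (0 <= dens2 A B)%E.
Proof. by apply: integral_ge0 => x _; apply: integral_ge0 => y _; rewrite lee_fin. Qed.

Lemma cut_ge0 A B p : (0 <= cut A B p)%E.
Proof. by rewrite lee_fin mulr_ge0. Qed.

Lemma measurable_cut A B : measurable A -> measurable B -> measurable_fun [set: R * R] (cut A B).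
Proof.
move=> mA mB; apply/measurable_EFinP; apply: measurable_funM => //; apply: measurable_funM.
  by apply: (measurableT_comp (f := \1_A : R -> R)) => //; exact: measurable_fst.
by apply: (measurableT_comp (f := \1_B : R -> R)) => //; exact: measurable_snd.
Qed.

Lemma dens2E A B : measurable A -> measurable B ->
  dens2 A B = (\int[mu]_x \int[mu]_y cut A B (x, y))%E.
Proof.
move=> mA mB; rewrite /dens2 integral_mkcond; apply: eq_integral => x _.
rewrite patchE; case: ifPn => xA.
  rewrite integral_mkcond; apply: eq_integral => y _.
  by rewrite patchE /cut /= !indicE xA; case: ifPn => yB; rewrite !(mul1r, mul0r).
by rewrite integral0_eq// => y _; rewrite /cut /= indicE (negbTE xA) !mul0r.
Qed.

Lemma dens2_prod A B : measurable A -> measurable B ->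
  (dens2 A B = \int[(mu \x mu)%E]_p cut A B p)%E.
Proof.
move=> mA mB; rewrite dens2E//.
by rewrite (@fubini_tonelli1 _ _ _ _ _ mu mu (cut A B) (measurable_cut mA mB) (@cut_ge0 A B)).
Qed.

Lemma dens2C A B : measurable A -> measurable B -> dens2 A B = dens2 B A.
Proof.
move=> mA mB; rewrite (dens2E mA mB) (dens2E mB mA).
transitivity (\int[mu]_y \int[mu]_x cut A B (x, y))%E.
  exact: (@fubini_tonelli _ _ _ _ _ mu mu (cut A B) (measurable_cut mA mB) (@cut_ge0 A B)).
apply: eq_integral => y _; apply: eq_integral => x _.
by rewrite /cut /= hC [\1_A _ * _]mulrC.
Qed.

Lemma dens2_bigcup F B : measurable B -> (forall i, measurable (F i)) -> trivIset setT F ->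
  (dens2 (\bigcup_i F i) B = \sum_(i <oo) dens2 (F i) B)%E.
Proof.
move=> mB mF tF; rewrite /dens2 ge0_integral_bigcup//.
- apply: measurable_funTS.
  rewrite [X in measurable_fun _ X](_ : _ = fun x => (\int[mu]_y cut setT B (x, y))%E); last first.
    apply/funext => x; rewrite integral_mkcond; apply: eq_integral => y _.
    by rewrite patchE /cut /= !indicE in_setT mul1r; case: ifPn => yB; rewrite !(mul1r, mul0r).
  apply: measurable_fun_fubini_tonelli_F; first exact: measurable_cut.
  by move=> p; exact: cut_ge0.
- by move=> x _; apply: integral_ge0 => y _; rewrite lee_fin.
Qed.

Section moments.
Variables (d : measure_display) (T : measurableType d) (P : probability T R) (Xi : T -> set R).
Hypothesis spp : simple_point_process Xi.

Definition mom A B : \bar R := (\int[P]_w (npoints (Xi w) A * npoints (Xi w) B))%E.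

Let lf w : locally_finite (Xi w). Proof. by case: spp. Qed.
Let mN A : measurable A -> measurable_fun setT (fun w => npoints (Xi w) A).
Proof. by case: spp => _; apply. Qed.

Lemma momC A B : mom A B = mom B A.
Proof. by apply: eq_integral => w _; rewrite muleC. Qed.

Lemma mom_ge0 A B : (0 <= mom A B)%E.
Proof. by apply: integral_ge0 => w _; apply: mule_ge0; exact: npoints_ge0. Qed.

Lemma measurable_mom A B : measurable A -> measurable B ->
  measurable_fun setT (fun w => npoints (Xi w) A * npoints (Xi w) B)%E.
Proof. by move=> mA mB; apply: emeasurable_funM; exact: mN. Qed.

Lemma npoints_fin S B (r : R) : locally_finite S -> B `<=` `[- r, r] -> npoints S B \is a fin_num.
Proof.
move=> lS Br; have [s us sE] := lf_points r lS.
rewrite (@npoints_seq _ _ _ _ us)//; first by rewrite sE => x [].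
by move=> x Sx /Br Bx; suff : [set` s] x by []; rewrite sE.
Qed.

Lemma mom_bigcup F B (r : R) : measurable B -> B `<=` `[- r, r] ->
  (forall i, measurable (F i)) -> trivIset setT F ->
  (mom (\bigcup_i F i) B = \sum_(i <oo) mom (F i) B)%E.
Proof.
move=> mB Br mF tF; rewrite /mom -integral_nneseries//.
- apply: eq_integral => w _; rewrite npoints_bigcup//.
  have Bf := npoints_fin (lf w) Br.
  rewrite muleC -(fineK Bf) -nneseriesZl; last by move=> i _; exact: npoints_ge0.
  by apply: eq_eseriesr => i _; rewrite muleC.
- by move=> i; exact: measurable_mom.
- by move=> i w _; apply: mule_ge0; exact: npoints_ge0.
Qed.

Lemma mom_le A A' B : measurable A -> measurable A' -> measurable B -> A `<=` A' ->
  (mom A B <= mom A' B)%E.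
Proof.
move=> mA mA' mB AA; apply: ge0_le_integral => //.
- by move=> w _; apply: mule_ge0; exact: npoints_ge0.
- exact: measurable_mom.
- exact: measurable_mom.
- by move=> w _; apply: lee_wpmul2r; [exact: npoints_ge0|exact: npoints_le].
Qed.

(** With [B] fixed, both sides are measures in the first argument, finite on [W], and they agree on
    open intervals. *)
Lemma mom_dens_ext W B (r : R) : measurable W -> measurable B -> B `<=` `[- r, r] ->
  (mom W B < +oo)%E ->
  (forall a c : R, mom (`]a, c[ `&` W) B = dens2 (`]a, c[ `&` W) B) ->
  forall A, measurable A -> mom (A `&` W) B = dens2 (A `&` W) B.
Proof.
move=> mW mB Br Wf H A mA.
pose m1 A := mom (A `&` W) B; pose m2 A := dens2 (A `&` W) B; suff : m1 A = m2 A by [].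
apply: borel_ext; rewrite /m1 /m2.
- by move=> *; exact: mom_ge0.
- by move=> *; exact: dens2_ge0.
- rewrite set0I; apply: integral0_eq => w _.
  by rewrite /npoints setI0 /counting asboolT// fset_set0 mul0e.
- by rewrite set0I /dens2 integral_set0.
- move=> F mF tF; rewrite setI_bigcupl; apply: (mom_bigcup mB Br).
    by move=> i; exact: measurableI.
  exact: trivIset_setIr.
- move=> F mF tF; rewrite setI_bigcupl; apply: dens2_bigcup => //.
    by move=> i; exact: measurableI.
  exact: trivIset_setIr.
- exact: H.
- by move=> C mC; apply: le_lt_trans Wf; apply: mom_le => //; exact: measurableI.
- by [].
Qed.

Hypothesis open_windows : forall a a' c c' : R, a' < c ->
  mom `]a, a'[%classic `]c, c'[%classic = dens2 `]a, a'[%classic `]c, c'[%classic.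
Hypothesis open_finite : forall a a' c c' : R, a' < c ->
  (mom `]a, a'[%classic `]c, c'[%classic < +oo)%E.

Lemma itv_bounded (a c : R) : `]a, c[ `<=` `[- (Num.max `|a| `|c|), Num.max `|a| `|c|].
Proof.
move=> x /=; rewrite !in_itv/= => /andP[ax xc]; rewrite -ler_norml le_max.
case: (ger0P x) => x0; apply/orP; [right|left].
  by rewrite (le_trans (ltW xc))// ler_norm.
by rewrite -(normrN a) (le_trans _ (ler_norm (- a)))// lerN2 ltW.
Qed.

(** The extension is made in one argument at a time, the second by symmetry. *)
Lemma mom_dens_windows A B (a a' c c' : R) : a' < c -> measurable A -> measurable B ->
  A `<=` `]a, a'[ -> B `<=` `]c, c'[ -> mom A B = dens2 A B.
Proof.
move=> ac mA mB AW BW.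
have openI (x y x' y' : R) : `]x, y[ `&` `]x', y'[ = `]Num.max x x', Num.min y y'[%classic.
  apply/seteqP; split => z /=; rewrite !in_itv/= gt_max lt_min.
    by case=> /andP[-> ->] /andP[-> ->].
  by move=> /andP[/andP[-> ->] /andP[-> ->]].
have step1 C e e' : a' < e -> measurable C -> mom (C `&` `]a, a'[) `]e, e'[%classic = dens2 (C `&` `]a, a'[) `]e, e'[%classic.
  move=> ae mC; apply: (mom_dens_ext _ _ (@itv_bounded e e')) => //.
    exact: open_finite.
  by move=> x y; rewrite openI; apply: open_windows; rewrite gt_min ae orbT.
have <- : A `&` `]a, a'[ = A by apply: setIidl.
have <- : B `&` `]c, c'[ = B by apply: setIidl.
set A' := A `&` _; have mA' : measurable A' by exact: measurableI.
have A'W : A' `<=` `]a, a'[ by move=> x [].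
rewrite momC [RHS]dens2C//; last exact: measurableI.
apply: (@mom_dens_ext _ _ (Num.max `|a| `|a'|)) => //.
- by apply: (subset_trans A'W); exact: itv_bounded.
- rewrite momC; apply: (@le_lt_trans _ _ (mom `]a, a'[%classic `]c, c'[%classic)); last exact: open_finite.
  exact: mom_le.
- move=> x y; rewrite momC [RHS]dens2C//; last exact: measurableI.
  by rewrite openI; apply: step1 => //; rewrite lt_max ac orbT.
Qed.

Section bounded.
Variables (r : nat) (D1 D2 : set R).
Hypothesis mD1 : measurable D1.
Hypothesis mD2 : measurable D2.
Hypothesis D1r : D1 `<=` `[- r%:R, r%:R[.
Hypothesis D2r : D2 `<=` `[- r%:R, r%:R[.
Hypothesis D12 : D1 `&` D2 = set0.

Let C k i := @cell R r k i.
Let mC k i : measurable (C k i). Proof. exact: measurable_cell. Qed.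
Let mI k i : measurable (D1 `&` C k i). Proof. exact: measurableI. Qed.
Let mI' k i : measurable (D2 `&` C k i). Proof. exact: measurableI. Qed.

Let Spts k w : \bar R := (\sum_(q <- far_pairs r k)
  npoints (Xi w) (D1 `&` C k q.1) * npoints (Xi w) (D2 `&` C k q.2))%E.

Let Tcut k p : \bar R := (\1_D1 p.1 * \1_D2 p.2 * farfun r k p.1 p.2 * h p.1 p.2)%:E.

Let ind1 x : \1_D1 x != 0 :> R -> - r%:R <= x < r%:R.
Proof. by rewrite indicE pnatr_eq0 eqb0 negbK => /set_mem/D1r /=; rewrite in_itv. Qed.

Let ind2 x : \1_D2 x != 0 :> R -> - r%:R <= x < r%:R.
Proof. by rewrite indicE pnatr_eq0 eqb0 negbK => /set_mem/D2r /=; rewrite in_itv. Qed.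

Let ind12 x y : \1_D1 x * \1_D2 y != 0 :> R -> [/\ - r%:R <= x < r%:R, - r%:R <= y < r%:R & x != y].
Proof.
rewrite mulf_eq0 negb_or => /andP[i1 i2]; split; [exact: ind1|exact: ind2|].
apply/eqP => xy; move: i1 i2; rewrite -xy !indicE !pnatr_eq0 !eqb0 !negbK => /set_mem h1 /set_mem h2.
by have : (D1 `&` D2) x by []; rewrite D12.
Qed.

Let cells_mom k : (\int[P]_w Spts k w = \int[(mu \x mu)%E]_p Tcut k p)%E.
Proof.
rewrite ge0_integral_sum//.
- transitivity (\sum_(q <- far_pairs r k) \int[(mu \x mu)%E]_p cut (D1 `&` C k q.1) (D2 `&` C k q.2) p)%E.
    rewrite !big_seq; apply: eq_bigr => -[i j] /=; rewrite mem_filter => /andP[/= ij _]; rewrite -dens2_prod// -/(mom _ _).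
    have k0 : 0 < k.+1%:R :> R by [].
    pose z (a : nat) : R := - r%:R + a%:R / k.+1%:R.
    (* Half a mesh: a half-open cell is enlarged to the left by [q] into an open window, and cells
       that are not adjacent still have separated windows. *)
    pose q : R := (2 * k.+1%:R)^-1.
    have q0 : 0 < q by rewrite invr_gt0 mulr_gt0.
    have zz (a c : nat) : (a < c)%N -> z a + 2 * q <= z c.
      move=> ac; rewrite /z /q invfM mulrA divff// mul1r -addrA lerD2l -[X in _ + X]mul1r -mulrDl ler_pM2r ?invr_gt0//.
      by rewrite natr1 ler_nat.
    have sub D (a : nat) : D `&` C k a `<=` `]z a - q, z a.+1[.
      move=> x [_]; rewrite /C /cell /= !in_itv/= => /andP[h1 ->]; rewrite andbT.
      by apply: lt_le_trans h1; rewrite ltrBlDr ltrDl.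
    case/orP: ij => ij.
      apply: mom_dens_windows; [|exact: mI|exact: mI'|exact: sub|exact: sub].
      by have := zz _ _ ij; lra.
    rewrite momC dens2C//; apply: mom_dens_windows; [|exact: mI'|exact: mI|exact: sub|exact: sub].
    by have := zz _ _ ij; lra.
  transitivity (\int[(mu \x mu)%E]_p \sum_(q <- far_pairs r k) cut (D1 `&` C k q.1) (D2 `&` C k q.2) p)%E.
    rewrite ge0_integral_sum//.
    + by move=> q; exact: measurable_cut.
    + by move=> q p _; exact: cut_ge0.
  apply: eq_integral => p _; rewrite /Tcut /farfun mulr_sumr mulr_suml -sumEFin; apply: eq_bigr => q _.
  by congr EFin; rewrite !indicI /=; ring.
- by move=> q; exact: measurable_mom.
- by move=> q w _; apply: mule_ge0; exact: npoints_ge0.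
Qed.

Let points w : exists s : seq R,
  (npoints (Xi w) D1 * npoints (Xi w) D2 = (\sum_(x <- s) \sum_(y <- s) \1_D1 x * \1_D2 y)%:E)%E /\
  forall k, (Spts k w = (\sum_(x <- s) \sum_(y <- s) \1_D1 x * \1_D2 y * farfun r k x y)%:E)%E.
Proof.
have [s us sE] := lf_points r%:R (lf w).
have sS : [set` s] `<=` Xi w by rewrite sE => x [].
have NE B : B `<=` `[- r%:R, r%:R[ -> npoints (Xi w) B = (lin \1_B s)%:E.
  move=> Br; apply: npoints_seq => // x Xx /Br; rewrite /= in_itv/= => /andP[h1 h2].
  by suff : [set` s] x by []; rewrite sE; split => //=; rewrite in_itv/= h1 ltW.
have prodE (f g : R -> R) : lin f s * lin g s = \sum_(x <- s) \sum_(y <- s) f x * g y.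
  by rewrite /lin mulr_suml; apply: eq_bigr => x _; rewrite mulr_sumr.
exists s; split; first by rewrite !NE// -EFinM prodE.
move=> k; rewrite /Spts.
transitivity ((\sum_(q <- far_pairs r k) \sum_(x <- s) \sum_(y <- s)
    (\1_(D1 `&` C k q.1) x * \1_(D2 `&` C k q.2) y : R))%:E).
  rewrite -sumEFin; apply: eq_bigr => q _.
  by rewrite !NE -?EFinM ?prodE// => x [] => [/D2r//|/D1r//].
congr EFin.
rewrite exchange_big/=; apply: eq_bigr => x _.
rewrite exchange_big/=; apply: eq_bigr => y _.
rewrite /farfun mulr_sumr; apply: eq_bigr => q _.
by rewrite !indicI /=; ring.
Qed.

Let farfun_term_cvg x y : \1_D1 x * \1_D2 y * farfun r k x y @[k --> \oo] --> (\1_D1 x * \1_D2 y : R).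
Proof.
apply: cvg_near_cst; have [->|xy] := eqVneq (\1_D1 x * \1_D2 y : R) 0.
  by near=> k; rewrite mul0r.
have [hx hy xNy] := ind12 xy; have := farfun_cvg hx hy xNy.
by apply: filterS => k ->; rewrite mulr1.
Unshelve. all: by end_near. Qed.

Let farfun_term_le k x y : \1_D1 x * \1_D2 y * farfun r k x y <= (\1_D1 x * \1_D2 y : R).
Proof.
have [->|xy] := eqVneq (\1_D1 x * \1_D2 y : R) 0; first by rewrite mul0r.
have [hx hy _] := ind12 xy; rewrite -[leRHS]mulr1; apply: ler_wpM2l; first exact: mulr_ge0.
exact: farfun_le1.
Qed.

Let Tcut_ge0 k p : (0 <= Tcut k p)%E.
Proof. by rewrite lee_fin mulr_ge0// mulr_ge0 ?farfun_ge0// mulr_ge0. Qed.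

Let measurable_Tcut k : measurable_fun setT (Tcut k).
Proof.
rewrite [Tcut k](_ : _ = fun p => (\sum_(q <- far_pairs r k) cut (D1 `&` C k q.1) (D2 `&` C k q.2) p)%E).
  by apply: emeasurable_sum => q; exact: measurable_cut.
apply/funext => p; rewrite /Tcut /farfun mulr_sumr mulr_suml -sumEFin; apply: eq_bigr => q _.
by congr EFin; rewrite !indicI /=; ring.
Qed.

Let Spts_ge0 k w : (0 <= Spts k w)%E.
Proof. by apply: sume_ge0 => q _; apply: mule_ge0; exact: npoints_ge0. Qed.

Let measurable_Spts k : measurable_fun setT (Spts k).
Proof. by apply: emeasurable_sum => q; exact: measurable_mom. Qed.

(* Away from adjacent cells the two sides agree; letting the mesh of the cells go
   to [0], Fatou's lemma on either side gives both inequalities. *)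
Lemma mom_dens_bounded : mom D1 D2 = dens2 D1 D2.
Proof.
apply/eqP; rewrite eq_le; apply/andP; split.
  apply: (@fatou_le _ _ _ P Spts) => //.
    move=> w; have [s [-> sE]] := points w; rewrite (eq_cvg _ _ sE); apply: cvg_EFin.
      by near=> k.
    apply: cvg_big => [|x _]; first exact: add_continuous.
    apply: cvg_big => [|y _]; first exact: add_continuous.
    exact: farfun_term_cvg.
  move=> k; rewrite cells_mom dens2_prod//; apply: ge0_le_integral => //; [exact: measurable_Tcut|exact: measurable_cut|].
  by move=> p _; rewrite lee_fin ler_wpM2r.
rewrite dens2_prod//; apply: (@fatou_le _ _ _ (mu \x mu)%E Tcut) => //.
  move=> p; apply: cvg_EFin; first by near=> k.
  by apply: cvgMl; exact: farfun_term_cvg.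
move=> k; rewrite -cells_mom; apply: ge0_le_integral => //; first exact: measurable_mom.
move=> w _; have [s [-> ->]] := points w; rewrite lee_fin.
by apply: ler_sum => x _; apply: ler_sum => y _.
Unshelve. all: by end_near. Qed.

End bounded.

(** Exhaustion by bounded intervals, with monotone convergence on both sides. *)
Lemma mom_dens D1 D2 : measurable D1 -> measurable D2 -> D1 `&` D2 = set0 -> mom D1 D2 = dens2 D1 D2.
Proof.
move=> m1 m2 D12; pose W (n : nat) : set R := `[- n%:R, n%:R[%classic.
have mW n : measurable (W n) by exact: measurable_itv.
have WS n : W n `<=` W n.+1.
  move=> x; rewrite /W /= !in_itv/= => /andP[h1 h2].
  have nS : n%:R <= n.+1%:R :> R by rewrite ler_nat.
  by rewrite (le_trans _ h1) ?lerN2// (lt_le_trans h2).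
have WT D : \bigcup_n (D `&` W n) = D.
  apply/seteqP; split => [x [n _ []]//|x Dx]; have [n xn] := nat_above `|x|.
  exists n => //; split => //; rewrite /W /= in_itv/=.
  by move: xn; rewrite ltr_norml => /andP[/ltW -> ->].
have mDW D n : measurable D -> measurable (D `&` W n) by move=> mD; exact: measurableI.
have DWS D n : D `&` W n `<=` D `&` W n.+1 by apply: setIS; exact: WS.
have WI n x : \1_(W n) x <= \1_(W n.+1) x :> R.
  rewrite !indicE ler_nat; case: (boolP (x \in W n)) => // /set_mem/WS xW.
  by rewrite mem_set.
have near_nat (x : R) : \forall n \near \oo, `|x| < n%:R.
  have [N hN] := nat_above `|x|; exists N => // n /= Nn.
  by apply: (lt_le_trans hN); rewrite ler_nat.
have cv1 : mom (D1 `&` W n) (D2 `&` W n) @[n --> \oo] --> mom D1 D2.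
  apply: mct.
  - by move=> n; apply: measurable_mom; exact: mDW.
  - by move=> n w; apply: mule_ge0; exact: npoints_ge0.
  - move=> n w; apply: lee_pmul; try exact: npoints_ge0.
      by apply: npoints_le => //; exact: mDW.
    by apply: npoints_le => //; exact: mDW.
  (* Counts may be infinite on unbounded sets, so a vanishing factor is treated apart from the
     product of limits. *)
  - move=> w; have N0 D n : measurable D -> npoints (Xi w) D = 0%E -> npoints (Xi w) (D `&` W n) = 0%E.
      move=> mD D0; apply/eqP; rewrite eq_le npoints_ge0 andbT -D0.
      by apply: npoints_le => //; exact: mDW.
    have [z1|z1] := eqVneq (npoints (Xi w) D1) 0%E.
      by rewrite z1 mul0e; apply: cvg_near_cst; near=> n; rewrite N0// mul0e.
    have [z2|z2] := eqVneq (npoints (Xi w) D2) 0%E.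
      by rewrite z2 mule0; apply: cvg_near_cst; near=> n; rewrite [X in (_ * X)%E]N0// mule0.
    have NC D : measurable D -> npoints (Xi w) (D `&` W n) @[n --> \oo] --> npoints (Xi w) D.
      by move=> mD; rewrite -{2}(WT D); apply: npoints_cvg => // n; exact: mDW.
    by apply: cvgeM; [apply: neq0_mule_def; rewrite mule_eq0 negb_or z1|exact: NC|exact: NC].
have cv2 : dens2 (D1 `&` W n) (D2 `&` W n) @[n --> \oo] --> dens2 D1 D2.
  rewrite (dens2_prod m1 m2) (eq_cvg _ _ (fun n => dens2_prod (mDW _ n m1) (mDW _ n m2))); apply: mct.
  - by move=> n; apply: measurable_cut; exact: mDW.
  - by move=> n p; exact: cut_ge0.
  - move=> n p; rewrite lee_fin ler_wpM2r// !indicI /=; apply: ler_pM; try exact: mulr_ge0.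
      by apply: ler_wpM2l => //; exact: WI.
    by apply: ler_wpM2l => //; exact: WI.
  - move=> p; apply: cvg_near_cst; near=> n; rewrite /cut !indicI /=.
    have WE x : `|x| < n%:R -> \1_(W n) x = 1 :> R.
      by move=> xn; rewrite indicE mem_set// /W /= in_itv/=; move: xn; rewrite ltr_norml => /andP[/ltW -> ->].
    by rewrite !WE ?mulr1//; near: n; [exact: near_nat|exact: near_nat].
apply: (cvg_unique _ cv1) => //; apply: cvg_trans cv2; apply: near_eq_cvg; near=> n.
apply/esym; apply: (@mom_dens_bounded n); [exact: mDW|exact: mDW|by move=> x []|by move=> x []|].
by apply/seteqP; split => // x [[h1 _] [h2 _]]; have : (D1 `&` D2) x by []; rewrite D12.
Unshelve. all: by end_near. Qed.

End moments.

End kernel.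

End borel_extension.

(** * The pair correlation function *)

Section pair_correlation.
Context {R : realType}.
Local Notation mu := (@lebesgue_measure R).
Implicit Types (a c x y : R) (k : nat).

(** Continuous, between 0 and 1, and increasing in [k] to the indicator of the open interval of
    radius [w] around [l]. *)
Definition tent k w l x : R := Num.min (k%:R * hat w l x) 1.

Lemma tent_ge0 k w l x : 0 <= tent k w l x.
Proof. by rewrite le_min ler01 andbT mulr_ge0// hat_ge0. Qed.

Lemma tent_le1 k w l x : tent k w l x <= 1.
Proof. by rewrite ge_min lexx orbT. Qed.

Lemma tent_continuous k w l : continuous (tent k w l).
Proof.
move=> x; apply/cvgrPdist_lt => e e0; near=> y.
apply: (le_lt_trans (min_lip _ _ _)); rewrite -mulrBr normrM normr_nat.
have k0 : 0 < k.+1%:R :> R by [].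
apply: (@le_lt_trans _ _ (k.+1%:R * `|x - y|)).
  by apply: ler_pM => //; [rewrite ler_nat|exact: hat_lip].
rewrite mulrC -ltr_pdivlMr//; near: y.
by apply: (@nbhsx_ballx _ R^o x (e / k.+1%:R)); rewrite divr_gt0.
Unshelve. all: by end_near. Qed.

Lemma tent_window k w l x : tent k w l x != 0 -> l - w <= x <= l + w.
Proof.
move=> h; apply: hat_window; apply: contra h => /eqP hx.
by rewrite /tent hx mulr0; apply/eqP/min_idPl.
Qed.

Lemma tent_mono k w l x : tent k w l x <= tent k.+1 w l x.
Proof.
rewrite le_min !ge_min lexx orbT andbT ler_wpM2r ?hat_ge0// ler_nat//.
Qed.

Lemma tent_cvg w l x : tent k w l x @[k --> \oo] --> (\1_`]l - w, l + w[ x : R).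
Proof.
apply: cvg_near_cst; rewrite indicE mem_setE in_itv/=.
have -> : (l - w < x < l + w) = (`|x - l| < w).
  by rewrite ltr_norml; apply/idP/idP => /andP[? ?]; apply/andP; split; lra.
case: ltP => h; last by near=> k; rewrite /tent hat_eq0// mulr0; apply/min_idPl.
have h0 : 0 < hat w l x by rewrite lt_max subr_gt0 h orbT.
have [N hN] := nat_above (hat w l x)^-1; exists N => // k /= Nk.
apply/min_idPr; rewrite -ler_pdivrMr// mul1r (le_trans (ltW hN))// ler_nat//.
Unshelve. all: by end_near. Qed.

Lemma corr_prod (f g G : R -> R) (p1 p2 q1 q2 : R) :
  measurable_fun setT f -> measurable_fun setT g -> measurable_fun setT G ->
  (forall x, 0 <= f x) -> (forall x, 0 <= g x) -> (forall x, 0 <= G x) ->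
  (forall x, f x != 0 -> p1 <= x <= p2) -> (forall x, g x != 0 -> q1 <= x <= q2) -> p2 < q1 ->
  (corr f g G = \int[(mu \x mu)%E]_p (f p.1 * g p.2 * G `|p.2 - p.1|)%:E)%E.
Proof.
move=> mf mg mG f0 g0 G0 fE gE pq.
pose F (p : R * R) := (f p.1 * g p.2 * G `|p.2 - p.1|)%:E.
have mF : measurable_fun setT F.
  apply/measurable_EFinP; apply: measurable_funM.
    apply: measurable_funM; first by apply: (measurableT_comp mf); exact: measurable_fst.
    by apply: (measurableT_comp mg); exact: measurable_snd.
  apply: (measurableT_comp mG); apply: measurableT_comp => //; exact: measurable_funB.
have F0 p : (0 <= F p)%E by rewrite lee_fin !mulr_ge0.
rewrite (@fubini_tonelli1 _ _ _ _ _ mu mu F mF F0) /corr.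
apply: eq_integral => x _; rewrite /fubini_F.
have mgx : measurable_fun setT (fun y : R => (g y * G (y - x))%:E).
  apply/measurable_EFinP; apply: measurable_funM => //; apply: (measurableT_comp mG).
  exact: measurable_funB.
rewrite (_ : (\int[mu]_y (g (x + y)%R * G y)%:E)%E = (\int[mu]_y (g y * G (y - x)%R)%:E)%E); last first.
  rewrite -(@ge0_integral_shift _ x (fun y => (g y * G (y - x))%:E))//.
  - by apply: eq_integral => y _; rewrite addrK addrC.
  - by move=> y; rewrite lee_fin mulr_ge0.
rewrite -ge0_integralZl//; [|by move=> y _; rewrite lee_fin mulr_ge0|by rewrite lee_fin].
apply: eq_integral => y _; rewrite /F /= -EFinM; congr EFin; rewrite mulrA.
have [->|/fE fx] := eqVneq (f x) 0; first by rewrite !mul0r.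
have [->|/gE gy] := eqVneq (g y) 0; first by rewrite mulr0 !mul0r.
rewrite ger0_norm//; move: fx gy => /andP[? ?] /andP[? ?]; lra.
Qed.

Section process.
Variables (b : R) (d : measure_display) (T : measurableType d) (P : probability T R) (Xi : T -> set R).
Hypothesis b0 : 0 < b.
Hypothesis cl : circular_limit b P Xi.
Hypothesis spp : simple_point_process Xi.

Let h x y : R := paircor b `|y - x|.
Let gc : gas_cvg b. Proof. exact: (circular_gas_cvg b0 cl spp). Qed.
Let h0 x y : 0 <= h x y. Proof. exact: paircor_ge0. Qed.
Let hC x y : h x y = h y x. Proof. by rewrite /h distrC. Qed.
Let mG : measurable_fun setT (paircor b). Proof. exact: measurable_paircor. Qed.
Let mh : measurable_fun [set: R * R] (fun p : R * R => h p.1 p.2).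
Proof.
apply: (measurableT_comp mG); apply: measurableT_comp => //; exact: measurable_funB.
Qed.
Let lf w : locally_finite (Xi w). Proof. by case: spp. Qed.

Lemma mom_set0l A : mom P Xi set0 A = 0%E.
Proof.
apply: integral0_eq => w _.
by rewrite /npoints setI0 /counting asboolT// fset_set0 mul0e.
Qed.

Lemma ball_itv (a a' : R) : `]a, a'[%classic = `](a + a') / 2 - (a' - a) / 2, (a + a') / 2 + (a' - a) / 2[%classic.
Proof.
have -> : (a + a') / 2 - (a' - a) / 2 = a by field.
by have -> : (a + a') / 2 + (a' - a) / 2 = a' by field.
Qed.

Lemma window_points w (l : seq R) : exists s : seq R, forall a a', a \in l -> a' \in l ->
  npoints (Xi w) `]a, a'[%classic = (lin \1_(`]a, a'[%classic) s)%:E /\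
  forall f, (forall x, f x != 0 -> a <= x <= a') -> linear_statistic f (Xi w) = lin f s.
Proof.
pose r := \sum_(x <- l) `|x|.
have lr x : x \in l -> `|x| <= r.
  by move=> xl; rewrite /r (big_rem x)//= lerDl sumr_ge0.
have [s us sE] := lf_points r (lf w).
have sS : [set` s] `<=` Xi w by rewrite sE => x [].
exists s => a a' /lr la /lr la'.
have rle x : Xi w x -> a <= x <= a' -> x \in s.
  move=> Xx hx; suff : [set` s] x by []; rewrite sE; split => //=; rewrite in_itv/=.
  by move: la la' hx; rewrite !ler_norml => /andP[? ?] /andP[? ?] /andP[? ?]; apply/andP; split; lra.
split; last by move=> f fE; apply: linear_statistic_seq => // x Xx /fE; exact: rle.
apply: npoints_seq => // x Xx; rewrite /= in_itv/= => /andP[/ltW h1 /ltW h2].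
by apply: rle => //; rewrite h1.
Qed.

(** [pair_moment] for tents, with monotone convergence towards the indicators; degenerate windows
    are empty. *)
Lemma open_windows a a' c c' : a' < c ->
  mom P Xi `]a, a'[%classic `]c, c'[%classic = dens2 h `]a, a'[%classic `]c, c'[%classic.
Proof.
move=> ac; case: (leP a' a) => aa.
  by rewrite set_itv_ge ?mom_set0l ?/dens2 ?integral_set0// bnd_simp -leNgt.
case: (leP c' c) => cc.
  rewrite [X in mom _ _ _ X]set_itv_ge ?bnd_simp -?leNgt// momC mom_set0l.
  rewrite [X in dens2 _ _ X]set_itv_ge ?bnd_simp -?leNgt// /dens2 integral0_eq// => x _.
  by rewrite integral_set0.
pose f k := tent k ((a' - a) / 2) ((a + a') / 2).
pose g k := tent k ((c' - c) / 2) ((c + c') / 2).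
have fE k x : f k x != 0 -> a <= x <= a'.
  by move=> /tent_window /andP[h1 h2]; apply/andP; split; lra.
have gE k x : g k x != 0 -> c <= x <= c'.
  by move=> /tent_window /andP[h1 h2]; apply/andP; split; lra.
have f01 k x : 0 <= f k x <= 1 by rewrite tent_ge0 tent_le1.
have g01 k x : 0 <= g k x <= 1 by rewrite tent_ge0 tent_le1.
have fcv x : f k x @[k --> \oo] --> (\1_(`]a, a'[%classic) x : R).
  by rewrite ball_itv; exact: tent_cvg.
have gcv x : g k x @[k --> \oo] --> (\1_(`]c, c'[%classic) x : R).
  by rewrite ball_itv; exact: tent_cvg.
have cf k : continuous (f k) by exact: tent_continuous.
have cg k : continuous (g k) by exact: tent_continuous.
have mf k : measurable_fun setT (f k) by exact: continuous_measurable_fun.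
have mg k : measurable_fun setT (g k) by exact: continuous_measurable_fun.
have lin_cvg (u : nat -> R -> R) (v : R -> R) s : (forall x, u k x @[k --> \oo] --> v x) ->
    lin (u k) s @[k --> \oo] --> lin v s.
  by move=> uv; apply: cvg_big => [|x _]; [exact: add_continuous|exact: uv].
pose M k := (\int[P]_w (linear_statistic (f k) (Xi w) * linear_statistic (g k) (Xi w))%:E)%E.
have cv1 : M k @[k --> \oo] --> mom P Xi `]a, a'[%classic `]c, c'[%classic.
  apply: mct.
  - move=> k; apply/measurable_EFinP; apply: measurable_funM.
      exact: (measurable_window_statistic spp (cf k) (f01 k) (@fE k)).
    exact: (measurable_window_statistic spp (cg k) (g01 k) (@gE k)).
  - move=> k w; rewrite lee_fin mulr_ge0// linear_statistic_ge0// => x; exact: tent_ge0.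
  - move=> k w; have [s ws] := window_points w [:: a; a'; c; c'].
    have [||_ sf] := ws a a'; rewrite ?inE ?eqxx ?orbT//; have [||_ sg] := ws c c'; rewrite ?inE ?eqxx ?orbT//.
    rewrite lee_fin (sf _ (@fE k)) (sf _ (@fE k.+1)) (sg _ (@gE k)) (sg _ (@gE k.+1)).
    by apply: ler_pM; rewrite ?lin_ge0//; try (by move=> x; exact: tent_ge0);
      apply: ler_sum => x _; exact: tent_mono.
  - move=> w; have [s ws] := window_points w [:: a; a'; c; c'].
    have [||-> sf] := ws a a'; rewrite ?inE ?eqxx ?orbT//; have [||-> sg] := ws c c'; rewrite ?inE ?eqxx ?orbT//.
    rewrite -EFinM; apply: cvg_EFin; first by near=> k.
    rewrite (_ : _ \o _ = fun k => lin (f k) s * lin (g k) s); last first.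
      by apply/funext => k /=; rewrite (sf _ (@fE k)) (sg _ (@gE k)).
    by apply: cvgM; exact: lin_cvg.
pose J k := (\int[(mu \x mu)%E]_p (f k p.1 * g k p.2 * h p.1 p.2)%:E)%E.
have MJ k : M k = J k.
  rewrite /M (pair_moment b0 cl spp (cf k) (cg k) (f01 k) (g01 k) (@fE k) (@gE k) aa ac (ltW cc)).
  by apply: (corr_prod (mf k) (mg k) mG _ _ _ (@fE k) (@gE k) ac) => // x; [exact: tent_ge0|exact: tent_ge0|exact: paircor_ge0].
have cv2 : J k @[k --> \oo] --> dens2 h `]a, a'[%classic `]c, c'[%classic.
  rewrite dens2_prod//; apply: mct.
  - move=> k; apply/measurable_EFinP; apply: measurable_funM => //; apply: measurable_funM.
      by apply: (measurableT_comp (mf k)); exact: measurable_fst.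
    by apply: (measurableT_comp (mg k)); exact: measurable_snd.
  - by move=> k p; rewrite lee_fin !mulr_ge0// tent_ge0.
  - move=> k p; rewrite lee_fin ler_wpM2r//; apply: ler_pM; try exact: tent_ge0; exact: tent_mono.
  - move=> p; apply: cvg_EFin; first by near=> k.
    by apply: cvgMl; apply: cvgM; [exact: fcv|exact: gcv].
rewrite (eq_cvg _ _ MJ) in cv1; exact: (cvg_unique _ cv1 cv2).
Unshelve. all: by end_near. Qed.

(** The indicators are dominated by continuous tents on windows enlarged by a quarter of their
    separation, which remain separated and have a finite moment. *)
Lemma open_finite a a' c c' : a' < c -> (mom P Xi `]a, a'[%classic `]c, c'[%classic < +oo)%E.
Proof.
move=> ac; case: (leP a' a) => aa; first by rewrite set_itv_ge ?mom_set0l ?ltry// bnd_simp -leNgt.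
case: (leP c' c) => cc.
  by rewrite momC set_itv_ge ?mom_set0l ?ltry// bnd_simp -leNgt.
pose q := (c - a') / 4; have q0 : 0 < q by rewrite divr_gt0// subr_gt0.
have [k hk] := nat_above q^-1.
pose f := tent k ((a' - a) / 2 + q) ((a + a') / 2).
pose g := tent k ((c' - c) / 2 + q) ((c + c') / 2).
have fE x : f x != 0 -> a - q <= x <= a' + q.
  by move=> /tent_window /andP[h1 h2]; apply/andP; split; lra.
have gE x : g x != 0 -> c - q <= x <= c' + q.
  by move=> /tent_window /andP[h1 h2]; apply/andP; split; lra.
have f01 x : 0 <= f x <= 1 by rewrite tent_ge0 tent_le1.
have g01 x : 0 <= g x <= 1 by rewrite tent_ge0 tent_le1.
have big w l x : `|x - l| < w -> 1 <= tent k (w + q) l x.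
  move=> xl; rewrite le_min lexx andbT.
  have hq : q <= hat (w + q) l x by rewrite le_max; apply/orP; right; lra.
  apply: (@le_trans _ _ (q^-1 * q)); first by rewrite mulVf ?gt_eqF.
  have qi : 0 <= q^-1 by rewrite invr_ge0 ltW.
  by apply: ler_pM => //; exact: ltW.
have fb x : \1_(`]a, a'[%classic) x <= f x.
  rewrite indicE mem_setE in_itv/=; case: (boolP (a < x < a')) => hx; last exact: tent_ge0.
  by apply: big; rewrite ltr_norml; case/andP: hx => ? ?; apply/andP; split; lra.
have gb x : \1_(`]c, c'[%classic) x <= g x.
  rewrite indicE mem_setE in_itv/=; case: (boolP (c < x < c')) => hx; last exact: tent_ge0.
  by apply: big; rewrite ltr_norml; case/andP: hx => ? ?; apply/andP; split; lra.
have p12 : a - q < a' + q by lra.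
have pq : a' + q < c - q by rewrite /q; lra.
have q12 : c - q <= c' + q by lra.
have cf : continuous f by exact: tent_continuous.
have cg : continuous g by exact: tent_continuous.
have [C CE _] := pair_mean_limit b0 cl spp cf cg f01 g01 fE gE p12 pq q12.
apply: (@le_lt_trans _ _ C%:E); last by rewrite ltry.
rewrite -CE -(pair_moment b0 cl spp cf cg f01 g01 fE gE p12 pq q12).
apply: ge0_le_integral => //.
- by move=> w _; apply: mule_ge0; exact: npoints_ge0.
- by apply: measurable_mom => //; exact: measurable_itv.
- apply/measurable_EFinP; apply: measurable_funM.
    exact: (measurable_window_statistic spp cf f01 fE).
  exact: (measurable_window_statistic spp cg g01 gE).
- move=> w _; have [s ws] := window_points w [:: a; a'; c; c'; a - q; a' + q; c - q; c' + q].
  have [||-> _] := ws a a'; rewrite ?inE ?eqxx ?orbT//; have [||-> _] := ws c c'; rewrite ?inE ?eqxx ?orbT//.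
  have [||_ ->//] := ws (a - q) (a' + q); rewrite ?inE ?eqxx ?orbT//.
  have [||_ ->//] := ws (c - q) (c' + q); rewrite ?inE ?eqxx ?orbT//.
  rewrite -EFinM lee_fin; apply: ler_pM; try exact: lin_ge0.
    by apply: ler_sum => x _; exact: fb.
  by apply: ler_sum => x _; exact: gb.
Qed.

Lemma paircor_is_pair_correlation : is_pair_correlation P Xi (fun x y => paircor b `|y - x|).
Proof.
split => // D1 D2 mD1 mD2 D12.
exact: (mom_dens h0 hC mh spp open_windows open_finite mD1 mD2 D12).
Qed.

End process.

Lemma dens2_const (h : R -> R -> R) (A B : set R) (v al be : R) : measurable A -> measurable B ->
  mu A = al%:E -> mu B = be%:E -> (forall x y, A x -> B y -> h x y = v) ->
  dens2 h A B = (v * al * be)%:E.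
Proof.
move=> mA mB muA muB hv; rewrite /dens2.
rewrite (eq_integral (cst (v * be)%:E)); last first.
  move=> x /set_mem Ax; rewrite (eq_integral (cst v%:E)); last by move=> y /set_mem By; rewrite hv.
  by rewrite integral_cst//= muB.
by rewrite integral_cst//= muA -EFinM; congr EFin; ring.
Qed.

Lemma le_dens2 (h1 h2 : R -> R -> R) (A B : set R) : measurable A -> measurable B ->
  (forall x y, 0 <= h1 x y) -> (forall x y, 0 <= h2 x y) ->
  measurable_fun [set: R * R] (fun p : R * R => h1 p.1 p.2) ->
  measurable_fun [set: R * R] (fun p : R * R => h2 p.1 p.2) ->
  (forall x y, A x -> B y -> h1 x y <= h2 x y) -> (dens2 h1 A B <= dens2 h2 A B)%E.
Proof.
move=> mA mB h10 h20 m1 m2 h12; rewrite !dens2_prod//.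
apply: ge0_le_integral => //.
- by move=> p _; rewrite lee_fin !mulr_ge0.
- exact: measurable_cut.
- exact: measurable_cut.
- move=> p _; rewrite lee_fin !indicE.
  case: (boolP (p.1 \in A)) => /= [/set_mem Ap|_]; last by rewrite !mul0r.
  case: (boolP (p.2 \in B)) => /= [/set_mem Bp|_]; last by rewrite mulr0 !mul0r.
  by rewrite !mul1r h12.
Qed.

(** If [g1 l > g2 l], then continuity separates the two functions near [l]. The product of the small
    intervals [A] and [B] only involves differences near [l], and the two versions would give
    different values to the same second moment. *)
Lemma continuous_version_le (d : measure_display) (T : measurableType d) (P : probability T R)
    (Xi : T -> set R) (g1 g2 : R -> R) (l : R) :
  is_continuous_version P Xi g1 -> is_continuous_version P Xi g2 -> 0 < l -> g1 l <= g2 l.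
Proof.
move=> [[p1 _ m1 e1] c1] [[p2 _ m2 e2] c2] l0; rewrite leNgt; apply/negP => g12.
have cont (g : R -> R) (e : R) : {within [set l : R | 0 < l], continuous g} -> 0 < e ->
    exists2 del : R, 0 < del & forall y, `|l - y| < del -> `|g l - g y| < e.
  rewrite continuous_open_subspace; last exact: open_gt.
  move=> /(_ l (mem_set l0)) /cvgrPdist_lt cg /cg /nbhs_ballP [del d0 H].
  by exists del => // y ly; exact: H.
pose e := (g1 l - g2 l) / 3; have e0 : 0 < e by rewrite divr_gt0// subr_gt0.
have [d1 d10 H1] := cont g1 e c1 e0; have [d2 d20 H2] := cont g2 e c2 e0.
(* [q <= l] makes the two intervals disjoint, and the other bounds keep the differences in the
   neighbourhoods where [g1] and [g2] are nearly constant. *)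
pose q := Num.min l (Num.min d1 d2).
have q0 : 0 < q by rewrite !lt_min l0 d10.
have ql : q <= l by rewrite ge_min lexx.
have qd1 : q <= d1 by rewrite !ge_min lexx !orbT.
have qd2 : q <= d2 by rewrite !ge_min lexx !orbT.
clearbody q.
pose A : set R := `]0, q[%classic; pose B : set R := `]l, l + q[%classic.
have mA : measurable A by exact: measurable_itv.
have mB : measurable B by exact: measurable_itv.
have muA : mu A = q%:E by rewrite lebesgue_measure_itv/= lte_fin q0 -EFinD subr0.
have muB : mu B = q%:E.
  by rewrite lebesgue_measure_itv/= lte_fin ltrDl q0 -EFinB addrAC subrr add0r.
have AB : A `&` B = set0.
  apply/seteqP; split => // x []; rewrite /A /B /= !in_itv/= => /andP[_ xq] /andP[lx _].
  by move: (lt_trans lx (lt_le_trans xq ql)); rewrite ltxx.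
have near x y : A x -> B y -> `|l - `|y - x| | < q.
  rewrite /A /B /= !in_itv/= => /andP[? ?] /andP[? ?].
  by rewrite (ger0_norm (_ : 0 <= y - x)) ?ltr_norml; [apply/andP; split; lra|lra].
have g2l : 0 <= g2 l by have := p2 0 l; rewrite subr0 gtr0_norm.
have v0 : 0 <= g2 l + e by rewrite addr_ge0// ltW.
have v1 : 0 <= g1 l - e by rewrite /e; lra.
have up : (dens2 (fun x y : R => (g2 `|y - x|)%R) A B <= ((g2 l + e) * q * q)%:E)%E.
  rewrite -(@dens2_const (fun _ _ : R => (g2 l + e)%R) A B)//; apply: le_dens2 => //.
  move=> x y Ax By; have := H2 `|y - x| (lt_le_trans (near x y Ax By) qd2).
  by rewrite ltr_norml => /andP[? ?]; lra.
have lo : (((g1 l - e) * q * q)%:E <= dens2 (fun x y : R => (g1 `|y - x|)%R) A B)%E.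
  rewrite -(@dens2_const (fun _ _ : R => (g1 l - e)%R) A B)//; apply: le_dens2 => //.
  move=> x y Ax By; have := H1 `|y - x| (lt_le_trans (near x y Ax By) qd1).
  by rewrite ltr_norml => /andP[? ?]; lra.
have := le_trans lo (_ : dens2 (fun x y : R => (g1 `|y - x|)%R) A B <= ((g2 l + e) * q * q)%:E)%E.
rewrite /dens2 -e1// e2// => /(_ up); rewrite lee_fin !ler_pM2r// leNgt => /negP; apply.
by rewrite /e; lra.
Qed.

Lemma paircor_joint (b l : R) : 0 < b -> 0 < l -> forall e, 0 < e ->
  exists2 del : R, 0 < del & forall c y, gas_cvg b -> gas_cvg c -> `|b - c| < del -> `|l - y| < del ->
    `|paircor b l - paircor c y| <= e.
Proof.
move=> b0 l0 e e0; have b20 : 0 < b / 2 by lra.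
have l20 : 0 < l / 2 by lra.
have l22 : l / 2 <= 2 * l by lra.
have [del d0 H] := paircor_equicont (2 * b) b20 l20 l22 e0.
exists (Num.min del (Num.min (b / 2) (l / 2))); first by rewrite !lt_min d0 b20.
move=> c y gb gc; rewrite !lt_min => /and3P[h1 h2 _] /and3P[h3 _ h4].
by apply: H => //; move: h2 h4; rewrite ?ltr_norml => /andP[? ?] /andP[? ?]; apply/andP; split; lra.
Qed.

End pair_correlation.

Theorem theorem2 (R : realType) (d : R -> measure_display)
    (T : forall beta : R, measurableType (d beta))
    (P : forall beta : R, probability (T beta) R)
    (Xi : forall beta : R, T beta -> set R)
    (Xi_sine : forall beta : R, 0 < beta ->
       is_sine_process beta (P beta) (Xi beta)) :
  (forall beta : R, 0 < beta ->
     exists g : R -> R,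
       is_continuous_version (P beta) (Xi beta) g /\
       forall h : R -> R, is_continuous_version (P beta) (Xi beta) h ->
         forall lambda : R, 0 < lambda -> h lambda = g lambda) /\
  (forall rho : R -> R -> R,
     (forall beta : R, 0 < beta ->
        is_continuous_version (P beta) (Xi beta) (rho beta)) ->
     (forall lambda : R, 0 < lambda ->
        {within [set beta : R | 0 < beta],
           continuous (fun beta => rho beta lambda)}) /\
     {within [set p : R * R | 2 < p.1 /\ 0 < p.2],
        continuous (fun p : R * R => rho p.1 p.2)}).
Proof.
have gc (beta : R) : 0 < beta -> gas_cvg beta.
  by move=> b0; have [spp _ _ _ cl] := Xi_sine beta b0; exact: (circular_gas_cvg b0 cl spp).
have ver (beta : R) : 0 < beta -> is_continuous_version (P beta) (Xi beta) (paircor beta).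
  move=> b0; have [spp _ _ _ cl] := Xi_sine beta b0; split.
    exact: (paircor_is_pair_correlation b0 cl spp).
  rewrite continuous_open_subspace; last exact: open_gt.
  move=> l /set_mem l0; apply/cvgrPdist_le => e e0.
  have [del d0 H] := paircor_joint b0 l0 e0.
  near=> y; apply: H; [exact: gc|exact: gc|by rewrite subrr normr0|].
  by near: y; exact: (@nbhsx_ballx _ R^o l del d0).
have uniq (beta : R) h (l : R) : 0 < beta -> is_continuous_version (P beta) (Xi beta) h -> 0 < l ->
    h l = paircor beta l.
  move=> b0 hv l0; apply/eqP; rewrite eq_le.
  by rewrite (continuous_version_le hv (ver _ b0) l0) (continuous_version_le (ver _ b0) hv l0).
split.
  by move=> beta b0; exists (paircor beta); split; [exact: ver|move=> h hv l l0; exact: uniq].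
(* By uniqueness, any choice of continuous versions agrees with [paircor] at positive arguments, so
   its continuity follows from [paircor_joint]. *)
move=> rho rhov; split.
  move=> l l0; rewrite continuous_open_subspace; last exact: open_gt.
  move=> b /set_mem b0; apply/cvgrPdist_le => e e0.
  have [del d0 H] := paircor_joint b0 l0 e0.
  near=> c; have c0 : 0 < c by near: c; exact: lt_nbhsr.
  rewrite (uniq _ _ _ b0 (rhov _ b0) l0) (uniq _ _ _ c0 (rhov _ c0) l0).
  apply: H; [exact: gc|exact: gc| |by rewrite subrr normr0].
  by near: c; exact: (@nbhsx_ballx _ R^o b del d0).
rewrite continuous_open_subspace; last first.
  rewrite (_ : [set p : R * R | _] = fst @^-1` [set b | 2 < b] `&` snd @^-1` [set l | 0 < l])//.
  apply: openI; apply: open_comp; try exact: open_gt.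
    by move=> p _; exact: cvg_fst.
  by move=> p _; exact: cvg_snd.
move=> [b l] /set_mem [/= b2 l0]; apply/cvgrPdist_le => e e0.
have b0 : 0 < b by exact: lt_trans b2.
have [del d0 H] := paircor_joint b0 l0 e0.
have bn : nbhs b [set c | 0 < c /\ `|b - c| < del].
  by apply: filterI; [exact: lt_nbhsr|exact: (@nbhsx_ballx _ R^o b del d0)].
have ln : nbhs l [set y | 0 < y /\ `|l - y| < del].
  by apply: filterI; [exact: lt_nbhsr|exact: (@nbhsx_ballx _ R^o l del d0)].
exists ([set c | 0 < c /\ `|b - c| < del], [set y | 0 < y /\ `|l - y| < del]) => // q /= [[q1 bq] [q2 lq]].
rewrite (uniq _ _ _ b0 (rhov _ b0) l0) (uniq _ _ _ q1 (rhov _ q1) q2).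
by apply: H => //; exact: gc.
Unshelve. all: by end_near. Qed.
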